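(* Let $(A,\mathfrak m)$ be an excellent two-dimensional normal local ring containing an algebraically closed field $k\cong A/\mathfrak m$, and let $f\colon X\to \operatorname{Spec}A$ be a resolution of singularities. Let $Z>0$ be a cycle on $X$ such that $\mathcal O_X(-Z)$ has no fixed component. Then: (1) $h^1(\mathcal O_X(-Z))\le p_g(A)$. (2) If $h^1(\mathcal O_X(-Z))=p_g(A)$, then $\mathcal O_X(-Z)$ is generated by global sections.
   Context: $E=f^{-1}(\mathfrak m)=\bigcup_i E_i$ is the decomposition of the exceptional divisor into irreducible components; a cycle is a divisor on $X$ supported in $E$. $\mathcal O_X(-Z)$ has no fixed component if $H^0(X,\mathcal O_X(-Z))\ne H^0(X,\mathcal O_X(-Z-E_i))$ for every $E_i\subset E$. $h^i(\mathcal F)=\ell_A(H^i(X,\mathcal F))$ denotes length, and $p_g(A)=h^1(\mathcal O_X)$ is the geometric genus (independent of the resolution). *)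

(* Defs.v *)
From HB Require Import structures.
From mathcomp Require Import all_boot all_order all_algebra.
From mathcomp Require Import boolp classical_sets functions cardinality topology.

Set Implicit Arguments.
Unset Strict Implicit.
Unset Printing Implicit Defensive.

Import GRing.Theory.
Local Open Scope classical_set_scope.
Local Open Scope ring_scope.

(* Rings are commutative with 1 and possibly zero ([comPzRingType]), since the
   ring of sections over the empty set is zero.  Localizations, completions,
   tensor products and stalks are treated as predicates that characterize them
   up to a unique isomorphism. *)

Section Ideals.
Variable R : comPzRingType.

Definition is_unit (a : R) : Prop := exists b, a * b = 1.

Definition nonunits : set R := [set a | ~ is_unit a].

Definition is_ideal (I : set R) : Prop :=
  [/\ I 0, forall a b, I a -> I b -> I (a + b) & forall a b, I b -> I (a * b)].

Definition ideal_gen (G : set R) : set R :=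
  [set a | forall I, is_ideal I -> G `<=` I -> I a].

Definition ideal_pow (I : set R) (n : nat) : set R :=
  ideal_gen [set a | exists2 t : 'I_n -> R,
                       (forall i, I (t i)) & a = \prod_i t i].

Definition is_prime (p : set R) : Prop :=
  [/\ is_ideal p, ~ p 1 & forall a b, p (a * b) -> p a \/ p b].

Definition noetherian : Prop :=
  forall I, is_ideal I -> exists (n : nat) (t : 'I_n -> R), I = ideal_gen (range t).

Definition is_local : Prop :=
  1 <> 0 :> R /\ forall a b : R, nonunits a -> nonunits b -> nonunits (a + b).

Definition prime_chain (n : nat) (c : nat -> set R) : Prop :=
  (forall i, (i <= n)%N -> is_prime (c i)) /\
  (forall i, (i < n)%N -> c i `<` c i.+1).

Definition krull_dim (d : nat) : Prop :=
  (exists c, prime_chain d c) /\ (forall n c, prime_chain n c -> (n <= d)%N).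

Definition regular_local : Prop :=
  [/\ noetherian, is_local &
      exists d, krull_dim d /\
        exists t : 'I_d -> R, nonunits = ideal_gen (range t)].

Definition saturated_chain (p q : set R) (n : nat) (c : nat -> set R) : Prop :=
  [/\ prime_chain n c, c 0%N = p, c n = q &
      forall i, (i < n)%N ->
        ~ exists r, [/\ is_prime r, c i `<` r & r `<` c i.+1]].

Definition catenary : Prop :=
  forall p q, is_prime p -> is_prime q -> p `<=` q ->
    exists n, (exists c, saturated_chain p q n c) /\
              (forall m c, saturated_chain p q m c -> m = n).

End Ideals.

Section RingMaps.
Variables (R S : comPzRingType) (phi : {rmorphism R -> S}).

Definition is_localization (M : set R) : Prop :=
  [/\ forall m, M m -> is_unit (phi m),
      forall s, exists a m, M m /\ s * phi m = phi a &
      forall a, phi a = 0 -> exists2 m, M m & m * a = 0].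

Definition finite_type_algebra : Prop :=
  exists (n : nat) (t : 'I_n -> S), forall P : set S,
    P 1 -> (forall a b, P a -> P b -> P (a - b)) ->
    (forall a b, P a -> P b -> P (a * b)) ->
    range phi `<=` P -> range t `<=` P -> forall s, P s.

(* For a finitely generated ideal I (the only case used) this characterizes
   S = lim_n R / I^n: the maps R / I^n -> S / I^n S are bijective, and S is
   separated and complete for the I-adic topology. *)
Definition is_completion (I : set R) : Prop :=
  let J n := ideal_gen (phi @` ideal_pow I n) in
  [/\ forall n, phi @^-1` J n = ideal_pow I n,
      forall n s, exists a, J n (s - phi a),
      forall s, (forall n, J n s) -> s = 0 &
      forall u : nat -> S, (forall n, J n (u n.+1 - u n)) ->
        exists s, forall n, J n (s - u n)].

End RingMaps.

(* P = S (x)_R T, as a pushout of commutative rings. *)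
Definition is_tensor (R S T P : comPzRingType)
    (phi : {rmorphism R -> S}) (psi : {rmorphism R -> T})
    (i : {rmorphism S -> P}) (j : {rmorphism T -> P}) : Prop :=
  (forall r, i (phi r) = j (psi r)) /\
  forall (Q : comPzRingType) (u : {rmorphism S -> Q}) (v : {rmorphism T -> Q}),
    (forall r, u (phi r) = v (psi r)) ->
    exists w : {rmorphism P -> Q},
      [/\ forall s, w (i s) = u s, forall t, w (j t) = v t &
          forall w' : {rmorphism P -> Q},
            (forall s, w' (i s) = u s) -> (forall t, w' (j t) = v t) ->
            forall z, w' z = w z].

Definition regular_prime (R : comPzRingType) (p : set R) : Prop :=
  exists (S : comPzRingType) (phi : {rmorphism R -> S}),
    is_localization phi (~` p) /\ regular_local S.

Definition regular_ring (R : comPzRingType) : Prop :=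
  noetherian R /\ forall p : set R, is_prime p -> regular_prime p.

(* L is a finite extension of the field of fractions of psi(R). *)
Definition finite_over (R : comPzRingType) (L : fieldType)
    (psi : {rmorphism R -> L}) : Prop :=
  exists (n : nat) (t : 'I_n -> L), forall x, exists (b : R) (c : 'I_n -> R),
    psi b <> 0 /\ psi b * x = \sum_i psi (c i) * t i.

(* All fibres of phi are geometrically regular.  A finite extension L of the
   residue field of a prime p of R is given by the map psi : R -> L with
   kernel p; every prime of R arises in this way. *)
Definition geom_regular_fibres (R S : comPzRingType)
    (phi : {rmorphism R -> S}) : Prop :=
  forall (L : fieldType) (psi : {rmorphism R -> L}), finite_over psi ->
    exists (P : comPzRingType) (i : {rmorphism S -> P}) (j : {rmorphism L -> P}),
      is_tensor phi psi i j /\ regular_ring P.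

Definition G_ring (R : comPzRingType) : Prop :=
  forall p : set R, is_prime p ->
    exists (Rp Rh : comPzRingType)
           (l : {rmorphism R -> Rp}) (c : {rmorphism Rp -> Rh}),
      [/\ is_localization l (~` p), is_completion c (@nonunits Rp) &
          geom_regular_fibres c].

Definition J2_ring (R : comPzRingType) : Prop :=
  forall (B : comPzRingType) (phi : {rmorphism R -> B}), finite_type_algebra phi ->
    forall p : set B, is_prime p -> regular_prime p ->
      exists2 g, ~ p g & forall q : set B, is_prime q -> ~ q g -> regular_prime q.

Definition universally_catenary (R : comPzRingType) : Prop :=
  forall (B : comPzRingType) (phi : {rmorphism R -> B}),
    finite_type_algebra phi -> catenary B.

Definition excellent (R : comPzRingType) : Prop :=
  [/\ noetherian R, universally_catenary R, G_ring R & J2_ring R].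

Definition normal_domain (A : idomainType) : Prop :=
  forall x : {fraction A}, integralOver (@tofrac A) x -> exists a, x = @tofrac A a.

(* [None] is infinity. *)
Definition enat_le (a b : option nat) : Prop :=
  match a, b with
  | _, None => True
  | Some m, Some n => (m <= n)%N
  | None, Some _ => False
  end.

Definition enat_sup (P : set nat) : option nat :=
  match pselect (exists n, P n /\ forall m, P m -> (m <= n)%N) with
  | left e => Some (sval (cid e))
  | right _ => None
  end.

Section Length.
Variables (A R : comPzRingType) (alg : {rmorphism A -> R}) (M : lmodType R).

Definition is_submodule (N : set M) : Prop :=
  [/\ N 0, forall x y, N x -> N y -> N (x + y) &
      forall a x, N x -> N (alg a *: x)].

(* The length over A of the subquotient C / B of M, for A-submodules B and C
   with B included in C: submodules of C / B are those between B and C. *)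
Definition subquotient_length (B C : set M) : option nat :=
  enat_sup [set n | exists c : nat -> set M,
    [/\ forall i, (i <= n)%N -> is_submodule (c i),
        forall i, (i < n)%N -> c i `<` c i.+1,
        B `<=` c 0%N & c n `<=` C]].

End Length.

Record opens (T : topologicalType) := Opens { oset :> T -> Prop ; oset_open : open oset }.

Definition opensT (T : topologicalType) : opens T := Opens openT.

Definition opensI (T : topologicalType) (U V : opens T) : opens T :=
  Opens (openI (oset_open U) (oset_open V)).

Definition preim (S T : topologicalType) (f : S -> T) (cf : continuous f)
    (V : opens T) : opens S :=
  Opens (proj1 (continuousP f) cf _ (oset_open V)).

Definition is_sheaf (T : topologicalType) (F : opens T -> Type)
    (res : forall U V : opens T, V `<=` U -> F U -> F V) : Prop :=
  forall (U : opens T) (I : Type) (V : I -> opens T) (hV : forall i, V i `<=` U),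
    (forall x, U x -> exists i, V i x) ->
    forall s : forall i, F (V i),
      (forall i j (W : opens T) (hi : W `<=` V i) (hj : W `<=` V j),
         res _ _ hi (s i) = res _ _ hj (s j)) ->
      exists! t : F U, forall i, res _ _ (hV i) t = s i.

Record ringed_space := RingedSpace {
  space :> topologicalType;
  OO : opens space -> comPzRingType;
  rres : forall U V : opens space, V `<=` U -> {rmorphism OO U -> OO V};
  rres_id : forall (U : opens space) (h : U `<=` U) s, rres h s = s;
  rres_comp : forall (U V W : opens space) (h : V `<=` U) (k : W `<=` V)
    (l : W `<=` U) s, rres k (rres h s) = rres l s;
  rres_sheaf : is_sheaf (fun U V h => rres h) }.

Arguments OO : clear implicits.
Arguments rres {r U V} h.

(* The germ of s at x is invertible in the stalk at x. *)
Definition invertible_at (X : ringed_space) (U : opens X) (x : X) (s : OO X U) : Prop :=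
  exists (V : opens X) (h : V `<=` U), V x /\ is_unit (rres h s).

Definition spec_point (X : ringed_space) (U : opens X) (R : comPzRingType)
    (phi : {rmorphism R -> OO X U}) (x : X) : set R :=
  [set r | ~ invertible_at x (phi r)].

(* (U, O_X|U) is isomorphic to Spec R as a ringed space, inducing phi on global
   sections: such an isomorphism sends x to [spec_point phi x], it is a
   homeomorphism for the Zariski topology, and on the basic open set D(r) it
   identifies the sections of O_X with the localization of R at r. *)
Definition is_spec (X : ringed_space) (U : opens X) (R : comPzRingType)
    (phi : {rmorphism R -> OO X U}) : Prop :=
  [/\ forall x, U x -> is_prime (spec_point phi x),
      forall x y, U x -> U y -> spec_point phi x = spec_point phi y -> x = y,
      forall p, is_prime p -> exists2 x, U x & spec_point phi x = p,
      forall W : set X, W `<=` U ->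
        (open W <-> exists G : set R,
           forall x, U x -> (W x <-> ~ (G `<=` spec_point phi x))) &
      forall (r : R) (D : opens X) (h : D `<=` U),
        (forall x, D x <-> U x /\ ~ spec_point phi x r) ->
        is_localization (rres h \o phi) [set a | exists n, a = r ^+ n]].

Definition affine (X : ringed_space) (U : opens X) : Prop :=
  exists (R : comPzRingType) (phi : {rmorphism R -> OO X U}), is_spec phi.

(* A ringed space that is locally isomorphic to spectra is locally ringed. *)
Record scheme := Scheme {
  scheme_space :> ringed_space;
  schemeP : forall x : scheme_space, exists2 U : opens scheme_space, U x & affine U }.

(* Morphisms of locally ringed spaces.  The map O_Y -> f_* O_X is given in the
   form O_Y(V) -> O_X(U) for all opens U of X and V of Y with f(U) in V. *)
Record morphism (X Y : ringed_space) := Morphism {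
  mfun :> X -> Y;
  mfun_cont : continuous mfun;
  msh : forall (V : opens Y) (U : opens X), U `<=` mfun @^-1` V ->
    {rmorphism OO Y V -> OO X U};
  msh_nat : forall (V V' : opens Y) (U U' : opens X)
    (hV : V' `<=` V) (hU : U' `<=` U)
    (h : U `<=` mfun @^-1` V) (h' : U' `<=` mfun @^-1` V') s,
    msh h' (rres hV s) = rres hU (msh h s);
  msh_local : forall (V : opens Y) (U : opens X) (h : U `<=` mfun @^-1` V) x s,
    U x -> invertible_at x (msh h s) -> invertible_at (mfun x) s }.

Arguments mfun_cont {X Y} m.
Arguments msh {X Y} m {V U} h.

Definition mor_eq (X Y : ringed_space) (f g : morphism X Y) : Prop :=
  (forall x, f x = g x) /\
  forall (V : opens Y) (U : opens X) (h : U `<=` f @^-1` V) (h' : U `<=` g @^-1` V) s,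
    msh f h s = msh g h' s.

Section Comp.
Variables (X Y W : ringed_space) (g : morphism Y W) (f : morphism X Y).

Definition comp_sh (V : opens W) (U : opens X) (h : U `<=` (g \o f) @^-1` V) :
    {rmorphism OO W V -> OO X U} :=
  msh f (V := preim (mfun_cont g) V) h
    \o msh g (V := V) (U := preim (mfun_cont g) V) (@subset_refl _ _).

Lemma comp_cont : continuous (g \o f).
Proof. by move=> x; apply: continuous_comp; [exact: (mfun_cont f) | exact: (mfun_cont g)]. Qed.

Lemma comp_nat (V V' : opens W) (U U' : opens X)
    (hV : V' `<=` V) (hU : U' `<=` U)
    (h : U `<=` (g \o f) @^-1` V) (h' : U' `<=` (g \o f) @^-1` V') s :
  comp_sh h' (rres hV s) = rres hU (comp_sh h s).
Proof.
rewrite /comp_sh /=.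
have hP : preim (mfun_cont g) V' `<=` preim (mfun_cont g) V.
  by move=> y /hV.
by rewrite (msh_nat (m:=g) hV hP (@subset_refl _ _)) (msh_nat (m:=f) hP hU h).
Qed.

Lemma comp_local (V : opens W) (U : opens X) (h : U `<=` (g \o f) @^-1` V) x s :
  U x -> invertible_at x (comp_sh h s) -> invertible_at ((g \o f) x) s.
Proof.
move=> Ux H.
apply: (@msh_local _ _ g V (preim (mfun_cont g) V) (@subset_refl _ _) (f x)).
  exact: (h x Ux).
exact: (@msh_local _ _ f (preim (mfun_cont g) V) U h x _ Ux H).
Qed.

Definition mor_comp : morphism X W := Morphism comp_cont comp_nat comp_local.

End Comp.

Section Id.
Variable X : ringed_space.

Definition id_sh (V U : opens X) (h : U `<=` idfun @^-1` V) :
  {rmorphism OO X V -> OO X U} := rres (h : U `<=` V).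

Lemma id_cont : continuous (idfun : X -> X).
Proof. by move=> x; apply: cvg_id. Qed.

Lemma id_nat (V V' U U' : opens X) (hV : V' `<=` V) (hU : U' `<=` U)
    (h : U `<=` idfun @^-1` V) (h' : U' `<=` idfun @^-1` V') s :
  id_sh h' (rres hV s) = rres hU (id_sh h s).
Proof.
have l : U' `<=` V by move=> x /hU /h.
by rewrite /id_sh (rres_comp _ _ l) (rres_comp _ _ l).
Qed.

Lemma id_local (V U : opens X) (h : U `<=` idfun @^-1` V) x s :
  U x -> invertible_at x (id_sh h s) -> invertible_at (idfun x) s.
Proof.
move=> _ [W [k [Wx]]]; have l : W `<=` V by move=> y /k /h.
by rewrite /id_sh (rres_comp _ _ l) => u; exists W, l.
Qed.

Definition mor_id : morphism X X := Morphism id_cont id_nat id_local.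

End Id.

Definition is_pullback (X Y S P : scheme) (f : morphism X S) (g : morphism Y S)
    (p : morphism P X) (q : morphism P Y) : Prop :=
  mor_eq (mor_comp f p) (mor_comp g q) /\
  forall (W : scheme) (a : morphism W X) (b : morphism W Y),
    mor_eq (mor_comp f a) (mor_comp g b) ->
    exists w : morphism W P,
      [/\ mor_eq (mor_comp p w) a, mor_eq (mor_comp q w) b &
          forall w' : morphism W P, mor_eq (mor_comp p w') a ->
            mor_eq (mor_comp q w') b -> mor_eq w' w].

Definition closed_map (X Y : ringed_space) (f : morphism X Y) : Prop :=
  forall C : set X, closed C -> closed (f @` C).

(* An injective closed map is a homeomorphism onto a closed subset; the last
   condition is surjectivity of O_Y -> i_* O_X. *)
Definition closed_immersion (X Y : ringed_space) (i : morphism X Y) : Prop :=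
  [/\ injective i, closed_map i &
      forall (V : opens Y) (U : opens X) (s : OO X U), U = i @^-1` V :> set X ->
        forall y, V y ->
          exists (V' : opens Y) (U' : opens X) (hU : U' `<=` U)
                 (h : U' `<=` i @^-1` V') (t : OO Y V'),
            [/\ V' y, V' `<=` V, U' = i @^-1` V' :> set X & msh i h t = rres hU s]].

Definition separated (X S : scheme) (f : morphism X S) : Prop :=
  exists (P : scheme) (p q : morphism P X) (diag : morphism X P),
    [/\ is_pullback f f p q, mor_eq (mor_comp p diag) (mor_id X),
        mor_eq (mor_comp q diag) (mor_id X) & closed_immersion diag].

Definition finite_type (X S : scheme) (f : morphism X S) : Prop :=
  forall y : S, exists V : opens S,
    [/\ V y, affine V &
        exists (n : nat) (U : 'I_n -> opens X),
          (forall x, V (f x) -> exists i, U i x) /\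
          forall i, affine (U i) /\
            exists h : U i `<=` f @^-1` V, finite_type_algebra (msh f h)].

Definition universally_closed (X S : scheme) (f : morphism X S) : Prop :=
  forall (T P : scheme) (g : morphism T S) (p : morphism P X) (q : morphism P T),
    is_pullback f g p q -> closed_map q.

Definition proper_morphism (X S : scheme) (f : morphism X S) : Prop :=
  [/\ separated f, finite_type f & universally_closed f].

(* f restricts to an isomorphism from a dense open subscheme U of X to a dense
   open subscheme V of S. *)
Definition birational (X S : scheme) (f : morphism X S) : Prop :=
  exists (U : opens X) (V : opens S),
    [/\ dense U /\ dense V,
        f @` U = V /\ (forall x y, U x -> U y -> f x = f y -> x = y),
        forall W : opens X, W `<=` U -> open (f @` W) &
        forall (V' : opens S) (U' : opens X) (h : U' `<=` f @^-1` V'),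
          V' `<=` V -> U' = U `&` f @^-1` V' :> set X -> bijective (msh f h)].

Definition is_stalk (X : ringed_space) (x : X) (R : comPzRingType)
    (germ : forall U : opens X, U x -> {rmorphism OO X U -> R}) : Prop :=
  [/\ forall (U V : opens X) (hU : U x) (hV : V x) (h : V `<=` U) s,
        germ V hV (rres h s) = germ U hU s,
      forall r, exists (U : opens X) (hU : U x) (s : OO X U), germ U hU s = r &
      forall (U : opens X) (hU : U x) (s : OO X U), germ U hU s = 0 ->
        exists (V : opens X) (h : V `<=` U), V x /\ rres h s = 0].

Definition regular_scheme (X : scheme) : Prop :=
  forall x : X, exists (R : comPzRingType)
    (germ : forall U : opens X, U x -> {rmorphism OO X U -> R}),
    is_stalk germ /\ regular_local R.

(* If S is integral, then so is X, being regular and birational to S. *)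
Definition resolution (X S : scheme) (f : morphism X S) : Prop :=
  [/\ regular_scheme X, proper_morphism f & birational f].

Record mod_sheaf (X : ringed_space) := ModSheaf {
  sec :> forall U : opens X, lmodType (OO X U);
  mres : forall U V : opens X, V `<=` U -> sec U -> sec V;
  mres_linear : forall (U V : opens X) (h : V `<=` U) a s t,
    mres h (a *: s + t) = rres h a *: mres h s + mres h t;
  mres_id : forall (U : opens X) (h : U `<=` U) s, mres h s = s;
  mres_comp : forall (U V W : opens X) (h : V `<=` U) (k : W `<=` V)
    (l : W `<=` U) s, mres k (mres h s) = mres l s;
  mres_sheaf : is_sheaf (fun U V h => @mres U V h) }.

Arguments mres {X} m {U V} h.

Record mod_mor (X : ringed_space) (M N : mod_sheaf X) := ModMor {
  mmap :> forall U : opens X, {linear M U -> N U};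
  mmap_nat : forall (U V : opens X) (h : V `<=` U) s,
    mmap V (mres M h s) = mres N h (mmap U s) }.

Definition mono_sheaf (X : ringed_space) (M N : mod_sheaf X) (u : mod_mor M N) : Prop :=
  forall U, injective (u U).

Definition exact_sheaf (X : ringed_space) (M N P : mod_sheaf X)
    (u : mod_mor M N) (v : mod_mor N P) : Prop :=
  (forall U s, v U (u U s) = 0) /\
  forall (U : opens X) (s : N U), v U s = 0 ->
    forall x, U x -> exists (V : opens X) (h : V `<=` U) (t : M V),
      V x /\ u V t = mres N h s.

Definition injective_sheaf (X : ringed_space) (I : mod_sheaf X) : Prop :=
  forall (M N : mod_sheaf X) (u : mod_mor M N) (v : mod_mor M I), mono_sheaf u ->
    exists w : mod_mor N I, forall U s, w U (u U s) = v U s.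

Record injective_resolution (X : ringed_space) (F : mod_sheaf X) := InjectiveResolution {
  ir_obj : nat -> mod_sheaf X;
  ir_aug : mod_mor F (ir_obj 0);
  ir_diff : forall n, mod_mor (ir_obj n) (ir_obj n.+1);
  ir_injective : forall n, injective_sheaf (ir_obj n);
  ir_mono : mono_sheaf ir_aug;
  ir_exact0 : exact_sheaf ir_aug (ir_diff 0);
  ir_exactS : forall n, exact_sheaf (ir_diff n) (ir_diff n.+1) }.

Arguments ir_obj {X F} i _.
Arguments ir_diff {X F} i n.

Section Cohomology.
Variables (A : comPzRingType) (X : ringed_space) (alg : {rmorphism A -> OO X (opensT X)}).
Variables (F : mod_sheaf X) (I : injective_resolution F).

Definition cocycles (i : nat) : set (ir_obj I i (opensT X)) :=
  [set s | ir_diff I i (opensT X) s = 0].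

Definition coboundaries (i : nat) : set (ir_obj I i (opensT X)) :=
  match i with
  | 0%N => [set 0]
  | j.+1 => range (ir_diff I j (opensT X))
  end.

Arguments cocycles : clear implicits.
Arguments coboundaries : clear implicits.

(* The length over A of H^i(X, F) = R^i Gamma(X, F), computed with I; it does
   not depend on I. *)
Definition cohomology_length (i : nat) : option nat :=
  subquotient_length alg (coboundaries i) (cocycles i).

End Cohomology.

Arguments cohomology_length {A X} alg {F} I i.

Definition globally_generated (X : ringed_space) (F : mod_sheaf X) : Prop :=
  forall (U : opens X) (s : F U) (x : X), U x ->
    exists (V : opens X) (h : V `<=` U) (n : nat)
           (a : 'I_n -> OO X V) (g : 'I_n -> F (opensT X)),
      V x /\ mres F h s = \sum_i a i *: mres F (U := opensT X) (@subsetT _ V) (g i).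

Section StructureSheaf.
Variable X : ringed_space.

Lemma rres_linear (U V : opens X) (h : V `<=` U) (a : OO X U) (s t : (OO X U)^o) :
  (rres h (a *: s + t) : (OO X V)^o) = rres h a *: (rres h s : (OO X V)^o) + rres h t.
Proof. by rewrite rmorphD rmorphM. Qed.

Definition OX : mod_sheaf X :=
  @ModSheaf X (fun U => (OO X U)^o) (fun U V h => rres h)
    rres_linear (@rres_id X) (@rres_comp X) (@rres_sheaf X).

End StructureSheaf.

(* Irreducible closed subsets of a scheme are encoded by their generic points. *)

Definition generization_chain (X : topologicalType) (x : X) (n : nat) (c : nat -> X) :=
  c 0%N = x /\ forall i, (i < n)%N -> closure [set c i.+1] (c i) /\ c i <> c i.+1.

Definition codim (X : topologicalType) (x : X) (d : nat) : Prop :=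
  (exists c, generization_chain x d c) /\
  (forall n c, generization_chain x n c -> (n <= d)%N).

(* The germ of s at x lies in the n-th power of the maximal ideal of the stalk
   at x; for x of codimension 1 on a regular scheme, this says that s vanishes
   to order at least n along the closure of x. *)
Definition order_ge (X : ringed_space) (U : opens X) (x : X) (n : nat) (s : OO X U) : Prop :=
  exists (V : opens X) (h : V `<=` U),
    V x /\ ideal_pow [set t : OO X V | ~ invertible_at x t] n (rres h s).

Section IdealSheaf.
Variables (X : ringed_space) (Z : X -> nat).

Definition in_minus (U : opens X) (s : OO X U) : Prop :=
  forall x, U x -> order_ge x (Z x) s.

Lemma ideal_gen_ideal (R : comPzRingType) (G : set R) : is_ideal (ideal_gen G).
Proof.
split=> [I [I0 _ _] _ //|a b Ha Hb I hI GI|a b Hb I hI GI].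
  by case: (hI) => _ D _; apply: D; [apply: Ha|apply: Hb].
by case: (hI) => _ _ M; apply: M; apply: Hb.
Qed.

Lemma invertible_res (U V : opens X) (h : V `<=` U) x (s : OO X U) :
  invertible_at x (rres h s) -> invertible_at x s.
Proof.
move=> [W [k [Wx]]]; have l : W `<=` U by move=> y /k /h.
by rewrite (rres_comp _ _ l) => u; exists W, l.
Qed.

Lemma res_invertible (U V : opens X) (h : V `<=` U) x (s : OO X U) :
  V x -> invertible_at x s -> invertible_at x (rres h s).
Proof.
move=> Vx [W [k [Wx [b ub]]]].
have hV : opensI V W `<=` V by move=> y [].
have hW : opensI V W `<=` W by move=> y [].
have hU : opensI V W `<=` U by move=> y [/h].
exists (opensI V W), hV; split; first by split.
exists (rres hW b).
by rewrite (rres_comp _ _ hU) -(rres_comp k hW) -rmorphM ub rmorph1.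
Qed.

Lemma res_ideal_pow (U V : opens X) (h : V `<=` U) x n (s : OO X U) : V x ->
  ideal_pow [set t : OO X U | ~ invertible_at x t] n s ->
  ideal_pow [set t : OO X V | ~ invertible_at x t] n (rres h s).
Proof.
move=> Vx /(_ (rres h @^-1` ideal_pow [set t | ~ invertible_at x t] n)); apply.
  case: (ideal_gen_ideal [set a | exists2 t : 'I_n -> OO X V,
    (forall i, ~ invertible_at x (t i)) & a = \prod_i t i]) => H0 HD HM.
  split=> [|a b Ha Hb|a b Hb] /=; rewrite ?rmorph0 ?rmorphD ?rmorphM //.
  - exact: HD.
  - exact: HM.
move=> _ [t Ht ->] I _ GI; apply: GI; exists (fun i => rres h (t i)).
  by move=> i /invertible_res; apply: Ht.
by rewrite rmorph_prod.
Qed.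

Lemma order_ge_res (U V : opens X) (h : V `<=` U) x n (s : OO X U) : V x ->
  order_ge x n s -> order_ge x n (rres h s).
Proof.
move=> Vx [W [k [Wx Hs]]].
have hV : opensI V W `<=` V by move=> y [].
have hW : opensI V W `<=` W by move=> y [].
have hU : opensI V W `<=` U by move=> y [/h].
exists (opensI V W), hV; split; first by split.
rewrite (rres_comp _ _ hU) -(rres_comp k hW); exact: res_ideal_pow.
Qed.

Lemma res_order_ge (U V : opens X) (h : V `<=` U) x n (s : OO X U) :
  order_ge x n (rres h s) -> order_ge x n s.
Proof.
move=> [W [k [Wx]]]; have l : W `<=` U by move=> y /k /h.
by rewrite (rres_comp _ _ l) => Hs; exists W, l.
Qed.

Definition minus_pred (U : opens X) : {pred (OO X U)^o} :=
  fun s => `[< in_minus s >].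

Lemma minus_submod (U : opens X) : submod_closed (minus_pred (U:=U)).
Proof.
split.
  apply/asboolP => x Ux; exists U, (@subset_refl _ U); split=> //.
  by rewrite rmorph0; case: (ideal_gen_ideal [set a | exists2 t : 'I_(Z x) -> OO X U,
    (forall i, ~ invertible_at x (t i)) & a = \prod_i t i]).
move=> a s t /asboolP Hs /asboolP Ht; apply/asboolP => x Ux.
have [V [h [Vx Hsx]]] := Hs x Ux; have [W [k [Wx Htx]]] := Ht x Ux.
have hV : opensI V W `<=` V by move=> y [].
have hW : opensI V W `<=` W by move=> y [].
have hU : opensI V W `<=` U by move=> y [/h].
exists (opensI V W), hU; split; first by split.
rewrite rmorphD rmorphM.
case: (ideal_gen_ideal [set a | exists2 t : 'I_(Z x) -> OO X (opensI V W),
    (forall i, ~ invertible_at x (t i)) & a = \prod_i t i]) => H0 HD HM.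
apply: HD; first apply: HM.
  by rewrite -(rres_comp h hV); apply: res_ideal_pow.
by rewrite -(rres_comp k hW); apply: res_ideal_pow.
Qed.

HB.instance Definition _ (U : opens X) :=
  GRing.isSubmodClosed.Build _ _ (minus_pred (U:=U)) (@minus_submod U).

Record minus_sec (U : opens X) := MinusSec {
  minus_val : (OO X U)^o ;
  minus_valP : minus_val \in minus_pred (U:=U) }.

HB.instance Definition _ (U : opens X) := [isSub for @minus_val U].
HB.instance Definition _ (U : opens X) := [Choice of minus_sec U by <:].
HB.instance Definition _ (U : opens X) :=
  [SubChoice_isSubLmodule of minus_sec U by <:].

Lemma minus_res_subproof (U V : opens X) (h : V `<=` U) (s : minus_sec U) :
  (rres h (val s) : (OO X V)^o) \in minus_pred (U:=V).
Proof.
apply/asboolP => x Vx; apply: order_ge_res => //.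
by have /asboolP := valP s; apply; apply: h.
Qed.

Definition minus_res (U V : opens X) (h : V `<=` U) (s : minus_sec U) : minus_sec V :=
  MinusSec (minus_res_subproof h s).

Lemma minus_res_linear (U V : opens X) (h : V `<=` U) a (s t : minus_sec U) :
  minus_res h (a *: s + t) = rres h a *: minus_res h s + minus_res h t.
Proof. by apply: val_inj => /=; rewrite rmorphD rmorphM. Qed.

Lemma minus_res_id (U : opens X) (h : U `<=` U) s : minus_res h s = s.
Proof. by apply: val_inj => /=; rewrite rres_id. Qed.

Lemma minus_res_comp (U V W : opens X) (h : V `<=` U) (k : W `<=` V)
  (l : W `<=` U) s : minus_res k (minus_res h s) = minus_res l s.
Proof. by apply: val_inj => /=; rewrite (rres_comp _ _ l). Qed.

Lemma minus_res_sheaf : is_sheaf (fun U V h => @minus_res U V h).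
Proof.
move=> U I V hV cov s Hs.
have [|t [Ht uniq_t]] := rres_sheaf hV cov (s := fun i => val (s i)).
  by move=> i j W hi hj; have /(congr1 val) := Hs i j W hi hj.
have tP : (t : (OO X U)^o) \in minus_pred (U:=U).
  apply/asboolP => x Ux; have [i Vix] := cov x Ux.
  apply: (res_order_ge (h := hV i)); rewrite Ht.
  by have /asboolP := valP (s i); apply.
exists (MinusSec tP); split=> [i|t' Ht']; first by apply: val_inj; rewrite /= Ht.
apply: val_inj => /=; apply: uniq_t => i.
by have /(congr1 val) := Ht' i.
Qed.

(* The ideal sheaf O_X(-Z) of the effective divisor Z, the sum over all points
   x of Z(x) times the closure of x. *)
Definition OX_minus : mod_sheaf X :=
  @ModSheaf X (fun U => minus_sec U) minus_res
    minus_res_linear minus_res_id minus_res_comp minus_res_sheaf.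

End IdealSheaf.

Section Cycles.
Variables (A : comPzRingType) (S X : scheme).
Variables (phi : {rmorphism A -> OO S (opensT S)}) (f : morphism X S).

(* E = f^{-1}(m), for A local with maximal ideal m and S = Spec A. *)
Definition exceptional_set : set X :=
  [set x | spec_point phi (f x) = @nonunits A].

(* The prime divisors in E, that is, the E_i: E is a proper closed subset, so
   a point of codimension 1 of X lying in E is generic in E. *)
Definition exceptional_curve (x : X) : Prop := exceptional_set x /\ codim x 1.

Definition effective_cycle (Z : X -> nat) : Prop :=
  finite_set [set x | Z x <> 0%N] /\ forall x, Z x <> 0%N -> exceptional_curve x.

(* H^0(O_X(-Z)) and H^0(O_X(-Z-E_i)) are compared as subsets of H^0(O_X). *)
Definition no_fixed_component (Z : X -> nat) : Prop :=
  forall x : X, exceptional_curve x ->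
    [set s : OO X (opensT X) | in_minus Z s] <>
    [set s : OO X (opensT X) | in_minus (fun y => Z y + (y == x))%N s].

Definition structure_map : {rmorphism A -> OO X (opensT X)} :=
  msh f (V := opensT S) (U := opensT X) (fun _ _ => I) \o phi.

End Cycles.

(* Main.v *)
(* Let K be the fraction field of A. As O_X(-Z) embeds in the constant sheaf K, its H^1 is that
  of the families s : X -> K that locally are constant modulo the stalks, taken modulo those that are so
  globally. Since O_X(-Z) has no fixed component, a general combination h of finitely many global sections
  has order exactly Z_e along every exceptional curve e. So O_X(-Z)/hO_X has affine support,
  the strict transform of div(h), and multiplication by h maps H^1(O_X) onto H^1(O_X(-Z)), which
  is (1). If equality of the finite lengths holds, this map is injective, hence H^0(O_X(-Z)) maps
  onto the sections over the affine support, and O_X(-Z) is generated. Finiteness of H^1(O_X) comes from a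
  projective model of X and a pencil that generates it; universal catenarity bounds the chains of primes involved. *)
From HB Require Import structures.
From mathcomp Require Import all_boot all_order all_algebra.
From mathcomp Require Import boolp classical_sets functions cardinality topology.
From mathcomp Require Import ring.
From mathcomp Require Import -(notations) mpoly.
Require Import Defs.

Set Implicit Arguments.
Unset Strict Implicit.
Unset Printing Implicit Defensive.

Import GRing.Theory.
Local Open Scope classical_set_scope.
Local Open Scope ring_scope.

(** Both schemes become families of local rings inside K, and valuation rings of K replace most
    geometry: separatedness serves only as uniqueness of centers, universal closedness only as their
    existence, and statements on affine schemes become statements on the valuation rings over a
    subring of K. The H^1 of the statement comes from arbitrary injective resolutions, so families
    are matched with cocycles through the constant sheaf K and the injectivity of I^0. Bounds on
    dimension come from A[X] and A[X, Y]: the length of saturated chains up to (m, X) and (m, X, Y)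
    is fixed there, and residually independent elements would give longer chains. Hence the rings
    between A and K have dimension at most 2, and the points of the strict transform on the
    exceptional set have residue field k. As k is infinite, a combination over k can avoid finitely
    many residues; this is what a general combination means. Finiteness of the length of H^1(O_X)
    matters for (2): two infinite lengths would be equal without making a surjection injective. *)

Ltac fld := by field; repeat (apply/andP; split); rewrite ?mulf_neq0 ?expf_neq0 ?invr_neq0 ?oppr_eq0 ?oner_neq0.

(** * Subrings and valuation rings of a field *)

(** Zorn's lemma is applied to the sets B for which I0 together with B is good; in this form the
    empty chain is harmless, its union standing for I0. *)
Lemma Zorn_above (T : Type) (Good : set (set T)) (I0 : set T) :
  Good I0 ->
  (forall F : set (set T), F `<=` Good -> F !=set0 -> total_on F subset ->
   Good (\bigcup_(X in F) X)) ->
 exists A, [/\ Good A, I0 `<=` A & forall B, Good B -> A `<=` B -> B = A].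
Proof.
move=> G0 Gch.
pose P : set (set T) := [set B | Good (I0 `|` B)].
have [F FP totF|A [PA Amax]] := @Zorn_bigcup T P.
 have [->|/set0P [X0 FX0]] := eqVneq F set0.
  by rewrite /P /= bigcup_set0 setU0.
 rewrite /P /=; have -> : I0 `|` \bigcup_(X in F) X =
   \bigcup_(X in [set I0 `|` Y | Y in F]) X.
  apply/seteqP; split=> t.
   case=> [It|[Y FY Yt]]; first by exists (I0 `|` X0); [exists X0|left].
   by exists (I0 `|` Y); [exists Y|right].
  by case=> _ [Y FY <-] [It|Yt]; [left|right; exists Y].
 apply: Gch.
 - by move=> _ [Y FY <-]; apply: (FP Y FY).
 - by exists (I0 `|` X0), X0.
 - move=> _ _ [Y FY <-] [W FW <-]; have [YW|WY] := totF _ _ FY FW.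
   by left; apply: setUS.
  by right; apply: setUS.
exists (I0 `|` A); split=> // B GB AB.
apply/seteqP; split=> // t Bt; apply: contrapT => nAt.
have IB : I0 `|` B = B by apply/setUidPr => u Iu; apply: AB; left.
apply: (Amax B); last by rewrite /P /= IB.
split=> [u Au|/(_ t Bt) At]; first by apply: AB; right.
by apply: nAt; right.
Qed.

Lemma chain_pair (T : Type) (F : set (set T)) x y : total_on F subset -> (\bigcup_(X in F) X) x ->
 (\bigcup_(X in F) X) y -> exists X, [/\ F X, X x & X y].
Proof.
move=> totF [X FX Xx] [Y FY Yy]; have [XY|YX] := totF _ _ FX FY.
 by exists Y; split=> //; apply: XY.
by exists X; split=> //; apply: YX.
Qed.

Section Subrings.
Variable K : fieldType.
Implicit Types (R O V I J P Q : set K) (a b z : K).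

(** Rings and ideals are subsets of one field, so that localization, contraction and domination
    become inclusions of sets and no comparison maps occur. *)
Record subring R : Prop := Subring {
 sub1 : R 1;
 subB : forall a b, R a -> R b -> R (a - b);
 subM : forall a b, R a -> R b -> R (a * b) }.

Record ideal R J : Prop := Ideal {
 idS : J `<=` R;
 id0 : J 0;
 idD : forall a b, J a -> J b -> J (a + b);
 idM : forall a b, R a -> J b -> J (a * b) }.

Definition pideal R P : Prop :=
 [/\ ideal R P, ~ P 1 & forall a b, R a -> R b -> P (a * b) -> P a \/ P b].

Definition loc R P : set K :=
 [set z | exists a b, [/\ R a, R b, ~ P b & z * b = a]].

Definition nonunit O : set K := [set z | O z /\ ~ (z != 0 /\ O z^-1)].

Definition valring V : Prop := subring V /\ forall z, V z \/ V z^-1.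

Definition coefs_in (C : set K) (p : {poly K}) : Prop := forall i, C p`_i.

Definition adjoin R z : set K := [set p.[z] | p in coefs_in R].

Lemma expf_subV z i n : z != 0 -> (i <= n)%N -> z ^+ n * z^-1 ^+ (n - i) = z ^+ i.
Proof.
move=> z0 le; rewrite -{1}(subnK le) exprD mulrAC -exprMn mulfV // expr1n.
by rewrite mul1r.
Qed.

Section SubringTheory.
Variables (R : set K) (hR : subring R).

Lemma sub0 : R 0. Proof. by rewrite -(subrr 1); apply: subB => //; apply: sub1. Qed.
Lemma subN a : R a -> R (- a).
Proof. by move=> ?; rewrite -sub0r; apply: subB => //; apply: sub0. Qed.
Lemma subD a b : R a -> R b -> R (a + b).
Proof. by move=> ? ?; rewrite -[b]opprK; apply: subB => //; apply: subN. Qed.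
Lemma subX a n : R a -> R (a ^+ n).
Proof.
by move=> Ra; elim: n => [|n IH]; rewrite ?expr0 ?exprS; [exact: sub1|exact: subM].
Qed.
Lemma sub_sum (I : Type) (r : seq I) (p : pred I) (F : I -> K) :
 (forall i, p i -> R (F i)) -> R (\sum_(i <- r | p i) F i).
Proof. by move=> h; elim/big_ind: _ => //; [exact: sub0|exact: subD]. Qed.

Lemma sub_ideal : ideal R R.
Proof. by split=> //; [exact: sub0|exact: subD|exact: subM]. Qed.

Section IdealTheory.
Variables (J : set K) (hJ : ideal R J).

Lemma idMr a b : J a -> R b -> J (a * b).
Proof. by move=> ? ?; rewrite mulrC; apply: (idM hJ). Qed.
Lemma idN a : J a -> J (- a).
Proof. by move=> Ja; rewrite -mulN1r; apply: (idM hJ) => //; apply: subN; apply: sub1. Qed.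
Lemma idB a b : J a -> J b -> J (a - b).
Proof. by move=> ? ?; apply: (idD hJ) => //; apply: idN. Qed.
Lemma id_sum (I : Type) (r : seq I) (p : pred I) (F : I -> K) :
 (forall i, p i -> J (F i)) -> J (\sum_(i <- r | p i) F i).
Proof. by move=> h; elim/big_ind: _ => //; [exact: (id0 hJ)|exact: (idD hJ)]. Qed.
Lemma coefs_inD p q : coefs_in J p -> coefs_in J q -> coefs_in J (p + q).
Proof. by move=> hp hq i; rewrite coefD; apply: (idD hJ). Qed.
Lemma coefs_inB p q : coefs_in J p -> coefs_in J q -> coefs_in J (p - q).
Proof. by move=> hp hq i; rewrite coefB; apply: idB. Qed.
Lemma coefs_inM p q : coefs_in R p -> coefs_in J q -> coefs_in J (p * q).
Proof. by move=> hp hq i; rewrite coefM; apply: id_sum => j _; apply: (idM hJ). Qed.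
Lemma coefs_inC c : J c -> coefs_in J c%:P.
Proof. by move=> Jc i; rewrite coefC; case: eqP => // _; apply: (id0 hJ). Qed.

Lemma adjoin_ideal z : ideal (adjoin R z) (adjoin J z).
Proof.
split.
- by move=> _ [p hp <-]; exists p => // i; apply: (idS hJ).
- by exists 0; rewrite ?horner0 // => i; rewrite coef0; apply: (id0 hJ).
- by move=> _ _ [p hp <-] [q hq <-]; exists (p + q); rewrite ?hornerD //; apply: coefs_inD.
- by move=> _ _ [p hp <-] [q hq <-]; exists (p * q); rewrite ?hornerM //; apply: coefs_inM.
Qed.

End IdealTheory.

Lemma coefs_inX : coefs_in R 'X.
Proof. by move=> i; rewrite coefX; case: eqP => _; [exact: sub1|exact: sub0]. Qed.

Lemma adjoin_sr z : subring (adjoin R z).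
Proof.
split.
- by exists 1%:P; rewrite ?hornerC //; apply: (coefs_inC sub_ideal); apply: sub1.
- move=> _ _ [p hp <-] [q hq <-]; exists (p - q); rewrite ?hornerD ?hornerN //.
 exact: (coefs_inB sub_ideal).
- move=> _ _ [p hp <-] [q hq <-]; exists (p * q); rewrite ?hornerM //.
 exact: (coefs_inM sub_ideal).
Qed.

Lemma sub_adjoin z J : ideal R J -> J `<=` adjoin J z.
Proof. by move=> hJ a Ja; exists a%:P; rewrite ?hornerC //; apply: (coefs_inC hJ). Qed.

Lemma adjoin_gen z : adjoin R z z.
Proof. by exists 'X; rewrite ?hornerX //; apply: coefs_inX. Qed.

Section LocTheory.
Variables (P : set K) (hP : pideal R P).

Let iP : ideal R P. Proof. by case: hP. Qed.

Lemma prime1 : ~ P 1. Proof. by case: hP. Qed.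
Lemma primeM a b : R a -> R b -> P (a * b) -> P a \/ P b.
Proof. by case: hP => _ _; apply. Qed.
Lemma primeNM a b : R a -> R b -> ~ P a -> ~ P b -> ~ P (a * b).
Proof. by move=> Ra Rb na nb /(primeM Ra Rb) []. Qed.
Lemma primeX a n : R a -> P (a ^+ n) -> P a.
Proof.
move=> Ra; elim: n => [|n IH]; first by rewrite expr0 => /prime1.
by rewrite exprS => /(primeM Ra (subX _ Ra)) [|/IH].
Qed.
Lemma primeN0 b : ~ P b -> b != 0.
Proof. by move=> nPb; apply/eqP => b0; apply: nPb; rewrite b0; apply: (id0 iP). Qed.

Lemma sub_loc : R `<=` loc R P.
Proof. by move=> a Ra; exists a, 1; rewrite mulr1; split=> //; [exact: sub1|exact: prime1]. Qed.

Lemma locE a b : R a -> R b -> ~ P b -> loc R P (a / b).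
Proof. by move=> Ra Rb Pb; exists a, b; split=> //; rewrite divfK // primeN0. Qed.

Lemma locP z : loc R P z -> exists a b, [/\ R a, R b, ~ P b, b != 0 & z = a / b].
Proof.
move=> [a [b [Ra Rb Pb e]]]; exists a, b; split=> //; first exact: primeN0.
by rewrite -e mulfK // primeN0.
Qed.

Lemma loc_sr : subring (loc R P).
Proof.
split; first by apply: sub_loc; apply: sub1.
- move=> _ _ /locP [a [b [Ra Rb Pb b0 ->]]] /locP [c [d [Rc Rd Pd d0 ->]]].
 have -> : a / b - c / d = (a * d - c * b) / (b * d) by fld.
 by apply: locE; [apply: subB => //; apply: subM|apply: subM|apply: primeNM].
- move=> _ _ /locP [a [b [Ra Rb Pb b0 ->]]] /locP [c [d [Rc Rd Pd d0 ->]]].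
 have -> : a / b * (c / d) = (a * c) / (b * d) by fld.
 by apply: locE; [apply: subM|apply: subM|apply: primeNM].
Qed.

Lemma nonunit_locP z : nonunit (loc R P) z <-> exists a b, [/\ P a, R b, ~ P b & z = a / b].
Proof.
split.
 move=> [/locP [a [b [Ra Rb Pb b0 ->]]] nu]; exists a, b; split=> //.
 apply: contrapT => Pa; apply: nu; split.
  by rewrite mulf_neq0 ?invr_neq0 // primeN0.
 by rewrite invf_div; apply: locE.
move=> [a [b [Pa Rb Pb ->]]]; split; first by apply: locE => //; apply: (idS iP).
move=> [n0]; rewrite invf_div => /locP [c [d [Rc Rd Pd d0 e]]].
have a0 : a != 0 by apply: contraNneq n0 => ->; rewrite mul0r.
have : b * d = c * a.
 by move/eqP: e; rewrite eqr_div // => /eqP.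
move=> bd; have : P (b * d) by rewrite bd; apply: (idM iP).
exact: primeNM.
Qed.

Lemma nonunit_locR a : R a -> nonunit (loc R P) a <-> P a.
Proof.
move=> Ra; rewrite nonunit_locP; split=> [[c [d [Pc Rd Pd e]]]|Pa].
 have : P (a * d) by rewrite e divfK // primeN0.
 by case/(primeM Ra Rd).
by exists a, 1; rewrite divr1; split=> //; [exact: sub1|exact: prime1].
Qed.

Lemma loc_trace : R `&` nonunit (loc R P) = P.
Proof.
apply/seteqP; split=> [z [Rz /(nonunit_locR Rz)] //|z Pz]; have Rz := idS iP Pz.
by split=> //; apply/nonunit_locR.
Qed.

Lemma nonunit_loc_ideal : ideal (loc R P) (nonunit (loc R P)).
Proof.
split; first by move=> z [].
- by apply/nonunit_locR; [exact: sub0|exact: (id0 iP)].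
- move=> _ _ /nonunit_locP [a [b [Pa Rb Pb ->]]] /nonunit_locP [c [d [Pc Rd Pd ->]]].
 apply/nonunit_locP; exists (a * d + c * b), (b * d).
 have b0 := primeN0 Pb; have d0 := primeN0 Pd.
 split; [|exact: subM|exact: primeNM|fld].
 by apply: (idD iP); apply: idMr.
- move=> _ _ /locP [a [b [Ra Rb Pb b0 ->]]] /nonunit_locP [c [d [Pc Rd Pd ->]]].
 have d0 := primeN0 Pd.
 apply/nonunit_locP; exists (a * c), (b * d).
 split; [|exact: subM|exact: primeNM|fld].
 exact: (idM iP).
Qed.

End LocTheory.

End SubringTheory.

Lemma adjoin_min R z S : subring S -> R `<=` S -> S z -> adjoin R z `<=` S.
Proof.
move=> hS RS Sz _ [p hp <-]; rewrite horner_coef.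
apply: (sub_sum hS) => i _; apply: (subM hS); first exact/RS/hp.
exact: subX.
Qed.

Definition integral R z : Prop :=
 exists (n : nat) (c : nat -> K), (forall i, R (c i)) /\ z ^+ n = \sum_(i < n) c i * z ^+ i.

(** Of two nonzero nonunits one divides the other, so their sum is a multiple of one of them. *)
Lemma valring_ideal V : valring V -> ideal V (nonunit V).
Proof.
move=> [sV vV].
have nuM a b : V a -> nonunit V b -> nonunit V (a * b).
 move=> Va [Vb nb]; split; first exact: (subM sV).
 move=> [ab0 Vi]; apply: nb; move: ab0; rewrite mulf_eq0 negb_or => /andP[a0 b0].
 split=> //; have -> : b^-1 = a * (a * b)^-1 by fld.
 exact: (subM sV).
split.
- by move=> z [].
- by split; [exact: sub0|rewrite eqxx => -[]].
- move=> a b na nb; have [->|a0] := eqVneq a 0; first by rewrite add0r.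
 have [->|b0] := eqVneq b 0; first by rewrite addr0.
 have [Va _] := na; have [Vb _] := nb.
 case: (vV (a / b)) => [Vab|]; last rewrite invf_div => Vba.
  have -> : a + b = (a / b + 1) * b by fld.
  by apply: nuM => //; apply: (subD sV) => //; apply: sub1.
 have -> : a + b = (b / a + 1) * a by fld.
 by apply: nuM => //; apply: (subD sV) => //; apply: sub1.
- exact: nuM.
Qed.

Lemma not_nonunit R z : R z -> ~ nonunit R z -> z != 0 /\ R z^-1.
Proof. by move=> Rz nz; apply: contrapT => h; apply: nz. Qed.

Lemma nonunit_mul R a b : subring R -> R a -> R b -> nonunit R (a * b) -> nonunit R a \/ nonunit R b.
Proof.
move=> sR Ra Rb [_ nab]; apply: contrapT => /not_orP [/(not_nonunit Ra) [a0 Rai] /(not_nonunit Rb) [b0 Rbi]].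
by apply: nab; rewrite mulf_neq0 // invfM; split=> //; apply: (subM sR).
Qed.

Lemma nonunit_prime R : subring R -> ideal R (nonunit R) -> pideal R (nonunit R).
Proof.
move=> sR iR; split=> //; last by move=> a b; apply: nonunit_mul.
by move=> [_]; apply; split; [exact: oner_neq0|rewrite invr1; exact: sub1].
Qed.

Lemma prime_sub_nonunit R P : pideal R P -> P `<=` nonunit R.
Proof.
move=> [iP P1 _] z Pz; split; first exact: (idS iP).
by move=> [z0 zi]; apply: P1; rewrite -(mulVf z0); apply: (idM iP).
Qed.

Lemma valring_prime V : valring V -> pideal V (nonunit V).
Proof. by move=> vV; apply: nonunit_prime (vV.1) (valring_ideal vV). Qed.

Lemma valring_inv V z : valring V -> ~ V z -> nonunit V z^-1.
Proof.
move=> [sV vV] nz; case: (vV z) => // Vi; split=> // -[_].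
by rewrite invrK.
Qed.

Lemma nonunit_inv V z : V z^-1 -> z != 0 -> ~ nonunit V z.
Proof. by move=> Vi z0 [_]; apply. Qed.

Lemma adjoin1_sum J y : adjoin J y 1 -> exists n (c : nat -> K),
 (forall i, J (c i)) /\ 1 = \sum_(i < n.+1) c i * y ^+ i.
Proof.
move=> [p hp e]; exists (size p), (fun i => p`_i); split=> //.
rewrite -e horner_coef big_ord_recr /= [X in _ + X](_ : _ = 0) ?addr0 //.
by rewrite nth_default ?mul0r.
Qed.

Lemma adjoin_denom V I f s : ideal V I -> V f -> f != 0 -> (forall n, V (f ^+ n)) ->
 adjoin I f^-1 s -> exists n, I (f ^+ n * s).
Proof.
move=> iI Vf f0 VX [p hp <-]; exists (size p); rewrite horner_coef mulr_sumr.
apply: (id_sum iI) => i _; rewrite mulrCA; apply: (idMr iI) => //.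
have le : (i <= size p)%N by apply: ltnW.
by rewrite -[X in f^-1 ^+ X](subKn le) expf_subV ?leq_subr.
Qed.

(** * Chevalley's existence theorem for valuation rings *)

Section Chevalley.
Variables (S J : set K).
Hypotheses (sS : subring S) (iJ : ideal S J).
Hypothesis unitS : forall j, J j -> S (1 - j)^-1.
Hypothesis nJ1 : ~ J 1.

Let j1 j : J j -> 1 - j != 0.
Proof. by move=> Jj; apply: contra_notN nJ1; rewrite subr_eq0 => /eqP ->. Qed.

(* From [1 = c_0 + ... + c_n z^n] one can divide by the unit [1 - c_0]. *)
Lemma monic_of_rev (z : K) (c : nat -> K) n : z != 0 -> (forall i, J (c i)) ->
 1 = \sum_(i < n.+1) c i * z ^+ i ->
 exists d : nat -> K, (forall i, J (d i)) /\
  (z^-1) ^+ n = \sum_(i < n) d i * (z^-1) ^+ i.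
Proof.
move=> z0 Jc; rewrite big_ord_recl expr0 mulr1 => e.
pose u := (1 - c 0%N)^-1.
exists (fun i => u * c (n - i)%N); split=> [i|]; first by apply: (idM iJ) => //; apply: unitS.
have e' : 1 = \sum_(i < n) u * c i.+1 * z ^+ i.+1.
 apply: (mulfI (j1 (Jc 0%N))); rewrite mulr1 mulr_sumr.
 rewrite {1}e addrC addKr; apply: eq_bigr => i _ /=.
 by rewrite !mulrA mulfV ?j1 // mul1r.
rewrite -[LHS]mulr1 {}e' mulr_sumr (reindex_inj rev_ord_inj) /=.
apply: eq_bigr => i _; rewrite mulrCA; congr (_ * _).
 by rewrite subnSK.
by rewrite subnSK // -[in z ^+ _](invrK z) expf_subV ?invr_eq0 // ltnW.
Qed.

(** The relation of larger degree loses its leading term when the monic relation that [monic_of_rev]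
    makes of the other one is substituted into it; the sum of the degrees cannot decrease
    forever. *)
Lemma chevalley z : z != 0 -> adjoin J z 1 -> adjoin J z^-1 1 -> False.
Proof.
move=> z0 /adjoin1_sum ez /adjoin1_sum ez'.
pose D y n := exists c : nat -> K, (forall i, J (c i)) /\ 1 = \sum_(i < n.+1) c i * y ^+ i.
have red (y : K) k l : y != 0 -> D y k -> D y^-1 l -> (l <= k)%N -> exists2 k', (k' < k)%N & D y k'.
 move=> y0 [c [Jc ec]] [d [Jd ed]] lk.
 have yi0 : y^-1 != 0 by rewrite invr_eq0.
 case: l ed lk => [|l] ed lk.
  by case: nJ1; rewrite ed big_ord1 expr0 mulr1.
 have [d' [Jd' ed']] := monic_of_rev yi0 Jd ed; rewrite invrK in ed'.
 case: k ec lk => [//|k] ec lk; exists k => //.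
 exists (fun i => c i + c k.+1 * (if (k - l <= i)%N then d' (i - (k - l))%N else 0)); split.
  move=> i; apply: (idD iJ) => //; apply: (idM iJ); first exact: (idS iJ).
  by case: ifP => // _; apply: (id0 iJ).
 rewrite ec big_ord_recr /=; under [RHS]eq_bigr do rewrite mulrDl.
 rewrite big_split /=; congr (_ + _).
 rewrite -(subnK lk) exprD ed' subSS; set r := (k - l)%N.
 under [RHS]eq_bigr do rewrite -mulrA; rewrite -mulr_sumr; congr (_ * _).
 rewrite big_split_ord /= [X in _ = X + _]big1 ?add0r => [|i _]; last first.
  by rewrite leqNgt ltn_ord /= mul0r.
 rewrite mulr_sumr; apply: eq_bigr => i _.
 by rewrite leq_addr addKn exprD mulrCA.
suff H N y k l : (k + l < N)%N -> y != 0 -> D y k -> D y^-1 l -> False.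
 by have [k hk] := ez; have [l hl] := ez'; apply: (H _ z k l (ltnSn _)).
elim: N y k l => // N IH y k l; rewrite ltnS => le y0 hk hl.
have [lk|kl] := leqP l k.
 have [k' lt hk'] := red y k l y0 hk hl lk.
 by apply: (IH y k' l) => //; apply: leq_trans le; rewrite ltn_add2r.
have [||k' lt hk'] := red y^-1 l k _ hl _ (ltnW kl); rewrite ?invr_eq0 ?invrK //.
by apply: (IH y k k') => //; apply: leq_trans le; rewrite ltn_add2l.
Qed.

End Chevalley.

(* Zorn's lemma for pairs of a subring V and a proper ideal I of V. *)
Lemma valring_exists R J : subring R -> ideal R J -> ~ J 1 ->
 exists V, [/\ valring V, R `<=` V & J `<=` nonunit V].
Proof.
move=> sR iJ J1; pose ring (G : set (bool * K)) : set K := [set x | G (true, x)].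
pose idl (G : set (bool * K)) : set K := [set x | G (false, x)].
pose Good := [set G | [/\ subring (ring G), ideal (ring G) (idl G) & ~ idl G 1]].
have [||G [[sV iV nV] RG Gmax]] := @Zorn_above _ Good [set x : bool * K | if x.1 then R x.2 else J x.2].
- by split.
- move=> F FG [X0 FX0] totF; have [s0 i0 _] := FG _ FX0.
 split; last by move=> [X FX X1]; have [_ _] := FG X FX.
  split; first by exists X0 => //; exact: (sub1 s0).
   move=> a b /(chain_pair totF) h/h [X [FX Xa Xb]]; have [sX _ _] := FG _ FX.
   by exists X => //; exact: (subB sX).
  move=> a b /(chain_pair totF) h/h [X [FX Xa Xb]]; have [sX _ _] := FG _ FX.
  by exists X => //; exact: (subM sX).
 split; first by move=> a [X FX Xa]; exists X => //; have [_ iX _] := FG X FX; exact: (idS iX).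
 - by exists X0 => //; exact: (id0 i0).
 - move=> a b /(chain_pair totF) h/h [X [FX Xa Xb]]; have [_ iX _] := FG _ FX.
  by exists X => //; exact: (idD iX).
 - move=> a b /(chain_pair totF) h/h [X [FX Xa Xb]]; have [_ iX _] := FG _ FX.
  by exists X => //; exact: (idM iX).
set V := ring G in sV iV *; set I := idl G in iV nV.
(* By maximality, V[x] with the ideal I[x] is either V with I itself or not proper. *)
have big x : ~ adjoin I x 1 -> V x.
 move=> L1; have hx := @adjoin_gen V sV x; rewrite /V /ring /= -(Gmax [set y | if y.1 then adjoin V x y.2 else adjoin I x y.2]) //.
  by split=> //=; [exact: adjoin_sr|exact: adjoin_ideal].
 by move=> [[] y] Gy /=; [exact: (sub_adjoin _ (sub_ideal sV))|exact: (sub_adjoin _ iV)].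
(* If I[1/f] contained 1, then I would contain a power of f; but every power of f = 1 - j is 1
   modulo I. *)
have local j : I j -> V (1 - j)^-1.
 move=> Ij; set f := 1 - j; have f0 : f != 0.
  by apply: contra_notN nV; rewrite subr_eq0 => /eqP ->.
 have Vf : V f by apply: (subB sV); [exact: sub1|exact: (idS iV)].
 apply: big => /(adjoin_denom iV Vf f0) [n|n]; [exact: subX|rewrite mulr1 => Ifn; apply: nV].
 have : I (1 - f ^+ n).
  elim: (n) => [|l IH]; first by rewrite expr0 subrr; apply: (id0 iV).
  have -> : 1 - f ^+ l.+1 = (1 - f ^+ l) + f ^+ l * j by rewrite exprS /f; ring.
  by apply: (idD iV) => //; apply: (idM iV) => //; apply: subX.
 by move=> /(idD iV Ifn); rewrite addrC subrK.
have adj z : ~ V z -> adjoin I z 1 by move=> nz; apply: contrapT => /big.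
exists V; split.
- split=> // z; have [->|z0] := eqVneq z 0; first by left; apply: sub0.
 by apply: contrapT => /not_orP [/adj h1 /adj h2]; exact: (chevalley iV local nV z0).
- by move=> x Rx; apply: (RG (true, x)).
move=> j Jj; have Ij : I j by apply: (RG (false, j)).
split; first exact: (idS iV).
by move=> [j0 Vj]; apply: nV; rewrite -(mulVf j0); apply: (idM iV).
Qed.

Lemma contract_prime R S P : subring R -> R `<=` S -> pideal S P -> pideal R (R `&` P).
Proof.
move=> sR RS [iP n1 pP]; split; last first.
- by move=> a b Ra Rb [_ /pP] [||h|h]; [exact: RS|exact: RS|left|right].
- by case.
split; first by move=> a [].
- by split; [exact: sub0|exact: (id0 iP)].
- by move=> a b [? ?] [? ?]; split; [exact: subD|exact: (idD iP)].
- by move=> a b Ra [? ?]; split; [exact: (subM sR)|apply: (idM iP) => //; exact: RS].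
Qed.

Lemma center_prime R V : subring R -> valring V -> R `<=` V -> pideal R (R `&` nonunit V).
Proof. by move=> sR vV RV; apply: contract_prime (valring_prime vV). Qed.

Lemma loc_contract R S Q : subring R -> R `<=` S -> pideal S Q ->
 loc R (R `&` Q) `<=` loc S Q /\ nonunit (loc R (R `&` Q)) `<=` nonunit (loc S Q).
Proof.
move=> sR RS hQ; have hP := contract_prime sR RS hQ.
have nQ b : R b -> ~ (R `&` Q) b -> ~ Q b by move=> Rb nb Qb; apply: nb.
split=> z.
 by move=> /(locP hP) [a [b [Ra Rb nb _ ->]]]; apply: (locE hQ); [exact: RS|exact: RS|exact: nQ].
move=> /(nonunit_locP hP) [a [b [[_ Qa] Rb nb ->]]]; apply/(nonunit_locP hQ).
by exists a, b; split=> //; [exact: RS|exact: nQ].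
Qed.

Lemma loc_contract_eq R S Q : subring R -> subring S -> R `<=` S -> pideal S Q ->
 S `<=` loc R (R `&` Q) -> loc S Q = loc R (R `&` Q).
Proof.
move=> sR sS RS hQ SL; have [l1 l2] := loc_contract sR RS hQ.
apply/seteqP; split=> // z /(locP hQ) [a [b [Sa Sb nb b0 ->]]].
apply: (subM (loc_sr sR (contract_prime sR RS hQ))); first exact: SL.
by have [|//] := not_nonunit (SL _ Sb); move=> /l2 /(nonunit_locR sS hQ Sb).
Qed.

Lemma loc_center R V : subring R -> valring V -> R `<=` V ->
 loc R (R `&` nonunit V) `<=` V /\ forall z, loc R (R `&` nonunit V) z ->
  nonunit V z <-> nonunit (loc R (R `&` nonunit V)) z.
Proof.
move=> sR vV RV; have sV := vV.1; have hV := valring_prime vV.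
have VE : loc V (nonunit V) = V.
 apply/seteqP; split; last exact: (sub_loc sV hV).
 by move=> z /(locP hV) [a [b [Va Vb nb _ ->]]]; apply: (subM sV) => //; case: (not_nonunit Vb nb).
have := loc_contract sR RV hV; rewrite VE => -[l1 l2]; split=> // z lz; split; last exact: l2.
by move=> [Vz nz]; split=> // -[z0 lz']; apply: nz; split=> //; apply: l1.
Qed.

(** V is a valuation ring dominating the localization at P; the last clause lets units of the
    localization be recognized in V. *)
Lemma valring_over_prime R P : subring R -> pideal R P ->
 exists V, [/\ valring V, R `<=` V, loc R P `<=` V, R `&` nonunit V = P &
  forall a, loc R P a -> nonunit V a <-> nonunit (loc R P) a].
Proof.
move=> sR hP; have iP := nonunit_loc_ideal sR hP.
have [|V [vV LV PV]] := valring_exists (loc_sr sR hP) iP.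
 by move=> /(nonunit_locR sR hP (sub1 sR)); case: hP.
have N a : loc R P a -> nonunit V a <-> nonunit (loc R P) a.
 move=> La; split; last exact: PV.
 by move=> Va; split=> // -[a0 /LV Lai]; apply: (nonunit_inv Lai a0 Va).
have RV : R `<=` V by move=> z Rz; apply/LV/(sub_loc sR hP).
exists V; split=> //; rewrite -[RHS](loc_trace sR hP).
by apply/seteqP; split=> z [Rz] /(N z (sub_loc sR hP Rz)).
Qed.

(** The extension of J to R[1/a] is proper because no power of a lies in J; in any valuation ring
    over R[1/a], a is a unit. *)
Lemma valring_avoid R J a : subring R -> ideal R J -> R a -> (forall n, ~ J (a ^+ n)) ->
 exists V, [/\ valring V, R `<=` V, J `<=` nonunit V & ~ nonunit V a].
Proof.
move=> sR iJ Ra nJ; have a0 : a != 0.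
 by apply/eqP => a0; apply: (nJ 1%N); rewrite a0 expr1; apply: (id0 iJ).
have [|V [vV RV JV]] := valring_exists (adjoin_sr sR a^-1) (adjoin_ideal iJ a^-1).
 by move=> /(adjoin_denom iJ Ra a0 (fun n => subX sR n Ra)) [n]; rewrite mulr1 => /nJ.
exists V; split=> // [z Rz|z Jz|].
- exact/RV/(sub_adjoin _ (sub_ideal sR)).
- exact/JV/(sub_adjoin _ iJ).
- by apply: (nonunit_inv _ a0); apply/RV/adjoin_gen.
Qed.

Section PrimeTheory.
Variables (R : set K) (hR : subring R).

Lemma prime_avoid J a : ideal R J -> R a -> (forall n, ~ J (a ^+ n)) ->
 exists P, [/\ pideal R P, J `<=` P & ~ P a].
Proof.
move=> iJ Ra /(valring_avoid hR iJ Ra) [V [vV RV JV na]].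
exists (R `&` nonunit V); split; [exact: center_prime| |by case].
by move=> z Jz; split; [apply: (idS iJ)|apply: JV].
Qed.

(** The denominators of z form an ideal. If it contained no power of a, some prime would contain it
    and avoid a, and z would have no denominator there: this is the quasi-compactness of D(a). *)
Lemma loc_denom z a : R a -> (forall P, pideal R P -> ~ P a -> loc R P z) ->
 exists n, R (a ^+ n * z).
Proof.
move=> Ra h; apply: contrapT => nex.
pose J := [set b | R b /\ R (b * z)].
have hJ : ideal R J.
 split; first by move=> b [].
 - by split; rewrite ?mul0r; apply: sub0.
 - by move=> x y [? ?] [? ?]; split; rewrite ?mulrDl; apply: subD.
 - by move=> x y Rx [? ?]; split; rewrite -?mulrA; apply: subM.
have [n [_ Jn]|P [hP JP Pa]] := prime_avoid hJ Ra.
 by apply: nex; exists n.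
have [x [b [Rx Rb Pb e]]] := h P hP Pa.
by apply: Pb; apply: JP; split=> //; rewrite mulrC e.
Qed.

Lemma loc_inter z : (forall P, pideal R P -> loc R P z) -> R z.
Proof.
move=> h; have [|P hP _|n] := @loc_denom z 1; first exact: sub1.
 exact: h.
by rewrite expr1n mul1r.
Qed.

Lemma power_split b b' i j : R b -> R b' ->
 exists u v, [/\ R u, R v & (b + b') ^+ (i + j) = u * b ^+ i + v * b' ^+ j].
Proof.
move=> Rb Rb'; have Rc n : R ((b + b') ^+ n) by apply: (subX hR); apply: (subD hR).
elim: i j => [|i IH] j.
 by exists ((b + b') ^+ j), 0; rewrite mulr1 mul0r addr0; split=> //; exact: sub0.
elim: j => [|j [u [v [Ru Rv e]]]].
 by exists 0, ((b + b') ^+ (i.+1 + 0)); rewrite mul0r mulr1 add0r; split=> //; exact: sub0.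
have [u' [v' [Ru' Rv' e']]] := IH j.+1; exists (u' + b' * u), (b * v' + v).
split; try by apply: subD => //; apply: subM.
by rewrite addnS exprS mulrDl {2}e addSnnS e' !exprS; ring.
Qed.

(* A cocycle on an affine scheme with values in the quotient of the constant
  sheaf K by a quasi-coherent subsheaf is a coboundary. *)
Lemma affine_family (s : set K -> K) :
 (forall P, pideal R P -> exists b, [/\ R b, ~ P b &
   forall Q, pideal R Q -> ~ Q b -> loc R Q (s Q - s P)]) ->
 exists k, forall P, pideal R P -> loc R P (s P - k).
Proof.
(* J consists of the b such that one constant serves on all of D(b). The point is that J is closed
   under addition; then J contains 1, since no prime contains it. *)
move=> h; pose J := [set b | R b /\ exists k, forall P, pideal R P -> ~ P b -> loc R P (s P - k)].
have iJ : ideal R J.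
 split; first by move=> b [].
 - by split; [exact: sub0|exists 0 => P [iP _ _] []; exact: (id0 iP)].
 - move=> b b' [Rb [k hk]] [Rb' [k' hk']]; split; first exact: subD.
  have [->|b0] := eqVneq b 0; first by rewrite add0r; exists k'.
  have [->|b0'] := eqVneq b' 0; first by rewrite addr0; exists k.
  have [|P hP nP|N RN] := @loc_denom (k - k') (b * b'); first exact: subM.
   have [iP _ _] := hP; rewrite (_ : k - k' = (s P - k') - (s P - k)); last by ring.
   by apply: (subB (loc_sr hR hP)); [apply: hk'|apply: hk] => // h'; apply: nP; [apply: (idM iP)|apply: (idMr iP)].
  have [u [v [Ru Rv e]]] := power_split N N Rb Rb'.
  have [bN bN'] := (expf_neq0 N b0, expf_neq0 N b0'); have Rc : R ((b + b') ^+ (N + N)) by apply: (subX hR); apply: (subD hR).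
  (* With c = (b + b')^(2N) = u b^N + v b'^N as partition of unity, k - k' is the sum of its
     multiples by v b'^N / c and u b^N / c. The first has denominator c b^N and corrects k on D(b),
     the second has denominator c b'^N and corrects k' on D(b'). *)
  exists (k - v * ((b * b') ^+ N * (k - k')) / ((b + b') ^+ (N + N) * b ^+ N)) => P hP nP; have [iP _ _] := hP.
  have sP := loc_sr hR hP; have nc n : ~ P ((b + b') ^+ n) by move=> /(primeX hR hP (subD hR Rb Rb')).
  have cN := primeN0 hP (nc (N + N)%N).
  have [Pb|nb] := EM (P b).
   have nb' n : ~ P (b' ^+ n) by move=> /(primeX hR hP Rb') h'; apply: nP; apply: (idD iP).
   rewrite (_ : s P - _ = (s P - k') - u * ((b * b') ^+ N * (k - k')) / ((b + b') ^+ (N + N) * b' ^+ N)).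
    apply: (subB sP); first by apply: hk' => // h'; apply: nP; apply: (idD iP).
    by apply: (locE hP); [exact: subM|apply: subM => //; apply: subX|apply: (primeNM hP) => //; apply: subX].
   by rewrite e exprMn; field; rewrite -e cN bN bN'.
  rewrite (_ : s P - _ = (s P - k) - - v * ((b * b') ^+ N * (k - k')) / ((b + b') ^+ (N + N) * b ^+ N)); last by ring.
  apply: (subB sP); first exact: hk.
  apply: (locE hP); [apply: subM => //; exact: subN|apply: subM => //; exact: subX|apply: (primeNM hP) => //; first exact: subX].
  by move=> /(primeX hR hP Rb).
 - move=> a b Ra [Rb [k hk]]; split; first exact: subM.
  by exists k => P hP nP; apply: hk => // Pb; apply: nP; have [iP _ _] := hP; apply: (idM iP).
have [k hk] : exists k, forall P, pideal R P -> ~ P 1 -> loc R P (s P - k).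
 suff [] : J 1 by [].
 apply: contrapT => n1; have [n|P [hP JP _]] := prime_avoid iJ (sub1 hR); first by rewrite expr1n => /n1.
 have [b [Rb nb hb]] := h P hP.
 by apply/nb/JP; split=> //; exists (s P).
by exists k => P hP; apply: hk => //; exact: (prime1 hP).
Qed.

End PrimeTheory.

Lemma seq_max V (s : seq K) a : valring V -> a != 0 -> exists y, [/\ y \in a :: s, y != 0 &
 forall z, z \in a :: s -> V (z / y)].
Proof.
move=> [sV vV] a0; elim: s => [|g s [y [hy y0 my]]].
 by exists a; rewrite mem_head; split=> // z; rewrite inE => /eqP ->; rewrite divff //; apply: sub1.
have sub z : z \in a :: g :: s -> z = g \/ z \in a :: s.
 by rewrite !inE => /or3P [->|/eqP|->]; [right|left|right; rewrite orbT].
have [Vg|ng] := EM (V (g / y)).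
 exists y; split=> // [|z /sub [-> //|/my //]].
 by move: hy; rewrite !inE => /orP [->|->]; rewrite ?orbT.
have g0 : g != 0 by apply/eqP => g0; apply: ng; rewrite g0 mul0r; apply: sub0.
have Vyg : V (y / g) by case: (vV (g / y)) => //; rewrite invf_div.
exists g; rewrite !inE eqxx orbT; split=> // z /sub [->|/my hz].
 by rewrite divff //; apply: sub1.
by rewrite (_ : z / g = z / y * (y / g)); [apply: subM|fld].
Qed.

(** If 1/z is not invertible in R[1/z], some valuation ring over R[1/z] has it in its maximal ideal
    and so misses z. If it is, then z is a polynomial in 1/z, and clearing denominators gives a
    monic equation. *)
Lemma integral_vals R z : subring R ->
 (forall V, valring V -> R `<=` V -> V z) -> integral R z.
Proof.
move=> sR h; have [->|z0] := eqVneq z 0.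
 exists 1%N, (fun _ => 0); split; first by move=> _; apply: sub0.
 by rewrite big_ord1 mul0r expr1.
have sW := adjoin_sr sR z^-1; set W := adjoin R z^-1 in sW.
have Wz : W z^-1 by apply: adjoin_gen.
pose J := [set z^-1 * y | y in W].
have iJ : ideal W J.
 split.
 - by move=> _ [y Wy <-]; apply: (subM sW).
 - by exists 0; rewrite ?mulr0 //; apply: sub0.
 - by move=> _ _ [y Wy <-] [x Wx <-]; exists (y + x); rewrite ?mulrDr //; apply: subD.
 - by move=> a _ Wa [y Wy <-]; exists (a * y); rewrite 1?mulrCA //; apply: (subM sW).
have [[_ [p hp <-] e]|n1] := pselect (J 1).
 have {}e : z = p.[z^-1].
  by apply: (mulfI (invr_neq0 z0)); rewrite mulVf // e.
 exists (size p).+1, (fun i => p`_(size p - i)); split=> [i|]; first exact: hp.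
 rewrite exprSr {2}e horner_coef mulr_sumr big_ord_recl /= subn0 nth_default // mul0r add0r.
 rewrite (reindex_inj rev_ord_inj) /=; apply: eq_bigr => i _.
 rewrite mulrCA; congr (_ * _); rewrite /bump /= add1n.
 by rewrite expf_subV.
have [V [vV WV JV]] := valring_exists sW iJ n1.
have RV : R `<=` V by move=> x Rx; apply: WV; apply: (sub_adjoin _ (sub_ideal sR)).
have Vz := h V vV RV; have [_ []] : nonunit V z^-1.
 by apply: JV; exists 1; rewrite ?mulr1 //; apply: sub1.
by rewrite invrK invr_neq0.
Qed.

End Subrings.

(** * Noetherian and regular local rings *)

Section Noetherian.
Variable R : comPzRingType.
Implicit Types (I J P : set R) (a b z : R).

Lemma is_idealN I : is_ideal I -> forall a, I a -> I (- a).
Proof. by case=> _ _ IM a Ia; rewrite -mulN1r; apply: (IM). Qed.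

Lemma is_idealB I : is_ideal I -> forall a b, I a -> I b -> I (a - b).
Proof. by move=> iI a b Ia Ib; case: (iI) => _ ID _; apply: (ID) => //; apply: is_idealN. Qed.

Lemma is_ideal_sum I : is_ideal I -> forall (T : Type) (r : seq T) (p : pred T) (F : T -> R),
 (forall i, p i -> I (F i)) -> I (\sum_(i <- r | p i) F i).
Proof. by case=> I0 ID _ T r p F h; elim/big_ind: _. Qed.

Lemma principal_ideal a : is_ideal [set z | exists c, z = c * a].
Proof.
split; first by exists 0; rewrite mul0r.
- by move=> _ _ [c ->] [d ->]; exists (c + d); rewrite mulrDl.
- by move=> r _ [c ->]; exists (r * c); rewrite mulrA.
Qed.

Lemma zero_ideal : is_ideal ([set 0] : set R).
Proof. by split=> //= [x y -> ->|x y ->]; rewrite ?addr0 ?mulr0. Qed.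

Lemma ideal_gen_sub (G : set R) : G `<=` ideal_gen G.
Proof. by move=> a Ga I _; apply. Qed.

Lemma ideal_gen_range n (t : 'I_n -> R) :
 ideal_gen (range t) = [set z | exists c : 'I_n -> R, z = \sum_i c i * t i].
Proof.
apply/seteqP; split=> [z|z [c ->]].
 apply.
  split; first by exists (fun _ => 0); rewrite big1 // => i _; rewrite mul0r.
  - move=> _ _ [c ->] [d ->]; exists (fun i => c i + d i).
   by rewrite -big_split; apply: eq_bigr => i _; rewrite mulrDl.
  - move=> a _ [c ->]; exists (fun i => a * c i); rewrite mulr_sumr.
   by apply: eq_bigr => i _; rewrite mulrA.
 move=> _ [i _ <-]; exists (fun j => (j == i)%:R); rewrite (bigD1 i) //= eqxx mul1r.
 by rewrite big1 ?addr0 // => j /negPf ->; rewrite mul0r.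
apply: is_ideal_sum; first exact: ideal_gen_ideal.
move=> i _; case: (ideal_gen_ideal (range t)) => _ _; apply; apply: ideal_gen_sub.
by exists i.
Qed.

Lemma noetherian_gens I : noetherian R -> is_ideal I ->
 exists n (t : 'I_n -> R), (forall i, I (t i)) /\
  forall z, I z -> exists c : 'I_n -> R, z = \sum_i c i * t i.
Proof.
move=> nR /nR [n [t ->]]; exists n, t; split=> [i|z]; last by rewrite ideal_gen_range.
by apply: ideal_gen_sub; exists i.
Qed.

Lemma noetherian_max (Good : set (set R)) I0 : noetherian R ->
  (forall I, Good I -> is_ideal I) -> Good I0 ->
 exists A, [/\ Good A, I0 `<=` A & forall B, Good B -> A `<=` B -> B = A].
Proof.
move=> nR Gid G0; apply: Zorn_above => // F FG [X0 FX0] totF.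
have iU : is_ideal (\bigcup_(X in F) X).
 split.
 - by exists X0 => //; case: (Gid _ (FG _ FX0)).
 - move=> a b /(chain_pair totF) h/h [X [FX Xa Xb]]; exists X => //.
  by case: (Gid _ (FG _ FX)) => _ h' _; apply: h'.
 - move=> a b [X FX Xb]; exists X => //.
  by case: (Gid _ (FG _ FX)) => _ _; apply.
have [n [t [Ut Ugen]]] := noetherian_gens nR iU.
have [X FX Xt] : exists2 X, F X & forall i, X (t i).
 have : forall s : seq 'I_n, exists2 X, F X & forall i, i \in s -> X (t i).
  elim=> [|j s [X FX hX]]; first by exists X0.
  have [Y FY Yj] := Ut j; have [XY|YX] := totF _ _ FX FY; [exists Y|exists X] => // i.
   by rewrite inE => /predU1P [-> //|/hX/XY].
  by rewrite inE => /predU1P [->|/hX //]; apply: YX.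
 by move=> /(_ (enum 'I_n)) [X FX h]; exists X => // i; apply: h; rewrite mem_enum.
have -> : \bigcup_(X in F) X = X.
 apply/seteqP; split=> [z /Ugen [c ->]|]; last by move=> z Xz; exists X.
 have iX := Gid _ (FG _ FX); apply: is_ideal_sum => // i _.
 by case: iX => _ _; apply.
exact: FG.
Qed.

Lemma is_primeX P a n : is_prime P -> P (a ^+ n) -> P a.
Proof.
case=> _ P1 PM; elim: n => [|n IH]; first by rewrite expr0 => /P1.
by rewrite exprS => /PM [].
Qed.

Lemma prime_nonunit P : is_prime P -> P `<=` @nonunits R.
Proof.
move=> [[_ _ PM] P1 _] a Pa [b ab]; apply: P1.
by rewrite -ab mulrC; apply: PM.
Qed.

(* Nakayama's lemma for the localization at q, by elimination of generators. *)
Lemma nakayama (q I : set R) n (z : nat -> R) : is_prime q -> is_ideal I ->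
 (forall l, (l < n)%N -> exists2 s, ~ q s & exists2 c : nat -> R,
   (forall m, q (c m)) & I (s * z l - \sum_(m < n) c m * z m)) ->
 exists2 s, ~ q s & forall l, (l < n)%N -> I (s * z l).
Proof.
move=> hq iI; have [[q0 qD qM] q1 qP] := hq; have [I0 ID IM] := iI.
have iq : is_ideal q by [].
elim: n => [|n IH] h; first by exists 1.
have [s ns [c qc Is]] := h n (ltnSn n).
rewrite big_ord_recr /= in Is.
pose s' := s - c n.
have ns' : ~ q s'.
 by move=> qs'; apply: ns; have := qD _ _ qs' (qc n); rewrite subrK.
have Is' : I (s' * z n - \sum_(m < n) c m * z m).
 by have -> : s' * z n - \sum_(m < n) c m * z m =
   s * z n - (\sum_(i < n) c i * z i + c n * z n) by rewrite /s'; ring.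
have [l ln|t nt ht] := IH.
 have [r nr [d qd Ir]] := h l (ltnW ln); rewrite big_ord_recr /= in Ir.
 exists (s' * r); first by move=> /qP [].
 exists (fun m => s' * d m + d n * c m).
  by move=> m; apply: (qD); [apply: (qM)|rewrite mulrC; apply: (qM)].
 have -> : s' * r * z l - \sum_(m < n) (s' * d m + d n * c m) * z m =
   s' * (r * z l - (\sum_(i < n) d i * z i + d n * z n)) +
   d n * (s' * z n - \sum_(m < n) c m * z m).
  have -> : \sum_(m < n) (s' * d m + d n * c m) * z m =
   s' * (\sum_(m < n) d m * z m) + d n * (\sum_(m < n) c m * z m).
   rewrite !mulr_sumr -big_split; apply: eq_bigr => i _ /=; ring.
  ring.
 by apply: (ID); apply: (IM).
exists (t * s'); first by move=> /qP [].
move=> l; rewrite ltnS leq_eqVlt => /predU1P [->|/ht It]; last first.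
 by rewrite -mulrA mulrCA; apply: (IM).
have -> : t * s' * z n = t * (s' * z n - \sum_(m < n) c m * z m) + \sum_(m < n) c m * (t * z m).
 have -> : \sum_(m < n) c m * (t * z m) = t * \sum_(m < n) c m * z m.
  by rewrite mulr_sumr; apply: eq_bigr => i _; ring.
 ring.
apply: (ID); first exact: (IM).
by apply: is_ideal_sum => // i _; apply: (IM); apply: ht.
Qed.

Section Local.
Hypotheses (nR : noetherian R) (lR : is_local R).
Local Notation m := (@nonunits R).

Lemma nonunits_prime : is_prime m.
Proof.
have iM a b : m b -> m (a * b).
 by move=> mb [c e]; apply: mb; exists (c * a); rewrite -e; ring.
split; first split=> //.
- by move=> [c]; rewrite mul0r => /esym/lR.1.
- exact: lR.2.
- by apply; exists 1; rewrite mulr1.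
- move=> a b mab; apply: contrapT => /not_orP [/contrapT [c ec] /contrapT [d ed]].
 by apply: mab; exists (c * d); rewrite -[1]mulr1 -{1}ec -ed; ring.
Qed.

Lemma local_nakayama I J a : is_ideal I -> is_ideal J -> m a ->
 (forall z, J z -> exists2 y, J y & I (z - a * y)) -> J `<=` I.
Proof.
move=> iI iJ ma h; have [n [t [Jt Jgen]]] := noetherian_gens nR iJ.
pose z k := if insub k is Some i then t i else 0.
have zE (i : 'I_n) : z i = t i by rewrite /z valK.
have [l ln|s us hs] := @nakayama m I n z nonunits_prime iI.
 have [y Jy Iy] := h _ (Jt (Ordinal ln)); have [c ec] := Jgen _ Jy.
 exists 1; first by apply; exists 1; rewrite mulr1.
 exists (fun k => a * (if insub k is Some i then c i else 0)).
  move=> k; rewrite mulrC; have [[_ _ qM] _ _] := nonunits_prime; exact: (qM).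
 rewrite mul1r (_ : \sum_(_ < _) _ = a * y); first by rewrite -(zE (Ordinal ln)) in Iy.
 by rewrite ec mulr_sumr; apply: eq_bigr => i _; rewrite zE valK mulrA.
move=> x /Jgen [c ->]; apply: is_ideal_sum => // i _.
have [_ _ IM] := iI; apply: (IM); have := hs i (ltn_ord i); rewrite zE.
have [r er] : is_unit s by apply: contrapT.
by move=> /(IM r); rewrite mulrA [r * s]mulrC er mul1r.
Qed.

Lemma order_step I b z i : is_ideal I -> (forall z, m z -> exists c, I (z - c * b)) ->
 (exists y, I (z - b ^+ i * y)) \/ exists u j, is_unit u /\ I (z - u * b ^+ j).
Proof.
move=> [I0 ID IM] gen; elim: i => [|i [[y Iy]|h]]; [|have [uy|ny] := pselect (is_unit y)|by right].
- by left; exists z; rewrite mul1r subrr.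
- by right; exists y, i; rewrite [y * _]mulrC.
- left; have [d Id] := gen y ny; exists d.
 have -> : z - b ^+ i.+1 * d = (z - b ^+ i * y) + b ^+ i * (y - d * b).
  by rewrite exprS; ring.
 by apply: (ID) => //; apply: (IM).
Qed.

(** It is to be shown that the intersection J of the ideals I + b^i R is I. The ideals (I : b^c)
    stabilize, which allows one factor b to be cancelled and gives J contained in I + bJ; Nakayama's
    lemma concludes. *)
Lemma local_order I b : is_ideal I -> (forall z, m z -> exists c, I (z - c * b)) -> m b ->
 forall z, ~ I z -> exists u i, is_unit u /\ I (z - u * b ^+ i).
Proof.
move=> iI gen mb; have [I0 ID IM] := iI.
pose Q c := [set z | I (b ^+ c * z)].
have iQ c : is_ideal (Q c).
 split; rewrite /Q /=; first by rewrite mulr0.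
 - by move=> x y Ix Iy; rewrite mulrDr; apply: (ID).
 - by move=> x y Iy; rewrite mulrCA; apply: (IM).
have [A [[c _ eA] cmax]] : exists A, range Q A /\
  forall B, range Q B -> A `<=` B -> B = A.
 have [||A [hA _ hmax]] := @noetherian_max (range Q) (Q 0%N) nR.
 - by move=> _ [c _ <-].
 - by exists 0%N.
 by exists A.
have stab i z : I (b ^+ (c + i) * z) -> I (b ^+ c * z).
 have {}cmax : Q (c + i)%N = Q c.
  rewrite [RHS]eA; apply: cmax; first by exists (c + i)%N.
  rewrite -eA => y; rewrite /Q /= addnC exprD -mulrA; exact: (IM).
 by move=> h; have : Q (c + i)%N z by []; rewrite cmax.
pose J := [set z | forall i, exists y, I (z - b ^+ i * y)].
have iJ : is_ideal J.
 split.
 - by move=> i; exists 0; rewrite mulr0 subr0.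
 - move=> x y Jx Jy i; have [x' Ix] := Jx i; have [y' Iy] := Jy i; exists (x' + y').
  by have := ID _ _ Ix Iy; rewrite mulrDr opprD addrACA.
 - move=> x y Jy i; have [y' Iy] := Jy i; exists (x * y').
  by have := IM x _ Iy; rewrite mulrBr mulrCA.
have JI : J `<=` I.
 apply: (@local_nakayama I J b) => // z Jz; have [y0 Iy0] := Jz c.+1.
 exists (b ^+ c * y0); last by rewrite mulrA -exprS.
 move=> i; have [y Iy] := Jz (c.+1 + i)%N; exists (b ^+ c * y).
 have : I (b ^+ c.+1 * (y0 - b ^+ i * y)).
  have -> : b ^+ c.+1 * (y0 - b ^+ i * y) =
    (z - b ^+ (c.+1 + i) * y) - (z - b ^+ c.+1 * y0) by rewrite exprD; ring.
  exact: is_idealB.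
 rewrite -addn1 => /stab; rewrite mulrBr; congr (I (_ - _)); ring.
move=> z nIz; apply: contrapT => nex; apply: nIz; apply: JI => i.
by case: (order_step z i iI gen).
Qed.

Fixpoint ipow (q : set R) n : set R :=
 if n is n'.+1 then ideal_gen [set z | exists x y, [/\ q x, ipow q n' y & z = x * y]]
 else setT.

Lemma ipow_ideal q n : is_ideal (ipow q n).
Proof. by case: n => [|n]; [split|exact: ideal_gen_ideal]. Qed.

Lemma ipowS q n : ipow q n.+1 `<=` ipow q n.
Proof.
move=> z; apply; first exact: ipow_ideal.
by move=> _ [x [y [_ hy ->]]]; have [_ _] := ipow_ideal q n; apply.
Qed.

Lemma ipowX q n x : q x -> ipow q n (x ^+ n).
Proof.
move=> qx; elim: n => [//|n IH]; apply: ideal_gen_sub.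
by exists x, (x ^+ n); rewrite exprS.
Qed.

Lemma ipow_lincomb q n k (t : 'I_k -> R) : is_ideal q ->
 (forall z, ipow q n z -> exists c : 'I_k -> R, z = \sum_i c i * t i) ->
 forall z, ipow q n.+1 z -> exists2 c : 'I_k -> R, (forall i, q (c i)) & z = \sum_i c i * t i.
Proof.
move=> [q0 qD qM] gen z; pose I := [set z | exists2 c : 'I_k -> R, (forall i, q (c i)) & z = \sum_i c i * t i].
move=> /(_ I); apply.
 split.
 - by exists (fun _ => 0) => //; rewrite big1 // => i _; rewrite mul0r.
 - move=> _ _ [c qc ->] [d qd ->]; exists (fun i => c i + d i) => [i|]; first exact: (qD).
  by rewrite -big_split; apply: eq_bigr => i _; rewrite mulrDl.
 - move=> a _ [c qc ->]; exists (fun i => a * c i) => [i|]; first exact: (qM).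
  by rewrite mulr_sumr; apply: eq_bigr => i _; rewrite mulrA.
move=> _ [x [y [qx /gen [c ->] ->]]]; exists (fun i => x * c i) => [i|].
 by rewrite mulrC; apply: (qM).
by rewrite mulr_sumr; apply: eq_bigr => i _; rewrite mulrA.
Qed.

Section Dim2.
Variables (a b : R).
Hypotheses (ma : m a) (mb : m b).
Hypothesis gen : forall z, m z -> exists c d, z = c * a + d * b.
Let aR : set R := [set z | exists c, z = c * a].

Let aR_ideal : is_ideal aR := principal_ideal a.

Let gen_mod z : m z -> exists d, aR (z - d * b).
Proof. by move=> /gen [c [d ->]]; exists d; rewrite addrK; exists c. Qed.

(* A case of Krull's principal ideal theorem, proved with symbolic powers. *)
Lemma krull_height (p q : set R) : is_prime p -> is_prime q -> p `<` q -> q `<` m ->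
 forall n, ~ aR (b ^+ n).
Proof.
move=> hp hq [pq qp] [qm mq] n an.
have [iq q1 qP] := hq; have [q0 qD qM] := iq; have [A0 AD AM] := aR_ideal.
have nqa : ~ q a.
 move=> qa; apply: mq => z /gen [c [d ->]]; apply: (qD); first exact: (qM).
 apply: (qM); apply: (is_primeX (n := n) hq); case: an => c' ->; exact: (qM).
have dec z : aR z \/ exists u i, is_unit u /\ aR (z - u * b ^+ i).
 case: (order_step z n aR_ideal gen_mod) => [[y Iy]|]; [left|by right].
 rewrite -[z](subrK (b ^+ n * y)); apply: (AD) => //; rewrite mulrC; exact: (AM).
pose sy i := [set z | exists2 s, ~ q s & ipow q i (s * z)].
have isy i : is_ideal (sy i).
 have [p0 pD pM] := ipow_ideal q i; split.
 - by exists 1 => //; rewrite mulr0.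
 - move=> x y [s ns hs] [t nt ht]; exists (s * t); first by move=> /qP [].
  have -> : s * t * (x + y) = t * (s * x) + s * (t * y) by ring.
  by apply: (pD); apply: (pM).
 - by move=> x y [s ns hs]; exists s => //; rewrite mulrCA; apply: (pM).
have syS i : sy i.+1 `<=` sy i by move=> z [s ns /ipowS hs]; exists s.
(* [Jd i] is the set of exponents e with b^e in [sy i] + aR. It determines this ideal, since by
   [dec] every element is, modulo a, zero or a unit times a power of b. *)
pose Jd i := [set e | exists c, sy i (b ^+ e + c * a)].
have Jn i : Jd i n.
 by case: an => c e; exists (- c); rewrite e mulNr subrr; case: (isy i).
have JS i : Jd i.+1 `<=` Jd i by move=> e [c h]; exists c; apply: syS.
have JU i e e' : Jd i e -> (e <= e')%N -> Jd i e'.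
 move=> [c h] le; exists (b ^+ (e' - e) * c); rewrite -(subnK le) exprD subnK //.
 by rewrite -mulrA -mulrDr; case: (isy i) => _ _; apply.
(* The sets [Jd i] decrease and all contain n. Were every inclusion strict, all members of [Jd i]
   would be at least i, which fails for i = n + 1. *)
have [i hi] : exists i, Jd i `<=` Jd i.+1.
 apply: contrapT => nex.
 have grow i : exists e, Jd i e /\ ~ Jd i.+1 e.
  by apply: contrapT => h; apply: nex; exists i => e Je; apply: contrapT => ne; apply: h; exists e.
 have low i : forall e, Jd i e -> (i <= e)%N.
  elim: i => [//|i IH] e Je; have [e' [Je' nJe']] := grow i.
  rewrite ltn_neqAle (IH _ (JS _ _ Je)) andbT; apply/eqP => ie.
  by apply: nJe'; apply: (JU _ _ _ Je); rewrite -ie; apply: IH.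
 by have := low n.+1 n (Jn _); rewrite ltnn.
(* Now z in [sy i] is z' + a r with z' in [sy i.+1]. As a lies outside q, r is again in [sy i], and
   Nakayama's lemma applies with a. *)
have key : sy i `<=` sy i.+1.
 apply: (@local_nakayama _ _ a) => // z syz.
 have [z' [r [sz' e]]] : exists z' r, sy i.+1 z' /\ z = z' + a * r.
  case: (dec z) => [[c e]|[u [j [[v uv] [c e]]]]].
   by exists 0, c; rewrite add0r [a * _]mulrC; split=> //; case: (isy i.+1).
  have ej : b ^+ j = v * (z - c * a).
   by rewrite -e -[LHS]mul1r -uv; ring.
  have : Jd i j.
   exists (v * c); rewrite ej.
   have -> : v * (z - c * a) + v * c * a = v * z by ring.
   by case: (isy i) => _ _; apply.
  move=> /hi [d hd]; exists (u * (b ^+ j + d * a)), (c - u * d); split.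
   by case: (isy i.+1) => _ _; apply.
  by rewrite -[z](subrK (u * b ^+ j)) e; ring.
 exists r; last by rewrite e addrK.
 have : sy i (a * r).
  by have -> : a * r = z - z' by [rewrite e addrC addKr]; apply: is_idealB => //; apply: syS.
 by move=> [s ns hs]; exists (s * a); [move=> /qP []|rewrite -mulrA].
have [k [t [tq tgen]]] := noetherian_gens nR (ipow_ideal q i).
pose z l := if insub l is Some j then t j else 0.
have zE (j : 'I_k) : z j = t j by rewrite /z valK.
(* Equality of two consecutive symbolic powers makes the i-th power of q vanish in the localization
   at q. Hence x^i is killed by an element outside q for each x in q, which puts x into p. *)
have [l lk|s ns hs] := @nakayama q [set 0] k z hq zero_ideal.
- have [|s ns hs] := key (z l).
  by exists 1 => //; rewrite mul1r (zE (Ordinal lk)).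
 have [c qc ec] := ipow_lincomb iq tgen hs; exists s => //.
 exists (fun j => if insub j is Some j' then c j' else 0).
  by move=> j; case: insubP.
 rewrite /= ec (_ : \sum_(_ < k) _ = \sum_i c i * t i) ?subrr //.
 by apply: eq_bigr => j _; rewrite zE valK.
apply: qp => x qx; apply: (is_primeX (n := i) hp).
have [[p0 _ _] _ pP] := hp.
have /tgen [c ec] := ipowX i qx.
have : p (s * x ^+ i).
 rewrite (_ : s * x ^+ i = 0) // ec mulr_sumr big1 // => j _.
 by rewrite mulrCA; have := hs j (ltn_ord j); rewrite zE /= => ->; rewrite mulr0.
by case/pP => // /pq.
Qed.

Hypothesis nab : forall n, ~ aR (b ^+ n).

Let order z : ~ aR z -> exists u i, is_unit u /\ aR (z - u * b ^+ i).
Proof. exact: local_order. Qed.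

Let N_units u v c i : is_unit u -> is_unit v -> aR (c - u * v * b ^+ i) -> ~ aR c.
Proof.
move=> [u' uu] [v' vv] h hc; apply: (nab (n := i)).
have -> : b ^+ i = u' * v' * (c - (c - u * v * b ^+ i)).
 have -> : u' * v' * (c - (c - u * v * b ^+ i)) = (u * u') * (v * v') * b ^+ i by ring.
 by rewrite uu vv !mul1r.
by case: aR_ideal => _ _; apply; apply: is_idealB.
Qed.

(** Modulo a, every nonzero element is a unit times a power of b, and no power of b vanishes. *)
Lemma dim2_prime : is_prime aR.
Proof.
split=> //; first by move=> [c e]; apply: ma; exists c; rewrite mulrC.
move=> x y axy; apply: contrapT => /not_orP [/order [u [i [uu [c ex]]]]].
move=> /order [v [j [vv [d ey]]]]; case: (@N_units u v (x * y) (i + j) uu vv) => //.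
exists (c * y + u * b ^+ i * d).
have -> : x = c * a + u * b ^+ i by rewrite -ex subrK.
have -> : y = d * a + v * b ^+ j by rewrite -ey subrK.
rewrite exprD; ring.
Qed.

Lemma dim2_height1 P : is_prime P -> ~ m `<=` P -> P a -> P `<=` aR.
Proof.
move=> hP nmP Pa z Pz; have [iP _ _] := hP; have [_ PD PM] := iP.
apply: contrapT => /order [u [i [[v uv] [c e]]]].
apply: nmP => y /gen [c' [d ->]]; apply: (PD); apply: (PM) => //.
apply: (is_primeX (n := i) hP).
have -> : b ^+ i = v * (z - (z - u * b ^+ i)).
 have -> : v * (z - (z - u * b ^+ i)) = (u * v) * b ^+ i by ring.
 by rewrite uv mul1r.
by apply: (PM); apply: is_idealB => //; rewrite e; apply: (PM).
Qed.

(** Height one primes are principal. If a is not in P, let w in P have the least order in b modulo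
    a. Each y in P is c w + d a, where d is in P since P is prime, and Nakayama's lemma shows that w
    generates P. *)
Lemma dim2_principal P : is_prime P -> ~ m `<=` P -> (exists2 s, P s & s <> 0) ->
 exists2 w, w <> 0 & P = [set z | exists c, z = c * w].
Proof.
move=> hP nmP [s Ps s0]; have [iP P1 PM] := hP; have [P0 PD PMl] := iP.
have [Pa|nPa] := pselect (P a).
 have PaR := dim2_height1 hP nmP Pa; exists a.
  by move=> a0; apply: s0; have [c ->] := PaR _ Ps; rewrite a0 mulr0.
 by apply/seteqP; split=> // z [c ->]; apply: (PMl).
have div z : P (z * a) -> P z by case/PM.
have [PaR|] := pselect (P `<=` aR).
 have : P `<=` [set 0].
  apply: (@local_nakayama _ _ a) => //; first exact: zero_ideal.
  move=> z Pz; have [c e] := PaR _ Pz; exists c; first by apply: div; rewrite -e.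
  by rewrite /= e [a * _]mulrC subrr.
 by move=> /(_ _ Ps).
move=> /existsNP [z0 /not_implyP [Pz0 nz0]].
pose ex := [set i : nat | exists w u, [/\ P w, is_unit u & aR (w - u * b ^+ i)]].
have exi : exists i, `[< ex i >].
 by have [u [i [uu h]]] := order nz0; exists i; apply/asboolP; exists z0, u.
have [i /asboolP [w [u [Pw uu aw]]] imin] := ex_minnP exi.
exists w.
 move=> w0; apply: (@N_units u 1 w i) => //; first by exists 1; rewrite mulr1.
  by rewrite mulr1.
 by rewrite w0; case: aR_ideal.
have iW := principal_ideal w.
apply/seteqP; split=> z; last by move=> [c ->]; apply: (PMl).
apply: (@local_nakayama [set z | exists c, z = c * w] P a) => // y Py.
have [c [d ed]] : exists c d, y - c * w = d * a.
 have [[d e]|/order [v [j [vv [d e]]]]] := pselect (aR y).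
  by exists 0, d; rewrite mul0r subr0.
 have ij : (i <= j)%N by apply: imin; apply/asboolP; exists y, v; split=> //; exists d.
 have [u' eu] := uu; have [c ec] := aw.
 exists (v * u' * b ^+ (j - i)), (d - v * u' * b ^+ (j - i) * c).
 have ew : w = c * a + u * b ^+ i by rewrite -ec subrK.
 have -> : y = d * a + v * b ^+ j by rewrite -e subrK.
 rewrite ew -{1}(subnK ij) exprD.
 have -> : v * (b ^+ (j - i) * b ^+ i) = v * (u * u') * b ^+ (j - i) * b ^+ i by rewrite eu mulr1 mulrA.
 ring.
exists d; first by apply: div; rewrite -ed; apply: is_idealB => //; apply: (PMl).
by exists c; rewrite [a * d]mulrC -ed; ring.
Qed.

End Dim2.

(** An associated prime of R / sR: among the proper colon ideals of the multiples of r modulo s, a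
    maximal one is prime. *)
Lemma colon_prime r s : ~ (exists c, r = s * c) ->
 exists c, is_prime [set e : R | exists f, e * (c * r) = s * f].
Proof.
move=> nsr; pose Q c : set R := [set e | exists f, e * (c * r) = s * f].
have iQ c : is_ideal (Q c).
 split; first by exists 0; rewrite mul0r mulr0.
 - by move=> x y [f e] [g h]; exists (f + g); rewrite mulrDl e h mulrDr.
 - by move=> x y [f e]; exists (x * f); rewrite -mulrA e mulrCA.
pose Good := [set I | exists2 c, I = Q c & ~ Q c 1].
have [||A [[c -> nc] _ cmax]] := @noetherian_max Good (Q 1) nR.
- by move=> _ [c -> _].
- by exists 1 => // -[f]; rewrite !mul1r => h; apply: nsr; exists f.
exists c; split=> //; first exact: iQ.
move=> x y [f exy]; apply: contrapT => /not_orP [nx ny]; apply: ny.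
have eQ : Q (x * c) = Q c.
 apply: cmax; first by exists (x * c) => // -[g]; rewrite mul1r -mulrA => h; apply: nx; exists g.
 by move=> z [g e]; exists (x * g); rewrite -mulrA mulrCA e mulrCA.
have : Q (x * c) y by exists f; rewrite -exy; ring.
by rewrite eQ.
Qed.

End Local.

(* A fraction r / s outside R is detected at a principal prime. *)
Definition principal_colons : Prop :=
 forall r s : R, s <> 0 -> ~ (exists c, r = s * c) -> exists c w,
  [/\ w <> 0, is_prime [set z : R | exists c, z = c * w] &
    forall e, (exists f, e * (c * r) = s * f) <-> exists g, e = g * w].

Lemma krull_dim_inj d d' : krull_dim R d -> krull_dim R d' -> d = d'.
Proof.
move=> [[c hc] max] [[c' hc'] max']; apply/eqP; rewrite eqn_leq.
by rewrite (max' _ _ hc) (max _ _ hc').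
Qed.

(** A least prime P0 is assumed because the domain property is to be proved: in dimension two a lies
    outside P0 but P0 is contained in aR, so P0 = a P0 vanishes. Principality of the colon ideals
    then replaces unique factorization. *)
Lemma regular_local_dim2 d : regular_local R -> krull_dim R d -> (d <= 2)%N ->
  (exists2 P0 : set R, is_prime P0 & forall q : set R, is_prime q -> P0 `<=` q) ->
 (forall x y : R, x * y = 0 -> x = 0 \/ y = 0) /\ principal_colons.
Proof.
move=> [nR lR [d' [kd' [t mt0]]]] kd d2 [P0 hP0 minP0].
have e := krull_dim_inj kd' kd; case: d / e kd d2 => kd d2.
have hm := nonunits_prime lR.
have mt z : nonunits z -> exists c : 'I_d' -> R, z = \sum_i c i * t i.
 by rewrite mt0 ideal_gen_range.
have tm i : nonunits (t i).
 by rewrite mt0; apply: ideal_gen_sub; exists i.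
have prin r s c w : let P := [set e | exists f, e * (c * r) = s * f] in
  is_prime P -> w <> 0 -> P = [set z | exists c, z = c * w] ->
 exists c w, [/\ w <> 0, is_prime [set z : R | exists c, z = c * w] &
  forall e, (exists f, e * (c * r) = s * f) <-> exists g, e = g * w].
 move=> P hP w0 eP; exists c, w; rewrite -eP; split=> // e.
 by have := congr1 (fun X : set R => X e) eP; rewrite /P /= => ->.
case: d' t mt tm kd d2 {kd' mt0} => [|[|[|//]]] t mt tm [[ch [chP chlt]] dmax] _.
- have unit0 z : z <> 0 -> is_unit z.
  by move=> z0; apply: contrapT => /mt [c]; rewrite big_ord0.
 split=> // [x y xy|r s s0 nsr].
  apply: contrapT => /not_orP [/unit0 [x' ex] /unit0 [y' ey]].
  by apply: lR.1; rewrite -ex -[x]mulr1 -ey mulrA xy !mul0r.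
 by case: nsr; have [s' es] := unit0 _ s0; exists (s' * r); rewrite mulrA es mul1r.
(* Dimension one is the preceding theory with a = 0. *)
- pose b := t ord0.
 have gen z : nonunits z -> exists c, z = c * b.
  by move=> /mt [c]; rewrite big_ord1 => ->; exists (c ord0).
 have nb n : b ^+ n <> 0.
  move=> b0; have [h1 h2] := (chP 0%N isT, chP 1%N isT).
  have [_] := chlt 0%N isT; apply => z cz.
  have [c ->] := gen z (prime_nonunit h2 cz).
  have [[z0 _ pM] _ _] := h1; apply: (pM); apply: (is_primeX (n := n) h1).
  by rewrite b0.
 have gen' z : nonunits z -> exists c d, z = c * 0 + d * b.
  by move=> /gen [c ->]; exists 0, c; rewrite mulr0 add0r.
 have nb' n : ~ [set z : R | exists c, z = c * 0] (b ^+ n).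
  by move=> [c]; rewrite mulr0 => /nb.
 have m0 : nonunits (0 : R) by move=> [c]; rewrite mul0r => /esym/lR.1.
 split=> [x y xy|r s s0 nsr].
  have [_ _ h] := @dim2_prime nR lR 0 b m0 (tm _) gen' nb'.
  by case: (h x y); rewrite ?xy; [exists 0; rewrite mulr0|move=> [c ->]; left; rewrite mulr0|
   move=> [c ->]; right; rewrite mulr0].
 have [c hP] := colon_prime nR nsr; set P := [set e | _] in hP.
 have [w w0 ew] : exists2 w, w <> 0 & P = [set z | exists c, z = c * w].
  have [mP|nmP] := pselect (@nonunits R `<=` P); last first.
   apply: (@dim2_principal nR lR 0 b m0 (tm _) gen' nb' P hP nmP).
   by exists s => //; exists (c * r).
  exists b; first by have := nb 1%N; rewrite expr1.
  apply/seteqP; split=> z; first by move=> /(prime_nonunit hP)/gen.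
  by move=> [c' ->]; have [[_ _ PM] _ _] := hP; apply: (PM); apply: mP; apply: tm.
 exact: prin hP w0 ew.
pose a := t ord0; pose b := t (lift ord0 ord0).
have gen z : nonunits z -> exists c d, z = c * a + d * b.
 by move=> /mt [c]; rewrite big_ord_recl big_ord1 => ->; exists (c ord0), (c (lift ord0 ord0)).
have [h0 h1 h2] := And3 (chP 0%N isT) (chP 1%N isT) (chP 2%N isT).
have l0 := chlt 0%N isT; have l1 := chlt 1%N isT.
have l2 : ch 1%N `<` @nonunits R.
 split; first exact: prime_nonunit.
 by move=> h; have [_] := l1; apply => z cz; apply: h; apply: (prime_nonunit h2).
have nab n : ~ [set z : R | exists c, z = c * a] (b ^+ n).
 by apply: krull_height h0 h1 l0 l2 n => //; apply: tm.
have pa : is_prime [set z : R | exists c, z = c * a].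
 by apply: dim2_prime gen nab => //; apply: tm.
have pr (P : set R) : is_prime P -> ~ @nonunits R `<=` P -> (exists2 s, P s & s <> 0) ->
  exists2 w, w <> 0 & P = [set z | exists c, z = c * w].
 by apply: dim2_principal gen nab _ => //; apply: tm.
(* Otherwise the middle prime of the chain would contain a, hence lie in aR and so in P0, which is
   below the first prime of the chain. *)
have nP0a : ~ P0 a.
 move=> P0a; have [iP0 _ _] := hP0; have [_ _ P0M] := iP0.
 have [_] := l0; apply => z cz; apply: (minP0 _ h0).
 have [|c ->] := dim2_height1 nR lR (tm _) gen h1 l2.2 _ cz; last exact: (P0M).
 exact: (minP0 _ h1).
have dom (x y : R) : x * y = 0 -> x = 0 \/ y = 0.
 have P00 : P0 `<=` [set 0].
  have [iP0 _ P0p] := hP0.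
  apply: (@local_nakayama nR lR _ _ a) => //; [exact: zero_ideal|exact: tm|].
  move=> z P0z; have [c ec] := minP0 _ pa z P0z.
  exists c; last by rewrite /= ec [a * _]mulrC subrr.
  by move: P0z; rewrite ec => /P0p [].
 move=> xy; have [[P0_0 _ _] _ P0p] := hP0.
 by have [/P00|/P00] : P0 x \/ P0 y by [apply: P0p; rewrite xy]; [left|right].
split=> // r s s0 nsr; have [c hP] := colon_prime nR nsr.
set P := [set e | _] in hP.
have Ps : P s by exists (c * r).
have [||w w0 ew] := pr P hP _; last first.
- exact: prin hP w0 ew.
- by exists s.
(* The colon prime is not the maximal ideal, since a, b is a regular sequence: from a c r = s f and
   b c r = s g follows b f = a g, so a divides f and s divides c r. *)
move=> mP; have [f ef] := mP a (tm _); have [g eg] := mP b (tm _).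
have : s * (b * f - a * g) = 0.
 have -> : s * (b * f - a * g) = b * (s * f) - a * (s * g) by ring.
 by rewrite -ef -eg; ring.
case/dom=> // /subr0_eq ebf; have [_ _ paM] := pa.
have : [set z | exists c, z = c * a] (b * f) by exists g; rewrite ebf mulrC.
case/paM=> [|[h eh]]; first by have := nab 1%N; rewrite expr1.
have : a * (c * r - s * h) = 0 by rewrite mulrBr ef eh; ring.
case/dom=> [a0|/subr0_eq e].
 by case: nP0a; rewrite a0; case: hP0 => -[].
by have [_ P1 _] := hP; case: P1; exists h; rewrite mul1r.
Qed.

End Noetherian.

(** * Residual algebraic dependence *)

Lemma rmorphism_of (R S : pzRingType) (f : R -> S) :
 f 1 = 1 -> {morph f : x y / x - y} -> {morph f : x y / x * y} ->
 exists g : {rmorphism R -> S}, g =1 f.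
Proof.
move=> f1 fB fM.
pose aM := GRing.isZmodMorphism.Build R S f fB.
pose mM := GRing.isMonoidMorphism.Build R S f (f1, fM).
pose g : {rmorphism R -> S} := HB.pack f aM mM.
by exists g.
Qed.

Lemma kernel_prime (R : comPzRingType) (D : idomainType) (f : {rmorphism R -> D}) :
 is_prime [set x | f x = 0].
Proof.
split; first split.
- exact: rmorph0.
- by move=> x y /= fx fy; rewrite rmorphD fx fy addr0.
- by move=> x y /= fy; rewrite rmorphM fy mulr0.
- by move=> /= /eqP; rewrite rmorph1 oner_eq0.
- by move=> x y /= /eqP; rewrite rmorphM mulf_eq0 => /orP [/eqP|/eqP]; [left|right].
Qed.

Lemma zero_prime (D : idomainType) : is_prime [set 0 : D].
Proof. exact: (kernel_prime (idfun : {rmorphism D -> D})). Qed.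

Lemma preimage_prime (R D : comPzRingType) (f : {rmorphism R -> D}) (P : set D) :
 is_prime P -> is_prime [set x | P (f x)].
Proof.
move=> [[P0 PD PM] P1 PP]; split; first split.
- by rewrite /= rmorph0.
- by move=> x y /= fx fy; rewrite rmorphD; apply: PD.
- by move=> x y /= fy; rewrite rmorphM; apply: PM.
- by rewrite /= rmorph1.
- by move=> x y /=; rewrite rmorphM; apply: PP.
Qed.

Section RangePrimes.
Variables (K : fieldType) (R : comPzRingType) (v : {rmorphism R -> K}).

Lemma range_sr : subring (range v).
Proof.
split; first by exists 1; rewrite ?rmorph1.
- by move=> _ _ [a _ <-] [b _ <-]; exists (a - b); rewrite ?rmorphB.
- by move=> _ _ [a _ <-] [b _ <-]; exists (a * b); rewrite ?rmorphM.
Qed.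

Lemma pideal_preim P : pideal (range v) P -> is_prime [set a | P (v a)].
Proof.
move=> [iP P1 PM]; split; first split; rewrite /=.
- by rewrite rmorph0; apply: (id0 iP).
- by move=> a b Pa Pb; rewrite rmorphD; apply: (idD iP).
- by move=> a b Pb; rewrite rmorphM; apply: (idM iP) => //; exists a.
- by rewrite rmorph1.
- by move=> a b; rewrite rmorphM; apply: PM; [exists a|exists b].
Qed.

Lemma image_pideal q : is_prime q -> (forall r, v r = 0 -> q r) ->
 pideal (range v) (v @` q) /\ forall r, (v @` q) (v r) <-> q r.
Proof.
move=> [[q0 qD qM] q1 qP] ker.
have inj r : (v @` q) (v r) <-> q r.
 split=> [[s qs e]|qr]; last by exists r.
 by rewrite -(subrK s r); apply: (qD) => //; apply: ker; rewrite rmorphB e subrr.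
split=> //; split; first split.
- by move=> _ [r _ <-]; exists r.
- by exists 0; rewrite ?rmorph0.
- by move=> _ _ [x qx <-] [y qy <-]; exists (x + y); rewrite ?rmorphD //; apply: (qD).
- by move=> _ _ [x _ <-] [y qy <-]; exists (x * y); rewrite ?rmorphM //; apply: (qM).
- by rewrite -(rmorph1 v) => /inj.
- by move=> _ _ [x _ <-] [y _ <-]; rewrite -rmorphM => /inj /qP [h|h]; [left|right]; apply/inj.
Qed.

End RangePrimes.
Lemma poly_factorX (R : idomainType) (F : {poly R}) : F != 0 ->
 exists n G, G.[0] != 0 /\ F = G * 'X^n.
Proof.
move=> F0; have [n [G nr ->]] := multiplicity_XsubC F 0.
by exists n, G; rewrite subr0; split=> //; move: nr; rewrite F0.
Qed.

(** * Chains of primes in polynomial rings *)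

Section Catenary.

Lemma saturated_concat (R : comPzRingType) (p q r : set R) n m c d :
 saturated_chain p q n c -> saturated_chain q r m d ->
 saturated_chain p r (n + m) (fun i => if (i <= n)%N then c i else d (i - n)%N).
Proof.
move=> [[cP clt] c0 cn cs] [[dP dlt] d0 dm ds].
have E i : (i <= n)%N = false -> exists2 j, i = (n + j.+1)%N & (i - n)%N = j.+1.
 move=> /negbT; rewrite -ltnNge => ni; exists (i - n).-1; rewrite prednK ?subn_gt0 //.
 by rewrite subnKC // ltnW.
have F i : (if (i <= n)%N then c i else d (i - n)%N) = if (i < n)%N then c i else d (i - n)%N.
 by rewrite leq_eqVlt; have [->|//] := eqVneq i n; rewrite ltnn subnn d0 cn.
have step i : (i < n)%N = false -> (i - n).+1 = (i.+1 - n)%N.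
 by move=> /negbT; rewrite -leqNgt => ni; rewrite subSn.
split.
- split=> i.
  by case: ifP => [le _|/E [j -> _]]; [apply: cP|rewrite leq_add2l addKn; apply: dP].
 rewrite (F i); case: ifP => [lt _|nlt im]; first exact: clt.
 by rewrite -step //; apply: dlt; rewrite ltn_subLR // leqNgt nlt.
- by [].
- case: ifP => [|_]; last by rewrite addKn.
 by rewrite -{2}[n]addn0 leq_add2l leqn0 => /eqP m0; rewrite m0 addn0 cn -dm m0 d0.
- move=> i; rewrite (F i); case: ifP => [lt _|nlt im]; first exact: cs.
 by rewrite -step //; apply: ds; rewrite ltn_subLR // leqNgt nlt.
Qed.

(** Every step of e refines to a saturated chain of positive length; these concatenate to a
    saturated chain from p to q, whose length must be n. *)
Lemma catenary_bound (R : comPzRingType) (p q : set R) n m c e :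
 catenary R -> saturated_chain p q n c -> prime_chain m e -> e 0%N = p -> e m = q ->
 (m <= n)%N.
Proof.
move=> cat sc [eP elt] e0 em.
have [n' [le [c' sc']]] : exists n', (m <= n')%N /\ exists c', saturated_chain (e 0%N) (e m) n' c'.
 elim: m eP elt {em} => [|m IH] eP elt.
  exists 0%N; split=> //; exists e; split=> //.
 have [i im|i im|n1 [le [c1 s1]]] := IH; [exact/eP/leqW|exact/elt/ltnW|].
 have [|n2 [[c2 s2] _]] := cat (e m) (e m.+1) (eP m (leqnSn m)) (eP _ (leqnn _)).
  by have [] := elt m (ltnSn m).
 exists (n1 + n2)%N; split; last by eexists; apply: saturated_concat s1 s2.
 rewrite -addn1; apply: leq_add => //; rewrite lt0n; apply/eqP => n20.
 have [_ h0 hn _] := s2; have [_ nle] := elt m (ltnSn m).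
 by apply: nle; rewrite -hn n20 h0.
rewrite e0 em in sc'; have hp : is_prime p by rewrite -e0; apply: eP.
have hq : is_prime q by rewrite -em; apply: eP.
have pq : p `<=` q.
 have : forall i, (i <= m)%N -> e 0%N `<=` e i.
  elim=> [_ //|i IH im]; apply: (subset_trans (IH (ltnW im))).
  by have [] := elt i im.
 by move=> /(_ m (leqnn m)); rewrite e0 em.
have [n0 [_ h]] := cat p q hp hq pq.
by rewrite (h n c sc) -(h n' c' sc').
Qed.

Lemma saturated_poly (R : idomainType) (q : set R) n c :
 saturated_chain [set 0 : R] q n c ->
 saturated_chain [set 0 : {poly R}] [set F : {poly R} | q F.[0]] n.+1
  (fun i => if i is i'.+1 then [set F : {poly R} | c i' F.[0]] else [set 0]).
Proof.
move=> [[cP clt] c0 cn cs].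
have hz : forall P : set R, is_prime P -> is_prime [set F : {poly R} | P F.[0]].
 by move=> P hP; exact: (@preimage_prime _ _ (horner_eval (0 : R)) P hP).
have h0 : is_prime [set 0 : {poly R}] := zero_prime _.
have X0 : 'X.[0] = 0 :> R by rewrite hornerX.
have split0 (P : set {poly R}) : is_prime P -> P 'X -> forall F : {poly R}, P F <-> P (F.[0])%:P.
 move=> [[P0 PD PM] _ _] PX F.
 have [G eG] : exists G, F = G * 'X + (F.[0])%:P.
  have /factor_theorem [G] : root (F - (F.[0])%:P) 0 by rewrite /root !hornerE subrr.
  by rewrite subr0 => eG; exists G; rewrite -eG subrK.
 have PGX : P (G * 'X) by apply: (PM).
 split=> h; last by rewrite eG; apply: (PD).
 have -> : (F.[0])%:P = F - G * 'X by rewrite {2}eG addrC addKr.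
 by apply: is_idealB.
split=> //.
- split=> [[|i]|[|i]] lei //.
 + by apply: hz; apply: cP.
 + split=> [F ->|h] /=; first by rewrite horner0 c0.
  have : [set 0 : {poly R}] 'X by apply: h; rewrite /= X0 c0.
  by move=> /eqP; rewrite polyX_eq0.
 + have [le nle] := clt i lei; split=> [F|h]; first exact: le.
  by apply: nle => a ca; have := h a%:P; rewrite /= hornerC; apply.
- by apply/seteqP; split=> F /=; rewrite cn.
- move=> [|i] lei [r [hr [lr1 lr2] [lr3 lr4]]].
  apply: lr4 => F /= F0; rewrite c0 /= in F0.
  have [G [Gr G0]] : exists G, r G /\ G <> 0.
   by apply: contrapT => nex; apply: lr2 => G rG; apply: contrapT => nG; apply: nex; exists G.
  have [m [H [H0 eG]]] := poly_factorX (introN eqP G0).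
  have [_ _ rP] := hr.
  have rX : r 'X.
   have [rH|/(is_primeX hr) //] : r H \/ r ('X^m) by apply: rP; rewrite -eG.
   by have := lr3 _ rH; rewrite /= c0 /= => /eqP; rewrite (negPf H0).
  by apply/(split0 r hr rX); rewrite F0; case: hr => -[].
 have ri := cP i (ltnW lei); have rX : r 'X.
  by apply: lr1; rewrite /= X0; case: ri => -[].
 pose r0 := [set a | r (a%:P)].
 have hr0 : is_prime r0 by exact: (@preimage_prime _ _ polyC r hr).
 apply: (cs i lei); exists r0; split=> //; split.
 + by move=> a ca; apply: lr1; rewrite /= hornerC.
 + by move=> h; apply: lr2 => F /(split0 r hr rX)/h.
 + by move=> a /lr3; rewrite /= hornerC.
 + by move=> h; apply: lr4 => F /h rF; apply/(split0 r hr rX).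
Qed.

End Catenary.

(** * The two-dimensional normal local domain *)

Section LocalDim2.
Variables (A : idomainType) (k : closedFieldType) (iota : {rmorphism k -> A}).
Hypotheses (lA : is_local A) (dA : krull_dim A 2).
Hypothesis resA : forall a : A, exists c : k, @nonunits A (a - iota c).
Hypotheses (cat1 : catenary {poly A}) (cat2 : catenary {poly {poly A}}).

Local Notation m := (@nonunits A).

Let hm : is_prime m := nonunits_prime lA.
Let im : is_ideal m. Proof. by case: hm. Qed.

Lemma iota_nonunit c : m (iota c) -> c = 0.
Proof.
move=> h; apply: contrapT => /eqP c0; apply: h; exists (iota c^-1).
by rewrite -rmorphM mulfV // rmorph1.
Qed.

Lemma exists_residue : exists res : {rmorphism A -> k},
 (forall c, res (iota c) = c) /\ forall a, res a = 0 <-> m a.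
Proof.
have [f hf] := choice resA.
have uniq a c : m (a - iota c) -> f a = c.
 move=> h; apply/eqP; rewrite -subr_eq0; apply/eqP; apply: iota_nonunit.
 have -> : iota (f a - c) = (a - iota c) - (a - iota (f a)) by rewrite rmorphB; ring.
 exact: is_idealB.
have [m0 mD mM] := im.
have [| | |res hres] := @rmorphism_of A k f.
- by apply: uniq; rewrite rmorph1 subrr.
- move=> x y; apply: uniq; rewrite rmorphB.
 have -> : x - y - (iota (f x) - iota (f y)) = (x - iota (f x)) - (y - iota (f y)) by ring.
 exact: is_idealB.
- move=> x y; apply: uniq; rewrite rmorphM.
 have -> : x * y - iota (f x) * iota (f y) =
  y * (x - iota (f x)) + iota (f x) * (y - iota (f y)) by ring.
 by apply: (mD); apply: (mM).
exists res; split=> [c|a]; rewrite hres; first by apply: uniq; rewrite subrr.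
split=> [fa|ma]; first by have := hf a; rewrite fa rmorph0 subr0.
by apply: uniq; rewrite rmorph0 subr0.
Qed.

Lemma no_chain3 p q : is_prime p -> is_prime q -> [set 0] `<` p -> p `<` q -> q `<` m -> False.
Proof.
move=> hp hq l1 l2 l3; have [_ dmax] := dA; suff : (3 <= 2)%N by [].
apply: (dmax 3%N (nth set0 [:: [set 0]; p; q; m])).
by split=> [[|[|[|[|//]]]]|[|[|[|//]]]] // _; apply: zero_prime.
Qed.

Lemma sat_chain_dim2 p : is_prime p -> [set 0] `<` p -> p `<` m ->
 saturated_chain [set 0] m 2 (nth set0 [:: [set 0]; p; m]).
Proof.
move=> hp l1 l2; split=> //.
 by split=> [[|[|[|//]]]|[|[|//]]] // _; apply: zero_prime.
by move=> [|[|//]] _ [r [hr r1 r2]]; [apply: (no_chain3 hr hp)|apply: (no_chain3 hp hr)].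
Qed.

Lemma exists_height1 : exists p, [/\ is_prime p, [set 0] `<` p & p `<` m].
Proof.
have [[c [cP clt]] dmax] := dA.
have h0 := cP 0%N isT; have h1 := cP 1%N isT; have h2 := cP 2%N isT.
have [l0 l0'] := clt 0%N isT; have [l1 l1'] := clt 1%N isT.
exists (c 1%N); split=> //.
 split=> [a ->|h]; first by case: h1 => -[].
 by apply: l0' => a /h ->; case: h0 => -[].
split; first exact: prime_nonunit.
by move=> h; apply: l1' => a /(prime_nonunit h2)/h.
Qed.

Section Fraction.
Variables (K : fieldType) (tf : {rmorphism A -> K}).
Hypothesis tf_inj : injective tf.
Hypothesis frac : forall z : K, exists a b, b != 0 /\ z = tf a / tf b.
Variable res : {rmorphism A -> k}.
Hypotheses (res_iota : forall c, res (iota c) = c) (res0 : forall a, res a = 0 <-> m a).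

Definition ev1 (x : K) : {rmorphism {poly A} -> K} :=
 horner_morph (fun a : A => mulrC x (tf a)).
Definition ev2 (x y : K) : {rmorphism {poly {poly A}} -> K} :=
 horner_morph (fun a : {poly A} => mulrC y (ev1 x a)).
Definition red1 : {rmorphism {poly A} -> {poly k}} := map_poly res.
Definition red2 : {rmorphism {poly {poly A}} -> {poly {poly k}}} := map_poly red1.

Lemma ev1C x a : ev1 x a%:P = tf a.
Proof. exact: horner_morphC. Qed.
Lemma ev1X x : ev1 x 'X = x.
Proof. exact: horner_morphX. Qed.
Lemma ev2C x y f : ev2 x y f%:P = ev1 x f.
Proof. exact: horner_morphC. Qed.
Lemma ev2X x y : ev2 x y 'X = y.
Proof. exact: horner_morphX. Qed.
Lemma red1_horner0 F : red1 F.[0] = (red2 F).[0].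
Proof. by rewrite /red2 /= -(rmorph0 red1) horner_map. Qed.
Lemma res_horner0 F : res F.[0] = (red1 F).[0].
Proof. by rewrite /red1 /= -(rmorph0 res) horner_map. Qed.
Lemma tf_eq0 a : tf a = 0 -> a = 0.
Proof. by rewrite -(rmorph0 tf) => /tf_inj. Qed.

(* Otherwise x, y would be algebraically independent modulo m, which gives a
  chain of primes of length 5 below (m, X, Y) in A[X, Y]. *)
Lemma residually_dependent2 x y : exists F, ev2 x y F = 0 /\ red2 F != 0.
Proof.
apply: contrapT => nex.
have dep F : ev2 x y F = 0 -> red2 F = 0.
 by move=> h; apply/eqP; apply/negPn/negP => h'; apply: nex; exists F.
have [p [hp lp1 lp2]] := exists_height1.
have := catenary_bound cat2 (saturated_poly (saturated_poly (sat_chain_dim2 hp lp1 lp2))).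
pose g1 : {rmorphism {poly {poly A}} -> {poly K}} := map_poly (ev1 x).
pose g4 : {rmorphism {poly {poly A}} -> {poly k}} := red1 \o horner_eval 0.
pose g5 : {rmorphism {poly {poly A}} -> k} := res \o (horner_eval 0 \o horner_eval 0).
(* With x substituted for the inner variable X and y for the outer variable Y, the chain is 0, the
   kernel of X -> x, the kernel of (X, Y) -> (x, y), m[X, Y], (m, Y), (m, X, Y). The third inclusion
   is the assumed independence. The saturated chain has length 2 + 1 + 1 = 4. *)
pose e i : set {poly {poly A}} := if i is 0%N then [set 0] else if i is 1%N then [set F | g1 F = 0]
 else if i is 2%N then [set F | ev2 x y F = 0] else if i is 3%N then [set F | red2 F = 0]
 else if i is 4%N then [set F | g4 F = 0] else [set F | g5 F = 0].
move=> /(_ 5%N e); suff [e1 e2] : prime_chain 5 e /\ e 5%N = [set F : {poly {poly A}} | m F.[0].[0]].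
 by move=> /(_ e1 erefl e2).
split; last first.
 by apply/seteqP; split=> F /=; rewrite /horner_eval => /res0.
split.
 move=> [|[|[|[|[|[|//]]]]]] _; rewrite /e; try exact: kernel_prime.
 exact: zero_prime.
have [[c [cP clt]] _] := dA.
have [b b0 mb] : exists2 b, b != 0 & m b.
 have [lt nlt] := lp1; apply: contrapT => h; apply: nlt => a pa /=.
 apply: contrapT => /eqP a0; apply: h; exists a => //.
 by have [lm _] := lp2; apply: lm.
have [ax [bx [bx0 ex]]] := frac x; have [ay [by_ [by0 ey]]] := frac y.
have tfN a : a != 0 -> tf a != 0 by apply: contra_neq => /tf_eq0.
move=> [|[|[|[|[|//]]]]] _; rewrite /e; split.
- by move=> F ->; apply: rmorph0.
- move=> /(_ ((bx%:P * 'X - ax%:P)%:P)) /= h.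
 have /h/eqP : g1 ((bx%:P * 'X - ax%:P)%:P) = 0.
  rewrite /g1 /= map_polyC /= rmorphB rmorphM /= !ev1C ev1X ex.
  by rewrite mulrC divfK ?tfN // subrr.
 rewrite polyC_eq0 subr_eq0 => /eqP/(congr1 (fun f : {poly A} => f`_1)).
 by rewrite coefCM coefX coefC /= mulr1 => /eqP; rewrite (negPf bx0).
- by move=> F /= g1F; rewrite /ev2 /= /horner_morph; rewrite /g1 /= in g1F; rewrite g1F horner0.
- move=> /(_ (by_%:P%:P * 'X - ay%:P%:P)) /= h.
 have /h : ev2 x y (by_%:P%:P * 'X - ay%:P%:P) = 0.
  rewrite rmorphB rmorphM /= !ev2C ev2X !ev1C ey.
  by rewrite mulrC divfK ?tfN // subrr.
 move=> /(congr1 (fun f : {poly K} => f`_1)).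
 rewrite /g1 /= coef_map /= coefB coefCM coefX coefC /= mulr1 subr0 ev1C coef0 => /tf_eq0/eqP.
 by rewrite (negPf by0).
- exact: dep.
- move=> /(_ b%:P%:P) /= h; have /h : red2 b%:P%:P = 0.
  by rewrite /red2 /= map_polyC /= map_polyC /=; have /res0 -> := mb; rewrite !polyC0.
 by rewrite ev2C ev1C => /tf_eq0/eqP; rewrite (negPf b0).
- by move=> F /= r2; rewrite /g4 /= /horner_eval; have := red1_horner0 F; rewrite /red2 /= r2 horner0.
- move=> /(_ 'X) /= h; have /h : g4 'X = 0 by rewrite /g4 /= /horner_eval hornerX rmorph0.
 by rewrite /red2 /= map_polyX => /eqP; rewrite polyX_eq0.
- by move=> F /= r2; rewrite /g5 /= /horner_eval res_horner0; move: r2; rewrite /g4 /= /horner_eval => ->; rewrite horner0.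
- move=> /(_ 'X%:P) /= h; have /h : g5 'X%:P = 0 by rewrite /g5 /= /horner_eval hornerC hornerX rmorph0.
 by rewrite /g4 /= /horner_eval hornerC map_polyX => /eqP; rewrite polyX_eq0.
Qed.

Local Notation AK := (range tf).

Let AK_sr : subring AK := range_sr tf.

Lemma tf_pideal q : is_prime q -> pideal AK (tf @` q).
Proof.
move=> hq; apply: (image_pideal hq _).1 => r /tf_eq0 ->.
by case: hq => -[].
Qed.

Lemma ev1_in (O : set K) y F : subring O -> AK `<=` O -> O y -> O (ev1 y F).
Proof.
move=> sO AO Oy; rewrite /ev1 /= /horner_morph horner_coef.
apply: (sub_sum sO) => i _; apply: (subM sO); last exact: subX.
by apply: AO; rewrite coef_map; exists F`_i.
Qed.

Section Height1.
Variables (P : set K).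
Hypothesis hP : pideal AK P.
Hypothesis P0 : exists2 a, a != 0 & P a.
Hypothesis Pm : exists2 a, m a & ~ P (tf a).

Let pA : is_prime [set a | P (tf a)] := pideal_preim hP.

Let lt1 : [set 0] `<` [set a | P (tf a)].
Proof.
split=> [a ->|h]; first by case: pA => -[].
have [z z0 Pz] := P0; have [a _ ea] : AK z by case: hP => iP _ _; apply: (idS iP).
by have /= a0 := h a; move: z0; rewrite -ea a0 ?rmorph0 ?eqxx //= ea.
Qed.

Let lt2 : [set a | P (tf a)] `<` m.
Proof.
split; first exact: prime_nonunit.
by have [a ma nPa] := Pm => /(_ a ma).
Qed.

(* The same for the one-dimensional local domain A / P: otherwise there is a
  chain of primes of length 4 below (m, X) in A[X]. *)
Lemma residually_dependent1 y : loc AK P y ->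
 exists F, nonunit (loc AK P) (ev1 y F) /\ red1 F != 0.
Proof.
move=> Ly; have sL := loc_sr AK_sr hP; have AL := sub_loc AK_sr hP.
have iN := nonunit_loc_ideal AK_sr hP.
pose C2 : set {poly A} := [set F | nonunit (loc AK P) (ev1 y F)].
have Lev F : loc AK P (ev1 y F) by apply: ev1_in.
have hC2 : is_prime C2.
 split; first split; rewrite /C2 /=.
 - by rewrite rmorph0; apply: (id0 iN).
 - by move=> F G h1 h2; rewrite rmorphD; apply: (idD iN).
 - by move=> F G h1; rewrite rmorphM; apply: (idM iN).
 - by rewrite rmorph1 => /((nonunit_locR AK_sr hP (sub1 AK_sr)).1); case: hP.
 - by move=> F G; rewrite rmorphM; apply: nonunit_mul.
apply: contrapT => nex.
have dep F : C2 F -> red1 F = 0.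
 by move=> CF; apply/eqP; apply/negPn/negP => h'; apply: nex; exists F.
have := catenary_bound cat1 (saturated_poly (sat_chain_dim2 pA lt1 lt2)).
pose g4 : {rmorphism {poly A} -> k} := res \o horner_eval 0.
pose e i : set {poly A} := if i is 0%N then [set 0] else if i is 1%N then [set F | ev1 y F = 0]
 else if i is 2%N then C2 else if i is 3%N then [set F | red1 F = 0]
 else [set F | g4 F = 0].
move=> /(_ 4%N e); suff [e1 e2] : prime_chain 4 e /\ e 4%N = [set F : {poly A} | m F.[0]].
 by move=> /(_ e1 erefl e2).
split; last by apply/seteqP; split=> F /=; rewrite /horner_eval => /res0.
split.
 move=> [|[|[|[|[|//]]]]] _; rewrite /e //; try exact: kernel_prime.
 exact: zero_prime.
have [ay [by_ [[a' _ ea] [b' _ eb] nb b0 ey]]] := locP hP Ly.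
move=> [|[|[|[|//]]]] _; rewrite /e; split.
- by move=> F ->; apply: rmorph0.
- move=> /(_ (b'%:P * 'X - a'%:P)) h; have /h/(congr1 (fun f : {poly A} => f`_1)) : ev1 y (b'%:P * 'X - a'%:P) = 0.
  by rewrite rmorphB rmorphM /= !ev1C ev1X ea eb ey mulrC divfK // subrr.
 by rewrite coefB coefCM coefX coefC mulr1 subr0 coef0 => b0'; move: b0; rewrite -eb b0' rmorph0 eqxx.
- by move=> F F0; rewrite /C2 /= F0; exact: (id0 iN).
- move=> h; have [z z0 Pz] := P0; have [a _ ea'] : AK z by case: hP => iP _ _; apply: (idS iP).
 have /h : C2 a%:P by rewrite /C2 /= ev1C ea'; apply/(nonunit_locR AK_sr hP) => //; exists a.
 by rewrite /= ev1C ea' => /eqP; rewrite (negPf z0).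
- exact: dep.
- have [a ma nPa] := Pm; move=> /(_ a%:P) h.
 have /h : red1 a%:P = 0 by rewrite /red1 /= map_polyC; have /res0 /= -> := ma; rewrite polyC0.
 by rewrite /C2 /= ev1C => /(nonunit_locR AK_sr hP) h'; apply: nPa; apply: h'; exists a.
- by move=> F /= r2; rewrite /g4 /= /horner_eval; have := res_horner0 F; rewrite /red1 /= r2 horner0.
- move=> /(_ 'X) /= h; have /h : g4 'X = 0 by rewrite /g4 /= /horner_eval hornerX rmorph0.
 by rewrite /red1 /= map_polyX => /eqP; rewrite polyX_eq0.
Qed.

Lemma height1_prime Q : pideal AK Q -> (exists2 a, a != 0 & Q a) -> Q `<=` P -> Q = P.
Proof.
move=> hQ [z z0 Qz] QP; apply/seteqP; split=> // x Px; apply: contrapT => nQx.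
have [iQ _ _] := hQ; have [a _ ea] := idS iQ Qz.
have [iP _ _] := hP; have [b _ eb] := idS iP Px.
apply: (no_chain3 (pideal_preim hQ) pA _ _ lt2).
- split=> [c ->|h]; first by rewrite /= rmorph0; apply: (id0 iQ).
 by have /= a0 := h a; move: z0; rewrite -ea a0 ?rmorph0 ?eqxx //= ea.
- split=> [c /QP //|h]; apply: nQx; rewrite -eb; apply: h.
 by rewrite /= eb.
Qed.

Hypothesis nA : noetherian A.
Hypothesis normA : forall z, integral AK z -> AK z.

(** Normality in codimension one. If V dominates the localization and y in V is not in it, a
    multiple w of y has P as its ideal of denominators, and w P stays in the maximal ideal. A
    denominator s outside P then gives s w P contained in P, so s w is integral over A. *)
Lemma height1_valring : valring (loc AK P).
Proof.
have sA := AK_sr; have sL := loc_sr sA hP; have [iP P1 PM] := hP; have AL := sub_loc sA hP.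
have [V [vV _ LV _ NV]] := valring_over_prime sA hP; have [sV Vi] := vV.
suff VL : V `<=` loc AK P by split=> // y; case: (Vi y) => /VL; [left|right].
move=> y Vy; apply: contrapT => ny.
pose Q c : set A := [set e | loc AK P (tf e * (tf c * y))].
have iQ c : is_ideal (Q c).
 split; rewrite /Q /= ?rmorph0 ?mul0r; first exact: sub0.
 - by move=> u v h1 h2; rewrite rmorphD mulrDl; apply: subD.
 - by move=> u v h; rewrite rmorphM -mulrA; apply: (subM sL) => //; apply: AL; exists u.
have Q1 c : Q c 1 <-> loc AK P (tf c * y) by rewrite /Q /= rmorph1 mul1r.
pose Good := [set I | exists2 c, I = Q c & ~ Q c 1].
have [||_ [[c -> /Q1 nw] _ cmax]] := @noetherian_max A Good (Q 1) nA.
- by move=> _ [c -> _].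
- by exists 1 => // /Q1; rewrite rmorph1 mul1r.
pose w := tf c * y.
have Qprime : is_prime (Q c).
 split=> // [/Q1 //|u v Quv]; apply: contrapT => /not_orP [nu]; apply.
 suff <- : Q (u * c) = Q c by move: Quv; rewrite /Q /= !rmorphM; congr (loc _ _ _); ring.
 apply: cmax => [|e Qe]; first by exists (u * c) => // /Q1; rewrite rmorphM -mulrA => /nu.
 by rewrite /Q /= rmorphM -mulrA mulrCA; apply: (subM sL) => //; apply: AL; exists u.
(* The prime [Q c] is nonzero and contained in P, hence equal to P. *)
have eQ e : P (tf e) -> Q c e.
 rewrite -(height1_prime (tf_pideal Qprime)) => [[u Qu /tf_inj <-] //||_ [u Qu <-]].
  have [a [b [b0 ey]]] := frac y; have tb : tf b != 0 by apply: contra_neq b0 => /tf_eq0.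
  exists (tf b) => //; exists b => //; rewrite /Q /= mulrCA ey (mulrC (tf b)) divfK // -rmorphM.
  by apply: AL; exists (c * a).
 apply: contrapT => nPu; apply: nw; have u0 := primeN0 hP nPu; rewrite -(mulKf u0 (tf c * y)).
 by apply: (subM sL) => //; rewrite -div1r; apply: (locE hP) => //; exact: sub1.
have wN e : P (tf e) -> nonunit (loc AK P) (w * tf e).
 move=> Pe; have Le : loc AK P (w * tf e) by rewrite mulrC; apply: eQ.
 have Ae : AK (tf e) by exists e.
 apply/NV => //; apply: (idM (valring_ideal vV)); first by apply: (subM sV) => //; apply/LV/AL; exists c.
 by apply/NV; [apply: AL|apply/(nonunit_locR sA hP)].
have [n [t [Pt gen]]] := noetherian_gens nA (let: And3 i _ _ := pA in i).
have /choice [b hb] i : exists b, [/\ AK b, ~ P b & P (b * (w * tf (t i)))].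
 have /(nonunit_locP hP) [x [b [Px Ab nb ->]]] := wN _ (Pt i).
 by exists b; rewrite mulrC divfK // (primeN0 hP nb).
have Ab (q : pred 'I_n) : AK (\prod_(i | q i) b i).
 by elim/big_ind: _ => [|u v|i _]; [exact: sub1|exact: subM|case: (hb i)].
pose s := \prod_i b i; have ns : ~ P s.
 suff [] : AK s /\ ~ P s by [].
 rewrite /s; elim/big_ind: _ => [|u v [? ?] [? ?]|i _]; first by split=> //; exact: sub1.
  by split; [exact: subM|exact: (primeNM hP)].
 by have [] := hb i.
have Psw e : P (tf e) -> P (s * w * tf e).
 move=> Pe; have [g ->] := gen e Pe; rewrite rmorph_sum mulr_sumr; apply: (id_sum iP) => i _.
 rewrite rmorphM mulrCA; apply: (idM iP); first by exists (g i).
 rewrite (_ : s * w * _ = \prod_(j | j != i) b j * (b i * (w * tf (t i)))); last by rewrite /s (bigD1 i) //=; ring.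
 by apply: (idM iP) => //; case: (hb i).
have s0 := primeN0 hP ns; apply: nw; rewrite -(mulKf s0 (tf c * y)) mulrC; apply: (locE hP) => //; last exact: (Ab xpredT).
(* In place of a determinant: in any valuation ring V' over A, choose u of largest size among
   generators of P. Then s w u lies in P, hence in u V', and s w is in V'. *)
apply/normA/integral_vals => // V' [sV' vV'] AV'; have [z z0 Pz] := P0.
have [u [hu u0 mu]] := seq_max [seq tf (t i) | i <- enum 'I_n] (conj sV' vV') z0.
have [e _ eu] : AK u.
 move: hu; rewrite inE => /predU1P [->|/mapP [i _ ->]]; [exact: (idS iP)|by exists (t i)].
have Pu : P u by move: hu; rewrite inE => /predU1P [->//|/mapP [i _ ->]]; apply: Pt.
have := Psw e; rewrite eu => /(_ Pu) Psu; have [g _ eg] := idS iP Psu.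
have [|d ed] := gen g; first by rewrite /= eg.
rewrite -[s * _](mulfK u0) -eg ed rmorph_sum mulr_suml; apply: (sub_sum sV') => i _.
rewrite rmorphM -mulrA; apply: (subM sV'); first by apply: AV'; exists (d i).
by apply: mu; rewrite inE; apply/orP; right; apply/mapP; exists i; rewrite ?mem_enum.
Qed.

End Height1.

Hypothesis nA : noetherian A.
Hypothesis normA : forall z, integral AK z -> AK z.

Definition evk (y : K) : {rmorphism {poly k} -> K} :=
 horner_morph (fun c : k => mulrC y ((tf \o iota) c)).
Definition evk2 (y x : K) : {rmorphism {poly {poly k}} -> K} :=
 horner_morph (fun f : {poly k} => mulrC x (evk y f)).

Lemma evkC y c : evk y c%:P = tf (iota c).
Proof. exact: (horner_morphC (f := tf \o iota)). Qed.
Lemma evkX y : evk y 'X = y.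
Proof. exact: (horner_morphX (f := tf \o iota)). Qed.
Lemma evk2C y x f : evk2 y x f%:P = evk y f.
Proof. exact: horner_morphC. Qed.
Lemma evk2X y x : evk2 y x 'X = x.
Proof. exact: horner_morphX. Qed.

Section Residue.
Variables (B : set K) (sB : subring B) (AB : AK `<=` B).

Lemma evk_in y f : B y -> B (evk y f).
Proof.
move=> By; elim/poly_ind: f => [|f c IH]; first by rewrite rmorph0; apply: sub0.
rewrite rmorphD rmorphM evkX evkC; apply: (subD sB); first exact: (subM sB).
by apply: AB; exists (iota c).
Qed.

Lemma evk2_in y x F : B y -> B x -> B (evk2 y x F).
Proof.
move=> By Bx; elim/poly_ind: F => [|F f IH]; first by rewrite rmorph0; apply: sub0.
rewrite rmorphD rmorphM evk2X evk2C; apply: (subD sB); first exact: (subM sB).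
exact: evk_in.
Qed.

(** Modulo an ideal containing m, only the reduction of the coefficients to k matters. *)
Lemma ev1_residue c y F : ideal B c -> (forall a, m a -> c (tf a)) -> B y ->
 c (ev1 y F - evk y (red1 F)).
Proof.
move=> ic mc By; elim/poly_ind: F => [|F a IH]; first by rewrite !rmorph0 subrr; apply: (id0 ic).
rewrite !rmorphD !rmorphM ev1X ev1C /= map_polyX map_polyC evkX evkC.
have -> : ev1 y F * y + tf a - (evk y (red1 F) * y + tf (iota (res a))) =
 y * (ev1 y F - evk y (red1 F)) + tf (a - iota (res a)) by rewrite rmorphB; ring.
apply: (idD ic); first exact: (idM ic).
by apply: mc; apply/res0; rewrite rmorphB res_iota subrr.
Qed.

Lemma ev2_residue c y x F : ideal B c -> (forall a, m a -> c (tf a)) -> B y -> B x ->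
 c (ev2 y x F - evk2 y x (red2 F)).
Proof.
move=> ic mc By Bx; elim/poly_ind: F => [|F f IH].
 by rewrite !rmorph0 subrr; apply: (id0 ic).
rewrite !rmorphD !rmorphM ev2X ev2C /= map_polyX map_polyC evk2X evk2C.
have -> : ev2 y x F * x + ev1 y f - (evk2 y x (red2 F) * x + evk y (red1 f)) =
 x * (ev2 y x F - evk2 y x (red2 F)) + (ev1 y f - evk y (red1 f)) by ring.
by apply: (idD ic); [apply: (idM ic)|apply: ev1_residue].
Qed.

Lemma evk_horner0 c y f : ideal B c -> c y -> c (evk y f - tf (iota f.[0])).
Proof.
move=> ic cy; have By := idS ic cy; elim/poly_ind: f => [|f a IH].
 by rewrite horner0 !rmorph0 subrr; apply: (id0 ic).
rewrite rmorphD rmorphM evkX evkC !hornerE addrK.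
by apply: (idM ic) => //; apply: evk_in.
Qed.

Lemma evk2_horner0 c y x F : ideal B c -> B y -> c x -> c (evk2 y x F - evk y F.[0]).
Proof.
move=> ic By cx; have Bx := idS ic cx; elim/poly_ind: F => [|F f IH].
 by rewrite horner0 !rmorph0 subrr; apply: (id0 ic).
rewrite rmorphD rmorphM evk2X evk2C hornerMXaddC mulr0 add0r addrK.
by apply: (idM ic) => //; apply: evk2_in.
Qed.

Lemma tf_iota_out c a : pideal B c -> c (tf (iota a)) -> a = 0.
Proof.
move=> [ic c1 _] h; apply: contrapT => /eqP a0; apply: c1.
have -> : 1 = tf (iota a^-1) * tf (iota a) by rewrite -!rmorphM mulVf // !rmorph1.
by apply: (idM ic) => //; apply: AB; exists (iota a^-1).
Qed.

(** An element of c' outside c is transcendental over k modulo c: f = g X^n with g(0) nonzero, and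
    g(y) is g(0) modulo c', hence not in c'. *)
Lemma evk_transcendental c c' y f : pideal B c -> pideal B c' -> c `<=` c' ->
 c' y -> ~ c y -> f != 0 -> ~ c (evk y f).
Proof.
move=> hc hc' cc' cy' ncy f0; have [ic c1 cM] := hc; have [ic' _ _] := hc'.
have By := idS ic' cy'.
have [n [g [g0 ->]]] := poly_factorX f0.
rewrite rmorphM rmorphXn /= evkX => /cM [||/cc' h|].
- exact: evk_in.
- exact: (subX sB).
- move/eqP: g0; apply; apply: (tf_iota_out hc').
 have -> : tf (iota g.[0]) = evk y g - (evk y g - tf (iota g.[0])) by rewrite subKr.
 by apply: (idB sB ic') => //; apply: (evk_horner0 g ic').
- by move=> /(primeX sB hc By).
Qed.

Lemma contract_neq0 c : pideal B c -> (exists2 z, z != 0 & c z) ->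
 exists2 a, a != 0 & (AK `&` c) a.
Proof.
move=> [ic c1 cM] [z z0 cz]; have [a [b [b0 e]]] := frac z.
have tb0 : tf b != 0 by apply: contra_neq b0 => /tf_eq0.
have ea : tf a = tf b * z by rewrite e mulrCA divff // mulr1.
exists (tf a); first by rewrite ea mulf_neq0.
by split; [exists a|rewrite ea; apply: (idM ic) => //; apply: AB; exists b].
Qed.

(** The localization of A at c is a valuation ring. If it missed z in B, then 1/z = x/y with x in c
    and y outside c, but y = z x lies in c. *)
Lemma height1_overring c : pideal B c -> (exists2 z, z != 0 & c z) ->
 (exists2 a, m a & ~ c (tf a)) -> B `<=` loc AK (AK `&` c).
Proof.
move=> hc c0 [a ma nca] z Bz; have hp := contract_prime AK_sr AB hc; have [ic _ cM] := hc.
have pm : exists2 a, m a & ~ (AK `&` c) (tf a) by exists a => // -[].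
have vL := height1_valring hp (contract_neq0 hc c0) pm nA normA.
apply: contrapT => nz; have := valring_inv vL nz.
move=> /(nonunit_locP hp) [x [y [[Ax cx] Ay nPy e]]].
have z0 : z != 0 by apply: contra_notN nz => /eqP ->; apply: (sub0 vL.1).
have y0 := primeN0 hp nPy; have ey : y = z * x.
 apply: (mulfI (invr_neq0 z0)); rewrite mulKf // e divfK //.
by apply: nPy; split=> //; rewrite ey; apply: (idM ic).
Qed.

(** The cases are those of the first prime that contains m. If not even c2 does, then c1 and c2
    contract to one height one prime, and B lies in the localization there. If c2 does but not c1,
    an element of c3 outside c2 is algebraic over k modulo c2. If c1 does, x in c2 and y in c3 are
    dependent modulo c1; both contradict [evk_transcendental]. *)
Lemma no_prime_chain3 c1 c2 c3 : pideal B c1 -> pideal B c2 -> pideal B c3 ->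
 (exists2 z, z != 0 & c1 z) -> c1 `<` c2 -> c2 `<` c3 -> False.
Proof.
move=> h1 h2 h3 c10 [l12 n12] [l23 n23].
have c20 : exists2 z, z != 0 & c2 z by have [z z0 cz] := c10; exists z => //; apply: l12.
have [y [cy ncy]] : exists y, c3 y /\ ~ c2 y.
 by apply: contrapT => h; apply: n23 => y cy; apply: contrapT => nc; apply: h; exists y.
have [i1 _ M1] := h1; have [i2 _ M2] := h2; have [i3 _ M3] := h3.
have By := idS i3 cy.
have [m2|/existsNP [a /not_implyP [ma nca]]] := EM (forall a, m a -> c2 (tf a)); last first.
 have out2 : exists2 a, m a & ~ c2 (tf a) by exists a.
 have hp2 := contract_prime AK_sr AB h2; have hp1 := contract_prime AK_sr AB h1.
 have e12 : AK `&` c1 = AK `&` c2.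
  apply: (height1_prime hp2 _ hp1 (contract_neq0 h1 c10)).
   by exists a => // -[].
  by move=> z [Az /l12].
 apply: n12 => z cz.
 have [x [t [Ax At nt t0 e]]] := locP hp2 (height1_overring h2 c20 out2 (idS i2 cz)).
 have : (AK `&` c1) x.
  rewrite e12; split=> //; have -> : x = t * z by rewrite e mulrCA divff // mulr1.
  by apply: (idM i2) => //; apply: AB.
 have -> : x = z * t by rewrite e divfK.
 move=> [_ /M1 [||//|ct]]; [exact: (idS i2)|exact: AB|].
 by case: nt; split=> //; apply: l12.
have Bm a : m a -> B (tf a) by move=> _; apply: AB; exists a.
have [m1|/existsNP [a /not_implyP [ma nca]]] := EM (forall a, m a -> c1 (tf a)); last first.
 have out1 : exists2 a, m a & ~ c1 (tf a) by exists a.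
 have hp1 := contract_prime AK_sr AB h1.
 have pm : exists2 a, m a & ~ (AK `&` c1) (tf a) by exists a => // -[].
 have Ly := height1_overring h1 c10 out1 By.
 have [F [/(nonunit_locP hp1) [x [t [[Ax cx] At nt e]]] F0]] :=
  residually_dependent1 hp1 (contract_neq0 h1 c10) pm Ly.
 have BF : B (ev1 y F) by apply: ev1_in.
 have cF : c2 (ev1 y F).
  have : c1 (ev1 y F * t) by rewrite e divfK // (primeN0 hp1 nt).
  by move=> /M1 [||/l12 //|ct]; [exact: BF|exact: AB|case: nt; split].
 apply: (evk_transcendental h2 h3 l23 cy ncy F0).
 have -> : evk y (red1 F) = ev1 y F - (ev1 y F - evk y (red1 F)) by rewrite subKr.
 by apply: (idB sB i2) => //; apply: ev1_residue.
have [x [cx ncx]] : exists x, c2 x /\ ~ c1 x.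
 by apply: contrapT => h; apply: n12 => x cx; apply: contrapT => nc; apply: h; exists x.
have Bx := idS i2 cx.
have [F [eF F0]] := residually_dependent2 y x.
have : c1 (evk2 y x (red2 F)).
 have -> : evk2 y x (red2 F) = - (ev2 y x F - evk2 y x (red2 F)) by rewrite eF sub0r opprK.
 by apply: (idN sB i1); apply: ev2_residue.
have [n [G [G0 ->]]] := poly_factorX F0.
rewrite rmorphM rmorphXn /= evk2X => /M1 [||/l12 cG|/(primeX sB h1 Bx) //].
- exact: evk2_in.
- exact: (subX sB).
apply: (evk_transcendental h2 h3 l23 cy ncy G0).
have -> : evk y G.[0] = evk2 y x G - (evk2 y x G - evk y G.[0]) by rewrite subKr.
by apply: (idB sB i2) => //; apply: evk2_horner0.
Qed.

End Residue.

End Fraction.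
End LocalDim2.

(** * Integral schemes inside a field *)

Section Charts.
Variables (K : fieldType) (T : topologicalType) (lc : T -> set K).

Definition trace (B : set K) (x : T) : set K := B `&` nonunit (lc x).

(* The open set U, with the local rings lc, looks like Spec B. *)
Record chart (U : set T) (B : set K) : Prop := Chart {
 chart_sr : subring B;
 chart_prime : forall x, U x -> pideal B (trace B x);
 chart_loc : forall x, U x -> lc x = loc B (trace B x);
 chart_surj : forall p, pideal B p -> exists2 x, U x & trace B x = p;
 chart_inj : forall x y, U x -> U y -> trace B x = trace B y -> x = y;
 chart_open : forall W, W `<=` U -> (open W <-> exists G, G `<=` B /\
  forall x, U x -> (W x <-> ~ (G `<=` nonunit (lc x)))) }.

Section Chart.
Variables (U : set T) (B : set K) (hU : chart U B).

Lemma lc_sr x : U x -> subring (lc x).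
Proof.
move=> Ux; rewrite (chart_loc hU Ux).
by apply: (loc_sr (chart_sr hU)); apply: (chart_prime hU).
Qed.

Lemma lc_nonunit_ideal x : U x -> ideal (lc x) (nonunit (lc x)).
Proof.
move=> Ux; have hP := chart_prime hU Ux; rewrite {1 2}(chart_loc hU Ux).
exact: (nonunit_loc_ideal (chart_sr hU) hP).
Qed.

Lemma chart_sub x : U x -> B `<=` lc x.
Proof.
move=> Ux; rewrite (chart_loc hU Ux).
exact: (sub_loc (chart_sr hU) (chart_prime hU Ux)).
Qed.

Lemma chart_isopen : open U.
Proof.
apply/(chart_open hU); first by [].
exists [set 1]; split=> [z ->|x Ux]; first exact: (sub1 (chart_sr hU)).
split=> // _ /(_ 1 erefl) [_ []]; split; first exact: oner_neq0.
by rewrite invr1; apply: (sub1 (lc_sr Ux)).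
Qed.

Lemma chart_inter z : (forall x, U x -> lc x z) -> B z.
Proof.
move=> h; apply: (loc_inter (chart_sr hU)) => P /(chart_surj hU) [x Ux <-].
by rewrite -(chart_loc hU Ux); apply: h.
Qed.

Lemma chart_basic b : B b -> open (U `&` [set x | ~ nonunit (lc x) b]).
Proof.
move=> Bb; apply/(chart_open hU) => [x [] //|]; exists [set b]; split=> [_ -> //|x Ux].
by split=> [[_ nb] /(_ b erefl)|h] //; split=> // nb; apply: h => _ ->.
Qed.

Lemma chart_nbhs W x : open W -> W x -> U x ->
 exists b, [/\ B b, ~ nonunit (lc x) b & U `&` [set y | ~ nonunit (lc y) b] `<=` W].
Proof.
move=> oW Wx Ux; have oWU : open (W `&` U) by apply: openI => //; exact: chart_isopen.
have [|G [GB hG]] := ((chart_open hU (W := W `&` U) _).1 oWU); first by move=> y [].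
have /existsNP [b /not_implyP [Gb nb]] := ((hG x Ux).1 (conj Wx Ux)).
exists b; split=> //; first exact: GB.
by move=> y [Uy nby]; apply: (proj1 ((hG y Uy).2 _)) => /(_ b Gb).
Qed.

End Chart.
End Charts.

(** The empty family covers U, and the gluing of nothing is unique. *)
Lemma sec0 (Y : ringed_space) (U : opens Y) (s t : OO Y U) :
 (forall x, ~ U x) -> s = t.
Proof.
move=> U0; have [||v [_ u]] := @rres_sheaf Y U False (fun _ => U) (fun _ => @subset_refl _ U) _
 (fun i => match i with end).
- by move=> x /U0.
- by move=> [].
by rewrite -(u s) ?(u t).
Qed.

Lemma zero_pideal (K : fieldType) (B : set K) : subring B -> pideal B [set 0].
Proof.
move=> sB; split; first split.
- by move=> _ ->; apply: (sub0 sB).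
- by [].
- by move=> _ _ -> ->; rewrite /= addr0.
- by move=> a _ _ ->; rewrite /= mulr0.
- by move=> /eqP; rewrite oner_eq0.
- by move=> a b _ _ /eqP; rewrite mulf_eq0 => /orP [/eqP|/eqP]; [left|right].
Qed.

(** An integral scheme with the values of its sections in K. By [fgenP] an open set missing the
    generic point is empty and has only the zero section, hence the premises on the generic
    point. *)
Record fscheme (K : fieldType) := FScheme {
 fsch :> scheme;
 fgen : fsch;
 fgenP : forall (U : opens fsch) x, U x -> U fgen;
 fval : forall U : opens fsch, OO fsch U -> K;
 fvalB : forall (U : opens fsch) (s t : OO fsch U), fval (s - t) = fval s - fval t;
 fvalM : forall (U : opens fsch) (s t : OO fsch U), fval (s * t) = fval s * fval t;
 fval1 : forall (U : opens fsch), U fgen -> fval (1 : OO fsch U) = 1;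
 fval_res : forall (U V : opens fsch) (h : V `<=` U) s, V fgen -> fval (rres h s) = fval s;
 fval_inj0 : forall (U : opens fsch) (s : OO fsch U), U fgen -> fval s = 0 -> s = 0 }.

Arguments fval {K f U}.
Arguments fgen {K}.

Section FSchemeTheory.
Variables (K : fieldType) (Y : fscheme K).
Implicit Types U V W : opens Y.

Definition floc (x : Y) : set K :=
 [set z | exists U (s : OO Y U), U x /\ fval s = z].

Lemma fval0 U : fval (0 : OO Y U) = 0.
Proof. by rewrite -(subrr 0) fvalB subrr. Qed.
Lemma fvalN U (s : OO Y U) : fval (- s) = - fval s.
Proof. by rewrite -sub0r fvalB fval0 sub0r. Qed.
Lemma fvalD U (s t : OO Y U) : fval (s + t) = fval s + fval t.
Proof. by rewrite -{1}(opprK t) fvalB fvalN opprK. Qed.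
Lemma fvalX U (s : OO Y U) n : U (fgen Y) -> fval (s ^+ n) = fval s ^+ n.
Proof. by move=> Ug; elim: n => [|n IH]; rewrite ?expr0 ?fval1 // !exprS fvalM IH. Qed.

Lemma fval_rmorph U : U (fgen Y) -> exists g : {rmorphism OO Y U -> K}, g =1 fval.
Proof.
move=> Ug; apply: rmorphism_of; [exact: fval1|exact: fvalB|exact: fvalM].
Qed.

Lemma fval_inj U (s t : OO Y U) : fval s = fval t -> s = t.
Proof.
move=> e; have [Ug|nUg] := EM (U (fgen Y)).
 by apply/eqP; rewrite -subr_eq0; apply/eqP/fval_inj0 => //; rewrite fvalB e subrr.
by apply: sec0 => x /fgenP.
Qed.

Lemma fval_res_eq U V W (h : W `<=` U) (k : W `<=` V) (s : OO Y U) (t : OO Y V) :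
 fval s = fval t -> rres h s = rres k t.
Proof.
move=> e; have [Wg|nWg] := EM (W (fgen Y)); first by apply: fval_inj; rewrite !fval_res.
by apply: sec0 => x /fgenP.
Qed.

Lemma floc_val U x (s : OO Y U) : U x -> floc x (fval s).
Proof. by exists U, s. Qed.

Lemma flocP2 x z w : floc x z -> floc x w ->
 exists U (s t : OO Y U), [/\ U x, fval s = z & fval t = w].
Proof.
move=> [U [s [Ux <-]]] [V [t [Vx <-]]]; exists (opensI U V).
have hU : opensI U V `<=` U by move=> y [].
have hV : opensI U V `<=` V by move=> y [].
have g : opensI U V (fgen Y) by split; [exact: fgenP Ux|exact: fgenP Vx].
by exists (rres hU s), (rres hV t); rewrite !fval_res.
Qed.

Lemma floc_sr x : subring (floc x).
Proof.
split.
- by exists (opensT Y), 1; split=> //; rewrite fval1.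
- by move=> z w /flocP2 h /h [U [s [t [Ux <- <-]]]]; rewrite -fvalB; apply: floc_val.
- by move=> z w /flocP2 h /h [U [s [t [Ux <- <-]]]]; rewrite -fvalM; apply: floc_val.
Qed.

Lemma fval_glue U z : U (fgen Y) -> (forall x, U x -> floc x z) -> exists s : OO Y U, fval s = z.
Proof.
move=> Ug h.
have /choice [V hV] : forall i : {x | U x}, exists V,
  [/\ V `<=` U, V (sval i) & exists s : OO Y V, fval s = z].
 move=> [x Ux]; have [V [s [Vx e]]] := h x Ux.
 have hl : opensI U V `<=` U by move=> y [].
 have hr : opensI U V `<=` V by move=> y [].
 exists (opensI U V); split=> //; exists (rres hr s); rewrite fval_res //.
 by split=> //; apply: fgenP Vx.
have VU i : V i `<=` U by case: (hV i).
have hs0 i : {s : OO Y (V i) | fval s = z} by apply: cid; case: (hV i).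
pose s i := sval (hs0 i); have hs i : fval (s i) = z := svalP (hs0 i).
have [||t [ht _]] := @rres_sheaf Y U _ V VU _ s.
- by move=> x Ux; exists (exist _ x Ux); case: (hV (exist _ x Ux)).
- by move=> i j W hi hj; apply: fval_res_eq; rewrite !hs.
exists t; have := ht (exist _ (fgen Y) Ug) => /(congr1 fval).
by rewrite hs fval_res //; case: (hV (exist _ (fgen Y) Ug)).
Qed.

Lemma finvP U x (s : OO Y U) : U x -> invertible_at x s <-> ~ nonunit (floc x) (fval s).
Proof.
move=> Ux; split=> [[V [h [Vx [b e]]]] [_]|nu].
 have Vg := fgenP Vx; have {}e : fval s * fval b = 1.
  by rewrite -(fval_res h) // -fvalM e fval1.
 have s0 : fval s != 0 by apply: contra_eq_neq e => ->; rewrite mul0r eq_sym oner_neq0.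
 apply; split=> //; rewrite (_ : _^-1 = fval b); first exact: floc_val.
 by apply: (mulfI s0); rewrite e divff.
have [s0 [V [b [Vx e]]]] : fval s != 0 /\ floc x (fval s)^-1.
 by apply: contrapT => h; apply: nu; split=> //; exact: floc_val.
have hl : opensI U V `<=` U by move=> y [].
have hr : opensI U V `<=` V by move=> y [].
exists (opensI U V), hl; split=> //; exists (rres hr b).
have g : opensI U V (fgen Y) by apply: (@fgenP _ Y _ x).
by apply: fval_inj; rewrite fvalM !fval_res // e divff // fval1.
Qed.

Lemma spec_bijective U (R : comPzRingType) (psi : {rmorphism R -> OO Y U}) :
 is_spec psi -> forall s, exists r, s = psi r.
Proof.
move=> [_ _ _ _ /(_ 1 U (@subset_refl _ U))] [|_ h _ s].
 move=> x; split=> [Ux|[] //]; split=> //; apply; rewrite /spec_point /=.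
 by exists U, (@subset_refl _ U); split=> //; exists 1; rewrite !rmorph1 mulr1.
have [a [m [[n ->]]]] := h s; rewrite expr1n /= rmorph1 rmorph1 mulr1 rres_id => ->.
by exists a.
Qed.

(** The bridge from affine schemes to subrings of K: the prime [spec_point psi x] is the inverse
    image of the trace at x of the maximal ideal. *)
Lemma spec_chart U (R : comPzRingType) (psi : {rmorphism R -> OO Y U}) :
 U (fgen Y) -> is_spec psi -> chart floc U (range (@fval K Y U)).
Proof.
move=> Ug hpsi; have surj := spec_bijective hpsi.
have [hP hI hS hO hL] := hpsi; set B := range _.
have BP z : B z -> exists r, z = fval (psi r).
 by move=> [s _ <-]; have [r ->] := surj s; exists r.
have Bv r : B (fval (psi r)) by exists (psi r).
have ptr x r : U x -> trace floc B x (fval (psi r)) <-> spec_point psi x r.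
 move=> Ux; rewrite /spec_point /=; split.
  by move=> [_ nu] /(finvP _ Ux).
 by move=> h; split=> //; apply: contrapT => nu; apply: h; apply/(finvP _ Ux).
have [v0 hv0] := fval_rmorph Ug; pose v : {rmorphism R -> K} := v0 \o psi.
have vE r : v r = fval (psi r) by rewrite /v /= hv0.
have BE : range v = B.
 by apply/seteqP; split=> [_ [r _ <-]|z /BP [r ->]]; [rewrite vE|exists r].
have sB : subring B by rewrite -BE; apply: range_sr.
have hprime x : U x -> pideal B (trace floc B x).
 move=> Ux; rewrite (_ : trace _ _ _ = v @` spec_point psi x); last first.
  apply/seteqP; split=> [z tz|_ [r hr <-]]; last by rewrite vE; apply/ptr.
  by have [r er] := BP _ tz.1; exists r; rewrite ?vE //; apply/ptr; rewrite // -er.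
 rewrite -BE; apply: (image_pideal (hP x Ux) _).1 => r.
 rewrite vE -(fval0 U) => /fval_inj e; apply/(ptr _ _ Ux); rewrite e -(rmorph0 psi).
 by apply/ptr => //; case: (hP x Ux) => -[].
have basic g : open (U `&` [set x | ~ spec_point psi x g]).
 apply/(hO _ _) => [x [] //|]; exists [set g] => x Ux.
 by split=> [[_ ng] /(_ g erefl) //|h]; split=> // ng; apply: h => _ ->.
split=> //.
- move=> x Ux; apply/seteqP; split=> z.
  move=> [W [s [Wx <-]]].
  have oWU : open (W `&` U) by exact: (oset_open (opensI W U)).
  have [|G hG] := (hO (W `&` U) _).1 oWU; first by move=> y [].
  have /existsNP [g /not_implyP [Gg ng]] := (hG x Ux).1 (conj Wx Ux).
  pose D := Opens (basic g).
  have DU : D `<=` U by move=> y [].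
  have DW : D `<=` W.
   by move=> y [Uy ngy]; apply: (proj1 ((hG y Uy).2 _)) => /(_ g Gg).
  have Dg : D (fgen Y) by apply: (@fgenP _ Y D x).
  have [_ h _] := hL g D DU (fun y => iff_refl _).
  have [a [m [[n ->] e]]] := h (rres DW s).
  exists (fval (psi a)), (fval (psi (g ^+ n))); split=> //.
   by move=> /(ptr _ _ Ux) /(is_primeX (hP x Ux)).
  by have := congr1 fval e; rewrite fvalM !fval_res.
 move=> [a [b [Ba Bb nb e]]]; have [s0 Fi] : b != 0 /\ floc x b^-1.
  apply: contrapT => h; apply: nb; split=> //; split=> //.
  by have [t _ <-] := Bb; apply: floc_val.
 rewrite (_ : z = a * b^-1); last by rewrite -e mulfK.
 by apply: (subM (floc_sr x)) => //; have [t _ <-] := Ba; apply: floc_val.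
- move=> p hp; have [|x Ux e] := hS [set r | p (fval (psi r))].
  rewrite -BE in hp; have := pideal_preim hp.
  by congr is_prime; apply/seteqP; split=> r; rewrite /= hv0.
 exists x => //; apply/seteqP; split=> z.
  by move=> tz; have [r er] := BP _ tz.1; move: tz; rewrite er => /(ptr _ _ Ux); rewrite e.
 move=> pz; have [i _ _] := hp; have [r er] := BP _ (idS i pz).
 by move: pz; rewrite er => pz; apply/ptr => //; rewrite e.
- move=> x y Ux Uy e; apply: hI => //; apply/seteqP; split=> r /=.
  by move=> /(ptr _ _ Ux); rewrite e => /(ptr _ _ Uy).
 by move=> /(ptr _ _ Uy); rewrite -e => /(ptr _ _ Ux).
- move=> W WU; rewrite (hO W WU); split.
  move=> [G hG]; exists [set fval (psi g) | g in G]; split=> [_ [g _ <-] //|x Ux].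
  rewrite (hG x Ux); split=> h1 h2; apply: h1.
   by move=> g Gg; apply/(ptr _ _ Ux); split=> //; apply: h2; exists g.
  by move=> _ [g Gg <-]; have /(ptr _ _ Ux) [] := h2 g Gg.
 move=> [G [GB hG]]; exists [set r | G (fval (psi r))] => x Ux.
 rewrite (hG x Ux); split=> h1 h2; apply: h1.
  by move=> z Gz; have [r er] := BP _ (GB _ Gz); rewrite er; move: Gz; rewrite er => /h2 /(ptr _ _ Ux) [].
 by move=> r Gr; apply/(ptr _ _ Ux); split=> //; apply: h2.
Qed.

Lemma affine_chart U : U (fgen Y) -> affine U -> chart floc U (range (@fval K Y U)).
Proof. by move=> Ug [R [psi /(spec_chart Ug)]]. Qed.

Lemma exists_chart (x : Y) : exists U B, U x /\ chart floc U B.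
Proof.
have [U Ux aU] := schemeP x; exists U, (range (@fval K Y U)); split=> //.
by apply: affine_chart => //; apply: fgenP Ux.
Qed.

Lemma floc_ideal x : ideal (floc x) (nonunit (floc x)).
Proof. by have [U [B [Ux hU]]] := exists_chart x; apply: (lc_nonunit_ideal hU). Qed.

End FSchemeTheory.

Arguments floc {K Y} x.
(* An integral scheme given by its local rings inside the field of rational
  functions. *)
Record model (F : fieldType) := Model {
 mspace :> topologicalType;
 mloc : mspace -> set F;
 mgen : mspace;
 mgenP : forall (U : opens mspace) x, U x -> U mgen;
 mchart : forall x, exists (U : opens mspace) B, U x /\ chart mloc U B }.

Arguments mloc {F m}.
Arguments mgen {F}.

Section ModelSheaf.
Variables (F : fieldType) (M : model F).
Implicit Types U V W : opens M.

Lemma mloc_sr (x : M) : subring (mloc x).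
Proof. by have [U [B [Ux hU]]] := mchart x; apply: (lc_sr hU). Qed.

Lemma mloc_nonunit_ideal (x : M) : ideal (mloc x) (nonunit (mloc x)).
Proof. by have [U [B [Ux hU]]] := mchart x; apply: (lc_nonunit_ideal hU). Qed.

Definition msec_pred U : {pred F} := fun z =>
 `[< (forall x, U x -> mloc x z) /\ (~ U (mgen M) -> z = 0) >].

Lemma msec_zmod U : zmod_closed (msec_pred U).
Proof.
split; first by apply/asboolP; split=> // x _; apply: (sub0 (mloc_sr x)).
move=> a b /asboolP [ha na] /asboolP [hb nb]; apply/asboolP; split=> [x Ux|nU].
 by apply: (subB (mloc_sr x)); [apply: ha|apply: hb].
by rewrite na // nb // subrr.
Qed.

HB.instance Definition _ U := GRing.isZmodClosed.Build F (msec_pred U) (@msec_zmod U).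

(* Over the empty set this is the zero ring. *)
Record msec U := MSec { mval : F ; mvalP : mval \in msec_pred U }.

HB.instance Definition _ U := [isSub for @mval U].
HB.instance Definition _ U := [Choice of msec U by <:].
HB.instance Definition _ U := [SubChoice_isSubZmodule of msec U by <:].

Definition mone U : F := if `[< U (mgen M) >] then 1 else 0.

Lemma mone_gen U : U (mgen M) -> mone U = 1.
Proof. by move=> Ug; rewrite /mone asboolT. Qed.

Lemma mone_empty U : ~ U (mgen M) -> mone U = 0.
Proof. by move=> Ug; rewrite /mone asboolF. Qed.

Lemma mone_subproof U : mone U \in msec_pred U.
Proof.
apply/asboolP; split=> [x Ux|/mone_empty //].
by rewrite mone_gen; [apply: (sub1 (mloc_sr x))|apply: mgenP Ux].
Qed.

Lemma mmul_subproof U (s t : msec U) : val s * val t \in msec_pred U.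
Proof.
have /asboolP [hs ns] := valP s; have /asboolP [ht nt] := valP t.
apply/asboolP; split=> [x Ux|/ns ->]; last by rewrite mul0r.
by apply: (subM (mloc_sr x)); [apply: hs|apply: ht].
Qed.

Definition mmul U (s t : msec U) : msec U := MSec (mmul_subproof s t).

Lemma mmulA U : associative (@mmul U).
Proof. by move=> a b c; apply: val_inj; rewrite /= mulrA. Qed.
Lemma mmulC U : commutative (@mmul U).
Proof. by move=> a b; apply: val_inj; rewrite /= mulrC. Qed.
Lemma mmul1 U : left_id (MSec (mone_subproof U)) (@mmul U).
Proof.
move=> a; apply: val_inj => /=; have [Ug|nUg] := EM (U (mgen M)).
 by rewrite mone_gen // mul1r.
by rewrite mone_empty // mul0r; have /asboolP [_ ->] := valP a.
Qed.
Lemma mmulD U : left_distributive (@mmul U) +%R.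
Proof. by move=> a b c; apply: val_inj; rewrite /= mulrDl. Qed.

HB.instance Definition _ U :=
 GRing.Zmodule_isComPzRing.Build (msec U) (@mmulA U) (@mmulC U) (@mmul1 U) (@mmulD U).

(** Restriction is multiplication by [mone V], which is 1 except over the empty set, where it sends
    everything to the only section 0. *)
Lemma mres_subproof U V (h : V `<=` U) (s : msec U) : mone V * val s \in msec_pred V.
Proof.
have /asboolP [hs ns] := valP s.
apply/asboolP; split=> [x Vx|/mone_empty ->]; last by rewrite mul0r.
by rewrite mone_gen ?mul1r; [apply/hs/h|apply: mgenP Vx].
Qed.

Definition msec_res U V (h : V `<=` U) (s : msec U) : msec V := MSec (mres_subproof h s).

Lemma mone_idem V : mone V * mone V = mone V.
Proof. by rewrite /mone; case: asbool; rewrite ?mulr1 ?mulr0. Qed.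

Lemma mone_sub U V : V `<=` U -> mone V * mone U = mone V.
Proof.
move=> h; have [Vg|nVg] := EM (V (mgen M)); last by rewrite mone_empty // mul0r.
by rewrite !mone_gen ?mul1r //; apply: h.
Qed.

Lemma msec_res_zmod U V (h : V `<=` U) : zmod_morphism (msec_res h).
Proof. by move=> s t; apply: val_inj; rewrite /= mulrBr. Qed.

Lemma msec_res_monoid U V (h : V `<=` U) : monoid_morphism (msec_res h).
Proof.
split=> [|s t]; apply: val_inj => /=; first exact: mone_sub.
by rewrite mulrACA mone_idem.
Qed.

HB.instance Definition _ U V (h : V `<=` U) :=
 GRing.isZmodMorphism.Build (msec U) (msec V) (msec_res h) (msec_res_zmod h).
HB.instance Definition _ U V (h : V `<=` U) :=
 GRing.isMonoidMorphism.Build (msec U) (msec V) (msec_res h) (msec_res_monoid h).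

Definition msec_rres U V (h : V `<=` U) : {rmorphism msec U -> msec V} := msec_res h.

Lemma mval_one U (s : msec U) : mone U * mval s = mval s.
Proof.
have [Ug|nUg] := EM (U (mgen M)); first by rewrite mone_gen // mul1r.
by have /asboolP [_ /(_ nUg) ->] := valP s; rewrite mulr0.
Qed.

Lemma msec_res_id U (h : U `<=` U) (s : msec U) : msec_rres h s = s.
Proof. by apply: val_inj; rewrite /= mval_one. Qed.

Lemma msec_res_comp U V W (h : V `<=` U) (k : W `<=` V) (l : W `<=` U) (s : msec U) :
 msec_rres k (msec_rres h s) = msec_rres l s.
Proof. by apply: val_inj; rewrite /= mulrA mone_sub. Qed.

Lemma msec_sheaf : is_sheaf (fun U V h => @msec_rres U V h).
Proof.
move=> U I V hV cov s Hs.
have [Ug|nUg] := EM (U (mgen M)); last first.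
 have nV i : ~ V i (mgen M) by move=> /hV.
 exists 0; split=> [i|t _]; apply: val_inj => /=.
  by rewrite mulr0; have /asboolP [_ /(_ (nV i)) ->] := valP (s i).
 by have /asboolP [_ /(_ nUg) ->] := valP t.
have [i0 Vi0] := cov _ Ug.
have same i x : V i x -> mval (s i) = mval (s i0).
 move=> Vx; have Vg := mgenP Vx.
 have hi : opensI (V i) (V i0) `<=` V i by move=> y [].
 have hj : opensI (V i) (V i0) `<=` V i0 by move=> y [].
 have /(congr1 val) /= := Hs i i0 _ hi hj.
 by rewrite mone_gen ?mul1r.
have tP : mval (s i0) \in msec_pred U.
 apply/asboolP; split=> // x Ux; have [i Vix] := cov x Ux.
 by rewrite -(same i x) //; have /asboolP [h _] := valP (s i); apply: h.
exists (MSec tP); split=> [i|t Ht]; apply: val_inj => /=.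
 have [Vg|nVg] := EM (V i (mgen M)); first by rewrite mone_gen // mul1r (same i _ Vg).
 by rewrite mone_empty // mul0r; have /asboolP [_ ->] := valP (s i).
by rewrite -(Ht i0) /= mone_gen // mul1r.
Qed.

Definition model_space : ringed_space :=
 RingedSpace msec_res_id msec_res_comp msec_sheaf.

Lemma model_glue U z : (forall x, U x -> mloc x z) -> U (mgen M) ->
 exists s : OO model_space U, mval s = z.
Proof. by move=> h Ug; have zP : z \in msec_pred U by [apply/asboolP]; exists (MSec zP). Qed.

Lemma mval_loc U x (s : msec U) : U x -> mloc x (mval s).
Proof. by move=> Ux; have /asboolP [h _] := valP s; apply: h. Qed.

Lemma minvP U x (s : OO model_space U) : U x ->
 invertible_at (X := model_space) x s <-> ~ nonunit (mloc x) (mval s).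
Proof.
move=> Ux; split=> [[V [h [Vx [b /(congr1 val) /= e]]]] [_]|nu].
 rewrite (mone_gen (mgenP Vx)) mul1r in e.
 have s0 : mval s != 0 by apply: contra_eq_neq e => ->; rewrite mul0r eq_sym oner_neq0.
 apply; split=> //; rewrite (_ : _^-1 = mval b); first exact: mval_loc.
 by apply: (mulfI s0); rewrite e divff.
have [s0 si] : mval s != 0 /\ mloc x (mval s)^-1.
 by apply: contrapT => h; apply: nu; split=> //; exact: mval_loc.
have [C [B [Cx hC]]] := mchart x; have sB := chart_sr hC.
move: si; rewrite (chart_loc hC Cx) => -[a [b [Ba Bb nb e]]].
pose V := opensI U (Opens (chart_basic hC Bb)).
have h : V `<=` U by move=> y [].
have nu' : ~ nonunit (mloc x) b.
 by move=> h'; apply: nb; split.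
have Vx : V x by [].
have [|t ht] := @model_glue V (mval s)^-1 _ (mgenP Vx).
 move=> y [Uy [Cy nby]]; rewrite -(mulfK (x := b) _ (mval s)^-1).
  rewrite e; apply: (subM (mloc_sr y)); first exact: (chart_sub hC Cy).
  by apply: contrapT => h'; apply: nby; split=> [|[_]//]; apply: (chart_sub hC Cy).
 by apply/eqP => b0; apply: nu'; rewrite b0; apply: (id0 (mloc_nonunit_ideal x)).
exists V, h; split=> //; exists t; apply: val_inj => /=.
by rewrite (mone_gen (mgenP Vx)) mul1r ht divff.
Qed.

Lemma chart_gen U B : chart mloc U B -> U (mgen M).
Proof.
move=> hU; have [x] := chart_surj hU (zero_pideal (chart_sr hU)).
by move/mgenP.
Qed.

Lemma model_spec U B : chart mloc U B ->
 is_spec (X := model_space) (U := U) (idfun : {rmorphism msec U -> msec U}).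
Proof.
move=> hU; have Ug := chart_gen hU.
have hB (s : msec U) : B (mval s) by apply: (chart_inter hU) => x Ux; exact: mval_loc.
have BE z : B z -> exists s : msec U, mval s = z.
 by move=> Bz; apply: model_glue => // x Ux; apply: (chart_sub hU Ux).
have [g gm] := @rmorphism_of (msec U) F (@mval U) (mone_gen Ug) (fun _ _ => erefl) (fun _ _ => erefl).
have gB : range g = B.
 by apply/seteqP; split=> [_ [s _ <-]|z /BE [s <-]]; [rewrite gm|exists s].
have sp x (s : msec U) : U x ->
  spec_point (X := model_space) (U := U) (idfun : {rmorphism msec U -> msec U}) x s
  <-> trace mloc B x (mval s).
 move=> Ux; rewrite /spec_point /=; split=> [h|[_ h] /(minvP _ Ux) //].
 by split=> //; apply: contrapT => nu; apply: h; apply/minvP.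
have sp' x (s : msec U) : U x ->
  spec_point (X := model_space) (U := U) (idfun : {rmorphism msec U -> msec U}) x s
  <-> nonunit (mloc x) (mval s).
 by move=> Ux; split=> [/(sp _ _ Ux) []//|h]; apply/sp.
split.
- move=> x Ux; have [ip p1 pP] := chart_prime hU Ux; split; first split.
 + by apply/sp => //; apply: (id0 ip).
 + by move=> a b /(sp _ _ Ux) ha /(sp _ _ Ux) hb; apply/sp => //; apply: (idD ip).
 + by move=> a b /(sp _ _ Ux) hb; apply/sp => //; apply: (idM ip (hB a) hb).
 + by move=> /(sp _ _ Ux) /=; rewrite mone_gen.
 + move=> a b /(sp _ _ Ux) h.
  by have [h'|h'] := pP _ _ (hB a) (hB b) h; [left|right]; apply/sp.
- move=> x y Ux Uy e; apply: (chart_inj hU) => //; apply/seteqP; split=> z tz;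
  have [s es] := BE _ tz.1; move: tz; rewrite -es.
  by move=> /(sp x s Ux); rewrite e => /(sp y s Uy).
 by move=> /(sp y s Uy); rewrite -e => /(sp x s Ux).
- move=> p hp; have [|x Ux e] := chart_surj hU (p := g @` p).
  rewrite -gB; apply: (image_pideal hp _).1 => s.
  by rewrite gm => s0; have -> : s = 0; [exact: val_inj|case: hp => -[]].
 exists x => //; apply/seteqP; split=> s.
  by move=> /(sp x s Ux); rewrite e -gm => -[t pt]; rewrite !gm => /val_inj <-.
 by move=> ps; apply/sp => //; rewrite e; exists s.
- move=> W WU; rewrite (chart_open hU WU); split=> [[G [GB hG]]|[G hG]].
  exists [set s | G (mval s)] => x Ux; rewrite (hG x Ux); split=> h1 h2; apply: h1.
   by move=> z Gz; have [s es] := BE _ (GB _ Gz); rewrite -es; apply/sp' => //; apply: h2; rewrite /= es.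
  by move=> s /= Gs; apply/sp' => //; apply: h2.
 exists [set mval s | s in G]; split=> [_ [s _ <-]//|x Ux].
 rewrite (hG x Ux); split=> h1 h2; apply: h1.
  by move=> s Gs; apply/sp' => //; apply: h2; exists s.
 by move=> _ [s Gs <-]; apply/sp' => //; apply: h2.
- move=> r D h hD.
 (* A basic open set D(r) misses the generic point only for r = 0; the localization at 0 is then the
    zero ring of sections over the empty set. *)
 have [Dg|nDg] := EM (D (mgen M)); last first.
  have r0 : r = 0.
   apply: val_inj; apply: contrapT => nr.
   have [x Ux e] := chart_surj hU (zero_pideal (chart_sr hU)).
   apply: nDg; apply: (@mgenP _ _ D x); apply/hD; split=> // /(sp _ _ Ux).
   by rewrite e.
  split=> [m _|s|a _].
  + by exists 0; apply: sec0 => x /mgenP.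
  + exists 0, 1; split; first by exists 0%N.
   by apply: sec0 => x /mgenP.
  + by exists 0; [exists 1%N; rewrite expr1|rewrite mul0r].
 have rn0 x : D x -> mval r != 0 /\ mloc x (mval r)^-1.
  move=> Dx; have [Ux nr] := (hD x).1 Dx.
  by apply: contrapT => h'; apply: nr; apply/sp' => //; split=> //; apply: mval_loc.
 have [r0 _] := rn0 _ Dg.
 split.
 + move=> _ [n ->]; have [|//|t ht] := @model_glue D ((mval r) ^+ n)^-1.
   by move=> x /rn0 [_ h']; rewrite -exprVn; apply: subX => //; apply: mloc_sr.
  exists t; apply: val_inj; rewrite rmorphXn /=.
  have -> : val ((msec_res h r) ^+ n) = mval r ^+ n.
   elim: n {t ht} => [|n IH]; first by rewrite !expr0 /= mone_gen.
   by rewrite !exprS /= IH mone_gen // mul1r.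
  by rewrite ht mone_gen // divff // expf_neq0.
 + move=> s; have [P hP nPr|n Bn] := loc_denom (chart_sr hU) (z := mval s) (hB r).
   have [x Ux e] := chart_surj hU hP; rewrite -e -(chart_loc hU Ux).
   apply: mval_loc; apply/hD; split=> // /(sp _ _ Ux).
   by rewrite e.
  have [a ea] := BE _ Bn; exists a, (r ^+ n); split; first by exists n.
  apply: val_inj; rewrite rmorphXn /= ea.
  have -> : val ((msec_res h r) ^+ n) = mval r ^+ n.
   elim: n {a ea Bn} => [|n IH]; first by rewrite !expr0 /= mone_gen.
   by rewrite !exprS /= IH mone_gen // mul1r.
  by rewrite mone_gen // mul1r mulrC.
 + move=> a /(congr1 val) /=; rewrite mone_gen // mul1r => a0.
  exists 1; first by exists 0%N.
  by rewrite mul1r; apply: val_inj.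
Qed.

Lemma model_schemeP (x : model_space) : exists2 U : opens model_space, U x & affine U.
Proof.
have [U [B [Ux hU]]] := mchart x; exists U => //.
by exists (msec U), (idfun : {rmorphism msec U -> msec U}); apply: (model_spec hU).
Qed.

Definition model_scheme : scheme := Scheme model_schemeP.

Lemma model_fval1 (U : opens model_scheme) : U (mgen M) -> mval (1 : OO model_scheme U) = 1.
Proof. exact: mone_gen. Qed.

Lemma model_fval_res (U V : opens model_scheme) (h : V `<=` U) (s : OO model_scheme U) :
 V (mgen M) -> mval (rres h s) = mval s.
Proof. by move=> Vg; rewrite /= mone_gen // mul1r. Qed.

Lemma model_fval_inj0 (U : opens model_scheme) (s : OO model_scheme U) :
 U (mgen M) -> mval s = 0 -> s = 0.
Proof. by move=> _ s0; apply: val_inj. Qed.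

Definition model_fscheme : fscheme F :=
 @FScheme F model_scheme (mgen M) (@mgenP F M) mval (fun U s t => erefl) (fun U s t => erefl)
  model_fval1 model_fval_res model_fval_inj0.

Lemma model_floc (x : M) : floc (Y := model_fscheme) x = mloc x.
Proof.
apply/seteqP; split=> z; first by move=> [U [s [Ux <-]]]; apply: mval_loc.
have [C [B [Cx hC]]] := mchart x.
rewrite {1}(chart_loc hC Cx) => -[a [b [Ba Bb nb e]]].
have nu : ~ nonunit (mloc x) b by move=> h; apply: nb; split.
pose V := Opens (chart_basic hC Bb).
have Vx : V x by [].
have [|t ht] := @model_glue V z _ (mgenP Vx); last by exists V, t.
move=> y [Cy nby].
have b0 : b != 0 by apply/eqP => b0; apply: nu; rewrite b0; apply: (id0 (mloc_nonunit_ideal x)).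
rewrite -(mulfK b0 z) e; apply: (subM (mloc_sr y)); first exact: (chart_sub hC Cy).
by apply: contrapT => h'; apply: nby; split=> [|[_]//]; apply: (chart_sub hC Cy).
Qed.

End ModelSheaf.

(** A nonzero element of a chart is a unit on a nonempty open set, which contains the generic
    point. *)
Lemma mgen_nonunit (K : fieldType) (M : model K) z : nonunit (mloc (mgen M)) z -> z = 0.
Proof.
have [U [B [Ug hU]]] := mchart (mgen M).
rewrite (chart_loc hU Ug) => /(nonunit_locP (chart_prime hU Ug)) [a [b [[Ba na] _ _ ->]]].
suff -> : a = 0 by rewrite mul0r.
apply: contrapT => /eqP a0; have [x Ux e] := chart_surj hU (zero_pideal (chart_sr hU)).
have : (U `&` [set y | ~ nonunit (mloc y) a]) x.
 split=> // nax; have : trace mloc B x a by [].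
 by rewrite e => /eqP; rewrite (negPf a0).
by move=> /(@mgenP _ M (Opens (chart_basic hU Ba))) [_ /(_ na)].
Qed.

Definition fmodel (K : fieldType) (Y : fscheme K) : model K :=
 @Model K Y (@floc K Y) (fgen Y) (@fgenP K Y) (@exists_chart K Y).

Lemma trace_gen (K : fieldType) (Y : fscheme K) (U : opens Y) B : U (fgen Y) ->
 chart floc U B -> trace floc B (fgen Y) = [set 0].
Proof.
move=> Ug hU; apply/seteqP; split=> [z [_]|_ ->] /=; first exact: (@mgen_nonunit K (fmodel Y)).
by split; [apply: (sub0 (chart_sr hU))|apply: (id0 (floc_ideal _))].
Qed.

(** * Morphisms and the separatedness criterion *)

Section MorEq.
Variables (X Y W L : ringed_space).

Lemma mor_eq_refl (f : morphism X Y) : mor_eq f f.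
Proof. by split=> // V U h h' s; rewrite (Prop_irrelevance h h'). Qed.

Lemma mor_eq_sym (f g : morphism X Y) : mor_eq f g -> mor_eq g f.
Proof. by move=> [e1 e2]; split=> [x|V U h h' s]; rewrite ?e1 // (e2 V U h' h). Qed.

Lemma mor_eq_trans (f g k : morphism X Y) : mor_eq f g -> mor_eq g k -> mor_eq f k.
Proof.
move=> [e1 e2] [e3 e4]; split=> [x|V U h h' s]; first by rewrite e1.
have hg : U `<=` g @^-1` V by move=> x /h; rewrite /preimage /= e1.
by rewrite (e2 V U h hg) (e4 V U hg h').
Qed.

Lemma msh_proof (f : morphism X Y) (V : opens Y) (U : opens X) (h h' : U `<=` f @^-1` V) s :
 msh f h s = msh f h' s.
Proof. by rewrite (Prop_irrelevance h h'). Qed.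

Lemma msh_res (f : morphism X Y) (V V' : opens Y) (U : opens X) (hV : V' `<=` V)
  (h : U `<=` f @^-1` V) (h' : U `<=` f @^-1` V') s : msh f h' (rres hV s) = msh f h s.
Proof. by rewrite (msh_nat hV (@subset_refl _ U) h h') rres_id. Qed.

Lemma msh_invertible (f : morphism X Y) (V : opens Y) (U : opens X) (h : U `<=` f @^-1` V) x
  (s : OO Y V) : U x -> invertible_at (f x) s -> invertible_at x (msh f h s).
Proof.
move=> Ux [V' [hV [V'x [b e]]]].
pose U' := opensI U (preim (mfun_cont f) V').
have hU : U' `<=` U by move=> y [].
have h' : U' `<=` f @^-1` V' by move=> y [].
exists U', hU; split=> //; exists (msh f h' b).
by rewrite -(msh_nat hV hU h h') -rmorphM e rmorph1.
Qed.

End MorEq.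

Lemma mor_comp_msh (X Y W : ringed_space) (g : morphism Y W) (f : morphism X Y)
  (V : opens W) (U : opens X) (h : U `<=` mor_comp g f @^-1` V) s :
 msh (mor_comp g f) h s =
 msh f (V := preim (mfun_cont g) V) h (msh g (@subset_refl _ (preim (mfun_cont g) V)) s).
Proof. by []. Qed.

Lemma mor_comp_congl (X Y W : ringed_space) (g g' : morphism Y W) (f : morphism X Y) :
 mor_eq g g' -> mor_eq (mor_comp g f) (mor_comp g' f).
Proof.
move=> [e1 e2]; split=> [x /=|V U h h' s]; first by rewrite e1.
rewrite !mor_comp_msh.
have hV : preim (mfun_cont g') V `<=` preim (mfun_cont g) V by move=> x; rewrite /= /preimage /= e1.
rewrite -(msh_res hV h h').
rewrite -(msh_nat (@subset_refl _ V) hV (@subset_refl _ _) (hV : _ `<=` g @^-1` V)) rres_id.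
by rewrite (e2 V _ hV (@subset_refl _ (preim (mfun_cont g') V))).
Qed.

Lemma mor_comp_congr (X Y W : ringed_space) (g : morphism Y W) (f f' : morphism X Y) :
 mor_eq f f' -> mor_eq (mor_comp g f) (mor_comp g f').
Proof.
move=> [e1 e2]; split=> [x /=|V U h h' s]; first by rewrite e1.
by rewrite !mor_comp_msh; apply: e2.
Qed.

Lemma mor_comp_assoc (X Y W L : ringed_space) (k : morphism W L) (g : morphism Y W) (f : morphism X Y) :
 mor_eq (mor_comp k (mor_comp g f)) (mor_comp (mor_comp k g) f).
Proof.
split=> // V U h h' s; rewrite !mor_comp_msh.
have hV : preim (mfun_cont (mor_comp k g)) V `<=` preim (mfun_cont g) (preim (mfun_cont k) V) by [].
rewrite -(msh_res hV h h').
by rewrite -(msh_nat (@subset_refl _ (preim (mfun_cont k) V)) hV (@subset_refl _ _) hV) rres_id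
 (msh_proof hV (@subset_refl _ (preim (mfun_cont (mor_comp k g)) V))).
Qed.

Lemma mor_comp_id (X Y : ringed_space) (f : morphism X Y) : mor_eq (mor_comp (mor_id Y) f) f.
Proof.
split=> // V U h h' s; rewrite mor_comp_msh.
by apply: msh_res.
Qed.

Section ValCompat.
Variables (K F : fieldType) (j : K -> F) (N : fscheme F) (Y : fscheme K).
Implicit Types (U : opens N) (V : opens Y).

(** Compatibility with a map j of function fields, a bare map so that [id] and composites fit
    without conversion. A compatible morphism of integral schemes is determined by its action on
    points. *)
Definition val_compat (m : morphism N Y) : Prop :=
 forall V U (h : U `<=` m @^-1` V) s,
  U (fgen N) -> fval (msh m h s) = j (fval s).

Lemma val_compat_eq (m m' : morphism N Y) : val_compat m -> val_compat m' ->
 (forall x, m x = m' x) -> mor_eq m m'.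
Proof.
move=> h h' e; split=> // V U k k' s; have [Ug|nUg] := EM (U (fgen N)).
 by apply: fval_inj; rewrite h // h'.
by apply: sec0 => x /fgenP.
Qed.

Lemma val_compat_loc (m : morphism N Y) w z : val_compat m -> floc (m w) z -> floc w (j z).
Proof.
move=> h [V [s [Vw <-]]].
have k : preim (mfun_cont m) V `<=` m @^-1` V by [].
by rewrite -(h V _ k s); [apply: floc_val|apply: (@fgenP _ N (preim (mfun_cont m) V) w)].
Qed.

Lemma val_compat_nonunit (m : morphism N Y) w z : val_compat m -> floc (m w) z ->
 nonunit (floc (m w)) z <-> nonunit (floc w) (j z).
Proof.
move=> h [V [s [Vw <-]]].
have k : preim (mfun_cont m) V `<=` m @^-1` V by [].
rewrite -(h V _ k s); last exact: (@fgenP _ N (preim (mfun_cont m) V) w).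
split=> nu; apply: contrapT => nu'.
 by move: nu'; rewrite -finvP // => /msh_local => /(_ Vw)/finvP => /(_ Vw).
by move: nu'; rewrite -finvP // => /(msh_invertible k Vw)/finvP => /(_ Vw).
Qed.

(** Sections are the elements common to all local rings, so a continuous map whose stalk inclusions
    are local extends to a morphism. *)
Lemma exists_val_compat (jm : {rmorphism K -> F}) (g : N -> Y) : jm =1 j -> continuous g ->
 (forall w z, floc (g w) z -> floc w (j z)) ->
 (forall w z, floc (g w) z -> nonunit (floc (g w)) z -> nonunit (floc w) (j z)) ->
 exists2 m : morphism N Y, val_compat m & forall x, m x = g x.
Proof.
move=> jE cg gl gn.
have H V U (h : U `<=` g @^-1` V) :
  {r : {rmorphism OO Y V -> OO N U} | U (fgen N) -> forall s, fval (r s) = j (fval s)}.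
 apply: cid; have [Ug|nUg] := EM (U (fgen N)); last first.
  have [|||r _] := @rmorphism_of (OO Y V) (OO N U) (fun _ => 0); last by exists r.
  - by apply: sec0 => x /fgenP.
  - by move=> s t; apply: sec0 => x /fgenP.
  - by move=> s t; apply: sec0 => x /fgenP.
 have Vg : V (fgen Y) by apply: (fgenP (h _ Ug)).
 have /choice [r hr] : forall s : OO Y V, exists t : OO N U, fval t = j (fval s).
  by move=> s; apply: fval_glue => // x Ux; apply: gl; apply: floc_val; apply: h.
 have [|||r' hr'] := @rmorphism_of _ _ r.
 - by apply: fval_inj; rewrite hr !fval1 // -jE rmorph1.
 - by move=> s t; apply: fval_inj; rewrite hr !fvalB !hr -!jE rmorphB.
 - by move=> s t; apply: fval_inj; rewrite hr !fvalM !hr -!jE rmorphM.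
 by exists r' => _ s; rewrite hr' hr.
pose sh V U h := sval (H V U h).
have shE V U (h : U `<=` g @^-1` V) s : U (fgen N) -> fval (sh V U h s) = j (fval s).
 by move=> Ug; apply: (svalP (H V U h)).
have nat V V' U U' (hV : V' `<=` V) (hU : U' `<=` U)
  (h : U `<=` g @^-1` V) (h' : U' `<=` g @^-1` V') s :
  sh _ _ h' (rres hV s) = rres hU (sh _ _ h s).
 have [Ug|nUg] := EM (U' (fgen N)); last by apply: sec0 => x /fgenP.
 apply: fval_inj; rewrite shE // !fval_res // ?shE //; first exact: hU.
 by apply: (fgenP (h' _ Ug)).
have local V U (h : U `<=` g @^-1` V) x s :
  U x -> invertible_at x (sh _ _ h s) -> invertible_at (g x) s.
 move=> Ux /(finvP _ Ux) nu; have Vx := h x Ux; apply/finvP => //.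
 move=> nu'; apply: nu; rewrite shE; last exact: fgenP Ux.
 by apply: gn => //; apply: floc_val; apply: h.
by exists (Morphism cg nat local) => // V U h s Ug; apply: shE.
Qed.

End ValCompat.

Lemma val_compat_comp (K F G : fieldType) (j : K -> F) (i : F -> G) (L : fscheme G)
  (N : fscheme F) (Y : fscheme K) (m : morphism N Y) (m' : morphism L N) :
 val_compat j m -> val_compat i m' -> val_compat (i \o j) (mor_comp m m').
Proof.
move=> h h' V U k s Ug; rewrite {1}/msh /= /comp_sh /= h' // h //.
exact: (@fgenP _ N (preim (mfun_cont m) V) _ (k _ Ug)).
Qed.

(** * The spectrum of a subring of K *)

Section SpecModel.
Variables (K : fieldType) (B : set K) (sB : subring B).

Definition spec_pt (s : subring B) : Type := {P : set K | pideal B P}.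

HB.instance Definition _ := gen_eqMixin (spec_pt sB).
HB.instance Definition _ := gen_choiceMixin (spec_pt sB).

Definition spec_open : set (set (spec_pt sB)) :=
 [set W | exists G, G `<=` B /\ forall x, W x <-> ~ (G `<=` sval x)].

Lemma spec_openT : spec_open setT.
Proof.
exists [set 1]; split=> [_ ->|x]; first exact: (sub1 sB).
have [_ P1 _] := svalP x.
by split=> // _ /(_ 1 erefl).
Qed.

Lemma spec_openI : setI_closed spec_open.
Proof.
move=> W W' [G [GB hG]] [G' [GB' hG']].
exists [set z | exists a b, [/\ G a, G' b & z = a * b]]; split.
 by move=> _ [a [b [Ga Gb ->]]]; apply: (subM sB); [apply: GB|apply: GB'].
move=> [P hP]; rewrite /setI /= hG hG' /=; have [iP _ PM] := hP; split.
 move=> [/existsNP [a /not_implyP [Ga na]] /existsNP [b /not_implyP [Gb nb]]].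
 move=> h; have : P (a * b) by apply: h; exists a, b.
 by move=> /(PM _ _ (GB _ Ga) (GB' _ Gb)) [].
move=> h; split=> h'; apply: h => _ [a [b [Ga Gb ->]]].
 by apply: (idMr iP); [apply: h'|apply: GB'].
by apply: (idM iP); [apply: GB|apply: h'].
Qed.

Lemma spec_open_bigU (I : Type) (f : I -> set (spec_pt sB)) :
 (forall i, spec_open (f i)) -> spec_open (\bigcup_i f i).
Proof.
move=> /choice [G hG]; exists (\bigcup_i G i); split=> [z [i _ Gz]|x].
 by have [GB _] := hG i; apply: GB.
split=> [[i _ /(hG i).2 h] h'|h]; first by apply: h => z Gz; apply: h'; exists i.
apply: contrapT => nx; apply: h => z [i _ Gz]; apply: contrapT => nz.
by apply: nx; exists i => //; apply/(hG i).2 => /(_ z Gz).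
Qed.

HB.instance Definition _ :=
 isOpenTopological.Build (spec_pt sB) spec_openT spec_openI spec_open_bigU.

Definition spec_loc (x : spec_pt sB) : set K := loc B (sval x).
Definition spec_gen : spec_pt sB := exist _ [set 0] (zero_pideal sB).

Lemma spec_trace x : trace spec_loc B x = sval x.
Proof. by rewrite /trace (loc_trace sB (svalP x)). Qed.

Lemma spec_pt_inj (x y : spec_pt sB) : sval x = sval y -> x = y.
Proof.
case: x y => [x hx] [y hy] /= e; case: y / e hy => hy.
by congr exist; apply: Prop_irrelevance.
Qed.

Lemma spec_chart0 : chart spec_loc [set: spec_pt sB] B.
Proof.
split=> //.
- by move=> x _; rewrite spec_trace; apply: (svalP x).
- by move=> x _; rewrite spec_trace.
- by move=> p hp; exists (exist _ p hp) => //; rewrite spec_trace.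
- by move=> x y _ _; rewrite !spec_trace => /spec_pt_inj.
- move=> W _; rewrite -[open W]/(spec_open W); split=> -[G [GB hG]]; exists G; split=> //.
  move=> x _; rewrite hG -spec_trace; split=> h h'; apply: h; first by move=> z Gz; split; [apply: GB|apply: h'].
  by move=> z /h' [].
 move=> x; rewrite (hG x I) -spec_trace; split=> h h'; apply: h; first by move=> z /h' [].
 by move=> z Gz; split; [apply: GB|apply: h'].
Qed.

Lemma spec_genP (U : opens (spec_pt sB)) x : U x -> U spec_gen.
Proof.
case: U => U [G [GB hG]] /= /hG /existsNP [z /not_implyP [Gz nz]]; apply/hG => /(_ z Gz) /= z0.
by apply: nz; rewrite z0; have [iP _ _] := svalP x; apply: (id0 iP).
Qed.

Lemma spec_mchart (x : spec_pt sB) : exists (U : opens (spec_pt sB)) C, U x /\ chart spec_loc U C.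
Proof. by exists (opensT _), B; split=> //; apply: spec_chart0. Qed.

Definition spec_model : model K := Model spec_genP spec_mchart.
Definition Spec : fscheme K := model_fscheme spec_model.

Lemma Spec_floc (x : spec_pt sB) : floc (Y := Spec) x = loc B (sval x).
Proof. exact: (@model_floc K spec_model x). Qed.

Lemma Spec_flocE : (floc : Spec -> set K) = spec_loc.
Proof. by apply/funext => x; apply: Spec_floc. Qed.

Lemma Spec_chart : chart (floc : Spec -> set K) [set: Spec] B.
Proof. by rewrite Spec_flocE; apply: spec_chart0. Qed.

Lemma Spec_trace (x : Spec) : trace floc B x = sval (x : spec_pt sB).
Proof. by rewrite Spec_flocE; apply: spec_trace. Qed.

End SpecModel.

(** * Centers of valuation rings *)

Section Center.
Variables (K : fieldType) (X : fscheme K).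
Implicit Types U W : opens X.

Definition dominated (x : X) (V : set K) : Prop :=
 floc x `<=` V /\ nonunit (floc x) `<=` nonunit V.

Lemma chart_center U B V : chart floc U B -> valring V -> B `<=` V ->
 exists2 x, U x & dominated x V.
Proof.
move=> hU hV BV; have sB := chart_sr hU.
have hp := center_prime sB hV BV; have [x Ux e] := chart_surj hU hp.
have [l1 l2] := loc_center sB hV BV; exists x => //; rewrite /dominated (chart_loc hU Ux) e.
by split=> // z nz; apply/l2 => //; case: nz.
Qed.

Lemma dominated_chart U B V x : chart floc U B -> U x -> valring V ->
 dominated x V -> B `<=` V /\ trace floc B x = B `&` nonunit V.
Proof.
move=> hU Ux hV [d1 d2]; have BF := chart_sub hU Ux; split; first by move=> b /BF/d1.
apply/seteqP; split=> z [Bz nz]; split=> //; first exact: d2.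
split; [exact: BF|move=> [z0 /d1 Vz]; exact: (nonunit_inv Vz z0)].
Qed.

(* The morphism Spec V -> X with center x, for a subring V of K dominating the
  local ring of x. *)
Lemma Spec_mor (V : set K) (sV : subring V) U B :
 chart floc U B -> B `<=` V -> exists m : morphism (Spec sV) X,
 val_compat id m /\ forall q : spec_pt sV, U (m q) /\ trace floc B (m q) = B `&` sval q.
Proof.
move=> hU BV; have sB := chart_sr hU.
have hq (q : spec_pt sV) := contract_prime sB BV (svalP q).
have /choice [g hg] : forall q : spec_pt sV, exists x, U x /\ trace floc B x = B `&` sval q.
 by move=> q; have [x Ux e] := chart_surj hU (hq q); exists x.
have gl (q : spec_pt sV) z : floc (g q) z -> floc (Y := Spec sV) q z.
 by rewrite Spec_floc; have [Ux e] := hg q; rewrite (chart_loc hU Ux) e; apply: (loc_contract sB BV (svalP q)).1.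
have gn (q : spec_pt sV) z : floc (g q) z -> nonunit (floc (g q)) z -> nonunit (floc (Y := Spec sV) q) z.
 by move=> _; rewrite Spec_floc; have [Ux e] := hg q; rewrite (chart_loc hU Ux) e; apply: (loc_contract sB BV (svalP q)).2.
have cg : continuous (g : Spec sV -> X).
 apply/continuousP => W oW.
 have oWU : open (W `&` U) by apply: openI => //; apply: oset_open.
 have [|G [GB hG]] := (chart_open hU (W := W `&` U) _).1 oWU; first by move=> y [].
 rewrite -[open _]/(spec_open (sB := sV) (g @^-1` W)).
 exists G; split=> [z /GB/BV //|q]; have [Ux e] := hg q.
 have -> : (g @^-1` W) q <-> (W `&` U) (g q) by split=> [|[]].
 rewrite (hG _ Ux); split=> h h'; apply: h => z Gz.
  have : (B `&` sval q) z by split; [apply: GB|apply: h'].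
  by rewrite -e => -[].
 have : trace floc B (g q) z by split; [apply: GB|apply: h'].
 by rewrite e => -[].
have [m hm em] := @exists_val_compat K K id (Spec sV) X (idfun : {rmorphism K -> K}) g
 (fun _ => erefl) cg gl gn.
by exists m; split=> // q; rewrite em.
Qed.

End Center.

Lemma setT_sr (K : fieldType) : subring [set: K].
Proof. by split. Qed.

Section SeparatedUnique.
Variables (K : fieldType) (X S : fscheme K) (f : morphism X S) (A : set K).
Hypotheses (fval_f : val_compat id f) (hS : chart floc [set: S] A).

Lemma val_compat_affine (N : fscheme K) (m m' : morphism N S) :
 val_compat id m -> val_compat id m' -> mor_eq m m'.
Proof.
move=> h h'; apply: (val_compat_eq h h') => x; apply: (chart_inj hS) => //.
apply/seteqP; split=> z [Az nz]; split=> //.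
 apply/(val_compat_nonunit h'); first exact: (chart_sub hS).
 by apply/(val_compat_nonunit h) => //; apply: (chart_sub hS).
apply/(val_compat_nonunit h); first exact: (chart_sub hS).
by apply/(val_compat_nonunit h') => //; apply: (chart_sub hS).
Qed.

(** The morphisms from Spec V with centers x and y agree at the generic point. The induced map to
    the fibre product therefore sends the generic point into the closed diagonal, hence also the
    closed point. *)
Lemma separated_unique (V : set K) (x y : X) : separated f -> valring V -> dominated x V -> dominated y V -> x = y.
Proof.
move=> [P [p [q [diag [[pq univ] pd qd [_ dcl _]]]]]] hV dx dy.
have [sV _] := hV; have sK := setT_sr K.
have [U [B [Ux hU]]] := exists_chart x; have [U' [B' [Uy hU']]] := exists_chart y.
have [BV ex] := dominated_chart hU Ux hV dx; have [BV' ey] := dominated_chart hU' Uy hV dy.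
have [a [ca ha]] := Spec_mor sV hU BV; have [b [cb hb]] := Spec_mor sV hU' BV'.
have fafb : mor_eq (mor_comp f a) (mor_comp f b).
 by apply: val_compat_affine; apply: (@val_compat_comp K K K id id).
have [w [pw qw _]] := univ _ a b fafb.
have [j [cj hj]] := @Spec_mor K (Spec sV) _ sK (opensT (Spec sV)) V (Spec_chart sV) (fun _ _ => I).
have [j' [cj' hj']] := Spec_mor sK hU (fun _ _ => I).
have gen (m : morphism (Spec sK) X) : val_compat id m -> m (spec_gen sK) = fgen X.
 move=> cm; have [C [D [Cm hC]]] := exists_chart (m (spec_gen sK)).
 have Cg := fgenP Cm; apply: (chart_inj hC) => //; rewrite (trace_gen Cg hC).
 apply/seteqP; split=> [z [Dz]|_ ->].
  move=> /(val_compat_nonunit cm (chart_sub hC Cm Dz)); rewrite Spec_floc => -[_ nz] /=.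
  apply: contrapT => /eqP z0; apply: nz; split=> //.
  by apply: (sub_loc sK (zero_pideal sK)).
 by split; [apply: (sub0 (chart_sr hC))|apply: (id0 (floc_ideal _))].
have caj : val_compat id (mor_comp a j) by apply: (@val_compat_comp K K K id id).
have cbj : val_compat id (mor_comp b j) by apply: (@val_compat_comp K K K id id).
have genE (m m' : morphism (Spec sK) X) : val_compat id m -> val_compat id m' -> mor_eq m m'.
 move=> cm cm'; apply: (val_compat_eq cm cm') => z.
 have -> : z = spec_gen sK.
  apply: spec_pt_inj; apply/seteqP; have [iz z1 _] := svalP z; split=> [t zt|_ ->]; last exact: (id0 iz).
  apply: contrapT => /eqP t0; apply: z1; rewrite -(mulVf t0).
  by apply: (idM iz).
 by rewrite (gen _ cm) (gen _ cm').
(* Both the restriction of w to Spec K and the diagonal after Spec K -> X have the projections of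
   w0, so they coincide. *)
have [w0 [_ _ uniq]] := univ _ (mor_comp a j) (mor_comp a j) (mor_eq_refl _).
have e1 : mor_eq (mor_comp w j) w0.
 apply: uniq; apply: (mor_eq_trans (mor_comp_assoc _ _ _)).
  exact: mor_comp_congl.
 apply: (mor_eq_trans (mor_comp_congl _ qw)).
 exact: genE.
have e2 : mor_eq (mor_comp diag j') w0.
 apply: uniq; apply: (mor_eq_trans (mor_comp_assoc _ _ _)).
  apply: (mor_eq_trans (mor_comp_congl _ pd)); apply: (mor_eq_trans (mor_comp_id _)).
  exact: genE.
 apply: (mor_eq_trans (mor_comp_congl _ qd)); apply: (mor_eq_trans (mor_comp_id _)).
 exact: genE.
have ew : w (j (spec_gen sK)) = diag (j' (spec_gen sK)) by exact: (etrans (e1.1 _) (esym (e2.1 _))).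
have ejg : j (spec_gen sK) = spec_gen sV.
 apply: spec_pt_inj; have [_] := hj (spec_gen sK).
 rewrite Spec_trace => ->; apply/seteqP; split=> [z []//|_ ->]; split=> //; exact: (sub0 sV).
(* A closed subset of Spec V containing the generic point is everything. *)
have cl : closed (w @^-1` (diag @` setT)).
 by move: (dcl setT closedT); apply: (continuous_closedP _).1; apply: mfun_cont.
have all : forall z, (w @^-1` (diag @` setT)) z.
 move=> z; apply: contrapT => nz.
 have := @spec_genP K V sV (Opens (closed_openC cl)) z nz; apply.
 by rewrite -ejg /preimage /= ew; exists (j' (spec_gen sK)).
pose c : spec_pt sV := exist _ (nonunit V) (valring_prime hV).
have [z _ ez] := all c.
have xz : a c = z.
 by rewrite -(pw.1 c) /= -ez; apply: (pd.1 z).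
have yz : b c = z.
 by rewrite -(qw.1 c) /= -ez; apply: (qd.1 z).
have -> : x = a c.
 by have [Uc ec] := ha c; apply: (chart_inj hU) => //; rewrite ec ex.
by rewrite xz -yz; have [Uc ec] := hb c; apply: (chart_inj hU') => //; rewrite ec ey.
Qed.

End SeparatedUnique.

(** * Affine space over an integral scheme *)

Section PolynomialsOver.
Variables (K : fieldType) (n : nat).

Definition ratfun : fieldType := {fraction mpoly n K}.
Definition tpol (p : mpoly n K) : ratfun := tofrac p.
HB.instance Definition _ := GRing.RMorphism.copy tpol (@tofrac (mpoly n K)).
Definition tconst (c : K) : ratfun := tpol (mpolyC n c).
HB.instance Definition _ := GRing.RMorphism.copy tconst (tpol \o @mpolyC n K).
Definition tvar (i : 'I_n) : ratfun := tpol (mpolyX K (mnm1 i)).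

Lemma tpolM p q : tpol (p * q) = tpol p * tpol q.
Proof. exact: rmorphM. Qed.
Lemma tpolD p q : tpol (p + q) = tpol p + tpol q.
Proof. exact: rmorphD. Qed.
Lemma tpolB p q : tpol (p - q) = tpol p - tpol q.
Proof. exact: rmorphB. Qed.
Lemma tpol1 : tpol 1 = 1.
Proof. exact: rmorph1. Qed.

Lemma tpol_inj : injective tpol.
Proof. by move=> p q /eqP; rewrite /tpol tofrac_eq => /eqP. Qed.

Lemma tconst_inj : injective tconst.
Proof. by move=> a b /tpol_inj /eqP; rewrite mpolyC_eq => /eqP. Qed.

Definition coefs (O : set K) : set (mpoly n K) := [set p | forall m, O (mcoeff m p)].

(** The ring O[t_1, ..., t_n] inside K(t_1, ..., t_n). *)
Definition pol (O : set K) : set ratfun := tpol @` coefs O.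

Lemma polE O p : pol O (tpol p) <-> coefs O p.
Proof. by split=> [[q hq /tpol_inj <-] //|h]; exists p. Qed.

Section Over.
Variables (O : set K) (sO : subring O).

Lemma coefsB p q : coefs O p -> coefs O q -> coefs O (p - q).
Proof. by move=> hp hq m; rewrite mcoeffB; apply: (subB sO). Qed.

Lemma coefsD p q : coefs O p -> coefs O q -> coefs O (p + q).
Proof. by move=> hp hq m; rewrite mcoeffD; apply: (subD sO). Qed.

Lemma coefsM p q : coefs O p -> coefs O q -> coefs O (p * q).
Proof. by move=> hp hq m; rewrite mcoeffM; apply: (sub_sum sO) => i _; apply: (subM sO). Qed.

Lemma coefsC c : O c -> coefs O (mpolyC n c).
Proof.
by move=> Oc m; rewrite mcoeffC; case: eqP; rewrite ?mulr1 ?mulr0 // => _; apply: (sub0 sO).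
Qed.

Lemma coefsX m : coefs O (mpolyX K m).
Proof. by move=> m'; rewrite mcoeffX; case: eqP => _; [apply: (sub1 sO)|apply: (sub0 sO)]. Qed.

Lemma pol_sr : subring (pol O).
Proof.
split.
- by exists 1; [rewrite -mpolyC1; apply: coefsC; apply: (sub1 sO)|rewrite rmorph1].
- by move=> _ _ [p hp <-] [q hq <-]; rewrite -rmorphB polE; apply: coefsB.
- by move=> _ _ [p hp <-] [q hq <-]; rewrite -rmorphM polE; apply: coefsM.
Qed.

Lemma pol_const c : pol O (tconst c) <-> O c.
Proof.
rewrite polE; split=> [/(_ mnm0)|]; first by rewrite mcoeffC eqxx mulr1.
exact: coefsC.
Qed.

Lemma pol_var i : pol O (tvar i).
Proof. by rewrite polE; apply: coefsX. Qed.

End Over.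

Lemma pol_sub (O O' : set K) : O `<=` O' -> pol O `<=` pol O'.
Proof. by move=> h _ [p hp <-]; apply/polE => m; apply: h. Qed.

Lemma pol_denom (O B S : set K) z : subring B -> S `<=` B -> S 1 ->
 (forall a b, S a -> S b -> S (a * b)) ->
 (forall c, O c -> exists2 s, S s & B (s * c)) -> pol O z -> exists2 s, S s & pol B (tconst s * z).
Proof.
move=> sB SB S1 SM h [p hp <-].
have [s Ss hs] : exists2 s, S s & forall m, m \in msupp p -> B (s * mcoeff m p).
 elim: (msupp p) => [|m r [s Ss hs]]; first by exists 1.
 have [s' Ss' hs'] := h _ (hp m); exists (s * s'); first exact: SM.
 move=> m'; rewrite inE => /predU1P [->|/hs h'].
  by rewrite -mulrA; apply: (subM sB) => //; apply: SB.
 by rewrite [s * s']mulrC -mulrA; apply: (subM sB) => //; apply: SB.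
exists s => //; have -> : tconst s * tpol p = tpol (mpolyC n s * p) by rewrite [RHS]rmorphM.
rewrite polE => m; rewrite mcoeffCM.
have [/hs //|/memN_msupp_eq0 ->] := boolP (m \in msupp p).
by rewrite mulr0; apply: (sub0 sB).
Qed.

(* A ring morphism G : O -> R and elements tau of R induce O[t] -> R; G is a
  function on K whose values outside O are irrelevant. *)
Section Eval.
Variables (O : set K) (sO : subring O) (R : comPzRingType) (G : K -> R) (tau : 'I_n -> R).
Hypotheses (G1 : G 1 = 1) (GB : forall a b, O a -> O b -> G (a - b) = G a - G b)
 (GM : forall a b, O a -> O b -> G (a * b) = G a * G b).

Definition monom (m : multinom n) : R := \prod_i tau i ^+ m i.
Definition peval (p : mpoly n K) : R := \sum_(m <- msupp p) G (mcoeff m p) * monom m.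

Lemma peval_seq (s : seq (multinom n)) p : uniq s -> (forall m, mcoeff m p != 0 -> m \in s) ->
 peval p = \sum_(m <- s) G (mcoeff m p) * monom m.
Proof.
move=> us hs; rewrite /peval [RHS](bigID (fun m => mcoeff m p != 0)) /=.
have G0 : G 0 = 0 by rewrite -(subrr 1) GB ?subrr //; apply: (sub1 sO).
rewrite [X in _ + X]big1 ?addr0; last by move=> m /negPn/eqP ->; rewrite G0 mul0r.
rewrite -[in RHS]big_filter; apply: perm_big; apply: uniq_perm.
- exact: msupp_uniq.
- exact: filter_uniq.
- move=> m; rewrite mem_filter mcoeff_msupp.
 by case: eqP => //= /eqP /hs ->.
Qed.

Lemma pevalB p q : coefs O p -> coefs O q -> peval (p - q) = peval p - peval q.
Proof.
move=> hp hq; pose s := undup (msupp p ++ msupp q).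
have us : uniq s by apply: undup_uniq.
have hs m : (mcoeff m p != 0) || (mcoeff m q != 0) -> m \in s.
 by rewrite mem_undup mem_cat !mcoeff_msupp.
rewrite !(@peval_seq s) //; first last.
- move=> m; rewrite mcoeffB => h; apply: hs; rewrite -negb_and; apply: contraNN h.
 by move=> /andP [/eqP -> /eqP ->]; rewrite subrr.
- by move=> m h; apply: hs; rewrite h.
- by move=> m h; apply: hs; rewrite h orbT.
by rewrite -sumrB; apply: eq_bigr => m _; rewrite mcoeffB GB // mulrBl.
Qed.

Lemma peval0 : peval 0 = 0.
Proof. by rewrite -(subrr 0) pevalB ?subrr // => m; rewrite mcoeff0; apply: (sub0 sO). Qed.

Lemma pevalD p q : coefs O p -> coefs O q -> peval (p + q) = peval p + peval q.
Proof.
have O0 : coefs O 0 by move=> m; rewrite mcoeff0; apply: (sub0 sO).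
move=> hp hq; have -> : p + q = p - (0 - q) by rewrite sub0r opprK.
by rewrite pevalB ?pevalB ?peval0 ?sub0r ?opprK // -sub0r; apply: coefsB.
Qed.

Lemma peval_term c m : peval (c *: mpolyX K m) = G c * monom m.
Proof.
rewrite (@peval_seq [:: m]) // => [|m'].
 by rewrite big_seq1 mcoeffZ mcoeffX eqxx mulr1.
by rewrite mcoeffZ mcoeffX inE; case: (m =P m') => [->|_]; rewrite ?eqxx // mulr0 eqxx.
Qed.

Lemma pevalC c : peval (mpolyC n c) = G c.
Proof.
have -> : mpolyC n c = c *: mpolyX K mnm0 by rewrite mpolyX0 -mul_mpolyC mulr1.
rewrite peval_term /monom big1 ?mulr1 // => i _.
by rewrite mnm0E expr0.
Qed.

Lemma peval1 : peval 1 = 1.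
Proof. by rewrite -mpolyC1 pevalC. Qed.

Lemma pevalX i : peval (mpolyX K (mnm1 i)) = tau i.
Proof.
rewrite -[mpolyX K _]scale1r peval_term G1 mul1r /monom (bigD1 i) //= mnm1E eqxx expr1.
by rewrite big1 ?mulr1 // => j ij; rewrite mnm1E eq_sym (negPf ij) expr0.
Qed.

Lemma coefs_term c m : O c -> coefs O (c *: mpolyX K m).
Proof. by move=> Oc; rewrite -mul_mpolyC; apply: coefsM => //; [apply: coefsC|apply: coefsX]. Qed.

Lemma peval_sum (I : Type) (r : seq I) (f : I -> mpoly n K) : (forall i, coefs O (f i)) ->
 coefs O (\sum_(i <- r) f i) /\ peval (\sum_(i <- r) f i) = \sum_(i <- r) peval (f i).
Proof.
move=> hf; elim: r => [|i r [IH1 IH2]].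
 by rewrite !big_nil peval0; split=> // m; rewrite mcoeff0; apply: (sub0 sO).
by rewrite !big_cons pevalD // IH2; split=> //; apply: coefsD.
Qed.

Lemma pevalM p q : coefs O p -> coefs O q -> peval (p * q) = peval p * peval q.
Proof.
move=> hp hq.
have e : p * q = \sum_(m <- msupp p) \sum_(m' <- msupp q)
  ((mcoeff m p * mcoeff m' q) *: mpolyX K (mnm_add m m')).
 rewrite {1}[p]mpolyE {1}[q]mpolyE mulr_suml; apply: eq_bigr => m _.
 rewrite mulr_sumr; apply: eq_bigr => m' _.
 by rewrite mpolyXD -scalerAl -scalerAr scalerA.
have ht m m' : coefs O ((mcoeff m p * mcoeff m' q) *: mpolyX K (mnm_add m m')).
 by apply: coefs_term; apply: (subM sO).
rewrite e (peval_sum _ (fun m => (peval_sum _ (ht m)).1)).2 {2 3}/peval mulr_suml.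
apply: eq_bigr => m _; rewrite (peval_sum _ (ht m)).2 mulr_sumr; apply: eq_bigr => m' _.
rewrite peval_term GM // mulrACA; congr (_ * _).
by rewrite /monom -big_split; apply: eq_bigr => i _; rewrite mnmDE exprD.
Qed.

End Eval.

Lemma peval_morph (R R' : comPzRingType) (r : {rmorphism R -> R'}) (G : K -> R) (G' : K -> R')
  (tau : 'I_n -> R) (tau' : 'I_n -> R') (O : set K) p :
 (forall c, O c -> G' c = r (G c)) -> (forall i, tau' i = r (tau i)) -> coefs O p ->
 peval G' tau' p = r (peval G tau p).
Proof.
move=> hG ht hp; rewrite /peval rmorph_sum; apply: eq_bigr => m _.
rewrite rmorphM hG; last exact: hp.
congr (_ * _); rewrite /monom rmorph_prod; apply: eq_bigr => i _.
by rewrite rmorphXn ht.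
Qed.

End PolynomialsOver.

Arguments pol {K} n O.

Section Extension.
Variables (K : fieldType) (n : nat) (M : model K).
Local Notation F := (ratfun K n).
Local Notation tc := (@tconst K n).

(* The points of M x A^n over x are the primes of the ring of polynomials over
  the local ring of x that lie over its maximal ideal. *)
Record ext_pt := ExtPt {
 ebase : M;
 eprime : set F;
 ext_primeP : pideal (pol n (mloc ebase)) eprime;
 ext_over : forall c, mloc ebase c -> eprime (tc c) <-> nonunit (mloc ebase) c }.

HB.instance Definition _ := gen_eqMixin ext_pt.
HB.instance Definition _ := gen_choiceMixin ext_pt.

(** A basis is given by the loci over an open set U of M where a polynomial with coefficients
    regular on U does not vanish. *)
Definition ext_open : set (set ext_pt) := [set W | forall w, W w ->
 exists (U : set M) (g : F), [/\ open U, U (ebase w), forall y, U y -> pol n (mloc y) g,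
  ~ eprime w g & forall w', U (ebase w') -> ~ eprime w' g -> W w']].

Lemma ext_prime1 (w : ext_pt) : ~ eprime w 1.
Proof. by have [_ h _] := ext_primeP w. Qed.

Lemma ext_openT : ext_open setT.
Proof.
move=> w _; exists setT, 1; split=> //; first exact: openT.
 by move=> y _; apply: (sub1 (pol_sr n (mloc_sr y))).
exact: ext_prime1.
Qed.

Lemma ext_openI : setI_closed ext_open.
Proof.
move=> W W' oW oW' w [Ww Ww'].
have [U [g [oU Uw hg ng hW]]] := oW w Ww; have [U' [g' [oU' Uw' hg' ng' hW']]] := oW' w Ww'.
exists (U `&` U'), (g * g'); split=> //; first exact: openI.
- move=> y [Uy Uy']; apply: (subM (pol_sr n (mloc_sr y))); [exact: hg|exact: hg'].
- by have [_ _ PM] := ext_primeP w; move=> /PM [|||]; [exact: hg|exact: hg'| |].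
- move=> w' [Uy Uy'] h; have [i _ _] := ext_primeP w'.
 have sp := pol_sr n (mloc_sr (ebase w')).
 split; [apply: hW => // h'|apply: hW' => // h']; apply: h.
  by apply: (idMr i) => //; apply: hg'.
 by apply: (idM i) => //; apply: hg.
Qed.

Lemma ext_open_bigU (I : Type) (f : I -> set ext_pt) :
 (forall i, ext_open (f i)) -> ext_open (\bigcup_i f i).
Proof.
move=> h w [i _ fw]; have [U [g [oU Uw hg ng hW]]] := h i w fw.
by exists U, g; split=> // w' Uw' ng'; exists i => //; apply: hW.
Qed.

HB.instance Definition _ :=
 isOpenTopological.Build ext_pt ext_openT ext_openI ext_open_bigU.

Lemma ext_openE (W : set ext_pt) : open W = ext_open W.
Proof. by []. Qed.

Definition ext_loc (w : ext_pt) : set F := loc (pol n (mloc (ebase w))) (eprime w).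

Lemma ext_pt_inj (w w' : ext_pt) : ebase w = ebase w' -> eprime w = eprime w' -> w = w'.
Proof.
case: w w' => [x q hq hx] [x' q' hq' hx'] /= e e'.
case: x' / e hq' hx'; case: q' / e' => hq' hx'.
by rewrite (Prop_irrelevance hq hq') (Prop_irrelevance hx hx').
Qed.

Lemma ext_nonunit (w : ext_pt) g : pol n (mloc (ebase w)) g -> nonunit (ext_loc w) g <-> eprime w g.
Proof. by move=> h; apply: (nonunit_locR (pol_sr n (mloc_sr _)) (ext_primeP w)). Qed.

Section ExtChart.
Variables (U : opens M) (B : set K) (hU : chart mloc U B).
Local Notation UT := [set w : ext_pt | U (ebase w)].

Let sB : subring B := chart_sr hU.
Let spB : subring (pol n B) := pol_sr n sB.

Lemma ext_clear x z : U x -> pol n (mloc x) z ->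
 exists2 s, B s /\ ~ nonunit (mloc x) s & pol n B (tc s * z).
Proof.
move=> Ux; apply: (pol_denom sB (S := [set s | B s /\ ~ nonunit (mloc x) s])).
- by move=> s [].
- by split; [apply: (sub1 sB)|move=> [_ []]; split; rewrite ?oner_neq0 ?invr1 //; apply: (sub1 (mloc_sr x))].
- move=> a b [Ba na] [Bb nb]; split; first exact: (subM sB).
 have hp := chart_prime hU Ux; have [_ _ PM] := hp.
 move=> h; have : trace mloc B x (a * b) by split=> //; apply: (subM sB).
 by move=> /PM [//|//|[]|[]].
- move=> c; rewrite {1}(chart_loc hU Ux) => -[a [s [Ba Bs ns e]]]; exists s.
  by split=> // h; apply: ns; split.
 by rewrite mulrC e.
Qed.

Lemma ext_unit_const (w : ext_pt) s : U (ebase w) -> B s -> ~ nonunit (mloc (ebase w)) s ->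
 ~ eprime w (tc s).
Proof. by move=> Uw Bs ns /ext_over; move=> /(_ (chart_sub hU Uw Bs)). Qed.

Lemma ext_trace (w : ext_pt) : U (ebase w) -> trace ext_loc (pol n B) w = pol n B `&` eprime w.
Proof.
move=> Uw; apply/seteqP; split=> z [hz nz]; split=> //.
 by apply/ext_nonunit => //; apply: pol_sub hz; apply: (chart_sub hU).
by apply/ext_nonunit => //; apply: pol_sub hz; apply: (chart_sub hU).
Qed.

Lemma ext_chart_prime (w : ext_pt) : U (ebase w) -> pideal (pol n B) (pol n B `&` eprime w).
Proof. by move=> Uw; apply: contract_prime (ext_primeP w) => //; apply/pol_sub/(chart_sub hU). Qed.

Lemma ext_chart_loc (w : ext_pt) : U (ebase w) ->
 ext_loc w = loc (pol n B) (pol n B `&` eprime w).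
Proof.
move=> Uw; have BL : pol n B `<=` pol n (mloc (ebase w)) by apply: pol_sub; apply: (chart_sub hU).
apply: (loc_contract_eq spB (pol_sr n (mloc_sr _)) BL (ext_primeP w)) => z hz.
have [s [Bs ns] hs] := ext_clear Uw hz; have ps := ext_unit_const Uw Bs ns.
have [i _ _] := ext_primeP w; have s0 : tc s != 0 by apply/eqP => s0; apply: ps; rewrite s0; apply: (id0 i).
rewrite -(mulKf s0 z) mulrC; apply: (locE (ext_chart_prime Uw)) => //; last by case.
by apply/pol_const.
Qed.

(** The constants in Q form a prime of B, hence give a point x. The localization L of B[t] at Q
    contains the polynomials over the local ring of x, and the contraction of its maximal ideal is
    the point sought over x. *)
Lemma ext_chart_surj Q : pideal (pol n B) Q ->
 exists2 w : ext_pt, U (ebase w) & pol n B `&` eprime w = Q.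
Proof.
move=> hQ; have [iQ Q1 QM] := hQ.
have hC c : B c -> pol n B (tc c) by move=> Bc; apply/pol_const.
have [|x Ux ex] := chart_surj hU (p := [set c | B c /\ Q (tc c)]).
 split; first split.
 - by move=> c [].
 - by split; [apply: (sub0 sB)|rewrite rmorph0; apply: (id0 iQ)].
 - by move=> a b [Ba Qa] [Bb Qb]; split; [apply: (subD sB)|rewrite rmorphD; apply: (idD iQ)].
 - by move=> a b Ba [Bb Qb]; split; [apply: (subM sB)|rewrite rmorphM; apply: (idM iQ) => //; apply: hC].
 - by rewrite /= rmorph1 => -[].
 - move=> a b Ba Bb [_]; rewrite rmorphM => /QM [|||]; try exact: hC; by [left|right].
have nu s : B s -> nonunit (mloc x) s <-> Q (tc s).
 move=> Bs; split=> h; first by have : trace mloc B x s by []; rewrite ex => -[].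
 by have : [set c | B c /\ Q (tc c)] s by []; rewrite -ex => -[].
pose L := loc (pol n B) Q; have sL : subring L := loc_sr spB hQ.
have iL := nonunit_loc_ideal spB hQ; have sx := mloc_sr x.
have uL s : B s -> ~ nonunit (mloc x) s -> L (tc s)^-1.
 move=> Bs ns; rewrite -div1r; apply: (locE hQ); [exact: (sub1 spB)|exact: hC|].
 by move=> /(nu _ Bs).
have BL : pol n (mloc x) `<=` L.
 move=> z hz; have [s [Bs ns] hs] := ext_clear Ux hz.
 have s0 : tc s != 0 := primeN0 hQ (fun h => ns ((nu s Bs).2 h)).
 by rewrite -(mulKf s0 z); apply: (subM sL); [apply: uL|apply: (sub_loc spB hQ)].
have hq := contract_prime (pol_sr n sx) BL (nonunit_prime sL iL).
have hx c : mloc x c -> (pol n (mloc x) `&` nonunit L) (tc c) <-> nonunit (mloc x) c.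
 move=> Lc; have pc : pol n (mloc x) (tc c) by apply/pol_const.
 split=> [[_ [_ nc]]|nc]; last first.
  split=> //; have : nonunit (loc B (trace mloc B x)) c by rewrite -(chart_loc hU Ux).
  move=> /(nonunit_locP (chart_prime hU Ux)) [a [b [[Ba na] Bb nb ->]]].
  rewrite rmorphM fmorphV; apply: (idMr iL); last by apply: uL => // h; apply: nb.
  by apply/(nonunit_locR spB hQ); [apply: hC|apply/nu].
 split=> // -[c0 ci]; apply: nc; rewrite fmorph_eq0 -fmorphV; split=> //.
 by apply/BL/pol_const.
exists (ExtPt hq hx) => //=; apply/seteqP; split=> z.
 by move=> [hz [_ /(nonunit_locR spB hQ hz)]].
move=> Qz; have hz := idS iQ Qz; split=> //; split; first by apply: pol_sub hz; apply: (chart_sub hU).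
by apply/(nonunit_locR spB hQ hz).
Qed.

Lemma ext_chart_inj (w w' : ext_pt) : U (ebase w) -> U (ebase w') ->
 pol n B `&` eprime w = pol n B `&` eprime w' -> w = w'.
Proof.
move=> Uw Uw' e; have eL : ext_loc w = ext_loc w' by rewrite !ext_chart_loc // e.
have eb : ebase w = ebase w'.
 have E v c : U (ebase v) -> B c -> nonunit (mloc (ebase v)) c <-> nonunit (ext_loc v) (tc c).
  move=> Uv Bc; have Lc := chart_sub hU Uv Bc; rewrite ext_nonunit; first exact: iff_sym (ext_over Lc).
  by apply/pol_const => //; apply: mloc_sr.
 apply: (chart_inj hU) => //; apply/seteqP; split=> c [Bc nc]; split=> //; apply/E => //.
  by rewrite -eL; apply/E.
 by rewrite eL; apply/E.
have E v z : eprime v z <-> pol n (mloc (ebase v)) z /\ nonunit (ext_loc v) z.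
 have [i _ _] := ext_primeP v; split=> [hz|[hz /ext_nonunit h]]; last exact: h.
 by have pz := idS i hz; split=> //; apply/ext_nonunit.
by apply: ext_pt_inj => //; apply/seteqP; split=> z /E hz; apply/E; rewrite ?eb ?eL -?eb -?eL in hz *.
Qed.

Lemma ext_chart_open W : W `<=` UT -> (open W <-> exists G, G `<=` pol n B /\
  forall w, UT w -> (W w <-> ~ (G `<=` nonunit (ext_loc w)))).
Proof.
move=> WU; have BL w : UT w -> pol n B `<=` pol n (mloc (ebase w)).
 by move=> Uw; apply: pol_sub; apply: (chart_sub hU).
have hC c : B c -> pol n B (tc c) by move=> Bc; apply/pol_const.
rewrite ext_openE; split=> [oW|[G [GB hG]]]; last first.
 move=> w Ww; have Uw := WU w Ww.
 have /existsNP [g /not_implyP [Gg ng]] := (hG w Uw).1 Ww.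
 exists U, g; split=> //; first exact: (chart_isopen hU).
 - by move=> y Uy; apply: pol_sub (GB _ Gg); apply: (chart_sub hU).
 - by move=> h; apply: ng; apply/ext_nonunit => //; apply: (BL _ Uw); apply: GB.
 - move=> w' Uw' ng'; apply/(hG w' Uw') => /(_ g Gg) /ext_nonunit h; apply: ng'; apply: h.
  by apply: (BL _ Uw'); apply: GB.
(* The largest choice: all g over B whose nonvanishing locus over U lies in W. *)
exists [set g | pol n B g /\ forall w, UT w -> ~ eprime w g -> W w]; split=> [g []//|w Uw].
split=> [Ww|h]; last first.
 have /existsNP [g /not_implyP [[Bg hg] ng]] := h; apply: hg => // h'; apply: ng.
 by apply/ext_nonunit => //; apply: BL.
have [U' [g [oU' U'w hg ng hW]]] := oW w Ww.
have [b [Bb nb Db]] := chart_nbhs hU oU' U'w Uw.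
(* The local equation g has coefficients regular only on a basic set D(b) of U. A power of b clears
   its denominators, and one more factor b confines the locus to D(b). *)
have hO c : (forall y, U y -> ~ nonunit (mloc y) b -> mloc y c) ->
  exists2 s, (exists k, s = b ^+ k) & B (s * c).
 move=> hc; have [P hP nPb|k hk] := loc_denom sB (z := c) Bb.
  have [y Uy ey] := chart_surj hU hP; rewrite -ey -(chart_loc hU Uy).
  by apply: hc => // h; apply: nPb; rewrite -ey; split.
 by exists (b ^+ k) => //; exists k.
have gO : pol n [set c | forall y, U y -> ~ nonunit (mloc y) b -> mloc y c] g.
 have [p _ ep] := hg _ U'w; rewrite -ep polE => m y Uy nby.
 by have := hg y (Db y (conj Uy nby)); rewrite -ep => /polE.
have [||a a' [k ->] [k' ->]|_ [k ->] hk] := pol_denom sB _ _ _ hO gO.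
- by move=> _ [k ->]; apply: subX.
- by exists 0%N.
- by exists (k + k')%N; rewrite exprD.
have bpow w' : UT w' -> eprime w' (tc (b ^+ k) * g) -> pol n (mloc (ebase w')) g ->
  ~ eprime w' (tc b) -> eprime w' g.
 move=> Uw' h hg' nb'; have [_ _ pM] := ext_primeP w'.
 have hb : pol n (mloc (ebase w')) (tc b) by apply: (BL _ Uw'); apply: hC.
 have sL := pol_sr n (mloc_sr (ebase w')).
 move: h; rewrite rmorphXn => /pM [|//|/(primeX sL (ext_primeP w') hb) //|//].
 exact: subX.
have nbw := ext_unit_const Uw Bb nb.
have hbk : pol n B (tc b * (tc (b ^+ k) * g)).
 by apply: (subM (pol_sr n sB)) => //; apply: hC.
move=> /(_ (tc b * (tc (b ^+ k) * g))) h.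
have : nonunit (ext_loc w) (tc b * (tc (b ^+ k) * g)).
 apply: h; split=> // w' Uw' nw'.
 have [i' _ _] := ext_primeP w'.
 have nb' : ~ nonunit (mloc (ebase w')) b.
  move=> /ext_over; move=> /(_ (chart_sub hU Uw' Bb)) h; apply: nw'.
  by apply: (idMr i') => //; apply: BL.
 have U'w' := Db _ (conj Uw' nb'); apply: hW => // gw'; apply: nw'.
 apply: (idM i'); first by apply: BL => //; apply: hC.
 by apply: (idM i') => //; apply: BL => //; apply: hC; apply: subX.
move=> /ext_nonunit; move=> /(_ (BL _ Uw _ hbk)); have [_ _ pM] := ext_primeP w.
move=> /pM [||/nbw //|/(bpow w Uw)] //; try (by apply: (BL _ Uw) => //; apply: hC).
by move=> /(_ (hg _ U'w) nbw).
Qed.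

End ExtChart.
Lemma ext_genP (c : K) : mloc (mgen M) c -> [set 0] (tc c) <-> nonunit (mloc (mgen M)) c.
Proof.
move=> _; split=> [/= c0|/mgen_nonunit ->]; last by rewrite /= rmorph0.
have -> : c = 0 by apply: (@tconst_inj K n); rewrite c0 rmorph0.
exact: (id0 (mloc_nonunit_ideal _)).
Qed.

Definition ext_gen : ext_pt :=
 ExtPt (zero_pideal (pol_sr n (mloc_sr (mgen M)))) ext_genP.

Lemma ext_gen_open (W : opens ext_pt) w : W w -> W ext_gen.
Proof.
move=> Ww; have oW : ext_open W := oset_open W.
have [U [g [oU Uw hg ng hW]]] := oW w Ww.
apply: hW; first exact: (@mgenP _ M (Opens oU) _ Uw).
by move=> /= g0; apply: ng; rewrite g0; have [i _ _] := ext_primeP w; apply: (id0 i).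
Qed.

Lemma ext_chart (U : opens M) B : chart mloc U B ->
 open [set w | U (ebase w)] /\ chart ext_loc [set w | U (ebase w)] (pol n B).
Proof.
move=> hU; have hc : chart ext_loc [set w | U (ebase w)] (pol n B).
 split.
 - exact: (pol_sr n (chart_sr hU)).
 - by move=> w Uw; rewrite (ext_trace hU) //; apply: (ext_chart_prime hU).
 - by move=> w Uw; rewrite (ext_trace hU) //; apply: (ext_chart_loc hU).
 - by move=> Q /(ext_chart_surj hU) [w Uw e]; exists w => //; rewrite (ext_trace hU).
 - by move=> w w' Uw Uw'; rewrite !(ext_trace hU) //; apply: (ext_chart_inj hU).
 - exact: (ext_chart_open hU).
by split=> //; apply: (chart_isopen hc).
Qed.

Lemma ext_exists_chart (w : ext_pt) : exists (W : opens ext_pt) C, W w /\ chart ext_loc W C.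
Proof.
have [U [B [Uw hU]]] := mchart (ebase w); have [oW hW] := ext_chart hU.
by exists (Opens oW), (pol n B).
Qed.

Definition ext_model : model F := Model ext_gen_open ext_exists_chart.

End Extension.

(** * The existence criterion for properness *)

Lemma open_local (T : topologicalType) (A : set T) :
 (forall x, A x -> exists B, [/\ open B, B x & B `<=` A]) -> open A.
Proof.
move=> h; rewrite openE => x /h [B [oB Bx BA]].
by apply: (filterS BA); apply: open_nbhs_nbhs; split.
Qed.

Lemma invertible_atM (W : ringed_space) (D : opens W) w (x y : OO W D) :
 invertible_at w (x * y) <-> invertible_at w x /\ invertible_at w y.
Proof.
split=> [[V [h [Vw [c]]]]|[[V [h [Vw [c e]]]] [V' [h' [V'w [c' e']]]]]].
 rewrite rmorphM => e; split; exists V, h; split=> //.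
  by exists (rres h y * c); rewrite mulrA.
 by exists (rres h x * c); rewrite mulrCA mulrA.
have k : opensI V V' `<=` V by move=> z [].
have k' : opensI V V' `<=` V' by move=> z [].
have l : opensI V V' `<=` D by move=> z [/h].
exists (opensI V V'), l; split=> //; exists (rres k c * rres k' c').
rewrite rmorphM -(rres_comp h k l) -(rres_comp h' k' l) mulrACA -!rmorphM e e' !rmorph1.
by rewrite mulr1.
Qed.

Lemma invertible_at0 (W : scheme) (U : opens W) w : U w -> ~ invertible_at w (0 : OO W U).
Proof.
move=> Uw; have [C Cw [R [psi [hP _ _ _ _]]]] := schemeP w.
have [[p0 _ _] _ _] := hP w Cw; move: p0; rewrite /spec_point /= rmorph0; apply: contra_not.
have h : opensI U C `<=` U by move=> y [].
have k : opensI U C `<=` C by move=> y [].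
move=> /(res_invertible h (conj Uw Cw)).
by rewrite rmorph0 -(rmorph0 (rres k)); apply: invertible_res.
Qed.

(** On a basic open set of an affine neighbourhood both sections are fractions with a power of g as
    denominator, and the numerators that are not invertible at w form a prime. *)
Lemma noninvertibleD (W : scheme) (U : opens W) w (s t : OO W U) : U w ->
 ~ invertible_at w s -> ~ invertible_at w t -> ~ invertible_at w (s + t).
Proof.
move=> Uw; have [C Cw [R [psi [hP _ _ hO hL]]]] := schemeP w.
have oUC : open (U `&` C) by exact: (oset_open (opensI U C)).
have [|G hG] := (hO (U `&` C) _).1 oUC; first by move=> y [].
have /existsNP [g /not_implyP [Gg ng]] := (hG w Cw).1 (conj Uw Cw).
have oD : open (C `&` [set y | ~ spec_point psi y g]).
 apply/(hO _ _) => [y [] //|]; exists [set g] => y Cy.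
 by split=> [[_ n] /(_ g erefl) //|h]; split=> // n; apply: h => _ ->.
pose D := Opens oD; have DC : D `<=` C by move=> y [].
have DU : D `<=` U.
 by move=> y [Cy ngy]; apply: (proj1 ((hG y Cy).2 _)) => /(_ g Gg).
have [_ hs _] := hL g D DC (fun y => iff_refl _).
have [a [_ [[n ->] ea]]] := hs (rres DU s); have [b [_ [[m ->] eb]]] := hs (rres DU t).
have Dw : D w by [].
have gi j : invertible_at w ((rres DC \o psi) (g ^+ j)).
 apply: res_invertible => //; apply: contrapT => ni; apply: ng.
 exact: (is_primeX (n := j) (hP w Cw)).
have red x (c : R) j : rres DU x * (rres DC \o psi) (g ^+ j) = (rres DC \o psi) c ->
  invertible_at w x <-> ~ spec_point psi w c.
 move=> e; split=> [ix nc|nc].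
  apply: nc; apply: (invertible_res (h := DC)); rewrite [rres DC _](esym e).
  by apply/invertible_atM; split=> //; apply: res_invertible.
 have : invertible_at w ((rres DC \o psi) c).
  by apply: res_invertible => //; apply: contrapT.
 by rewrite -e => /invertible_atM [/invertible_res].
move=> /(contra_not (red _ _ _ ea).2) /contrapT na /(contra_not (red _ _ _ eb).2) /contrapT nb.
have est : rres DU (s + t) * (rres DC \o psi) (g ^+ (n + m)) =
  (rres DC \o psi) (a * g ^+ m + b * g ^+ n).
 rewrite exprD !rmorphD !rmorphM -ea -eb; ring.
have [[_ pD pM] _ _] := hP w Cw.
move=> /(red _ _ _ est); apply; apply: (pD); rewrite mulrC; exact: (pM).
Qed.

Lemma local_eq (Y : ringed_space) (U : opens Y) (s t : OO Y U) :
 (forall x, U x -> exists (V : opens Y) (h : V `<=` U), V x /\ rres h s = rres h t) -> s = t.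
Proof.
move=> loceq.
have /choice [V hV] : forall i : {w | U w}, exists V : opens Y, exists hU : V `<=` U,
  V (sval i) /\ rres hU s = rres hU t by move=> [w Uw]; apply: loceq.
have VU i : V i `<=` U by case: (hV i).
have E i : rres (VU i) s = rres (VU i) t.
 by case: (hV i) => k [_]; rewrite (Prop_irrelevance k (VU i)).
have [||v [_ u]] := @rres_sheaf Y U _ V VU _ (fun i => rres (VU i) s).
- by move=> x Ux; exists (exist _ x Ux); case: (hV (exist _ x Ux)) => k [].
- move=> i j D hi hj; have l : D `<=` U by move=> y /hi /VU.
 by rewrite !(rres_comp _ _ l).
by rewrite -(u s) ?(u t).
Qed.

(** * The universal property of affine space *)

Section Universal.
Variables (K : fieldType) (n : nat) (Y : fscheme K).
Local Notation F := (ratfun K n).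
Local Notation tc := (@tconst K n).

Definition ext_scheme : fscheme F := model_fscheme (ext_model n (fmodel Y)).
Local Notation YT := ext_scheme.
Local Notation pt := (ext_pt n (fmodel Y)).

Lemma ext_floc (w : pt) :
 floc (Y := YT) w = loc (pol n (floc (ebase w : Y))) (eprime w).
Proof. exact: (@model_floc F (ext_model n (fmodel Y)) w). Qed.

Lemma ext_floc_nonunit (w : pt) g : pol n (floc (ebase w : Y)) g ->
 nonunit (floc (Y := YT) w) g <-> eprime w g.
Proof. by rewrite ext_floc; apply: (@ext_nonunit K n (fmodel Y) w g). Qed.

Lemma ext_floc_sub (w : pt) : pol n (floc (ebase w : Y)) `<=` floc (Y := YT) w.
Proof.
rewrite ext_floc; apply: (sub_loc (pol_sr n (floc_sr _)) (ext_primeP w)).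
Qed.

Lemma ext_base_continuous : continuous (@ebase K n (fmodel Y) : YT -> Y).
Proof.
apply/continuousP => U oU; rewrite -[open _]/(ext_open (_ @^-1` U)) => w Uw.
exists U, 1; split=> //; last exact: ext_prime1.
by move=> y _; apply: (sub1 (pol_sr n (floc_sr y))).
Qed.

Lemma exists_ext_proj : exists2 m : morphism YT Y, val_compat tc m &
 forall w, m w = ebase (w : pt).
Proof.
apply: (exists_val_compat (jm := tc : {rmorphism K -> F})) => // [|w z Lz|w z Lz nz].
- exact: ext_base_continuous.
- by apply: ext_floc_sub; apply/pol_const => //; apply: floc_sr.
- by apply/ext_floc_nonunit; [apply/pol_const => //; apply: floc_sr|apply/ext_over].
Qed.

Definition eproj : morphism YT Y := s2val (cid2 exists_ext_proj).
Lemma ext_proj_val : val_compat tc eproj.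
Proof. exact: (s2valP (cid2 exists_ext_proj)). Qed.
Lemma ext_projE w : eproj w = ebase (w : pt).
Proof. exact: (s2valP' (cid2 exists_ext_proj)). Qed.

Section Induced.
Variables (W : scheme) (b : morphism W Y) (tau : 'I_n -> OO W (opensT W)).
Implicit Types (V : opens Y) (U : opens W) (p q r : mpoly n K).

Definition secs V : set K := range (@fval K Y V).

Lemma secs_sr V : V (fgen Y) -> subring (secs V).
Proof.
by move=> /fval_rmorph [g /funext e]; rewrite /secs -e; apply: range_sr.
Qed.

Lemma secs_res V V' : V' `<=` V -> V' (fgen Y) -> secs V `<=` secs V'.
Proof. by move=> h V'g _ [s _ <-]; exists (rres h s); rewrite ?fval_res. Qed.

(** The pullback along b of the section of V with value c, with junk value 0 if there is none; as a
    function on K it can be fed to [peval]. *)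
Definition pull V U (h : U `<=` b @^-1` V) (c : K) : OO W U :=
 match pselect (exists s : OO Y V, fval s = c) with
 | left e => msh b h (sval (cid e))
 | right _ => 0
 end.

Lemma pullE V U (h : U `<=` b @^-1` V) s : pull h (fval s) = msh b h s.
Proof.
rewrite /pull; case: pselect => [e|[]]; last by exists s.
by congr (msh b h _); apply: fval_inj; rewrite (svalP (cid e)).
Qed.

Definition taur U (i : 'I_n) : OO W U := rres (U := opensT W) (@subsetT _ U) (tau i).
Definition pev V U (h : U `<=` b @^-1` V) (p : mpoly n K) : OO W U :=
 peval (pull h) (taur U) p.

Lemma pev_res V V' U U' (h : U `<=` b @^-1` V) (h' : U' `<=` b @^-1` V') (hV : V' `<=` V)
  (hU : U' `<=` U) p : V' (fgen Y) -> coefs (secs V) p -> pev h' p = rres hU (pev h p).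
Proof.
move=> V'g; apply: peval_morph => [_ [s _ <-]|i].
 have -> : pull h' (fval s) = msh b h' (rres hV s) by rewrite -pullE fval_res.
 by rewrite pullE; apply: msh_nat.
by rewrite /taur (rres_comp (U := opensT W) _ _ (@subsetT _ U')).
Qed.

Section PolynomialValues.
Variables (V : opens Y) (U : opens W) (h : U `<=` b @^-1` V).
Hypothesis Vg : V (fgen Y).
Let sV := secs_sr Vg.

Lemma pull1 : pull h 1 = 1.
Proof. by rewrite -(fval1 Vg) pullE rmorph1. Qed.
Lemma pullB c d : secs V c -> secs V d ->
 pull h (c - d) = pull h c - pull h d.
Proof. by move=> [s _ <-] [t _ <-]; rewrite -fvalB !pullE rmorphB. Qed.
Lemma pullM c d : secs V c -> secs V d ->
 pull h (c * d) = pull h c * pull h d.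
Proof. by move=> [s _ <-] [t _ <-]; rewrite -fvalM !pullE rmorphM. Qed.

Lemma pev1 : pev h 1 = 1.
Proof. by apply: (peval1 sV); [apply: pull1|apply: pullB]. Qed.
Lemma pevB p q : coefs (secs V) p ->
 coefs (secs V) q -> pev h (p - q) = pev h p - pev h q.
Proof. by apply: (pevalB sV); apply: pullB. Qed.
Lemma pevD p q : coefs (secs V) p ->
 coefs (secs V) q -> pev h (p + q) = pev h p + pev h q.
Proof. by apply: (pevalD sV); apply: pullB. Qed.
Lemma pevM p q : coefs (secs V) p ->
 coefs (secs V) q -> pev h (p * q) = pev h p * pev h q.
Proof. by apply: (pevalM sV); [apply: pullB|apply: pullM]. Qed.
Lemma pevC c : pev h (mpolyC n c) = pull h c.
Proof. by apply: (pevalC sV); apply: pullB. Qed.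
Lemma pevX i : pev h (mpolyX K (mnm1 i)) = taur U i.
Proof. by apply: (pevalX sV); [apply: pull1|apply: pullB]. Qed.

End PolynomialValues.

Lemma coefs_nbhs (x : Y) p : coefs (floc x) p ->
 exists V, V x /\ coefs (secs V) p.
Proof.
move=> hp; have [V [Vx hV]] : exists V, V x /\ forall m, m \in msupp p -> secs V (mcoeff m p).
 elim: (msupp p) => [|m r [V [Vx hV]]]; first by exists (opensT Y).
 have [V' [s [V'x e]]] := hp m; exists (opensI V V'); split=> // m'.
 have g : opensI V V' (fgen Y) by apply: (@fgenP _ Y _ x).
 rewrite inE => /predU1P [->|/hV h]; last by apply: secs_res h => // y [].
 by apply: (@secs_res V') => // [y []//|]; exists s.
exists V; split=> // m; have [/hV //|/memN_msupp_eq0 ->] := boolP (m \in msupp p).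
by apply: (sub0 (secs_sr (fgenP Vx))).
Qed.

Lemma coefs_res V V' p : V' `<=` V -> V' (fgen Y) -> coefs (secs V) p -> coefs (secs V') p.
Proof. by move=> h V'g hp m; apply: (secs_res h). Qed.

Local Notation bpre V := (preim (mfun_cont b) V).
Definition bpreP V : bpre V `<=` b @^-1` V := @subset_refl _ _.

Lemma pev_invertible V V' w p (Vw : V (b w)) (V'w : V' (b w)) : coefs (secs V) p ->
 coefs (secs V') p -> invertible_at w (pev (@bpreP V) p) -> invertible_at w (pev (@bpreP V') p).
Proof.
move=> hp hp'; pose V2 := opensI V V'.
have h1 : V2 `<=` V by move=> y [].
have h2 : V2 `<=` V' by move=> y [].
have k1 : bpre V2 `<=` bpre V by move=> y [].
have k2 : bpre V2 `<=` bpre V' by move=> y [].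
have V2g : V2 (fgen Y) by apply: (@fgenP _ Y _ (b w)).
move=> /(@res_invertible _ _ _ k1 w _ (conj Vw V'w)).
rewrite -(pev_res (@bpreP V) (@bpreP V2) h1 k1 V2g hp).
rewrite (pev_res (@bpreP V') (@bpreP V2) h2 k2 V2g hp').
exact: invertible_res.
Qed.

(** The image point of w over b(w): the polynomials whose pullback, with tau i in place of t_i, is
    not invertible at w. *)
Definition ind_prime (w : W) : set F := [set z | exists p, [/\ z = tpol p, coefs (floc (b w)) p &
 exists V, [/\ V (b w), coefs (secs V) p & ~ invertible_at w (pev (@bpreP V) p)]]].

Lemma ind_primeE w V p : V (b w) -> coefs (secs V) p ->
 ind_prime w (tpol p) <-> ~ invertible_at w (pev (@bpreP V) p).
Proof.
move=> Vw hp; split=> [[q [/tpol_inj <- _ [V' [V'w hp' ni]]]]|ni].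
 by apply: contra_not ni; apply: pev_invertible.
exists p; split=> //; last by exists V.
by move=> m; have [s _ <-] := hp m; apply: floc_val.
Qed.

Lemma secs_floc V (x : Y) p : V x -> coefs (secs V) p -> coefs (floc x) p.
Proof. by move=> Vx hp m; have [s _ <-] := hp m; apply: floc_val. Qed.

Lemma coefs_nbhs2 (x : Y) p q : coefs (floc x) p -> coefs (floc x) q ->
 exists V, [/\ V x, coefs (secs V) p & coefs (secs V) q].
Proof.
move=> /coefs_nbhs [V [Vx hp]] /coefs_nbhs [V' [V'x hq]].
have g : opensI V V' (fgen Y) by apply: (@fgenP _ Y _ x).
exists (opensI V V'); split=> //.
 by apply: coefs_res hp => // y [].
by apply: coefs_res hq => // y [].
Qed.

Lemma ind_primeP w : pideal (pol n (floc (b w))) (ind_prime w).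
Proof.
have pick z z' : pol n (floc (b w)) z -> pol n (floc (b w)) z' -> exists V p q, [/\ V (b w),
  coefs (secs V) p, coefs (secs V) q, z = tpol p & z' = tpol q].
 move=> [p hp <-] [q hq <-]; have [V [Vw h h']] := coefs_nbhs2 hp hq.
 by exists V, p, q.
have sub z : ind_prime w z -> pol n (floc (b w)) z.
 by move=> [p [-> hp _]]; apply/polE.
split; first split.
- exact: sub.
- have hp : coefs (secs (opensT Y)) (0 : mpoly n K).
  by move=> m; rewrite mcoeff0; apply: (sub0 (secs_sr _)).
 rewrite -[0](rmorph0 (@tpol K n)); apply/(ind_primeE (V := opensT Y)) => //.
 rewrite /pev (peval0 (secs_sr (V := opensT Y) I)); last exact: pullB.
 exact: invertible_at0.
- move=> z z' hz hz'; have [V [p [q [Vw hp hq ez ez']]]] := pick _ _ (sub _ hz) (sub _ hz').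
 have Vg := fgenP Vw; have sV := secs_sr Vg.
 move: hz hz'; rewrite ez ez' => /(ind_primeE Vw hp) hz /(ind_primeE Vw hq) hz'.
 rewrite -tpolD; apply/(ind_primeE Vw); first exact: coefsD.
 by rewrite pevD //; apply: noninvertibleD.
- move=> z z' hz hz'; have [V [p [q [Vw hp hq ez ez']]]] := pick _ _ hz (sub _ hz').
 have Vg := fgenP Vw; have sV := secs_sr Vg.
 move: hz'; rewrite ez ez' => /(ind_primeE Vw hq) hz'.
 rewrite -tpolM; apply/(ind_primeE Vw); first exact: coefsM.
 by rewrite pevM // => /invertible_atM [].
- rewrite -tpol1; move/(ind_primeE (V := opensT Y)); apply => //.
  by rewrite -mpolyC1; apply: coefsC; [exact: secs_sr|apply: (sub1 (secs_sr _))].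
 rewrite pev1 //; exists (bpre (opensT Y)), (@subset_refl _ _); split=> //.
 by exists 1; rewrite rmorph1 mulr1.
- move=> z z' hz hz'; have [V [p [q [Vw hp hq ez ez']]]] := pick _ _ hz hz'.
 have Vg := fgenP Vw; have sV := secs_sr Vg.
 rewrite ez ez' -tpolM => /(ind_primeE Vw (coefsM sV hp hq)) ni.
 apply: contrapT => /not_orP [/(contra_not (ind_primeE Vw hp).2) /contrapT ip].
 move=> /(contra_not (ind_primeE Vw hq).2) /contrapT iq; apply: ni.
 by rewrite pevM //; apply/invertible_atM.
Qed.

Lemma ind_over w c : floc (b w) c -> ind_prime w (tc c) <-> nonunit (floc (b w)) c.
Proof.
move=> [V [s [Vw <-]]]; have Vg := fgenP Vw.
rewrite (ind_primeE Vw); last by apply: coefsC; [exact: secs_sr|exists s].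
rewrite pevC // pullE; split=> h.
 by apply: contrapT => nu; apply: h; apply: msh_invertible => //; apply/finvP.
by move=> /msh_local => /(_ Vw) /(finvP _ Vw); apply.
Qed.

Definition ind_pt (w : W) : pt := @ExtPt K n (fmodel Y) (b w) _ (ind_primeP w) (@ind_over w).

Lemma invertible_open U (s : OO W U) : open [set w | U w /\ invertible_at w s].
Proof.
apply: open_local => w [Uw [V [h [Vw u]]]]; exists V; split=> //; first exact: oset_open.
by move=> y Vy; split; [exact: (h y Vy)|by exists V, h].
Qed.

Lemma ind_continuous : continuous (ind_pt : W -> YT).
Proof.
apply/continuousP => A oA; apply: open_local => w Aw.
have [U [g [oU Uw hg ng hA]]] := (oA : ext_open A) _ Aw.
pose V := Opens oU; have Vw : V (b w) := Uw; have Vg := fgenP Vw.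
have [p hp ep] := hg _ Uw.
have hpV : coefs (secs V) p.
 move=> m; have [|s <-] := fval_glue Vg (z := mcoeff m p); last by exists s.
 by move=> x Vx; have := hg x Vx; rewrite -ep => /polE; apply.
have gE w' : V (b w') -> eprime (ind_pt w') g <-> ~ invertible_at w' (pev (@bpreP V) p).
 by move=> Vw'; rewrite /= -ep; apply: ind_primeE.
exists [set w' | bpre V w' /\ invertible_at w' (pev (@bpreP V) p)].
split; first exact: invertible_open.
 by split=> //; apply: contrapT => ni; apply: ng; apply/gE.
by move=> w' [Vw' iw']; apply: hA => // /(gE _ Vw').
Qed.

(** The test scheme W is arbitrary and has no function field, so a section is tied to a rational
    function by fractions: z = p / r where the pullback of r is a unit, and s is the quotient of the
    pullbacks. *)
Definition rep (z : F) U (s : OO W U) U' (hU : U' `<=` U) V (h : U' `<=` b @^-1` V)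
  (p r : mpoly n K) : Prop :=
 [/\ coefs (secs V) p, coefs (secs V) r, tpol p = z * tpol r,
   is_unit (pev h r) & pev h r * rres hU s = pev h p].

(* s is the pullback of the rational function z. *)
Definition locrep (z : F) U (s : OO W U) : Prop := forall w, U w ->
 exists U' (hU : U' `<=` U) V (h : U' `<=` b @^-1` V) p r, U' w /\ rep z s hU h p r.

Lemma rep_res z U (s : OO W U) U' (hU : U' `<=` U) V (h : U' `<=` b @^-1` V) p r
  U2 (k : U2 `<=` U') (hU2 : U2 `<=` U) V2 (l : V2 `<=` V) (h2 : U2 `<=` b @^-1` V2) :
 V2 (fgen Y) -> rep z s hU h p r -> rep z s hU2 h2 p r.
Proof.
move=> Vg [hp hr e [c u] es]; split=> //.
- exact: coefs_res hp.
- exact: coefs_res hr.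
- by exists (rres k c); rewrite (pev_res h h2 l k Vg hr) -rmorphM u rmorph1.
- rewrite (pev_res h h2 l k Vg hr) (pev_res h h2 l k Vg hp).
 by rewrite -(rres_comp hU k hU2) -rmorphM es.
Qed.

Lemma locrep_common z z' U (s s' : OO W U) : locrep z s -> locrep z' s' -> forall w, U w ->
 exists U' (hU : U' `<=` U) V (h : U' `<=` b @^-1` V) p r p' r',
  [/\ U' w, V (fgen Y), rep z s hU h p r & rep z' s' hU h p' r'].
Proof.
move=> hs ht w Uw; have [U1 [hU1 [V1 [h1 [p1 [r1 [U1w R1]]]]]]] := hs w Uw.
have [U2 [hU2 [V2 [h2 [p2 [r2 [U2w R2]]]]]]] := ht w Uw.
pose U' := opensI U1 U2; pose V := opensI V1 V2.
have k1 : U' `<=` U1 by move=> y [].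
have k2 : U' `<=` U2 by move=> y [].
have l1 : V `<=` V1 by move=> y [].
have l2 : V `<=` V2 by move=> y [].
have h : U' `<=` b @^-1` V by move=> y [/h1 ? /h2 ?].
have hU : U' `<=` U by move=> y [/hU1].
have U'w : U' w by [].
have Vg : V (fgen Y) by apply: (fgenP (h _ U'w)).
exists U', hU, V, h, p1, r1, p2, r2; split=> //.
 exact: (rep_res k1 hU l1 h Vg R1).
exact: (rep_res k2 hU l2 h Vg R2).
Qed.

(** Cross multiplication; the pullbacks of both denominators are units. All identities between
    pulled back sections are proved through this uniqueness. *)
Lemma locrep_uniq z U (s t : OO W U) : locrep z s -> locrep z t -> s = t.
Proof.
move=> hs ht; apply: local_eq => w Uw.
have [U' [hU [V [h [p1 [r1 [p2 [r2 [U'w Vg]]]]]]]]] := locrep_common hs ht Uw.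
move=> [hp1 hr1 e1 [c1 u1] es] [hp2 hr2 e2 [c2 u2] et]; exists U', hU; split=> //.
have E : r1 * p2 = r2 * p1.
 by apply: tpol_inj; rewrite !tpolM e1 e2; ring.
have {E} /(congr1 (pev h)) E := E; rewrite !pevM // in E.
have D : pev h r1 * pev h r2 * (rres hU s - rres hU t) = 0.
 have -> : pev h r1 * pev h r2 * (rres hU s - rres hU t) =
  pev h r2 * (pev h r1 * rres hU s) - pev h r1 * (pev h r2 * rres hU t) by ring.
 by rewrite es et -E subrr.
apply/eqP; rewrite -subr_eq0; apply/eqP.
have -> : rres hU s - rres hU t = (pev h r1 * c1) * (pev h r2 * c2) * (rres hU s - rres hU t).
 by rewrite u1 u2 !mul1r.
have -> : (pev h r1 * c1) * (pev h r2 * c2) * (rres hU s - rres hU t) =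
 c1 * c2 * (pev h r1 * pev h r2 * (rres hU s - rres hU t)) by ring.
by rewrite D mulr0.
Qed.

Lemma locrep_res z U U' (k : U' `<=` U) (s : OO W U) : locrep z s -> locrep z (rres k s).
Proof.
move=> hs w U'w; have [U1 [hU1 [V [h [p [r [U1w R]]]]]]] := hs w (k _ U'w).
pose U2 := opensI U1 U'.
have k1 : U2 `<=` U1 by move=> y [].
have k2 : U2 `<=` U' by move=> y [].
have h' : U2 `<=` b @^-1` V by move=> y [/h].
have hU : U2 `<=` U by move=> y [/hU1].
have Vg : V (fgen Y) := fgenP (h _ U1w).
have [hp hr e u es] := rep_res k1 hU (@subset_refl _ V) h' Vg R.
by exists U2, k2, V, h', p, r; split=> //; split=> //; rewrite (rres_comp _ _ hU).
Qed.

Lemma locrepB z z' U (s s' : OO W U) : locrep z s -> locrep z' s' -> locrep (z - z') (s - s').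
Proof.
move=> hs ht w Uw; have [U' [hU [V [h [p1 [r1 [p2 [r2 [U'w Vg]]]]]]]]] := locrep_common hs ht Uw.
move=> [hp1 hr1 e1 [c1 u1] es] [hp2 hr2 e2 [c2 u2] et].
have sV := secs_sr Vg.
have h12 : coefs (secs V) (p1 * r2) by apply: coefsM.
have h21 : coefs (secs V) (p2 * r1) by apply: coefsM.
exists U', hU, V, h, (p1 * r2 - p2 * r1), (r1 * r2); split=> //; split.
- exact: coefsB.
- exact: coefsM.
- by rewrite tpolB !tpolM e1 e2; ring.
- by exists (c1 * c2); rewrite pevM // mulrACA u1 u2 mulr1.
- by rewrite pevB // !pevM // rmorphB -es -et; ring.
Qed.

Lemma locrepM z z' U (s s' : OO W U) : locrep z s -> locrep z' s' -> locrep (z * z') (s * s').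
Proof.
move=> hs ht w Uw; have [U' [hU [V [h [p1 [r1 [p2 [r2 [U'w Vg]]]]]]]]] := locrep_common hs ht Uw.
move=> [hp1 hr1 e1 [c1 u1] es] [hp2 hr2 e2 [c2 u2] et].
have sV := secs_sr Vg.
exists U', hU, V, h, (p1 * p2), (r1 * r2); split=> //; split.
- exact: coefsM.
- exact: coefsM.
- by rewrite !tpolM e1 e2; ring.
- by exists (c1 * c2); rewrite pevM // mulrACA u1 u2 mulr1.
- by rewrite !pevM // rmorphM -es -et; ring.
Qed.

Lemma coefs1 V : V (fgen Y) -> coefs (secs V) (1 : mpoly n K).
Proof.
by move=> Vg; rewrite -mpolyC1; apply: coefsC; [exact: secs_sr|apply: (sub1 (secs_sr Vg))].
Qed.

Lemma locrep_pev V U (h : U `<=` b @^-1` V) p : coefs (secs V) p -> locrep (tpol p) (pev h p).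
Proof.
move=> hp w Uw; have Vg : V (fgen Y) := fgenP (h _ Uw).
exists U, (@subset_refl _ _), V, h, p, 1; split=> //; split=> //.
- exact: coefs1.
- by rewrite tpol1 mulr1.
- by exists 1; rewrite mulr1 pev1.
- by rewrite pev1 // mul1r rres_id.
Qed.

Lemma locrep1 U : locrep 1 (1 : OO W U).
Proof.
move=> w Uw; have h : U `<=` b @^-1` opensT Y by [].
have := locrep_pev h (coefs1 (V := opensT Y) I).
by rewrite pev1 // tpol1 => /(_ w Uw).
Qed.

Lemma ind_fraction z w U : U w -> floc (Y := YT) (ind_pt w) z ->
 exists U' (hU : U' `<=` U) V (h : U' `<=` b @^-1` V) p r,
  [/\ U' w, coefs (secs V) p, coefs (secs V) r, tpol p = z * tpol r & is_unit (pev h r)].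
Proof.
rewrite ext_floc => Uw [_ [_ [[p hp <-] [r hr <-] nr e]]].
have [V [Vw hp' hr']] := coefs_nbhs2 hp hr.
have [U1 [h1 [U1w [c u]]]] : invertible_at w (pev (@bpreP V) r).
 by apply: contrapT => ni; apply: nr; apply: ((@ind_primeE w V r Vw hr').2 ni).
pose U' := opensI U U1; have k : U' `<=` U1 by move=> y [].
have hU : U' `<=` U by move=> y [].
have h : U' `<=` b @^-1` V by move=> y [_ /h1].
have k' : U' `<=` preim (mfun_cont b) V by move=> y [_ /h1].
exists U', hU, V, h, p, r; split=> //; exists (rres k c).
rewrite (pev_res (@bpreP V) h (@subset_refl _ V) k' (fgenP Vw) hr').
by rewrite -(rres_comp h1 k k') -rmorphM u rmorph1.
Qed.

Lemma locrep_one z w U : U w -> floc (Y := YT) (ind_pt w) z ->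
 exists U' (s : OO W U'), [/\ U' `<=` U, U' w & locrep z s].
Proof.
move=> Uw /(ind_fraction Uw) [U' [hU [V [h [p [r [U'w hp hr e [c u]]]]]]]].
exists U', (pev h p * c); split=> // y Uy; exists U', (@subset_refl _ _), V, h, p, r; split=> //.
by split=> //; [exists c|rewrite rres_id mulrCA u mulr1].
Qed.

Lemma locrep_exists z U : (forall w, U w -> floc (Y := YT) (ind_pt w) z) ->
 exists s : OO W U, locrep z s.
Proof.
move=> hz.
have /choice [f hf] : forall i : {w | U w}, exists D : {U' : opens W & OO W U'},
  [/\ projT1 D `<=` U, projT1 D (sval i) & locrep z (projT2 D)].
 move=> [w Uw]; have [U' [s [h1 h2 h3]]] := locrep_one Uw (hz w Uw).
 by exists (existT _ U' s).
have VU i : projT1 (f i) `<=` U by case: (hf i).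
have [||t [ht _]] := @rres_sheaf W U _ (fun i => projT1 (f i)) VU _ (fun i => projT2 (f i)).
- by move=> x Ux; exists (exist _ x Ux); case: (hf (exist _ x Ux)).
- move=> i j D hi hj; apply: (@locrep_uniq z); apply: locrep_res; by [case: (hf i)|case: (hf j)].
exists t => w Uw; pose i := exist U w Uw; have [_ iw Ri] := hf i.
have [U1 [hU1 [V [h [p [r [U1w [hp hr e u es]]]]]]]] := Ri w iw.
have hU : U1 `<=` U by move=> y /hU1/VU.
exists U1, hU, V, h, p, r; split=> //; split=> //.
by rewrite -es -(ht i) (rres_comp _ _ hU).
Qed.

Lemma exists_ind_sh (D : opens YT) U (h : U `<=` ind_pt @^-1` D) :
 exists r : {rmorphism OO YT D -> OO W U}, forall s, locrep (fval s) (r s).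
Proof.
have [Dg|nDg] := EM (D (fgen YT)); last first.
 have U0 x : ~ U x by move=> /h Dx; apply: nDg; apply: fgenP Dx.
 have [|||r _] := @rmorphism_of (OO YT D) (OO W U) (fun _ => 0).
 - exact: sec0.
 - by move=> s t; apply: sec0.
 - by move=> s t; apply: sec0.
 by exists r => s w /U0.
have /choice [r hr] : forall s : OO YT D, exists t : OO W U, locrep (fval s) t.
 by move=> s; apply: locrep_exists => w Uw; apply: floc_val; apply: h.
have [|||r' hr'] := @rmorphism_of _ _ r.
- by apply: (@locrep_uniq 1); [rewrite -(fval1 Dg); apply: hr|apply: locrep1].
- by move=> s t; apply: (@locrep_uniq (fval (s - t))) => //; rewrite fvalB; apply: locrepB.
- by move=> s t; apply: (@locrep_uniq (fval (s * t))) => //; rewrite fvalM; apply: locrepM.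
by exists r' => s; rewrite hr'.
Qed.

Lemma locrep_local (D : opens YT) U (h : U `<=` ind_pt @^-1` D) w (s : OO YT D) (t : OO W U) :
 locrep (fval s) t -> U w -> invertible_at w t -> invertible_at (ind_pt w : YT) s.
Proof.
move=> ht Uw it; have [U' [hU [V [k [p [r [U'w [hp hr e u es]]]]]]]] := ht w Uw.
have Vw : V (b w) := k _ U'w; have Vg := fgenP Vw.
have kk : U' `<=` preim (mfun_cont b) V by move=> y /k.
have ir : invertible_at w (pev k r).
 by exists U', (@subset_refl _ _); split=> //; rewrite rres_id.
have nr : ~ ind_prime w (tpol r).
 apply/(ind_primeE Vw hr) => ni; apply: ni; apply: (invertible_res (h := kk)).
 by rewrite -(pev_res (@bpreP V) k (@subset_refl _ V) kk Vg hr).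
have np : ~ ind_prime w (tpol p).
 apply/(ind_primeE Vw hp) => ni; apply: ni; apply: (invertible_res (h := kk)).
 rewrite -(pev_res (@bpreP V) k (@subset_refl _ V) kk Vg hp) -es.
 by apply/invertible_atM; split=> //; apply: res_invertible.
apply/finvP; first exact: h.
have pp q : coefs (secs V) q -> pol n (floc (ebase (ind_pt w) : Y)) (tpol q).
 by move=> hq; apply/polE; apply: (secs_floc Vw).
move=> nu; apply: np; apply: ((ext_floc_nonunit (pp _ hp)).1); rewrite e.
by apply: (idMr (floc_ideal (Y := YT) _) nu); apply: (ext_floc_sub (pp _ hr)).
Qed.

Lemma exists_induced : exists m : morphism W YT, (forall w, m w = ind_pt w) /\
 forall (D : opens YT) U (h : U `<=` m @^-1` D) s, locrep (fval s) (msh m h s).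
Proof.
pose sh (D : opens YT) U (h : U `<=` ind_pt @^-1` D) := sval (cid (exists_ind_sh h)).
have shP (D : opens YT) U (h : U `<=` ind_pt @^-1` D) s : locrep (fval s) (sh D U h s).
 exact: (svalP (cid (exists_ind_sh h))).
have nat (D D' : opens YT) U U' (hD : D' `<=` D) (hU : U' `<=` U)
  (h : U `<=` ind_pt @^-1` D) (h' : U' `<=` ind_pt @^-1` D') s :
  sh _ _ h' (rres hD s) = rres hU (sh _ _ h s).
 have [[w Uw]|nU] := EM (exists w, U' w); last by apply: sec0 => w Uw; apply: nU; exists w.
 have Dg : D' (fgen YT) := fgenP (h' _ Uw).
 apply: (@locrep_uniq (fval s)); last exact: locrep_res.
 by rewrite -(fval_res hD).
by exists (Morphism ind_continuous nat (fun D U h w s => locrep_local h (shP D U h s))).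
Qed.

Local Notation epre V := (preim (mfun_cont eproj) V).

Lemma induced_proj (m : morphism W YT) : (forall w, m w = ind_pt w) ->
 (forall (D : opens YT) U (h : U `<=` m @^-1` D) s, locrep (fval s) (msh m h s)) ->
 mor_eq (mor_comp eproj m) b /\
 forall i (s : OO YT (opensT YT)) (h : opensT W `<=` m @^-1` opensT YT),
  fval s = tvar K i -> msh m h s = tau i.
Proof.
move=> em hm; split; first split.
- by move=> w; rewrite /= ext_projE em.
- move=> V U h h' s; have [[w Uw]|nU] := EM (exists w, U w); last by apply: sec0 => w Uw; apply: nU; exists w.
 have Vg : V (fgen Y) := fgenP (h' _ Uw).
 apply: (@locrep_uniq (tc (fval s))).
  rewrite mor_comp_msh -(ext_proj_val (@subset_refl _ (epre V))); first exact: hm.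
  by apply: (@fgenP _ YT (epre V) _ (h _ Uw)).
 rewrite -(pullE h') -pevC //; apply: locrep_pev; apply: coefsC; first exact: secs_sr.
 by exists s.
- move=> i s h es; apply: (@locrep_uniq (tvar K i)); first by rewrite -es; apply: hm.
 have k : opensT W `<=` b @^-1` opensT Y by [].
 have -> : tau i = pev k (mpolyX K (mnm1 i)) by rewrite pevX // /taur rres_id.
 by apply: locrep_pev; apply: coefsX; apply: (@secs_sr (opensT Y)).
Qed.

Lemma fval_peval V (t : 'I_n -> OO YT (epre V))
  (G : K -> OO YT (epre V)) p :
 V (fgen Y) -> (forall i, fval (t i) = tvar K i) -> (forall c, secs V c -> fval (G c) = tc c) ->
 coefs (secs V) p -> fval (peval G t p) = tpol p.
Proof.
move=> Vg ht hG hp.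
have g : epre V (fgen YT) by rewrite /= /preimage ext_projE.
have [v hv] := fval_rmorph g.
rewrite -hv -(peval_morph (G' := tc) (tau' := @tvar K n) (O := secs V) _ _ hp) => [|c /hG <-|i].
- rewrite {2}[p]mpolyE /tpol rmorph_sum; apply: eq_bigr => m _.
 rewrite -mul_mpolyC rmorphM; congr (_ * _).
 rewrite /monom mpolyXE_id rmorph_prod; apply: eq_bigr => i _.
 by rewrite rmorphXn.
- by rewrite hv.
- by rewrite hv ht.
Qed.

(** A morphism with these components must pull polynomials back by [pev]. This fixes the primes of
    its image points, and the pullback of a fraction as well. *)
Lemma ext_mor_char (m : morphism W YT) : mor_eq (mor_comp eproj m) b ->
 (forall i (s : OO YT (opensT YT)) (h : opensT W `<=` m @^-1` opensT YT),
  fval s = tvar K i -> msh m h s = tau i) ->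
 (forall w, m w = ind_pt w) /\
 forall (D : opens YT) U (h : U `<=` m @^-1` D) s, locrep (fval s) (msh m h s).
Proof.
move=> [e1 e2] ht.
have t0 i : exists s : OO YT (opensT YT), fval s = tvar K i.
 apply: fval_glue => // w _; apply: ext_floc_sub; apply: pol_var; exact: floc_sr.
have /choice [t0' ht0] := t0.
(* the image under m of the section p over the preimage of V *)
have main V U (k : U `<=` b @^-1` V) p : V (fgen Y) -> coefs (secs V) p ->
  exists (k' : U `<=` m @^-1` epre V) sg, fval sg = tpol p /\ msh m k' sg = pev k p.
 move=> Vg hp; have k' : U `<=` m @^-1` epre V.
  by move=> w /k; rewrite /preimage /= -e1.
 exists k'; pose t i := rres (U := opensT YT) (@subsetT _ (epre V)) (t0' i).
 have [G hG] : exists G : K -> OO YT (epre V), forall s : OO Y V,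
   G (fval s) = msh eproj (@subset_refl _ (epre V)) s.
  have /choice [G hG] : forall c, exists g, forall s : OO Y V, fval s = c ->
    g = msh eproj (@subset_refl _ (epre V)) s; last first.
   by exists G => s; apply: hG.
  move=> c; have [[s es]|ns] := EM (exists s : OO Y V, fval s = c); last first.
   by exists 0 => s es; case: ns; exists s.
  exists (msh eproj (V := V) (@subset_refl _ (epre V)) s) => s' es'.
  by have -> : s = s' by apply: fval_inj; rewrite es es'.
 have pg : epre V (fgen YT) by rewrite /= /preimage ext_projE.
 exists (peval G t p); split.
  apply: fval_peval => // [i|_ [s _ <-]]; first by rewrite /t fval_res.
  by rewrite hG ext_proj_val.
 rewrite /pev (peval_morph (r := msh m k') (G := G) (tau := t) (O := secs V) _ _ hp) //.
  move=> _ [s _ <-]; rewrite pullE hG; have h0 : U `<=` mor_comp eproj m @^-1` V by [].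
  by rewrite -(e2 V U h0 k) mor_comp_msh; apply: msh_proof.
 move=> i; rewrite /taur /t.
 have h0 : opensT W `<=` m @^-1` opensT YT by [].
 rewrite -(ht i (t0' i) h0) //; apply: esym; exact: msh_nat.
have em w : m w = ind_pt w.
 have eb : ebase (m w : pt) = b w by rewrite -ext_projE; apply: (e1 w).
 apply: ext_pt_inj => //; apply/seteqP.
 have E z : pol n (floc (b w)) z -> eprime (m w : pt) z <-> ind_prime w z.
  move=> [p hp <-]; have [V [Vw hpV]] := coefs_nbhs hp; have Vg := fgenP Vw.
  have [k' [sg [esg emsg]]] := main V _ (@bpreP V) p Vg hpV.
  rewrite (ind_primeE Vw hpV) -emsg.
  have pm : pol n (floc (ebase (m w : pt) : Y)) (tpol p) by rewrite eb; apply/polE.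
  rewrite -(ext_floc_nonunit pm) -esg.
  have Dm : epre V (m w) := k' w Vw.
  split=> [nu /(msh_local (h := k')) |ni]; first by move=> /(_ Vw) /(finvP _ Dm).
  apply: contrapT => nu; apply: ni; apply: msh_invertible => //.
  by apply/finvP.
 have [i1 _ _] := ext_primeP (m w : pt); have [i2 _ _] := ind_primeP w.
 split=> z hz.
  by apply/E => //; rewrite -eb; apply: (idS i1 hz).
 by apply/E => //; apply: (idS i2 hz).
split=> // D U h s w Uw.
have Dm : D (m w) := h _ Uw.
have : floc (m w) (fval s) by apply: floc_val.
rewrite em => /(ind_fraction Uw) [U' [hU [V [hb [p [r [U'w hp' hr' e u]]]]]]].
have Vg : V (fgen Y) := fgenP (hb _ U'w).
exists U', hU, V, hb, p, r; split=> //; split=> //.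
have [kp [sp [esp <-]]] := main V U' hb p Vg hp'; have [kr [sr [esr <-]]] := main V U' hb r Vg hr'.
pose D' := opensI D (epre V).
have d1 : D' `<=` D by move=> y [].
have d2 : D' `<=` epre V by move=> y [].
have kD : U' `<=` m @^-1` D' by move=> y Uy; split; [apply: h; apply: hU|apply: kr].
rewrite -(msh_nat d1 hU h kD) -(msh_res d2 kr kD) -(msh_res d2 kp kD) -rmorphM.
congr (msh m kD _); have D'g : D' (fgen YT) by apply: (@fgenP _ YT D' (m w)); apply: kD.
by apply: fval_inj; rewrite fvalM !fval_res // esr esp e mulrC.
Qed.

End Induced.

Lemma ext_universal (W : scheme) (b : morphism W Y) (tau : 'I_n -> OO W (opensT W)) :
 exists m : morphism W YT, mor_eq (mor_comp eproj m) b /\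
 forall i (s : OO YT (opensT YT)) (h : opensT W `<=` m @^-1` opensT YT),
  fval s = tvar K i -> msh m h s = tau i.
Proof.
have [m [h1 h2]] := exists_induced b tau; exists m.
exact: (induced_proj h1 h2).
Qed.

Lemma ext_unique (W : scheme) (m m' : morphism W YT) :
 mor_eq (mor_comp eproj m) (mor_comp eproj m') ->
 (forall i (s : OO YT (opensT YT)) (h : opensT W `<=` m @^-1` opensT YT)
  (h' : opensT W `<=` m' @^-1` opensT YT), fval s = tvar K i -> msh m h s = msh m' h' s) ->
 mor_eq m m'.
Proof.
move=> e et.
have /choice [t0 ht0] : forall i : 'I_n, exists s : OO YT (opensT YT), fval s = tvar K i.
 move=> i; apply: fval_glue => // w _; apply: ext_floc_sub; apply: pol_var; exact: floc_sr.
have k' : opensT W `<=` m' @^-1` opensT YT by [].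
pose tau i := msh m' k' (t0 i).
have sE i (s : OO YT (opensT YT)) : fval s = tvar K i -> s = t0 i.
 by move=> es; apply: fval_inj; rewrite ht0.
have [h1 h2] := @ext_mor_char W (mor_comp eproj m') tau m e
 (fun i s h es => etrans (et i s h k' es) (congr1 (msh m' k') (sE i s es))).
have [h1' h2'] := @ext_mor_char W (mor_comp eproj m') tau m' (mor_eq_refl _)
 (fun i s h es => etrans (msh_proof h k' s) (congr1 (msh m' k') (sE i s es))).
split=> [w|D U h h' s]; first by rewrite h1 h1'.
exact: (locrep_uniq (h2 D U h s) (h2' D U h' s)).
Qed.

End Universal.

(** * Base change to affine space *)

Section BaseChange.
Variables (K : fieldType) (n : nat) (X S : fscheme K) (f : morphism X S).
Hypothesis fval_f : val_compat id f.
Local Notation XT := (ext_scheme n X).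
Local Notation ST := (ext_scheme n S).
Local Notation tc := (@tconst K n).
Local Notation ptX := (ext_pt n (fmodel X)).
Local Notation ptS := (ext_pt n (fmodel S)).

Lemma floc_base (w : ptX) : floc (f (ebase w)) `<=` floc (ebase w : X).
Proof. by move=> z; apply: val_compat_loc. Qed.

Lemma ext_map_primeP (w : ptX) : pideal (pol n (floc (f (ebase w))))
 (pol n (floc (f (ebase w))) `&` eprime w).
Proof.
have BL := pol_sub (n := n) (@floc_base w).
have sp := pol_sr n (floc_sr (f (ebase w))).
exact: contract_prime sp BL (ext_primeP w).
Qed.

Lemma ext_map_over (w : ptX) c : floc (f (ebase w)) c ->
 (pol n (floc (f (ebase w))) `&` eprime w) (tc c) <-> nonunit (floc (f (ebase w))) c.
Proof.
move=> Lc; rewrite (val_compat_nonunit fval_f Lc) -(@ext_over K n (fmodel X) w c (floc_base Lc)).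
by split=> [[]//|h]; split=> //; apply/pol_const => //; apply: floc_sr.
Qed.

Definition ext_map_pt (w : ptX) : ptS :=
 @ExtPt K n (fmodel S) (f (ebase w)) _ (ext_map_primeP w) (@ext_map_over w).

Lemma ext_map_continuous : continuous (ext_map_pt : XT -> ST).
Proof.
apply/continuousP => D oD; rewrite -[open _]/(ext_open _) => w Dw.
have [U [g [oU Uw hg ng hD]]] := (oD : ext_open D) _ Dw.
have gX (w' : ptX) : U (f (ebase w')) -> pol n (floc (ebase w' : X)) g.
 by move=> Uw'; apply: pol_sub (hg _ Uw'); apply: floc_base.
exists (f @^-1` U), g; split=> //.
- by move: oU; apply: (continuousP _).1; apply: mfun_cont.
- move=> y Uy; apply: pol_sub (hg (f y) Uy) => z; exact: (val_compat_loc fval_f).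
- by move=> h; apply: ng; split=> //; apply: hg.
- by move=> w' Uw' nw'; apply: hD => // -[].
Qed.

Lemma exists_ext_map : exists2 q : morphism XT ST, val_compat id q & forall w, q w = ext_map_pt w.
Proof.
apply: (exists_val_compat (jm := idfun : {rmorphism _ -> _})) => // [|w z|w z].
- exact: ext_map_continuous.
- rewrite !ext_floc; apply: (loc_contract (pol_sr n (floc_sr _)) _ (ext_primeP w)).1.
 exact: pol_sub (@floc_base w).
- move=> _; rewrite !ext_floc; apply: (loc_contract (pol_sr n (floc_sr _)) _ (ext_primeP w)).2.
 exact: pol_sub (@floc_base w).
Qed.

Lemma tvar_section (Y : fscheme K) i : exists s : OO (ext_scheme n Y) (opensT _), fval s = tvar K i.
Proof.
by apply: fval_glue => // w _; apply: ext_floc_sub; apply: pol_var; exact: floc_sr.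
Qed.

(** A morphism to X[t] amounts to one to X together with n functions; the functions are read off
    from the given morphism to S[t]. *)
Lemma ext_pullback (q : morphism XT ST) : val_compat id q -> (forall w, q w = ext_map_pt w) ->
 is_pullback f (eproj n S) (eproj n X) q.
Proof.
move=> cq eq; have sq : mor_eq (mor_comp f (eproj n X)) (mor_comp (eproj n S) q).
 apply: (@val_compat_eq K _ tc XT S).
 - by apply: (@val_compat_comp K K _ id tc) => //; apply: ext_proj_val.
 - by apply: (@val_compat_comp K _ _ tc id) => //; apply: ext_proj_val.
 - by move=> w; rewrite /= !ext_projE eq.
split=> // W a b fab.
have /choice [tS htS] := tvar_section S.
have hb : opensT W `<=` b @^-1` opensT ST by [].
pose tau i := msh b hb (tS i).
have [w [pw tw]] := ext_universal a tau.
have qS i (s : OO XT (opensT XT)) (h : opensT XT `<=` q @^-1` opensT ST) :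
  fval s = tvar K i -> s = msh q h (tS i).
 by move=> es; apply: fval_inj; rewrite cq // es htS.
have hq : opensT XT `<=` q @^-1` opensT ST by [].
have tE i (s : OO ST (opensT ST)) : fval s = tvar K i -> s = tS i.
 by move=> es; apply: fval_inj; rewrite htS.
have compE (w' : morphism W XT) (h : opensT W `<=` mor_comp q w' @^-1` opensT ST)
  (h' : opensT W `<=` w' @^-1` opensT XT) (s : OO ST (opensT ST)) :
  msh (mor_comp q w') h s = msh w' h' (msh q hq s).
 rewrite mor_comp_msh.
 have hV : preim (mfun_cont q) (opensT ST) `<=` opensT XT by [].
 rewrite -(msh_res hV h' h) -(msh_nat (@subset_refl _ (opensT ST)) hV hq
  (@subset_refl _ (preim (mfun_cont q) (opensT ST)))).
 by rewrite rres_id.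
exists w; split=> //.
- apply: ext_unique.
  apply: (mor_eq_trans (mor_comp_assoc _ _ _)).
  apply: (mor_eq_trans (mor_comp_congl w (mor_eq_sym sq))).
  apply: (mor_eq_trans (mor_eq_sym (mor_comp_assoc _ _ _))).
  by apply: (mor_eq_trans (mor_comp_congr f pw)).
 move=> i s h h' es; rewrite (tE i s es).
 have k : opensT W `<=` w @^-1` opensT XT by [].
 rewrite (compE w h k) (tw i) ?cq ?htS // /tau; exact: msh_proof.
- move=> w' pw' qw'; apply: ext_unique; first exact: (mor_eq_trans pw' (mor_eq_sym pw)).
 move=> i s h h' es; rewrite (tw i _ _ es) (qS i s hq es).
 have k : opensT W `<=` mor_comp q w' @^-1` opensT ST by [].
 by rewrite -(compE w' k h) (qw'.2 _ _ k hb).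
Qed.

End BaseChange.

Lemma val_compat_gen (K : fieldType) (X S : fscheme K) (f : morphism X S) A :
 val_compat id f -> chart floc [set: S] A -> f (fgen X) = fgen S.
Proof.
move=> cf hS; apply: (chart_inj hS) => //; rewrite (trace_gen (U := opensT S) _ hS) //.
apply/seteqP; split=> [z [Az]|_ ->]; last first.
 by split; [apply: (sub0 (chart_sr hS))|apply: (id0 (floc_ideal _))].
move=> /(val_compat_nonunit cf (chart_sub hS (x := f (fgen X)) I Az)).
exact: (@mgen_nonunit K (fmodel X)).
Qed.

(* If the chart B_i contains x_i outside V for all i, let C be the closed
  subset of X[t_1, .., t_n] given by x_i t_i = 1 over the i-th chart. Its image
  is closed in S[t_1, .., t_n] and contains the K-point t_i = 1 / x_i, hence
  also the specialization of this point defined by V, at which all t_i vanish. *)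
Lemma valuative_existence (K : fieldType) (X S : fscheme K) (f : morphism X S) A n
  (U : 'I_n -> opens X) (B : 'I_n -> set K) (V : set K) :
 val_compat id f -> chart floc [set: S] A -> universally_closed f ->
 (forall x, exists i, U i x) -> (forall i, chart floc (U i) (B i)) ->
 valring V -> A `<=` V -> exists i, B i `<=` V.
Proof.
move=> cf hS uc cov hU vV AV; apply: contrapT => nex.
have /choice [x hx] : forall i, exists x, B i x /\ ~ V x.
 move=> i; apply: contrapT => h; apply: nex; exists i => z Bz; apply: contrapT => nV.
 by apply: h; exists z.
have [q cq eq] := exists_ext_map n cf.
have clq : closed_map q := uc _ _ _ _ _ (ext_pullback cq eq).
have [sV _] := vV; have iV := valring_ideal vV; have hpV := valring_prime vV.
pose kap i := (x i)^-1.
have Vk i : nonunit V (kap i) by have [_ nV] := hx i; apply: valring_inv.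
have x0 i : x i != 0 by have [_ nV] := hx i; apply: contra_notN nV => /eqP ->; apply: sub0.
pose ev (p : mpoly n K) : K := peval id kap p.
have sT := setT_sr K.
have cT p : coefs [set: K] p by [].
have evM p r : ev (p * r) = ev p * ev r by apply: (pevalM sT).
have evD p r : ev (p + r) = ev p + ev r by apply: (pevalD sT).
have evB p r : ev (p - r) = ev p - ev r by apply: (pevalB sT).
have evC c : ev (mpolyC n c) = c by apply: (pevalC sT).
have evX i : ev (mpolyX K (mnm1 i)) = kap i by apply: (pevalX sT).
have ev1 : ev 1 = 1 by rewrite -mpolyC1 evC.
have ev0 : ev 0 = 0 by rewrite -mpolyC0 evC.
(* the prime of O[t] induced by a prime of a ring containing O and the 1 / x_i *)
have mkpt (y : fscheme K) (z : y) (T J : set K) : pideal T J ->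
  (forall p, coefs (floc z) p -> T (ev p)) -> (forall c, floc z c -> J c <-> nonunit (floc z) c) ->
  exists w : ext_pt n (fmodel y), ebase w = z /\
   forall p, coefs (floc z) p -> eprime w (tpol p) <-> J (ev p).
 move=> [iJ J1 JP] hT Jc; have sz := floc_sr z; have sp := pol_sr n sz.
 pose P : set (ratfun K n) := [set w | exists p, [/\ w = tpol p, coefs (floc z) p & J (ev p)]].
 have PE p : coefs (floc z) p -> P (tpol p) <-> J (ev p).
  by move=> hp; split=> [[r [/tpol_inj <-]] //|h]; exists p.
 have hP : pideal (pol n (floc z)) P.
  split; first split.
  - by move=> _ [p [-> hp _]]; apply/polE.
  - exists 0; split; rewrite ?rmorph0 ?ev0 //; last exact: (id0 iJ).
   by move=> m; rewrite mcoeff0; apply: (sub0 sz).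
  - move=> _ _ [p [-> hp hJ]] [r [-> hr hJ']]; rewrite -tpolD; exists (p + r).
   by rewrite evD; split=> //; [apply: coefsD|apply: (idD iJ)].
  - move=> _ _ [p hp <-] [r [-> hr hJ']]; rewrite -tpolM; exists (p * r).
   by rewrite evM; split=> //; [apply: coefsM|apply: (idM iJ) => //; apply: hT].
  - rewrite -tpol1 => /PE; rewrite ev1 => h; apply: J1; apply: h.
   by rewrite -mpolyC1; apply: coefsC => //; apply: (sub1 sz).
  - move=> _ _ [p hp <-] [r hr <-]; rewrite -tpolM => /(PE _ (coefsM sz hp hr)).
   by rewrite evM => /(JP _ _ (hT _ hp) (hT _ hr)) [h|h]; [left|right]; apply/PE.
 have hPc c : floc z c -> P (tconst n c) <-> nonunit (floc z) c.
  by move=> Lc; rewrite -(Jc c Lc) -{2}(evC c); apply: PE; apply: coefsC.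
 by exists (@ExtPt K n (fmodel y) z P hP hPc).
(* w0 is the K-point t_i = 1 / x_i over the generic point of X. *)
have [//|c _|w0 [bw0 pw0]] := mkpt X (fgen X) _ _ (zero_pideal sT).
 by split=> [->|]; [exact: (id0 (floc_ideal _))|exact: (@mgen_nonunit K (fmodel X))].
have [y _ [dy1 dy2]] := chart_center (U := opensT S) hS vV AV.
have evV p : coefs (floc y) p -> V (ev p).
 move=> hp; rewrite /ev /peval; apply: (sub_sum sV) => m _; apply: (subM sV); first exact/dy1/hp.
 rewrite /monom; elim/big_rec: _ => [|i z _ Vz]; first exact: (sub1 sV).
 by apply: (subM sV) => //; apply: (subX sV); have [] := Vk i.
(* s1 is the specialization of its image: it lies over the center of V, and its prime consists of
   the polynomials whose value at the 1 / x_i is in the maximal ideal of V. *)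
have [||s1 [bs1 ps1]] := mkpt S y _ _ hpV; [exact: evV| |].
 move=> c Lc; split=> [nc|/dy2 //]; split=> // -[c0 /dy1 Vc].
 exact: (nonunit_inv Vc c0 nc).
pose C : set (ext_scheme n X) := [set w | forall i, U i (ebase (w : ext_pt _ (fmodel X)) : X) ->
 eprime (w : ext_pt _ (fmodel X)) (tpol (mpolyC n (x i) * mpolyX K (mnm1 i) - 1))].
have pol_i i z : U i z -> coefs (floc z) (mpolyC n (x i) * mpolyX K (mnm1 i) - 1).
 move=> Uz; have sz := floc_sr z; apply: coefsB => //.
  apply: coefsM => //; last exact: coefsX.
  by apply: coefsC => //; apply: (chart_sub (hU i) Uz); have [] := hx i.
 by rewrite -mpolyC1; apply: coefsC => //; apply: (sub1 sz).
have clC : closed C.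
 rewrite -[C]setCK; apply: open_closedC; rewrite -[open _]/(ext_open _) => w.
 move=> /existsNP [i /not_implyP [Uw nw]].
 exists (U i), (tpol (mpolyC n (x i) * mpolyX K (mnm1 i) - 1)); split=> //.
 - exact: oset_open.
 - by move=> z Uz; apply/polE; apply: pol_i.
 - by move=> w' Uw' nw' /(_ i Uw').
have Cw0 : C w0.
 move=> i; rewrite bw0 => Ui; apply/pw0; first exact: pol_i.
 by rewrite evB evM evC evX ev1 mulfV // subrr.
have clD := clq C clC.
(* A basic neighbourhood of s1 in the complement of the image is given by a polynomial p. Since the
   image of w0 is excluded, p vanishes at the 1 / x_i, hence at s1, a contradiction. *)
have : (q @` C) s1.
 apply: contrapT => ns1.
 have oD : ext_open (~` (q @` C)) := closed_openC clD.
 have [G [g [oG Gs1 hg ng hD]]] := oD _ ns1.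
 have [p hp ep] := hg _ Gs1.
 have Gg : G (fgen S) by apply: (@fgenP _ S (Opens oG) _ Gs1).
 have bq : ebase (q w0 : ext_pt n (fmodel S)) = fgen S.
  by rewrite eq /= bw0 (val_compat_gen cf hS).
 have hq0 : (q @` C) (q w0) by exists w0.
 apply: (hD (q w0) _ _ hq0); rewrite ?bq //.
 rewrite eq => -[_ h0]; apply: ng; rewrite -ep; rewrite bs1 in hp; apply/ps1 => //.
 suff -> : ev p = 0 by apply: (id0 iV).
 apply/pw0; last by rewrite ep.
 move=> m; apply: (val_compat_loc cf); rewrite (val_compat_gen cf hS).
 by have := hg _ Gg; rewrite -ep => /polE; apply.
move=> [w1 Cw1 e1]; have [i Ui] := cov (ebase (w1 : ext_pt n (fmodel X))).
(* At a preimage w1 in C of s1, over the i-th chart, t_i vanishes although x_i t_i = 1. *)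
have nt : eprime (q w1 : ext_pt n (fmodel S)) (tvar K i).
 rewrite e1; apply/ps1; first by apply: coefsX; apply: floc_sr.
 by rewrite evX.
have nt1 : eprime (w1 : ext_pt n (fmodel X)) (tvar K i) by move: nt; rewrite eq => -[].
have [iw _ _] := ext_primeP (w1 : ext_pt n (fmodel X)).
have sp := pol_sr n (floc_sr (ebase (w1 : ext_pt n (fmodel X)) : X)).
apply: (@ext_prime1 _ _ _ (w1 : ext_pt n (fmodel X))).
have -> : 1 = tconst n (x i) * tvar K i - tpol (mpolyC n (x i) * mpolyX K (mnm1 i) - 1).
 by rewrite tpolB tpolM tpol1; ring.
apply: (idB sp iw); last exact: Cw1.
apply: (idM iw) => //; apply/pol_const; first exact: floc_sr.
by apply: (chart_sub (hU i) Ui); have [] := hx i.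
Qed.

(** * Rational functions *)

Lemma spec_fraction (Y : ringed_space) (C : opens Y) (R : comPzRingType) (psi : {rmorphism R -> OO Y C})
  (U : opens Y) x (s : OO Y U) : is_spec psi -> U x -> C x ->
 exists g (D : opens Y) (hU : D `<=` U) (hC : D `<=` C) a n,
  [/\ ~ spec_point psi x g, D x, rres hU s * rres hC (psi (g ^+ n)) = rres hC (psi a),
    is_unit (rres hC (psi g)) &
    forall c, rres hC (psi c) = 0 -> exists m, g ^+ m * c = 0].
Proof.
move=> [_ _ _ hO hL] Ux Cx.
have oUC : open (U `&` C) by exact: (oset_open (opensI U C)).
have [|G hG] := (hO (U `&` C) _).1 oUC; first by move=> y [].
have /existsNP [g /not_implyP [Gg ng]] := (hG x Cx).1 (conj Ux Cx).
have oD : open (C `&` [set y | ~ spec_point psi y g]).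
 apply/(hO _ _) => [y [] //|]; exists [set g] => y Cy.
 by split=> [[_ n] /(_ g erefl) //|h]; split=> // n; apply: h => _ ->.
pose D := Opens oD; have DC : D `<=` C by move=> y [].
have DU : D `<=` U.
 by move=> y [Cy ngy]; apply: (proj1 ((hG y Cy).2 _)) => /(_ g Gg).
have [hu hs h0] := hL g D DC (fun y => iff_refl _).
have [a [_ [[n ->] ea]]] := hs (rres DU s).
exists g, D, DU, DC, a, n; split=> //.
- by apply: hu; exists 1%N; rewrite expr1.
- by move=> c /h0 [_ [m ->] e]; exists m.
Qed.

Section Values.
Variables (A : idomainType) (K : fieldType) (tf : {rmorphism A -> K}) (tf_inj : injective tf).
Variables (Y : scheme) (xi : Y) (alg : {rmorphism A -> OO Y (opensT Y)}).
Implicit Types U V W : opens Y.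

Definition algr W (a : A) : OO Y W := rres (U := opensT Y) (@subsetT _ W) (alg a).
HB.instance Definition _ W := GRing.RMorphism.copy (algr W) (rres (U := opensT Y) (@subsetT _ W) \o alg).

Lemma algrB W a b : algr W (a - b) = algr W a - algr W b.
Proof. exact: rmorphB. Qed.
Lemma algrM W a b : algr W (a * b) = algr W a * algr W b.
Proof. exact: rmorphM. Qed.
Lemma algr0 W : algr W 0 = 0.
Proof. exact: rmorph0. Qed.
Lemma algr1 W : algr W 1 = 1.
Proof. exact: rmorph1. Qed.
Lemma algrE W (h : W `<=` opensT Y) a : rres h (alg a) = algr W a.
Proof. by rewrite /algr (Prop_irrelevance h (@subsetT _ W)). Qed.

Lemma algr_res U W (h : W `<=` U) a : rres h (algr U a) = algr W a.
Proof. exact: rres_comp. Qed.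

Hypothesis alg_inj : forall W a, W xi -> algr W a = 0 -> a = 0.
Hypothesis alg_unit : forall b, b != 0 -> invertible_at xi (alg b).
Hypothesis alg_frac : forall U (s : OO Y U), U xi ->
 exists W (h : W `<=` U) a b, [/\ W xi, b != 0 & algr W b * rres h s = algr W a].

Let rel U (s : OO Y U) (z : K) := exists W (h : W `<=` U) a b,
 [/\ W xi, b != 0, algr W b * rres h s = algr W a & z = tf a / tf b].

Let tfN b : b != 0 -> tf b != 0.
Proof. by move=> b0; apply: contraNneq b0 => e; apply/eqP; apply: tf_inj; rewrite e rmorph0. Qed.

Let rel_res U W0 (s : OO Y U) z : W0 xi -> rel s z -> exists W (h : W `<=` U) a b,
 [/\ W xi, W `<=` W0 & b != 0 /\ algr W b * rres h s = algr W a /\ z = tf a / tf b].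
Proof.
move=> W0x [W [h [a [b [Wx b0 e ez]]]]].
have k : opensI W W0 `<=` W by move=> y [].
have l : opensI W W0 `<=` U by move=> y [/h].
exists (opensI W W0), l, a, b; split=> //; first by move=> y [].
by do 2?split=> //; rewrite -(rres_comp h k l) -!(algr_res k) -rmorphM e.
Qed.

Let rel2 U (s t : OO Y U) z w : rel s z -> rel t w -> exists W (h : W `<=` U) a b c d,
 [/\ W xi, b != 0 /\ d != 0, algr W b * rres h s = algr W a, algr W d * rres h t = algr W c &
   z = tf a / tf b /\ w = tf c / tf d].
Proof.
move=> hs [W [h [c [d [Wx d0 e ew]]]]].
have [W' [h' [a [b [W'x k [b0 [e' ez]]]]]]] := rel_res Wx hs.
exists W', h', a, b, c, d; split=> //.
by rewrite -(rres_comp h k h') -!(algr_res k) -rmorphM e.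
Qed.

Let rel_fun U (s : OO Y U) z w : rel s z -> rel s w -> z = w.
Proof.
move=> /rel2 h /h [W [k [a [b [c [d [Wx [b0 d0] e1 e2 [-> ->]]]]]]]].
apply/eqP; rewrite eqr_div ?tfN // -!rmorphM; apply/eqP; congr (tf _).
apply/eqP; rewrite -subr_eq0; apply/eqP; apply: (alg_inj Wx).
rewrite algrB !algrM -e1 -e2; ring.
Qed.

(** The last clause only makes a section of value 0 vanish near the generic point. Injectivity of
    values means that the scheme is integral, which for X is obtained later from regularity. *)
Definition is_values (val : forall U, OO Y U -> K) : Prop :=
 [/\ forall U s t, val U (s - t) = val U s - val U t, forall U s t, val U (s * t) = val U s * val U t,
  forall U, U xi -> val U 1 = 1, forall U V (h : V `<=` U) s, V xi -> val V (rres h s) = val U s &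
  (forall U a, U xi -> val U (algr U a) = tf a) /\
  forall U s, U xi -> val U s = 0 -> exists W (h : W `<=` U), W xi /\ rres h s = 0].

Lemma exists_values : exists val, is_values val.
Proof.
pose val U (s : OO Y U) : K :=
 match pselect (exists z, rel s z) with left e => sval (cid e) | right _ => 0 end.
have valE U (s : OO Y U) z : rel s z -> val U s = z.
 move=> h; rewrite /val; case: pselect => [e|[]]; last by exists z.
 exact: (rel_fun (svalP (cid e)) h).
have relv U (s : OO Y U) : U xi -> rel s (val U s).
 move=> Ux; have [W [h [a [b [Wx b0 e]]]]] := alg_frac s Ux.
 by rewrite (valE _ _ (tf a / tf b)); exists W, h, a, b.
have val0 U (s : OO Y U) : ~ U xi -> val U s = 0.
 move=> nU; rewrite /val; case: pselect => // -[z [W [h [a [b [Wx]]]]]].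
 by case: nU; apply: h.
exists val; split.
- move=> U s t; have [Ux|nU] := EM (U xi); last by rewrite !val0 // subrr.
 have [W [k [a [b [c [d [Wx [b0 d0] e1 e2 [ez ew]]]]]]]] := rel2 (relv U s Ux) (relv U t Ux).
 apply: valE; exists W, k, (a * d - c * b), (b * d); split=> //; first exact: mulf_neq0.
  rewrite algrB !algrM rmorphB -e1 -e2; ring.
 by rewrite ez ew rmorphB !rmorphM; have tb := tfN b0; have td := tfN d0; fld.
- move=> U s t; have [Ux|nU] := EM (U xi); last by rewrite !val0 // mulr0.
 have [W [k [a [b [c [d [Wx [b0 d0] e1 e2 [ez ew]]]]]]]] := rel2 (relv U s Ux) (relv U t Ux).
 apply: valE; exists W, k, (a * c), (b * d); split=> //; first exact: mulf_neq0.
  rewrite !algrM rmorphM -e1 -e2; ring.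
 by rewrite ez ew !rmorphM mulf_div.
- move=> U Ux; apply: valE; exists U, (@subset_refl _ _), 1, 1; split=> //; first exact: oner_neq0.
  by rewrite rres_id mulr1.
 by rewrite rmorph1 divr1.
- move=> U V h s Vx; have [W [k [a [b [Wx kV [b0 [e ez]]]]]]] := rel_res Vx (relv U s (h _ Vx)).
 apply: valE; exists W, kV, a, b; split=> //.
 by rewrite (rres_comp _ _ k).
split=> [U a Ux|U s Ux v0].
 apply: valE; exists U, (@subset_refl _ _), a, 1; split=> //; first exact: oner_neq0.
  by rewrite rres_id algr1 mul1r.
 by rewrite rmorph1 divr1.
have [W [h [a [b [Wx b0 e]]]]] := relv U s Ux.
rewrite v0 => ez; have a0 : a = 0.
 apply: tf_inj; apply/eqP; rewrite rmorph0; move/esym/eqP: ez.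
 by rewrite mulf_eq0 invr_eq0 (negPf (tfN b0)) orbF.
have [V [k [Vx [c u]]]] := alg_unit b0.
have k1 : opensI V W `<=` V by move=> y [].
have k2 : opensI V W `<=` W by move=> y [].
have k3 : opensI V W `<=` U by move=> y [_ /h].
have kT : opensI V W `<=` opensT Y by [].
exists (opensI V W), k3; split=> //.
have eb : algr (opensI V W) b * rres k1 c = 1.
 by rewrite -(algrE kT) -(rres_comp k k1 kT) -rmorphM u rmorph1.
rewrite -[LHS]mul1r -eb mulrAC -(rres_comp h k2 k3) -(algr_res k2) -rmorphM e a0.
by rewrite algr0 rmorph0 mul0r.
Qed.

End Values.

Section SpecValues.
Variables (A : idomainType) (K : fieldType) (tf : {rmorphism A -> K}) (tf_inj : injective tf).
Variables (S : scheme) (phi : {rmorphism A -> OO S (opensT S)}) (hphi : is_spec phi).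

Lemma spec_generic : exists eta, spec_point phi eta = [set 0] /\
 forall (U : opens S) x, U x -> U eta.
Proof.
have [hP _ hS hO _] := hphi.
have [eta _ e] := hS [set 0] (zero_prime A).
exists eta; split=> // U x Ux.
have [|G hG] := (hO U _).1 (oset_open U); first by [].
apply/(hG eta I); rewrite e => h; apply: ((hG x I).1 Ux) => g /h ->.
by have [[p0 _ _] _ _] := hP x I.
Qed.

Variables (eta : S) (eta0 : spec_point phi eta = [set 0])
 (gen : forall (U : opens S) x, U x -> U eta).

Lemma spec_alg_inj (W : opens S) a : W eta -> algr phi W a = 0 -> a = 0.
Proof.
move=> Wx e; have [g [D [hU [hC [_ [_ [ng Dx _ _ h0]]]]]]] := spec_fraction (0 : OO S W) hphi Wx I.
have [|m gm] := h0 a; first by rewrite algrE -(algr_res phi hU) e rmorph0.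
apply/eqP; move/eqP: gm; rewrite mulf_eq0 => /orP [|//] /eqP gm.
have hp := (let: And5 h _ _ _ _ := hphi in h) eta I; have [[p0 _ _] _ _] := hp.
by case: ng; apply: (is_primeX (n := m) hp); rewrite gm.
Qed.

Lemma spec_alg_unit b : b != 0 -> invertible_at eta (phi b).
Proof.
move=> b0; apply: contrapT => h; have : spec_point phi eta b by [].
by rewrite eta0 => /eqP; rewrite (negPf b0).
Qed.

Lemma spec_alg_frac (U : opens S) (s : OO S U) : U eta ->
 exists (W : opens S) (h : W `<=` U) a b, [/\ W eta, b != 0 & algr phi W b * rres h s = algr phi W a].
Proof.
move=> Ux; have [g [D [hU [hC [a [n [ng Dx e _ _]]]]]]] := spec_fraction s hphi Ux I.
exists D, hU, a, (g ^+ n); split=> //; last by rewrite -!(algrE phi hC) mulrC.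
by apply: expf_neq0; apply/eqP => g0; apply: ng; rewrite eta0.
Qed.

Lemma spec_values : exists2 val, is_values tf eta phi val & forall (U : opens S) s, U eta -> val U s = 0 -> s = 0.
Proof.
have [val hv] := exists_values tf_inj spec_alg_inj spec_alg_unit spec_alg_frac; have [_ hM _ hr [ha _]] := hv.
exists val => // U s Ux v0; apply: local_eq => x Ux'.
have [g [D [hU [hC [a [n [ng Dx e [c u] _]]]]]]] := spec_fraction s hphi Ux' I.
exists D, hU; split=> //; rewrite rmorph0.
have Dg := gen Dx; have := congr1 (val D) e.
rewrite hM hr // v0 mul0r algrE ha // => /esym a0.
have {}a0 : a = 0 by apply: tf_inj; rewrite a0 rmorph0.
move: e; rewrite a0 !rmorph0 => e.
have un : rres hC (phi (g ^+ n)) * c ^+ n = 1 by rewrite !rmorphXn -exprMn u expr1n.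
by rewrite -[LHS]mulr1 -un mulrA e mul0r.
Qed.

Section Birational.
Variables (X : scheme) (f : morphism X S) (bf : birational f).

Definition salg : {rmorphism A -> OO X (opensT X)} := structure_map phi f.

Lemma algr_msh (V : opens S) (U : opens X) (h : U `<=` f @^-1` V) a :
 algr salg U a = msh f h (algr phi V a).
Proof.
rewrite /algr /salg /structure_map /=.
by rewrite -(msh_nat (@subsetT _ V : V `<=` opensT S) (@subsetT _ U : U `<=` opensT X) _ h).
Qed.

(** The open set U0 has exactly one point over the generic point of S. A nonempty open set meets U0
    in a set with open image, which contains the generic point of S; so it contains that point. *)
Lemma birational_generic : exists xi : X, f xi = eta /\ (forall (U : opens X) x, U x -> U xi) /\
 exists (U0 : opens X), U0 xi /\ forall W : opens X, W `<=` U0 -> W xi ->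
  exists V : opens S, V eta /\ exists h : W `<=` f @^-1` V, bijective (msh f h).
Proof.
have [U0 [V0 [[dU dV] [eV inj] opn bij]]] := bf.
have V0eta : V0 eta.
 have [|x [_ Vx]] := dV setT _ openT; first by exists eta.
 exact: gen Vx.
have [xi Uxi fxi] : (f @` U0) eta by rewrite eV.
exists xi; split=> //; split.
 move=> U x Ux; have [|x' [Ux' U0x']] := dU U _ (oset_open U); first by exists x.
 have oW : open (f @` (U `&` U0)).
  apply: (opn (opensI U U0)) => // y [] //.
 have [x2 [Ux2 U0x2] e] : (f @` (U `&` U0)) eta.
  by apply: (gen (U := Opens oW) (x := f x')); exists x'.
 by rewrite (_ : xi = x2) //; apply: inj => //; rewrite e.
exists U0; split=> // W WU Wx.
have oV := opn W WU; pose V := Opens oV; exists V; split; first by exists xi.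
have h : W `<=` f @^-1` V by move=> y Wy; exists y.
exists h; apply: bij; first by move=> y [x Wx' <-]; rewrite -eV; exists x => //; apply: WU.
apply/seteqP; split=> y; first by move=> Wy; split; [apply: WU|apply: h].
by move=> [Uy [y' Wy' e]]; rewrite -(inj y' y) //; apply: WU.
Qed.

Variables (xi : X) (fxi : f xi = eta) .
Variables (U0 : opens X) (U0x : U0 xi) (bijU0 : forall W : opens X, W `<=` U0 -> W xi ->
  exists V : opens S, V eta /\ exists h : W `<=` f @^-1` V, bijective (msh f h)).

Lemma bir_alg_inj (W : opens X) a : W xi -> algr salg W a = 0 -> a = 0.
Proof.
move=> Wx e; have k : opensI W U0 `<=` W by move=> y [].
have [|//|V [Veta [h bij]]] := bijU0 (W := opensI W U0); first by move=> y [].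
apply: (spec_alg_inj Veta); apply: (bij_inj bij).
by rewrite -algr_msh rmorph0 -(algr_res salg k) e rmorph0.
Qed.

Lemma bir_alg_unit b : b != 0 -> invertible_at xi (salg b).
Proof. by move=> b0; apply: msh_invertible => //; rewrite fxi; apply: spec_alg_unit. Qed.

Lemma bir_alg_frac (U : opens X) (s : OO X U) : U xi ->
 exists (W : opens X) (h : W `<=` U) a b, [/\ W xi, b != 0 & algr salg W b * rres h s = algr salg W a].
Proof.
move=> Ux; have k : opensI U U0 `<=` U by move=> y [].
have [|//|V [Veta [h [inv _ invK]]]] := bijU0 (W := opensI U U0); first by move=> y [].
have [D [hD [a [b [Deta b0 e]]]]] := spec_alg_frac (inv (rres k s)) Veta.
pose W := opensI (opensI U U0) (preim (mfun_cont f) D).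
have h1 : W `<=` opensI U U0 by move=> y [].
have h2 : W `<=` f @^-1` D by move=> y [].
have hW : W `<=` U by move=> y [[]].
exists W, hW, a, b; split=> //; first by split=> //; rewrite /= /preimage fxi.
rewrite !(algr_msh h2) -e rmorphM (msh_nat hD h1 h h2) invK.
by rewrite (rres_comp k h1 hW).
Qed.

Lemma bir_values : exists val, is_values tf xi salg val.
Proof. exact: (exists_values tf_inj bir_alg_inj bir_alg_unit bir_alg_frac). Qed.

End Birational.
End SpecValues.
(** The rings between A0 and K have dimension at most two: with 0 below c1, a chain of length three
    is excluded. *)
Definition no_chains3 (K : fieldType) (A0 : set K) : Prop := forall B c1 c2 c3, subring B -> A0 `<=` B ->
 pideal B c1 -> pideal B c2 -> pideal B c3 ->
 (exists2 z, z != 0 & c1 z) -> c1 `<` c2 -> c2 `<` c3 -> False.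

Section RegularStalks.
Variables (K : fieldType) (A0 : set K).
Hypothesis sA : subring A0.
Hypothesis chain3 : no_chains3 A0.
Variables (X : scheme) (xi : X).
Implicit Types U V W D : opens X.
Hypothesis gen : forall U x, U x -> U xi.
Variable val : forall U, OO X U -> K.
Hypotheses (valB : forall U (s t : OO X U), val (s - t) = val s - val t)
 (valM : forall U (s t : OO X U), val (s * t) = val s * val t)
 (val1 : forall U, U xi -> val (1 : OO X U) = 1)
 (val_res : forall U V (h : V `<=` U) (s : OO X U), V xi -> val (rres h s) = val s)
 (val_A : forall z, A0 z -> exists s : OO X (opensT X), val s = z)
 (val_ker : forall U (s : OO X U), U xi -> val s = 0 ->
   exists W (h : W `<=` U), W xi /\ rres h s = 0).

Section Stalk.
Variables (x : X) (R : comPzRingType) (germ : forall U, U x -> {rmorphism OO X U -> R}).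
Hypotheses (hst : is_stalk germ) (regR : regular_local R).

Lemma germ_eq_val U V (hU : U x) (hV : V x) (s : OO X U) (t : OO X V) :
 germ hU s = germ hV t -> val s = val t.
Proof.
have [hr _ h0] := hst => e.
have k1 : opensI U V `<=` U by move=> y [].
have k2 : opensI U V `<=` V by move=> y [].
have hx : opensI U V x by [].
have [W [h [Wx e0]]] : exists W (h : W `<=` opensI U V), W x /\ rres h (rres k1 s - rres k2 t) = 0.
 by apply: (h0 _ hx); rewrite rmorphB (hr _ _ hU) (hr _ _ hV) e subrr.
have Wxi := gen Wx; have gxi := h _ Wxi.
apply/eqP; rewrite -subr_eq0 -(val_res k1) // -(val_res k2) // -valB -(val_res h) // e0.
by rewrite -(subrr 1) valB subrr.
Qed.

Lemma stalk_value : exists v : {rmorphism R -> K}, forall U (hU : U x) s, v (germ hU s) = val s.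
Proof.
have [hr hs h0] := hst.
have /choice [v hv] : forall r, exists z, forall U (hU : U x) s, germ hU s = r -> z = val s.
 by move=> r; have [U [hU [s <-]]] := hs r; exists (val s) => V hV t /germ_eq_val.
have vE U (hU : U x) (s : OO X U) : v (germ hU s) = val s by apply: hv.
have two a b : exists U (hU : U x) (s t : OO X U), germ hU s = a /\ germ hU t = b.
 have [U [hU [s <-]]] := hs a; have [V [hV [t <-]]] := hs b.
 have k1 : opensI U V `<=` U by move=> y [].
 have k2 : opensI U V `<=` V by move=> y [].
 have hx : opensI U V x by [].
 by exists (opensI U V), hx, (rres k1 s), (rres k2 t); rewrite (hr _ _ hU) (hr _ _ hV).
have [|a b|a b|v' hv'] := @rmorphism_of R K v.
- rewrite -(rmorph1 (germ (U := opensT X) I)) vE; exact: val1.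
- by have [U [hU [s [t [<- <-]]]]] := two a b; rewrite -rmorphB !vE valB.
- by have [U [hU [s [t [<- <-]]]]] := two a b; rewrite -rmorphM !vE valM.
by exists v' => U hU s; rewrite hv' vE.
Qed.

Variables (v : {rmorphism R -> K}).
Hypothesis vE : forall U (hU : U x) s, v (germ hU s) = val s.

Lemma germ_unit U (hU : U x) (s : OO X U) : invertible_at x s -> is_unit (germ hU s).
Proof.
have [hr _ _] := hst => -[V [h [Vx [b e]]]]; exists (germ Vx b).
by rewrite -(hr _ _ hU Vx h) -rmorphM e rmorph1.
Qed.

(** A section of value 0 vanishes near the generic point. If its numerator a on an affine chart were
    invertible at some point y, it would be invertible at the generic point too; so a lies in every
    prime of the chart. *)
Lemma stalk_ker r : v r = 0 -> forall q : set R, is_prime q -> q r.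
Proof.
move=> v0 q hq; have [hr hs h0] := hst; have [U [hU [s es]]] := hs r.
have [C Cx [Q [psi hpsi]]] := schemeP x.
have [g [D [kU [kC [a [n [ng Dx e _ _]]]]]]] := spec_fraction s hpsi hU Cx.
have Dxi := gen Dx; have Cxi := gen Cx.
have va : val (psi a) = 0.
 rewrite -(val_res kC) // -e valM (val_res kU) //.
 by have <- : v r = val s; [rewrite -es vE|rewrite v0 mul0r].
have [W [k [Wxi eW]]] := val_ker Cxi va.
have [hP _ hS _ _] := hpsi.
have alla p : is_prime p -> p a.
 move=> hp; have [y Cy <-] := hS p hp.
 have [h //|nh] := EM (spec_point psi y a).
 have [g' [D' [_ [kC' [_ [_ [ng' D'y _ _ _]]]]]]] := spec_fraction (0 : OO X (opensT X)) hpsi I Cy.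
 have [U' [h' [U'y [b eb]]]] : invertible_at y (psi a) by apply: contrapT.
 have U'xi := gen U'y.
 have k1 : opensI U' W `<=` U' by move=> z [].
 have k2 : opensI U' W `<=` W by move=> z [].
 have k3 : opensI U' W `<=` C by move=> z [/h'].
 case: (@invertible_at0 X W xi Wxi); rewrite -eW; apply: res_invertible => //.
 by exists U', h'; split=> //; exists b.
have hx : D x := Dx.
have : q (germ Cx (psi a)).
 exact: (alla [set c | q (germ Cx (psi c))] (preimage_prime (germ Cx \o psi) hq)).
have <- : germ Dx (rres kC (psi a)) = germ Cx (psi a) by apply: hr.
rewrite -e rmorphM (hr _ _ hU) es (hr _ _ Cx) => /(let: And3 _ _ h := hq in h) [//|qg].
have ig : invertible_at x (psi g) by apply: contrapT.
have [u eu] := germ_unit Cx ig.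
have [[_ _ qM] q1 _] := hq; case: q1; rewrite -(expr1n R n) -eu exprMn mulrC; apply: (qM).
by move: qg; rewrite !rmorphXn.
Qed.

Let Ox : set K := range v.

Let sOx : subring Ox := range_sr v.

Let image_mem (q : set R) r : is_prime q -> (v @` q) (v r) -> q r.
Proof. by move=> hq /(image_pideal hq (fun r h => stalk_ker h hq)).2. Qed.

Let image_prime q : is_prime q -> pideal Ox (v @` q).
Proof. by move=> hq; apply: (image_pideal hq (fun r h => stalk_ker h hq)).1. Qed.

Let image_lt q q' : is_prime q -> is_prime q' -> q `<` q' -> v @` q `<` v @` q'.
Proof.
move=> hq hq' [le nle]; split; first by move=> _ [r qr <-]; exists r => //; apply: le.
move=> h; apply: nle => r qr; apply: (image_mem hq); apply: h; by exists r.
Qed.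

(** The kernel of v lies in every prime of the stalk, so chains of primes map to chains of the same
    length in a subring of K. *)
Lemma stalk_dim d : krull_dim R d -> (d <= 2)%N.
Proof.
move=> [[c [cP clt]] _]; rewrite leqNgt; apply/negP => d3.
have hP i : (i <= 3)%N -> is_prime (c i) by move=> i3; apply: cP; apply: leq_trans d3.
have hlt i : (i < 3)%N -> c i `<` c i.+1 by move=> i3; apply: clt; apply: leq_trans d3.
apply: (@chain3 Ox (v @` c 1%N) (v @` c 2%N) (v @` c 3%N) sOx).
- move=> z /val_A [s <-]; exists (germ (U := opensT X) I s) => //; exact: vE.
- by apply: image_prime; apply: hP.
- by apply: image_prime; apply: hP.
- by apply: image_prime; apply: hP.
- have [_ nle] := hlt 0%N isT.
 have [r c1r c0r] : exists2 r, c 1%N r & ~ c 0%N r.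
  by apply: contrapT => h; apply: nle => r cr; apply: contrapT => nr; apply: h; exists r.
 exists (v r); last by exists r.
 by apply/eqP => v0; apply: c0r; apply: (stalk_ker v0); apply: hP.
- by apply: image_lt; [apply: hP|apply: hP|apply: hlt].
- by apply: image_lt; [apply: hP|apply: hP|apply: hlt].
Qed.

(** The kernel of v is the least prime required by [regular_local_dim2]. The stalk is then a domain,
    0 is prime, and the kernel, lying in every prime, vanishes. *)
Lemma stalk_regular : exists d, [/\ krull_dim R d, injective v,
 principal_colons R & exists t : 'I_d -> R, @nonunits R = ideal_gen (range t)].
Proof.
have [nR lR [d [kd ht]]] := regR; exists d.
have [|dom N] := regular_local_dim2 regR kd (stalk_dim kd).
 by exists [set r | v r = 0]; [apply: kernel_prime|move=> q hq r /stalk_ker; apply].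
split=> // r s e; apply/eqP; rewrite -subr_eq0; apply/eqP.
have := @stalk_ker (r - s) _ [set 0]; apply.
 by rewrite rmorphB e subrr.
split; [exact: zero_ideal|by have [] := lR|by move=> a b /= /dom].
Qed.

End Stalk.

Hypothesis regX : regular_scheme X.

Lemma regular_val_inj U (s : OO X U) : U xi -> val s = 0 -> s = 0.
Proof.
move=> Uxi v0; apply: local_eq => x Ux.
have [R [germ [hst regR]]] := regX x.
have [v vE] := stalk_value hst.
have [d [_ vinj _ _]] := stalk_regular hst regR vE.
have [_ _ h0] := hst.
have [|V [h [Vx e]]] := h0 U Ux s; first by apply: vinj; rewrite vE v0 rmorph0.
by exists V, h; rewrite e rmorph0.
Qed.

End RegularStalks.

(** * Regular points and discrete valuations *)

Section Closure.
Variables (K : fieldType) (X : fscheme K).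

Lemma gen_opens (x y : X) (U : opens X) : closure [set y] x -> U x -> U y.
Proof.
move=> cl Ux; have [|z [-> //]] := cl U.
by apply: open_nbhs_nbhs; split=> //; apply: oset_open.
Qed.

Lemma opens_gen (x y : X) : (forall U : opens X, U x -> U y) -> closure [set y] x.
Proof.
move=> h N; rewrite nbhsE => -[W [oW Wx] WN]; exists y; split=> //; apply: WN.
exact: (h (Opens oW)).
Qed.

Lemma gen_sub (x y : X) : closure [set y] x -> floc x `<=` floc y.
Proof. by move=> cl z [U [s [Ux <-]]]; apply: floc_val; apply: gen_opens Ux. Qed.

Lemma gen_fgen (x : X) : closure [set fgen X] x.
Proof. by apply: opens_gen => U /fgenP. Qed.

Lemma floc_nonunit_prime (x : X) : pideal (floc x) (nonunit (floc x)).
Proof. exact: nonunit_prime (floc_sr x) (floc_ideal x). Qed.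

(** Primes of a local ring are the generizations of the point; they are found in a chart by
    contraction. *)
Lemma prime_point (x : X) P : pideal (floc x) P ->
 exists y, [/\ closure [set y] x, floc y = loc (floc x) P & floc x `&` nonunit (floc y) = P].
Proof.
move=> hP; have [iP P1 PM] := hP; have Pn := prime_sub_nonunit hP.
have [U [B [Ux hU]]] := exists_chart x; have sB := chart_sr hU; have BF := chart_sub hU Ux.
have sx := floc_sr x.
have hp := contract_prime sB BF hP.
have [y Uy ey] := chart_surj hU hp.
have eloc : floc y = loc (floc x) P.
 rewrite (chart_loc hU Uy) ey; apply/esym/loc_contract_eq => // z.
 rewrite {1}(chart_loc hU Ux) => /(locP (chart_prime hU Ux)) [a [b [Ba Bb nb _ ->]]].
 by apply: (locE hp) => // -[_ /Pn h]; apply: nb.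
exists y; split=> //.
 apply: opens_gen => W Wx; have [b [Bb nb Db]] := chart_nbhs hU (oset_open W) Wx Ux.
 apply: Db; split=> // nby; apply: nb; apply: Pn.
 by have : trace floc B y b by []; rewrite ey => -[].
by rewrite eloc; apply: loc_trace.
Qed.

(* The local ring at e is a discrete valuation ring with uniformizer pi (it is
  noetherian here). *)
Definition dvr_pt (e : X) (pi : K) : Prop :=
 [/\ pi != 0, nonunit (floc e) pi & forall z, nonunit (floc e) z -> floc e (z / pi)].

End Closure.

Section RegularPoints.
Variables (K : fieldType) (A0 : set K) (X : fscheme K).
Hypothesis sA : subring A0.
Hypothesis frac0 : forall z : K, exists a b, [/\ A0 a, A0 b, b != 0 & z = a / b].
Hypothesis chain3 : no_chains3 A0.
Hypothesis regX : regular_scheme X.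
Hypothesis A0loc : forall x : X, A0 `<=` floc x.

Lemma stalk_at (x : X) : exists (R : comPzRingType) (v : {rmorphism R -> K}) d,
 [/\ range v = floc x, injective v, regular_local R, krull_dim R d &
  principal_colons R /\ exists t : 'I_d -> R, @nonunits R = ideal_gen (range t)].
Proof.
have [R [germ [hst regR]]] := regX x.
have [v vE] := @stalk_value K X (fgen X) (@fgenP K X) (@fval K X) (@fvalB K X) (@fvalM K X)
 (@fval1 K X) (@fval_res K X) x R germ hst.
have valA z : A0 z -> exists s : OO X (opensT X), fval s = z.
 by move=> Az; apply: fval_glue => // y _; apply: A0loc.
have ker (U : opens X) (s : OO X U) : U (fgen X) -> fval s = 0 ->
  exists (W : opens X) (h : W `<=` U), W (fgen X) /\ rres h s = 0.
 by move=> Ug e; exists U, (@subset_refl _ _); rewrite (fval_inj0 Ug e) rmorph0.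
have [d [kd vi N ht]] := @stalk_regular K A0 chain3 X (fgen X) (@fgenP K X) (@fval K X)
 (@fvalM K X) (@fval_res K X) valA ker x R germ hst regR v vE.
exists R, v, d; split=> //; apply/seteqP; split=> z.
 move=> [r _ <-]; have [_ hs _] := hst; have [U [hU [s <-]]] := hs r.
 by rewrite vE; apply: floc_val.
by move=> [U [s [Ux <-]]]; exists (germ U Ux s).
Qed.

Lemma stalk_unit (R : comPzRingType) (v : {rmorphism R -> K}) (x : X) r :
 range v = floc x -> injective v -> nonunits r <-> nonunit (floc x) (v r).
Proof.
move=> ev vi; split=> [nr|[_ nu] [s e]].
 split; first by rewrite -ev; exists r.
 rewrite -ev => -[v0 [s _ es]]; apply: nr; exists s; apply: vi.
 by rewrite rmorphM es mulfV // rmorph1.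
have evs : v r * v s = 1 by rewrite -rmorphM e rmorph1.
have v0 : v r != 0 by apply: contra_eq_neq evs => ->; rewrite mul0r eq_sym oner_neq0.
apply: nu; split=> //; rewrite -ev; exists s => //.
by apply: (mulfI v0); rewrite evs divff.
Qed.

Lemma dvr_order (e : X) pi z : dvr_pt e pi -> z != 0 -> floc e z ->
 exists n, floc e (z / pi ^+ n) /\ floc e (z / pi ^+ n)^-1.
Proof.
move=> [pi0 npi hpi] z0 Fz; have [R [v [d [ev vi [nR lR _] _ _]]]] := stalk_at e.
have inv w : floc e w -> exists r, v r = w by rewrite -ev => -[r _ <-]; exists r.
have [b eb] := inv pi npi.1; have [r er] := inv z Fz.
have [||||u [n [[u' eu] er']]] := @local_order R nR lR [set 0] b _ _ _ r.
- exact: zero_ideal.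
- move=> s /(stalk_unit _ ev vi) /hpi/inv [c ec]; exists c; apply: vi.
 by rewrite rmorph0 rmorphB rmorphM ec eb divfK // subrr.
- by apply/(stalk_unit _ ev vi); rewrite eb.
- by move=> /= r0; move: z0; rewrite -er r0 rmorph0 eqxx.
have {er'} ez : z = v u * pi ^+ n.
 by rewrite -er -eb -rmorphXn -rmorphM; apply/eqP; rewrite -subr_eq0 -rmorphB er' rmorph0.
have pn0 := expf_neq0 n pi0; exists n; rewrite ez mulfK //; split; rewrite -ev; first by exists u.
exists u' => //; have {}eu : v u * v u' = 1 by rewrite -rmorphM eu rmorph1.
have u0 : v u != 0 by apply: contra_eq_neq eu => ->; rewrite mul0r eq_sym oner_neq0.
by apply: (mulfI u0); rewrite eu divff.
Qed.

Lemma dvr_orderZ (e : X) pi z : dvr_pt e pi -> z != 0 -> exists n m,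
 floc e (z * pi ^+ m / pi ^+ n) /\ floc e (z * pi ^+ m / pi ^+ n)^-1.
Proof.
move=> hd z0; have [a [b [Aa Ab b0 ez]]] := frac0 z.
have [pi0 _ _] := hd; have a0 : a != 0 by apply: contraNneq z0 => a0; rewrite ez a0 mul0r.
have [n [h1 h2]] := dvr_order hd a0 (A0loc e Aa); have [m [h3 h4]] := dvr_order hd b0 (A0loc e Ab).
have pn0 := expf_neq0 n pi0; have pm0 := expf_neq0 m pi0; have se := floc_sr e.
exists n, m; rewrite (_ : z * pi ^+ m / pi ^+ n = (a / pi ^+ n) * (b / pi ^+ m)^-1).
 by split; last rewrite invfM invrK; apply: (subM se).
by rewrite ez; fld.
Qed.

Lemma dvr_valring (e : X) pi : dvr_pt e pi -> valring (floc e).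
Proof.
move=> hd; have se := floc_sr e; split=> // z.
have [->|z0] := eqVneq z 0; first by left; apply: (sub0 se).
have [n [m [h1 h2]]] := dvr_orderZ hd z0; have [pi0 [Fpi _] _] := hd.
have pn0 := expf_neq0 n pi0; have pm0 := expf_neq0 m pi0.
have [le|/ltnW le] := leqP m n; [left|right].
 have -> : z = (z * pi ^+ m / pi ^+ n) * pi ^+ (n - m).
  by have pnm := expf_neq0 (n - m) pi0; rewrite -{1}(subnK le) exprD; fld.
 by apply: (subM se) => //; apply: (subX se).
have -> : z^-1 = (z * pi ^+ m / pi ^+ n)^-1 * pi ^+ (m - n).
 by have pnm := expf_neq0 (m - n) pi0; rewrite -{1}(subnK le) exprD; fld.
by apply: (subM se) => //; apply: (subX se).
Qed.

(** Local rings of a regular surface are intersections of discrete valuation rings. For z = r / s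
    outside the local ring, [principal_colons] gives a principal prime wR; its point e has
    uniformizer w, and a denominator of z outside wR would contradict the description of the colon
    ideal. *)
Lemma dvr_detect (x : X) z : ~ floc x z ->
 exists e pi, [/\ closure [set e] x, dvr_pt e pi & ~ floc e z].
Proof.
move=> nz; have [R [v [d [ev vi _ _ [N _]]]]] := stalk_at x.
have inv w : floc x w -> exists r, v r = w by rewrite -ev => -[r _ <-]; exists r.
have [a [b [Aa Ab b0 ez]]] := frac0 z.
have [r er] := inv a (A0loc x Aa); have [s es] := inv b (A0loc x Ab).
have s0 : s <> 0 by move=> s0; move: b0; rewrite -es s0 rmorph0 eqxx.
have [|c [w [w0 hw hN]]] := N r s s0.
 move=> [c ec]; apply: nz; rewrite -ev; exists c => //.
 by rewrite ez -er -es ec rmorphM mulrAC mulfV ?mul1r // es.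
pose P := [set v u | u in [set u : R | exists g, u = g * w]].
have ker s' : v s' = 0 -> exists g, s' = g * w.
 by rewrite -(rmorph0 v) => /vi ->; exists 0; rewrite mul0r.
have [hP _] := image_pideal hw ker; rewrite ev in hP.
have [e [cl el en]] := prime_point hP.
have w0' : v w != 0 by apply/eqP; rewrite -(rmorph0 v) => /vi.
have Pw : P (v w) by exists w => //; exists 1; rewrite mul1r.
exists e, (v w); split=> //.
 have [_ nw] : (floc x `&` nonunit (floc e)) (v w) by rewrite en.
 split=> //.
 move=> y; rewrite el => /(nonunit_locP hP) [_ [t [[_ [g ->] <-] Ft nt ->]]].
 have t0 := primeN0 hP nt.
 rewrite rmorphM (_ : v g * v w / t / v w = v g / t); last by fld.
 by apply: (locE hP) => //; rewrite -ev; exists g.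
rewrite el => -[f [t [Ff Ft nt e']]]; apply: nt.
have [f' ef] := inv f Ff; have [t' et] := inv t Ft.
exists t' => //; apply/(hN t').1; exists (c * f'); apply: vi.
have {}e' : v r * v t' = v f' * v s.
 by rewrite ef -e' et er es ez mulrAC divfK.
rewrite !rmorphM; have -> : v t' * (v c * v r) = v c * (v r * v t') by ring.
by rewrite e'; ring.
Qed.

(** A chain of two steps in the stalk would give two successive generizations of x, against
    codimension one. So the stalk has dimension at most one, and by regularity its maximal ideal is
    principal. *)
Lemma codim1_dvr (x : X) : codim x 1 -> (exists2 z, z != 0 & nonunit (floc x) z) ->
 exists pi, dvr_pt x pi.
Proof.
move=> [_ cmax] [z z0 nz]; have [R [v [d [ev vi rR kd [_ [t ht]]]]]] := stalk_at x.
have inv w : floc x w -> exists r, v r = w by rewrite -ev => -[r _ <-]; exists r.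
have [r er] := inv z nz.1.
have nr : nonunits r by apply/(stalk_unit _ ev vi); rewrite er.
have d1 : (d <= 1)%N.
 rewrite leqNgt; apply/negP => d2; have [[c [cP clt]] _] := kd.
 have h0 : is_prime (c 0%N) by apply: cP.
 have h1 : is_prime (c 1%N) by apply: cP; apply: ltnW.
 have h2 : is_prime (c 2%N) by apply: cP.
 have [l01 n01] := clt 0%N (ltnW d2); have [l12 n12] := clt 1%N d2.
 pose P := v @` c 1%N.
 have [|hP inj] := image_pideal (v := v) h1.
  by move=> u; rewrite -(rmorph0 v) => /vi ->; case: h1 => -[].
 rewrite ev in hP.
 have [y [cl el en]] := prime_point hP.
 have : (2 <= 1)%N; last by [].
 apply: (cmax 2%N (fun i => if i is 0%N then x else if i is 1%N then y else fgen X)).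
 split=> // -[|[|//]] _; split=> //.
 - move=> exy; apply: n12 => u c2u; apply/inj; rewrite -en -exy; split; first by rewrite -ev; exists u.
  by apply/(stalk_unit _ ev vi); apply: (prime_nonunit h2).
 - exact: gen_fgen.
 - move=> eyx; apply: n01 => u c1u.
  have : (floc x `&` nonunit (floc y)) (v u) by rewrite en; apply/inj.
  rewrite eyx => -[_ /(@mgen_nonunit K (fmodel X))].
  by rewrite -(rmorph0 v) => /vi ->; case: h0 => -[].
case: d t ht d1 {kd} => [|[|//]] t ht _.
 move: nr; rewrite ht ideal_gen_range => -[c]; rewrite big_ord0 => r0.
 by move: z0; rewrite -er r0 rmorph0 eqxx.
have tE s : nonunits s -> exists c, s = c * t ord0.
 by rewrite ht ideal_gen_range => -[c ->]; exists (c ord0); rewrite big_ord1.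
exists (v (t ord0)); have [c ec] := tE r nr.
have t0 : v (t ord0) != 0.
 by apply: contraNneq z0 => t0; rewrite -er ec rmorphM t0 mulr0.
split=> //.
 by apply/(stalk_unit _ ev vi); rewrite ht; apply: ideal_gen_sub; exists ord0.
move=> w nw; have [s es] := inv w nw.1.
have [|c' ec'] := tE s; first by apply/(stalk_unit _ ev vi); rewrite es.
by rewrite -es ec' rmorphM mulfK // -ev; exists c'.
Qed.

Lemma order_geP (e : X) pi (U : opens X) (s : OO X U) n : U e -> dvr_pt e pi ->
 order_ge e n s <-> floc e (fval s / pi ^+ n).
Proof.
move=> Ue [pi0 npi hpi]; have pn0 := expf_neq0 n pi0; have se := floc_sr e.
split.
 move=> [V [h [Ve hg]]]; rewrite -(fval_res h); last exact: fgenP Ve.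
 have := hg [set t : OO X V | floc e (fval t / pi ^+ n)]; apply.
  split=> [|a b ha hb|a b hb] /=.
  - by rewrite fval0 mul0r; apply: (sub0 se).
  - by rewrite fvalD mulrDl; apply: (subD se).
  - by rewrite fvalM -mulrA; apply: (subM se) => //; apply: floc_val.
 move=> _ [t ht ->] /=; have {}ht i : floc e (fval (t i) / pi).
  apply: hpi; apply: contrapT => nu; apply: (ht i); exact/finvP.
 have [g hgv] := fval_rmorph (fgenP Ve).
 rewrite -hgv rmorph_prod (_ : _ / _ = \prod_i (fval (t i) / pi)).
  by elim/big_rec: _ => [|i y _ hy]; [apply: (sub1 se)|apply: (subM se)].
 rewrite big_split prodr_const card_ord exprVn /=; congr (_ / _).
 by apply: eq_bigr => i _; rewrite hgv.
move=> hs; have [V [p [c [Ve ep ec]]]] := flocP2 npi.1 hs.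
have hl : opensI U V `<=` U by move=> y [].
have hr : opensI U V `<=` V by move=> y [].
have UVe : opensI U V e by [].
have g := fgenP UVe; exists (opensI U V), hl; split=> //.
have -> : rres hl s = rres hr c * \prod_(i < n) rres hr p.
 apply: fval_inj; rewrite prodr_const card_ord fvalM fvalX // !fval_res // ep ec divfK //.
have [_ _ M] := ideal_gen_ideal [set a | exists2 t : 'I_n -> OO X (opensI U V),
 (forall i, ~ invertible_at e (t i)) & a = \prod_i t i].
apply: (M); apply: ideal_gen_sub; exists (fun _ => rres hr p) => // i.
by move=> /(finvP _ UVe); rewrite fval_res // ep; apply.
Qed.

End RegularPoints.

(** * Finite modules *)

Section FiniteModules.
Variables (K : fieldType) (A0 : set K) (k : fieldType) (kap : {rmorphism k -> K}).
Hypotheses (sA : subring A0) (kA : forall c, A0 (kap c)).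
Hypothesis resA : forall a, A0 a -> exists c, nonunit A0 (a - kap c).
Hypothesis noethA : forall J, ideal A0 J -> exists n (t : 'I_n -> K), (forall i, J (t i)) /\
 forall z, J z -> exists c : 'I_n -> K, (forall i, A0 (c i)) /\ z = \sum_i c i * t i.
Hypothesis localA : ideal A0 (nonunit A0).

Definition subm (D : set K) : Prop :=
 [/\ D 0, forall a b, D a -> D b -> D (a + b) & forall a b, A0 a -> D b -> D (a * b)].

Lemma submN D a : subm D -> D a -> D (- a).
Proof. by move=> [_ _ M] Da; rewrite -mulN1r; apply: M => //; apply: (subN sA); apply: (sub1 sA). Qed.

Lemma submB D a b : subm D -> D a -> D b -> D (a - b).
Proof. by move=> sD Da Db; have [_ P _] := sD; apply: P => //; apply: submN. Qed.

Lemma subm_sum D (I : Type) (r : seq I) (F : I -> K) : subm D -> (forall i, D (F i)) ->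
 D (\sum_(i <- r) F i).
Proof. by move=> [D0 DD _] h; elim/big_rec: _ => // i x _; apply: DD. Qed.

(** The sum D + C u_1 + ... + C u_r, by recursion on the list. The coefficients C are A0 for finite
    generation and the copy of k for finite dimension. *)
Fixpoint spanD (C D : set K) (us : seq K) : set K :=
 if us is u :: us' then [set z | exists2 c, C c & spanD C D us' (z - c * u)] else D.

Lemma spanD_base C D us d : C 0 -> D d -> spanD C D us d.
Proof. by move=> C0 Dd; elim: us => [//|u us IH]; exists 0; rewrite // mul0r subr0. Qed.

Lemma spanD_mem C D us u : C 0 -> C 1 -> D 0 -> u \in us -> spanD C D us u.
Proof.
move=> C0 C1 D0; elim: us => [//|w us IH]; rewrite inE => /predU1P [->|/IH h].
 by exists 1; rewrite // mul1r subrr; apply: spanD_base.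
by exists 0; rewrite // mul0r subr0.
Qed.

Lemma spanD_cat C D us ws x y : (forall a b, D a -> D b -> D (a + b)) ->
 spanD C D us x -> spanD C D ws y -> spanD C D (us ++ ws) (x + y).
Proof.
move=> DD; elim: us x => [|u us IH] x /=; last first.
 by move=> [c Cc /IH h] /h hy; exists c; rewrite // addrAC.
elim: ws y => [|w ws IH] y Dx /=; first exact: DD.
by move=> [c Cc /(IH _ Dx) hy]; exists c; rewrite // -addrA.
Qed.

Lemma spanD_map C D ws (I : Type) (r : seq I) (c f : I -> K) z : (forall i, C (c i)) ->
 spanD C D ws (z - \sum_(i <- r) c i * f i) -> spanD C D ([seq f i | i <- r] ++ ws) z.
Proof.
move=> Cc; elim: r z => [|i r IH] z; first by rewrite big_nil subr0.
by rewrite big_cons opprD addrA => /IH h; exists (c i).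
Qed.

Lemma spanD_subm D us : subm D -> subm (spanD A0 D us).
Proof.
move=> sD; elim: us => [//|u us [S0 SD SM]]; split.
- by exists 0; [exact: (sub0 sA)|rewrite mul0r subr0].
- move=> a b [c Ac ha] [d Ad hb]; exists (c + d); first exact: (subD sA).
 by rewrite mulrDl opprD addrACA; apply: SD.
- move=> a b Aa [c Ac hb]; exists (a * c); first exact: (subM sA).
 by rewrite -mulrA -mulrBr; apply: SM.
Qed.

(** Induction on the generators: the coefficients of u in elements of M form an ideal J. Lifts of
    generators of J reduce M to the part spanned by the remaining generators. *)
Lemma submodule_fg D M us : subm D -> subm M -> D `<=` M -> M `<=` spanD A0 D us ->
 exists2 ws, forall w, w \in ws -> M w & M `<=` spanD A0 D ws.
Proof.
move=> sD; elim: us M => [|u us IH] M sM DM Mu; first by exists [::].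
have [M0 MD MM] := sM; have sS := spanD_subm us sD; have [S0 SD SM] := sS.
pose J := [set c | A0 c /\ exists2 y, spanD A0 D us y & M (y + c * u)].
have iJ : ideal A0 J.
 split; first by move=> c [].
 - by split; [apply: (sub0 sA)|exists 0; rewrite ?mul0r ?addr0].
 - move=> a b [Aa [y hy My]] [Ab [y' hy' My']]; split; first exact: (subD sA).
  by exists (y + y'); [exact: SD|rewrite mulrDl addrACA; apply: MD].
 - move=> a b Aa [Ab [y hy My]]; split; first exact: (subM sA).
  by exists (a * y); [exact: SM|rewrite -mulrA -mulrDr; apply: MM].
have [m [t [Jt genJ]]] := noethA iJ.
have /choice [y hy] i : exists y, spanD A0 D us y /\ M (y + t i * u).
 by have [_ [y]] := Jt i; exists y.
have [|d Dd|z [_ //]|ws Mw hw] := IH (M `&` spanD A0 D us).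
- split=> // [a b [h1 h2] [h3 h4]|a b Aa [h1 h2]]; first by split; [apply: MD|apply: SD].
 by split; [apply: MM|apply: SM].
- by split; [apply: DM|apply: spanD_base => //; apply: (sub0 sA)].
exists ([seq y i + t i * u | i <- enum 'I_m] ++ ws).
 by move=> w; rewrite mem_cat => /orP [/mapP [i _ ->]|/Mw []//]; case: (hy i).
move=> z Mz; have [c Ac hz] := Mu z Mz; have [|a [Aa ec]] := genJ c.
 by split=> //; exists (z - c * u); rewrite // subrK.
apply: (spanD_map Aa); apply: hw; split.
 by apply: (submB sM Mz); apply: (subm_sum _ sM) => i; apply: MM => //; case: (hy i).
rewrite (_ : z - _ = z - c * u - \sum_(i <- enum 'I_m) a i * y i).
 by apply: (submB sS hz); apply: (subm_sum _ sS) => i; apply: SM => //; case: (hy i).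
rewrite -addrA -opprD ec mulr_suml -(big_enum _ _ _ (fun i => a i * t i * u)) -big_split; congr (_ - _).
by apply: eq_bigr => i _ /=; ring.
Qed.

Lemma kspan_span D ws : subm D ->
 (forall w, w \in ws -> exists us, forall a, A0 a -> spanD (range kap) D us (a * w)) ->
 exists us, spanD A0 D ws `<=` spanD (range kap) D us.
Proof.
move=> sD; elim: ws => [|w ws IH] h; first by exists [::].
have [x hx|us hus] := IH; first by apply: h; rewrite inE hx orbT.
have [us' hus'] := h w (mem_head _ _); exists (us' ++ us) => z [c Ac hz].
by rewrite -(subrKC (c * w) z); apply: spanD_cat; [case: sD|apply: hus'|apply: hus].
Qed.

(* A module over A0 = k + m that is generated by one element killed by powers of
  the generators of m is a finite-dimensional vector space over k. *)
Lemma torsion_cyclic D v : subm D -> (forall a, nonunit A0 a -> exists n, D (a ^+ n * v)) ->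
 exists us, forall a, A0 a -> spanD (range kap) D us (a * v).
Proof.
move=> sD tor; have [D0 DD DM] := sD.
have [d [x [mx gen]]] := noethA localA.
have /choice [N hN] : forall i, exists n, D (x i ^+ n * v) by move=> i; apply: tor.
have Ax i : A0 (x i) by have [] := mx i.
(* downward induction on the exponents of a monomial in the x i *)
suff H b (e : 'I_d -> nat) : (\sum_i (N i - e i) < b)%N ->
  exists us, forall a, A0 a -> spanD (range kap) D us (a * ((\prod_i x i ^+ e i) * v)).
 have [us hus] := H _ (fun _ => 0%N) (ltnSn _).
 by exists us => a Aa; have := hus a Aa; rewrite big1 ?mul1r.
elim: b e => // b IH e; rewrite ltnS => le.
have [[i hi]|ne] := EM (exists i : 'I_d, (N i <= e i)%N).
 exists [::] => a Aa; apply: (DM) => //; rewrite (bigD1 i) //= -(subnK hi) exprD.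
 have Ap : A0 (\prod_(j < d | j != i) x j ^+ e j).
  by elim/big_rec: _ => [|j y _ hy]; [apply: (sub1 sA)|apply: (subM sA) => //; apply: subX].
 rewrite (_ : _ * v = x i ^+ (e i - N i) * (\prod_(j < d | j != i) x j ^+ e j) * (x i ^+ N i * v)); last by ring.
 by apply: (DM) => //; apply: (subM sA) => //; apply: subX.
have lt i : (e i < N i)%N by rewrite ltnNge; apply/negP => h; apply: ne; exists i.
pose e' (i j : 'I_d) := (e j + (j == i))%N; set w := _ * v.
have [_ /mapP [i _ ->]|us hus] := @kspan_span D [seq (\prod_j x j ^+ e' i j) * v | i <- enum 'I_d] sD.
 apply: IH; apply: leq_trans le; rewrite (bigD1 i) //= [X in (_ < X)%N](bigD1 i) //= /e' eqxx addn1.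
 rewrite (eq_bigr (fun j => (N j - e j)%N)) => [|j /negPf ->]; last by rewrite addn0.
 by rewrite ltn_add2r subnS prednK // subn_gt0.
exists (w :: us) => a Aa; have [c mc] := resA Aa; exists (kap c); first by exists c.
have [c' [Ac' ec']] := gen _ mc; apply: hus; rewrite -[X in spanD A0 D X]cats0; apply: (spanD_map Ac').
rewrite -mulrBl ec' big_enum mulr_suml (eq_bigr (fun i => c' i * (\prod_j x j ^+ e' i j * v))) ?subrr // => i _.
rewrite /w /e' (bigD1 i) //= [in RHS](bigD1 i) //= eqxx addn1 exprS.
rewrite [in RHS](eq_bigr (fun j => x j ^+ e j)) => [|j /negPf ->]; last by rewrite addn0.
ring.
Qed.

End FiniteModules.

(* A chain of k-subspaces is not longer than the number of generators. *)
Lemma kspan_chain (K k : fieldType) (R0 : pzRingType) (T : lmodType R0) (rho : {rmorphism k -> R0})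
  (kap : {rmorphism k -> K})
  (D : set K) (us : seq K) (c : nat -> set T) n (rel : T -> K -> Prop) :
 (forall i, (i <= n)%N -> c i 0 /\ forall l x y, c i x -> c i y -> c i (rho l *: x + y)) ->
 (forall i, (i < n)%N -> c i `<` c i.+1) ->
 D 0 -> (forall a b, D a -> D b -> D (a + b)) -> (forall l a, D a -> D (kap l * a)) ->
 rel 0 0 ->
 (forall l x y a b, rel x a -> rel y b -> rel (rho l *: x + y) (kap l * a + b)) ->
 (forall x, c n x -> exists2 a, rel x a & spanD (range kap) D us a) ->
 (forall x a, rel x a -> D a -> c 0%N x) -> (n <= size us)%N.
Proof.
move=> cS clt D0 DD DM r0 rD hsp hker; rewrite leqNgt; apply/negP => Rn.
have cle i j : (i <= j)%N -> (j <= n)%N -> c i `<=` c j.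
 elim: j => [|j IH]; first by rewrite leqn0 => /eqP -> _ z.
 rewrite leq_eqVlt => /predU1P [-> _ z //|ij jn].
 by apply: (subset_trans (IH ij (ltnW jn))); have [] := clt j jn.
have /choice [x hx] : forall i : 'I_n, exists x, c i.+1 x /\ ~ c i x.
 move=> i; have [_ h] := clt i (ltn_ord i).
 by apply: contrapT => h'; apply: h => x cx; apply: contrapT => nx; apply: h'; exists x.
have /choice [a ha] : forall i : 'I_n, exists a, rel (x i) a /\ spanD (range kap) D us a.
 move=> i; have [|a h1 h2] := hsp (x i); last by exists a.
 by apply: (cle i.+1 n) => //; case: (hx i).
have coord z : spanD (range kap) D us z -> exists d, D d /\ exists l : nat -> k, z = d + \sum_(j < size us) kap (l j) * us`_j.
 elim: us z {hsp Rn ha} => [|u us IH] z /=; first by exists z; split=> //; exists (fun _ => 0); rewrite big_ord0 addr0.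
 move=> [_ [c0 _ <-] /IH [d [Dd [l e]]]]; exists d; split=> //; exists (fun j => if j is j.+1 then l j else c0).
 by rewrite big_ord_recl addrCA -e addrC subrK.
have /choice [d hd] i : exists d, D d /\ exists l : nat -> k, a i = d + \sum_(j < size us) kap (l j) * us`_j.
 by apply: coord; case: (ha i).
have /choice [L hL] i : exists l : nat -> k, a i = d i + \sum_(j < size us) kap (l j) * us`_j by case: (hd i).
pose M : 'M[k]_(n, size us) := \matrix_(i, j) L i j.
(* The coordinate matrix has more rows than columns, so its rows satisfy a nontrivial linear
   relation over k. *)
have [mu mu0 muM] : exists2 mu : 'rV[k]_n, mu != 0 & mu *m M = 0.
 exists (nz_row (kermx M)); last by apply: sub_kermxP; apply: nz_row_sub.
 rewrite nz_row_eq0 kermx_eq0; apply/negP => /eqP h.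
 by have := rank_leq_col M; rewrite h leqNgt Rn.
pose X := \sum_i rho (mu 0 i) *: x i.
have sumrel (s : seq 'I_n) : rel (\sum_(i <- s) rho (mu 0 i) *: x i) (\sum_(i <- s) kap (mu 0 i) * a i).
 elim: s => [|i s IH]; first by rewrite !big_nil.
 by rewrite !big_cons; apply: rD => //; case: (ha i).
have cX : c 0%N X.
 apply: hker (sumrel _) _; rewrite (eq_bigr (fun i => kap (mu 0 i) * d i +
   \sum_(j < size us) kap (mu 0 i * L i j) * us`_j)); last first.
  by move=> i _; rewrite hL mulrDr mulr_sumr; congr (_ + _); apply: eq_bigr => j _; rewrite rmorphM mulrA.
 rewrite big_split exchange_big /= [X in _ + X]big1 ?addr0.
  by elim/big_rec: _ => // i y _ hy; apply: DD => //; apply: DM; case: (hd i).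
 move=> j _; rewrite -mulr_suml -rmorph_sum (_ : \sum_i _ = 0) ?rmorph0 ?mul0r //.
 have := congr1 (fun A : 'rV_(size us) => A 0 j) muM; rewrite !mxE => {2}<-.
 by apply: eq_bigr => i _; rewrite mxE.
(* With i the last index occurring in the relation, the chosen element of step i + 1 is expressed by
   elements of step i, against its choice. *)
have [i0 hi0] : exists i, mu 0 i != 0.
 apply: contrapT => h; move/eqP: mu0; apply; apply/rowP => i; rewrite mxE.
 by apply/eqP/negPn/negP => h'; apply: h; exists i.
pose i := [arg max_(j > i0 | mu (0%R : 'I_1) j != 0%R) (j : nat)]%N.
have [mi imax] : mu 0 i != 0 /\ forall j, mu 0 j != 0 -> (j <= i)%N.
 by rewrite /i; case: arg_maxnP.
have [cxi ncxi] := hx i; apply: ncxi.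
have [c00 cS0] := cS i (ltnW (ltn_ord i)).
have ceq : x i = rho (mu 0 i)^-1 *: (X + rho (-1) *: \sum_(j < n | j != i) rho (mu 0 j) *: x j).
 by rewrite /X (bigD1 i) //= rmorphN1 scaleN1r addrK scalerA -rmorphM mulVf // rmorph1 scale1r.
have rest : c i (\sum_(j < n | j != i) rho (mu 0 j) *: x j).
 elim/big_rec: _ => // j y ji hy.
 have [->|mj] := eqVneq (mu 0 j) 0; first by rewrite rmorph0 scale0r add0r.
 apply: cS0 => //; have lt : (j < i)%N by rewrite ltn_neqAle ji imax.
 by have [h _] := hx j; apply: (cle j.+1 i lt (ltnW (ltn_ord i))).
rewrite ceq -[X in c i X]addr0; apply: (cS0) => //.
rewrite addrC; apply: (cS0) => //; apply: (cle 0%N i) => //; exact: ltnW.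
Qed.

Section Spans.
Variable K : fieldType.
Implicit Types (R S N good : set K) (v ws : seq K) (x z : K).

Definition spn R ws : set K :=
 [set z | forall N : set K, subm R N -> (forall w, w \in ws -> N w) -> N z].

Lemma spn_sub R ws : subm R (spn R ws).
Proof.
split=> [N [] //|a b ha hb N sN hN|a b Aa hb N sN hN].
 by have [_ D _] := sN; apply: D; [apply: ha|apply: hb].
by have [_ _ M] := sN; apply: M => //; apply: hb.
Qed.

Lemma spn_mem R ws w : w \in ws -> spn R ws w.
Proof. by move=> hw N _; apply. Qed.

Lemma spn_sr R S ws : subring S -> R `<=` S -> (forall w, w \in ws -> S w) -> spn R ws `<=` S.
Proof.
move=> sS RS hw z; apply=> //; split; first exact: sub0.
 by move=> a b; apply: subD.
by move=> a b Ra; apply: (subM sS); apply: RS.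
Qed.

Lemma shift_subm R z N : subm R N -> subm R [set y | N (y * z)].
Proof.
move=> [N0 ND NM]; split=> [|a b ha hb|a b Aa hb] /=; first by rewrite mul0r.
 by rewrite mulrDl; apply: ND.
by rewrite -mulrA; apply: NM.
Qed.

Lemma spn_stable R v x z : (forall y, y \in v -> spn R v (y * x)) -> spn R v z -> spn R v (z * x).
Proof. by move=> h hz; apply: (hz [set z | spn R v (z * x)]); first exact: (shift_subm _ (spn_sub R v)). Qed.

Lemma stable_sr R v : subring R -> R `<=` [set x | forall y, spn R v y -> spn R v (y * x)] /\
 subring [set x | forall y, spn R v y -> spn R v (y * x)].
Proof.
move=> sR; have sv := spn_sub R v; split=> [a Ra y hy|]; first by rewrite mulrC; case: sv => _ _; apply.
split=> [y|a b ha hb y hy|a b ha hb y hy]; first by rewrite mulr1.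
 by rewrite mulrBr; apply: (submB sR sv); [exact: ha|exact: hb].
by rewrite mulrA; apply: hb; apply: ha.
Qed.

Lemma subm_adjoin R x N : subring R -> subm R N -> (forall z, N z -> N (x * z)) -> subm (adjoin R x) N.
Proof.
move=> sR sN hx; have [N0 ND NM] := sN; split=> // c z hc; move: z.
apply: (@adjoin_min _ R x [set c | forall z, N z -> N (c * z)]) hc => //; last by move=> a Ra z; apply: NM.
split=> [z|a b ha hb z hz|a b ha hb z hz]; first by rewrite mul1r.
 by rewrite mulrBl; apply: (submB sR sN); [exact: ha|exact: hb].
by rewrite -mulrA; apply: ha; apply: hb.
Qed.

(* Finitely many integral elements generate a finite module; [good] is a property of its
  generating monomials. *)
Lemma finite_span R (good : set K) (G : seq K) : subring R -> good 1 ->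
 (forall x z, good x -> good z -> good (x * z)) ->
 (forall x, x \in G -> integral R x /\ good x) ->
 exists v : seq K, [/\ forall x, x \in v -> good x, spn R v 1 &
  forall x z, x \in G -> spn R v z -> spn R v (z * x)].
Proof.
move=> sR g1 gM; elim: G => [|x G IH] hG.
 exists [:: 1]; split=> //; first by move=> x; rewrite inE => /eqP ->.
 by apply: spn_mem; rewrite mem_head.
have [|v [gv v1 hv]] := IH; first by move=> z hz; apply: hG; rewrite inE hz orbT.
have [[d [c [Ac ex]]] gx] := hG x (mem_head _ _).
pose v' := [seq a * x ^+ i | a <- v, i <- iota 0 d.+1]; have sv := spn_sub R v'; have [T0 TD TM] := sv.
have lift i z : (i <= d)%N -> spn R v z -> spn R v' (z * x ^+ i).
 move=> id hz; apply: (hz [set z | spn R v' (z * x ^+ i)]); first exact: (shift_subm _ sv).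
 move=> a av; apply: spn_mem; apply/allpairsP; exists (a, i).
 by rewrite mem_iota add0n ltnS.
exists v'; split.
- move=> _ /allpairsP [[a i] [/= av _ ->]]; apply: (gM); first exact: gv.
 by elim: i => [|i IHi]; rewrite ?expr0 // exprS; apply: gM.
- by have := lift 0%N _ isT v1; rewrite expr0 mulr1.
- move=> y z; rewrite inE => yG hz; apply: (spn_stable _ hz) => w /allpairsP [[a i] []].
 rewrite mem_iota add0n ltnS /= => av hi ->; have va : spn R v a by apply: spn_mem.
 case/predU1P: yG => [->|yG]; last by rewrite mulrAC; apply: lift => //; apply: hv.
 rewrite -mulrA -exprSr; move: hi; rewrite leq_eqVlt => /predU1P [->|hi]; last exact: lift.
 rewrite exprS ex mulr_sumr mulr_sumr; elim/big_rec: _ => [|j b _ hb]; first exact: T0.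
 apply: TD => //; rewrite (_ : _ * _ = c j * (a * x ^+ j.+1)); last by rewrite exprS; ring.
 by apply: TM => //; apply: lift.
Qed.

End Spans.

(** * Cohomology of a resolution by families *)

Section Surface.
Variables (K : fieldType) (A0 : set K) (k : closedFieldType) (kap : {rmorphism k -> K}) (X : fscheme K).
Hypotheses (sA : subring A0) (kA : forall c, A0 (kap c)).
Hypothesis resA : forall a, A0 a -> exists c, nonunit A0 (a - kap c).
Hypothesis noethA : forall J, ideal A0 J -> exists n (t : 'I_n -> K), (forall i, J (t i)) /\
 forall z, J z -> exists c : 'I_n -> K, (forall i, A0 (c i)) /\ z = \sum_i c i * t i.
Hypothesis localA : ideal A0 (nonunit A0).
Hypothesis normA : forall z, integral A0 z -> A0 z.
Hypothesis frac0 : forall z : K, exists a b, [/\ A0 a, A0 b, b != 0 & z = a / b].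
Hypothesis chain3 : no_chains3 A0.

Definition height1 (P : set K) : Prop :=
 [/\ pideal A0 P, exists2 z, z != 0 & P z & exists2 b, nonunit A0 b & ~ P b].
Definition dominating (V : set K) : Prop :=
 [/\ valring V, A0 `<=` V & nonunit A0 `<=` nonunit V].

Hypothesis height1V : forall P, height1 P -> valring (loc A0 P).
Hypothesis height1_finite : forall a, A0 a -> a != 0 -> finite_set [set P | height1 P /\ P a].
(** The curve F = 0 contains the pair of residues of x and y at every dominating valuation ring
    where they exist: a transcendence degree of at most one, stated without residue fields. *)
Hypothesis residues2 : forall x y, exists2 F : {poly {poly k}}, F != 0 &
 forall V c d, dominating V -> nonunit V (x - kap c) -> nonunit V (y - kap d) -> F.[d%:P].[c] = 0.
Hypothesis residues1 : forall P y, height1 P -> loc A0 P y -> exists C : seq k,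
 forall V, dominating V -> V `<=` loc A0 P -> V y -> exists2 c, c \in C & nonunit V (y - kap c).

Variables (n : nat) (U : 'I_n -> opens X) (B : 'I_n -> set K) (gens : 'I_n -> seq K).
Hypothesis hU : forall i, chart floc (U i) (B i).
Hypothesis cover : forall x, exists i, U i x.
Hypothesis Bgens : forall i g, g \in gens i -> B i g.
Hypothesis Bgen : forall i (S : set K), subring S -> A0 `<=` S -> (forall g, g \in gens i -> S g) ->
 B i `<=` S.
Hypothesis exists_center : forall V, valring V -> A0 `<=` V -> exists i, B i `<=` V.
Hypothesis unique_center : forall V x y, valring V -> dominated (X := X) x V -> dominated y V -> x = y.
Hypothesis A0loc : forall x : X, A0 `<=` floc x.
Hypothesis detect : forall (x : X) z, ~ floc x z ->
 exists e pi, [/\ closure [set e] x, dvr_pt e pi & ~ floc e z].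
Hypothesis dvrV : forall (e : X) pi, dvr_pt e pi -> valring (floc e).
Hypothesis dvr_ord : forall (e : X) pi z, dvr_pt e pi -> z != 0 -> floc e z ->
 exists n, floc e (z / pi ^+ n) /\ floc e (z / pi ^+ n)^-1.

Lemma center V : valring V -> A0 `<=` V -> exists x : X, dominated x V.
Proof.
move=> vV AV; have [i Bi] := exists_center vV AV.
by have [x _ dx] := chart_center (hU i) vV Bi; exists x.
Qed.

Lemma A0B i : A0 `<=` B i.
Proof. by move=> z Az; apply: (chart_inter (hU i)) => x _; apply: A0loc. Qed.

(** If the chart ring is contained in the localization of R at the center of V, the center of V on X
    depends only on that prime of R; in effect Spec R maps to X there. *)
Lemma center_loc R V i x : subring R -> valring V -> R `<=` V -> B i `<=` loc R (R `&` nonunit V) ->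
 dominated x V -> [/\ U i x, floc x `<=` loc R (R `&` nonunit V) & trace floc (B i) x = B i `&` nonunit V].
Proof.
move=> sR vV RV Bl dx; have [lV lN] := loc_center sR vV RV.
have sl := loc_sr sR (center_prime sR vV RV).
have [y Uy dy] := chart_center (hU i) vV (subset_trans Bl lV).
have xy := unique_center vV dx dy; subst y.
have [_ tr] := dominated_chart (hU i) Uy vV dx.
split=> // z; rewrite (chart_loc (hU i) Uy) tr => /(locP _) [|a [b [Ba Bb nb b0 ->]]].
 by rewrite -tr; apply: chart_prime.
apply: (subM sl); first exact: Bl.
have [|//] := not_nonunit (Bl _ Bb); move=> /(lN _ (Bl _ Bb)) h; exact: nb.
Qed.

Lemma loc_denoms R P (s : seq K) : subring R -> pideal R P -> (forall z, z \in s -> loc R P z) ->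
 exists b, [/\ R b, ~ P b & forall Q z, pideal R Q -> ~ Q b -> z \in s -> loc R Q z].
Proof.
move=> sR hP; elim: s => [|z s IH] h.
 by exists 1; split; [apply: (sub1 sR)|exact: (prime1 hP)|].
have [|b [Rb nb hb]] := IH; first by move=> w ws; apply: h; rewrite inE ws orbT.
have [a [d [Ra Rd nd d0 ez]]] := locP hP (h z (mem_head _ _)).
exists (d * b); split; [exact: (subM sR)|exact: (primeNM hP)|].
move=> Q w hQ nQ; have iQ : ideal R Q by case: hQ.
rewrite inE => /predU1P [->|ws].
 by rewrite ez; apply: locE => // Qd; apply: nQ; apply: (idMr iQ).
by apply: hb => // Qb; apply: nQ; apply: (idM iQ).
Qed.

Definition family (F : X -> set K) (s : X -> K) : Prop :=
 forall x, exists W : opens X, W x /\ forall y, W y -> F y (s y - s x).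

(* H^1 of an affine scheme Spec R over X vanishes. *)
Lemma affine_pull R s : subring R -> A0 `<=` R ->
 (forall P, pideal R P -> exists i, B i `<=` loc R P) -> family floc s ->
 exists c, forall V x, valring V -> R `<=` V -> dominated x V -> loc R (R `&` nonunit V) (s x - c).
Proof.
move=> sR AR hR fs.
(* To each prime of R is attached the center on X of some valuation ring over it; s then becomes a
   function on primes. *)
have /choice [xi hxi] : forall P, exists x : X, pideal R P ->
  exists V, [/\ valring V, R `<=` V, R `&` nonunit V = P & dominated x V].
 move=> P; have [hP|nP] := EM (pideal R P); last by exists (fgen X).
 have [V [vV RV _ eP _]] := valring_over_prime sR hP.
 by have [x dx] := center vV (subset_trans AR RV); exists x => _; exists V.
have [|c hc] := affine_family sR (s := fun P => s (xi P)).
 move=> P hP; have [V [vV RV eP dx]] := hxi P hP; subst P.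
 have [i Bi] := hR _ hP; have [Ux lx tr] := center_loc sR vV RV Bi dx.
 have [lV lN] := loc_center sR vV RV.
 have [W [Wx hW]] := fs (xi (R `&` nonunit V)).
 have [b [Bb nb bW]] := chart_nbhs (hU i) (oset_open W) Wx Ux.
 have ub : b != 0 /\ loc R (R `&` nonunit V) b^-1.
  apply: not_nonunit; first exact: Bi.
  move=> /(lN _ (Bi _ Bb)) nVb; apply: nb.
  by have : (B i `&` nonunit V) b by []; rewrite -tr => -[].
 have [|d [Rd nd hd]] := @loc_denoms R _ (b^-1 :: gens i) sR hP.
  by move=> z; rewrite inE => /predU1P [-> //|zg]; [case: ub|apply: Bi; apply: Bgens].
 exists d; split=> // Q hQ nQ; have [V' [vV' RV' eQ dy]] := hxi Q hQ; subst Q.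
 have BQ : B i `<=` loc R (R `&` nonunit V').
  apply: Bgen; first exact: (loc_sr sR hQ).
   by move=> z /AR; apply: (sub_loc sR hQ).
  by move=> g gi; apply: hd => //; rewrite inE gi orbT.
 have [Uy ly try] := center_loc sR vV' RV' BQ dy.
 apply: ly; apply: hW; apply: bW; split=> // nb'.
 have [lV' lN'] := loc_center sR vV' RV'.
 have [_ []] : nonunit (loc R (R `&` nonunit V')) b.
  apply/(lN' _ (BQ _ Bb)).
  by have : trace floc (B i) (xi (R `&` nonunit V')) b by []; rewrite try => -[].
 by split; [case: ub|apply: hd => //; rewrite mem_head].
exists c => V x vV RV dx; have hP := center_prime sR vV RV.
have [V' [vV' RV' eP dy]] := hxi _ hP; have [i Bi] := hR _ hP.
have [Ux lx tr] := center_loc sR vV RV Bi dx.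
have Bi' : B i `<=` loc R (R `&` nonunit V') by rewrite eP.
have [Uy ly try] := center_loc sR vV' RV' Bi' dy.
rewrite (_ : x = xi (R `&` nonunit V)); first exact: hc.
apply: (chart_inj (hU i)) => //; rewrite tr try.
have [_ lN] := loc_center sR vV RV; have [_ lN'] := loc_center sR vV' RV'.
apply/seteqP; split=> z [Bz nz]; split=> //.
 by apply/(lN' _ (Bi' _ Bz)); rewrite eP; apply/(lN _ (Bi _ Bz)).
by apply/(lN _ (Bi _ Bz)); rewrite -eP; apply/(lN' _ (Bi' _ Bz)).
Qed.

Lemma kap_nonunit (V : set K) c : A0 `<=` V -> nonunit V (kap c) -> c = 0.
Proof.
move=> AV [_ h]; apply: contrapT => /eqP c0; apply: h; rewrite fmorph_eq0; split=> //.
by rewrite -fmorphV; apply: AV.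
Qed.

Lemma residue_unique V x c d : subring V -> A0 `<=` V -> ideal V (nonunit V) -> nonunit V (x - kap c) ->
 nonunit V (x - kap d) -> c = d.
Proof.
move=> sV AV iV hc hd; apply/eqP; rewrite -subr_eq0; apply/eqP; apply: (kap_nonunit AV).
rewrite rmorphB (_ : _ - _ = (x - kap d) - (x - kap c)); last by ring.
exact: (idB sV iV).
Qed.

(** The localization of A0 at a height one prime is a valuation ring, and the only ring dominating
    it is itself. *)
Lemma not_dominating V : valring V -> A0 `<=` V -> ~ dominating V ->
 (forall z, V z) \/ exists2 P, height1 P & V = loc A0 P /\ P = A0 `&` nonunit V.
Proof.
move=> vV AV nd; have hP := center_prime sA vV AV.
have [lV lN] := loc_center sA vV AV.
have [[z z0 Pz]|nz] := EM (exists2 z, z != 0 & (A0 `&` nonunit V) z); last first.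
 left=> z; have [a [b [Aa Ab b0 ->]]] := frac0 z; apply: lV; apply: locE => // h; apply: nz.
 by exists b.
have h1 : height1 (A0 `&` nonunit V).
 split=> //; first by exists z.
 apply: contrapT => h; apply: nd; split=> // b nb; apply: contrapT => nVb; apply: h; exists b => //.
 by case.
right; exists (A0 `&` nonunit V) => //; split=> //; apply/seteqP; split=> // w Vw.
apply: contrapT => nl; have h := valring_inv (height1V h1) nl.
have : nonunit V w^-1 by apply/lN => //; case: h.
apply: nonunit_inv; first by rewrite invrK.
by rewrite invr_eq0; apply/eqP => w0; apply: nl; rewrite w0; apply: sub0; case: (height1V h1).
Qed.

Lemma avoid_seq (p : {poly k}) (s : seq k) : p != 0 -> exists2 c, p.[c] != 0 & c \notin s.
Proof.
move=> p0; have : p * \prod_(c <- s) ('X - c%:P) != 0.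
 by rewrite mulf_neq0 // monic_neq0 // monic_prod_XsubC.
move=> /closed_nonrootP [c]; rewrite /root hornerM mulf_eq0 negb_or => /andP [pc sc].
by exists c => //; apply: contra sc => cs; have := root_prod_XsubC s c; rewrite cs.
Qed.

(** For dominating valuations a point (c, d) off the curve F = 0 suffices. The others at which x has
    residue c are localizations at primes P containing the numerator a of x - c; these are finitely
    many, and each excludes at most one d. *)
Lemma avoid2 x y : exists c d, forall V, valring V -> A0 `<=` V ->
 nonunit V (x - kap c) -> nonunit V (y - kap d) -> False.
Proof.
have [F F0 hF] := residues2 x y.
have [i Fi] : exists i, F`_i != 0 by exists (size F).-1; rewrite -lead_coefE lead_coef_eq0.
(* c also differs from x, so that a is nonzero and has finitely many height one primes. *)
have [c Fc xc] : exists2 c, (F`_i).[c] != 0 & kap c <> x.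
 have [[c0 ec]|nc] := EM (exists c0, kap c0 = x).
  have [c pc cs] := avoid_seq [:: c0] Fi; exists c => // h; move: cs.
  by rewrite inE -(inj_eq (fmorph_inj kap)) h ec eqxx.
 by have [c pc _] := avoid_seq [::] Fi; exists c => // h; apply: nc; exists c.
have G0 : map_poly (horner_eval c) F != 0.
 by apply/eqP => /polyP /(_ i); rewrite coef_map coef0 /= /horner_eval; apply/eqP.
have [a [b [Aa Ab b0 exc]]] := frac0 (x - kap c).
have xc0 : x - kap c != 0 by rewrite subr_eq0; apply/eqP => h; apply: xc.
have a0 : a != 0 by apply: contraNneq xc0 => a0; rewrite exc a0 mul0r.
have /choice [g hg] : forall P, exists d0, height1 P -> forall d, nonunit (loc A0 P) (y - kap d) -> d = d0.
 move=> P; have [[d0 h0]|nd] := EM (exists d, nonunit (loc A0 P) (y - kap d)).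
  exists d0 => h1 d h; have hP : pideal A0 P by case: h1.
  apply: (residue_unique (V := loc A0 P)) h h0; [exact: (loc_sr sA)|exact: (sub_loc sA)|].
  exact: (nonunit_loc_ideal sA).
 by exists 0 => _ d h; case: nd; exists d.
have [s es] := (finite_seqP _).1 (finite_image g (height1_finite Aa a0)).
have [d Gd /negP ds] := avoid_seq s G0.
exists c, d => V vV AV nx ny; have [dV|nd] := EM (dominating V).
 have := hF V c d dV nx ny; move/eqP: Gd => Gd; apply: contra_not Gd => <-.
 by have := horner_map (horner_eval c) F d%:P; rewrite /= /horner_eval hornerC.
have [VK|[P h1 [eV eP]]] := not_dominating vV AV nd.
 by case: nx => _; apply; split=> //.
have Pa : P a.
 rewrite eP; split=> //; rewrite -(mulfVK b0 a) -exc.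
 by apply: (idMr (valring_ideal vV)) => //; apply: AV.
apply: ds; suff : [set` s] d by []; rewrite -es; exists P => //.
by apply/esym; apply: hg; rewrite // -eV.
Qed.

(** For ys in the span of ws this says that the linear system ys has no base points on the
    projective model defined by ws. *)
Definition covers (ws ys : seq K) : Prop := forall V, valring V -> A0 `<=` V ->
 exists y, [/\ y \in ys, y != 0 & forall w, w \in ws -> V (w / y)].

Lemma spn_div V ws y z : subring V -> A0 `<=` V -> (forall w, w \in ws -> V (w / y)) -> spn A0 ws z -> V (z / y).
Proof.
move=> sV AV h hz; apply: (hz [set z | V (z / y)]) => //; apply: (shift_subm y^-1); split; first exact: sub0.
 by move=> a b; apply: subD.
by move=> a b Aa; apply: (subM sV); apply: AV.
Qed.

Lemma shift_small V y w e : valring V -> A0 `<=` V -> y != 0 -> nonunit V (w / y) ->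
 y - kap e * w != 0 /\ V (y / (y - kap e * w)).
Proof.
move=> vV AV y0 nw; have sV := vV.1; have iV := valring_ideal vV.
have ne : nonunit V (kap e * (w / y)) by apply: (idM iV) => //; apply: AV.
have [||u0 Vu] := @not_nonunit _ V (1 - kap e * (w / y)).
- by apply: (subB sV); [apply: (sub1 sV)|case: ne].
- move=> h; have [_ n1 _] := valring_prime vV; apply: n1.
 by rewrite -(subrK (kap e * (w / y)) 1); apply: (idD iV).
have -> : y - kap e * w = y * (1 - kap e * (w / y)) by fld.
by rewrite mulf_neq0 // invfM (mulrA y) (divff y0) mul1r.
Qed.

Lemma shift_unit V y w e : subring V -> A0 `<=` V -> w != 0 -> V (y / w) -> ~ nonunit V (y / w - kap e) ->
 y - kap e * w != 0 /\ V (w / (y - kap e * w)).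
Proof.
move=> sV AV w0 Vy ne; have [|u0 Vu] := not_nonunit _ ne; first by apply: (subB sV) => //; apply: AV.
have -> : y - kap e * w = w * (y / w - kap e) by fld.
by rewrite mulf_neq0 // invfM (mulrA w) (divff w0) mul1r.
Qed.

(** Projection from a point: w is dropped, and x0, x1 are shifted by multiples of it. This could
    fail only where w is largest and x0 / w, x1 / w have residues c and d at once, which [avoid2]
    excludes. *)
Lemma pencil_step ws w x0 x1 r : covers ws [:: w, x0, x1 & r] ->
 spn A0 ws w -> spn A0 ws x0 -> spn A0 ws x1 ->
 exists c d, covers ws [:: x0 - kap c * w, x1 - kap d * w & r].
Proof.
move=> cov hw h0 h1; have [w0|w0] := eqVneq w 0.
 exists 0, 0 => V vV AV; have [y []] := cov V vV AV; rewrite w0 inE => /predU1P [->|]; first by rewrite eqxx.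
 by exists y; rewrite !mulr0 !subr0.
have [c [d hcd]] := avoid2 (x0 / w) (x1 / w); exists c, d => V vV AV.
have sV := vV.1; have iV := valring_ideal vV.
have [y [hy y0 my]] := cov V vV AV.
suff [y' [hy' y'0 Vy]] : exists y', [/\ y' \in [:: x0 - kap c * w, x1 - kap d * w & r], y' != 0 & V (y / y')].
 exists y'; split=> // z hz; rewrite (_ : z / y' = z / y * (y / y')); last by fld.
 by apply: (subM sV) => //; apply: my.
have [/= nw|nw] := EM (nonunit V (w / y)).
 have sh e := shift_small e vV AV y0 nw.
 move: hy; rewrite !inE => /or4P [/eqP e|/eqP e|/eqP e|hy].
 - by case: nw => _ []; rewrite -e divff // oner_eq0 invr1; split=> //; apply: (sub1 sV).
 - by exists (x0 - kap c * w); rewrite inE eqxx -e; have [] := sh c.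
 - by exists (x1 - kap d * w); rewrite !inE eqxx orbT -e; have [] := sh d.
 - by exists y; rewrite !inE hy !orbT divff //; split=> //; apply: (sub1 sV).
have [|_ Vyw] := not_nonunit _ nw; first exact: (spn_div sV AV my).
rewrite invf_div in Vyw.
have div z : spn A0 ws z -> V (z / w).
 move=> hz; rewrite (_ : z / w = z / y * (y / w)); last by fld.
 by apply: (subM sV) => //; apply: (spn_div sV AV my).
have fin x e : spn A0 ws x -> ~ nonunit V (x / w - kap e) -> x - kap e * w != 0 /\ V (y / (x - kap e * w)).
 move=> hx /(shift_unit sV AV w0 (div _ hx)) [n0 Vx]; split=> //.
 by rewrite (_ : y / _ = y / w * (w / (x - kap e * w))); [apply: subM|fld].
have [n0|n0] := EM (nonunit V (x0 / w - kap c)); last first.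
 by exists (x0 - kap c * w); rewrite inE eqxx; have [] := fin x0 c h0 n0.
have [n1|n1] := EM (nonunit V (x1 / w - kap d)); first by case: (hcd V).
by exists (x1 - kap d * w); rewrite !inE eqxx orbT; have [] := fin x1 d h1 n1.
Qed.

(** Projections are repeated until two generators remain. A zero among these two is replaced by the
    other one. *)
Lemma pencil ws : covers ws ws -> exists y0 y1, [/\ y0 != 0, y1 != 0, spn A0 ws y0, spn A0 ws y1 &
 forall V, valring V -> A0 `<=` V -> (forall w, w \in ws -> V (w / y0)) \/ (forall w, w \in ws -> V (w / y1))].
Proof.
move=> cov0.
suff H m : forall ys, size ys = m -> covers ws ys -> (forall y, y \in ys -> spn A0 ws y) ->
  exists y0 y1, [/\ spn A0 ws y0, spn A0 ws y1 & covers ws [:: y0; y1]].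
 have [|y0 [y1 [h0 h1 cov]]] := H _ ws erefl cov0; first by move=> y; apply: spn_mem.
 have fin y : y != 0 -> spn A0 ws y -> covers ws [:: y; y] -> exists y0 y1, [/\ y0 != 0, y1 != 0, spn A0 ws y0, spn A0 ws y1 &
  forall V, valring V -> A0 `<=` V -> (forall w, w \in ws -> V (w / y0)) \/ (forall w, w \in ws -> V (w / y1))].
  move=> n0 hy c; exists y, y; split=> // V vV AV; left.
  by have [z []] := c V vV AV; rewrite !inE orbb => /eqP ->.
 have [e0|n0] := eqVneq y0 0.
  have c1 : covers ws [:: y1; y1].
   move=> V vV AV; have [z []] := cov V vV AV; rewrite !inE => /orP [/eqP ->|hz nz]; first by rewrite e0 eqxx.
   by exists z; rewrite !inE hz.
  apply: (fin y1) => //; have [z []] := c1 _ (conj (setT_sr K) (fun z => or_introl I)) (fun _ _ => I).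
  by rewrite !inE orbb => /eqP ->.
 have [e1|n1] := eqVneq y1 0.
  apply: (fin y0) => // V vV AV; have [z []] := cov V vV AV; rewrite !inE => /orP [hz nz|/eqP ->]; last by rewrite e1 eqxx.
  by exists z; rewrite !inE hz.
 exists y0, y1; split=> // V vV AV; have [z []] := cov V vV AV.
 by rewrite !inE => /orP [/eqP ->|/eqP ->] _ h; [left|right].
elim: m => [|m IH] ys sz cov hys.
 case: ys sz cov hys => // _ cov _.
 by have [z []] := cov _ (conj (setT_sr K) (fun z => or_introl I)) (fun _ _ => I).
case: ys sz cov hys => [//|w [|x0 [|x1 r]]] sz cov hys.
- exists w, w; split; [by apply: hys; rewrite mem_head|by apply: hys; rewrite mem_head|].
 move=> V vV AV; have [z []] := cov V vV AV; rewrite inE => hz; exists z; split=> //.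
 by rewrite inE hz.
- by exists w, x0; split=> //; apply: hys; rewrite !inE eqxx ?orbT.
have hw : spn A0 ws w by apply: hys; rewrite mem_head.
have h0 : spn A0 ws x0 by apply: hys; rewrite !inE eqxx orbT.
have h1 : spn A0 ws x1 by apply: hys; rewrite !inE eqxx !orbT.
have [c [d cov']] := pencil_step cov hw h0 h1.
have [_ _ Ms] := spn_sub A0 ws.
apply: (IH _ _ cov'); first by case: sz.
move=> y; rewrite !inE => /or3P [/eqP ->|/eqP ->|hy].
- by apply: (submB sA (spn_sub A0 ws)) => //; apply: Ms.
- by apply: (submB sA (spn_sub A0 ws)) => //; apply: Ms.
- by apply: hys; rewrite !inE hy !orbT.
Qed.

(* Products of one element of each list 1 :: l: the chart rings become the affine charts of
  a projective model. *)
Definition segre (L : seq (seq K)) : seq K :=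
 foldr (fun l ws => [seq a * b | a <- 1 :: l, b <- ws]) [:: 1] L.

Lemma segre_max V L : valring V -> exists w, [/\ w \in segre L, w != 0 &
 forall z, z \in segre L -> V (z / w)].
Proof.
move=> vV; have sV := vV.1; elim: L => [|l L [w [hw w0 mw]]].
 by have [y []] := seq_max [::] vV (oner_neq0 K); exists y.
have [y [hy y0 my]] := seq_max l vV (oner_neq0 K).
exists (y * w); rewrite mulf_neq0 //; split=> //; first by apply: allpairs_f.
move=> z /allpairsP [[a b] [/= ha hb ->]].
by rewrite (_ : a * b / (y * w) = a / y * (b / w)); [apply: (subM sV); [apply: my|apply: mw]|fld].
Qed.

(** The product w has the factor 1 at the place of l, where it is largest because l lies in V;
    replacing this factor by g gives w g. *)
Lemma segre_chart V (L : seq (seq K)) (l : seq K) : valring V -> l \in L -> (forall g, g \in l -> V g) ->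
 exists w, [/\ w \in segre L, w != 0, forall z, z \in segre L -> V (z / w) &
  forall g, g \in l -> w * g \in segre L].
Proof.
move=> vV; have sV := vV.1; elim: L => [//|l' L IH]; rewrite inE => /predU1P [<-|hl] Vl.
 have [w [hw w0 mw]] := segre_max L vV.
 exists w; split=> //.
 - by rewrite -[w]mul1r; apply: allpairs_f; rewrite ?mem_head.
 - move=> z /allpairsP [[a b] [/= ha hb ->]]; rewrite -mulrA; apply: (subM sV); last exact: mw.
  by move: ha; rewrite inE => /predU1P [->|]; [apply: (sub1 sV)|apply: Vl].
 - by move=> g gl; rewrite mulrC; apply: allpairs_f => //; rewrite inE gl orbT.
have [w [hw w0 mw hg]] := IH hl Vl; have [y [hy y0 my]] := seq_max l' vV (oner_neq0 K).
exists (y * w); rewrite mulf_neq0 //; split=> //; first by apply: allpairs_f.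
 move=> z /allpairsP [[a b] [/= ha hb ->]].
 by rewrite (_ : a * b / (y * w) = a / y * (b / w)); [apply: (subM sV); [apply: my|apply: mw]|fld].
by move=> g gl; rewrite -mulrA; apply: allpairs_f => //; apply: hg.
Qed.

Definition ws0 : seq K := segre [seq gens i | i <- enum 'I_n].

Lemma ws0_covers : covers ws0 ws0.
Proof. by move=> V vV _; have [w hw] := segre_max [seq gens i | i <- enum 'I_n] vV; exists w. Qed.

Definition gensub (G : seq K) : set K :=
 [set z | forall S, subring S -> A0 `<=` S -> (forall g, g \in G -> S g) -> S z].

Lemma gensub_sr G : subring (gensub G).
Proof.
split=> [S sS _ _|a b ha hb S sS AS GS|a b ha hb S sS AS GS].
- exact: (sub1 sS).
- by apply: (subB sS); [apply: ha|apply: hb].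
- by apply: (subM sS); [apply: ha|apply: hb].
Qed.

Lemma gensub_A0 G : A0 `<=` gensub G. Proof. by move=> a Aa S _ AS _; apply: AS. Qed.
Lemma gensub_gen G g : g \in G -> gensub G g. Proof. by move=> gG S _ _; apply. Qed.
(** The affine chart A0[w / y : w in [ws0]] of the projective model. *)
Definition pchart (y : K) : set K := gensub [seq w / y | w <- ws0].

Lemma pchart_sub V y : subring V -> A0 `<=` V -> (forall w, w \in ws0 -> V (w / y)) -> pchart y `<=` V.
Proof. by move=> sV AV h z; apply=> // g /mapP [w hw ->]; apply: h. Qed.

Lemma pchart_spn y z : spn A0 ws0 z -> pchart y (z / y).
Proof.
apply: spn_div; [exact: gensub_sr|exact: gensub_A0|].
by move=> w hw; apply: gensub_gen; apply: map_f.
Qed.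

(** The projective model maps to X. A valuation ring over P contains some B i; the product w of
    [segre_chart] is as large as y there, so w / y is a unit at P and g = (w g / y) / (w / y) is
    regular at P. *)
Lemma pchart_dominates y P : y != 0 -> spn A0 ws0 y -> pideal (pchart y) P ->
 exists i, B i `<=` loc (pchart y) P.
Proof.
move=> y0 hy hP; have sR := gensub_sr [seq w / y | w <- ws0].
have [V [vV RV lV _ nV]] := valring_over_prime sR hP; have sV := vV.1.
have AV : A0 `<=` V by move=> z Az; apply: RV; apply: gensub_A0.
have [i Bi] := exists_center vV AV; exists i.
have [|g gi|w [hw w0 mw hg]] := @segre_chart V [seq gens i | i <- enum 'I_n] (gens i) vV.
- by apply: map_f; rewrite mem_enum.
- by apply: Bi; apply: Bgens.
have sl := loc_sr sR hP.
have Rw z : z \in ws0 -> loc (pchart y) P (z / y).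
 by move=> hz; apply: (sub_loc sR hP); apply: pchart_spn; apply: spn_mem.
have uw : loc (pchart y) P (w / y)^-1.
 have [|//] := @not_nonunit _ (loc (pchart y) P) (w / y) (Rw w hw).
 move=> /(nV _ (Rw w hw)); apply: nonunit_inv; last by rewrite mulf_neq0 ?invr_neq0.
 by rewrite invf_div; apply: (spn_div sV AV mw).
apply: Bgen => //; first by move=> z Az; apply: (sub_loc sR hP); apply: gensub_A0.
move=> g gi; rewrite (_ : g = (w * g) / y * (w / y)^-1); last by fld.
by apply: (subM sl) => //; apply: Rw; apply: hg.
Qed.

(** Over A0[1/a] no valuation ring is dominating, so it is a localization of A0 and contains a chart
    of X. Hence H^1 vanishes over this affine open subset of Spec A0. *)
Lemma away_pull s a : family floc s -> nonunit A0 a -> a != 0 ->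
 exists c, forall V x, valring V -> adjoin A0 a^-1 `<=` V -> dominated x V ->
  loc (adjoin A0 a^-1) (adjoin A0 a^-1 `&` nonunit V) (s x - c).
Proof.
move=> fs na a0; set R := adjoin A0 a^-1; have sR : subring R by apply: adjoin_sr.
have AR : A0 `<=` R by apply: (sub_adjoin _ (sub_ideal sA)).
have aR : R a^-1 by apply: adjoin_gen.
apply: affine_pull => // P hP.
have [V [vV RV lV ePV nV]] := valring_over_prime sR hP.
have AV := subset_trans AR RV.
have [i Bi] := exists_center vV AV; exists i.
have nd : ~ dominating V.
 move=> [_ _ h]; have [_ ] := h a na; apply; split=> //; exact: RV.
have NP d : A0 d -> ~ nonunit V d -> ~ P d by move=> Ad nd' Pd; apply: nd'; move: Pd; rewrite -ePV => -[].
have [VK|[P' [hP' _ _] [eV eP]]] := not_dominating vV AV nd.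
 move=> z' _; have [b [d [Ab Ad d0 ->]]] := frac0 z'.
 by apply: (locE hP); [exact: AR|exact: AR|apply: NP => // -[_]; apply; split].
apply: (subset_trans Bi); rewrite {1}eV => z' /(locP hP') [b [d [Ab Ad nd' _ ->]]].
apply: (locE hP); [exact: AR|exact: AR|apply: NP => // Vd].
by apply: nd'; rewrite eP.
Qed.

(** * Finiteness of the first cohomology of the structure sheaf *)

Section Pencil.
Variables (y0 y1 : K).
Hypotheses (n0 : y0 != 0) (n1 : y1 != 0) (h0 : spn A0 ws0 y0) (h1 : spn A0 ws0 y1).
Hypothesis hV : forall V, valring V -> A0 `<=` V ->
 (forall w, w \in ws0 -> V (w / y0)) \/ (forall w, w \in ws0 -> V (w / y1)).

Local Notation t := (y1 / y0).
Local Notation B0 := (pchart y0).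
Local Notation B1 := (pchart y1).

Let sB0 : subring B0. Proof. exact: gensub_sr. Qed.
Let sB1 : subring B1. Proof. exact: gensub_sr. Qed.
Let t0 : t != 0. Proof. by rewrite mulf_neq0 // invr_neq0. Qed.
Let B0t : B0 t. Proof. exact: pchart_spn. Qed.
Let B1t : B1 t^-1. Proof. by rewrite invf_div; apply: pchart_spn. Qed.

(** D and B01 are the coboundaries and the cocycles of the cover by the two charts of the pencil. *)
Let D : set K := [set z | exists b0 b1, [/\ B0 b0, B1 b1 & z = b0 + b1]].
Let B01 : set K := gensub ([seq w / y0 | w <- ws0] ++ [seq w / y1 | w <- ws0]).

Let sB01 : subring B01. Proof. exact: gensub_sr. Qed.
Let B0_B01 : B0 `<=` B01.
Proof.
apply: pchart_sub => // [|w hw]; [exact: gensub_A0|apply: gensub_gen].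
by rewrite mem_cat; apply/orP; left; apply: (map_f (fun w => w / y0)).
Qed.
Let B1_B01 : B1 `<=` B01.
Proof.
apply: pchart_sub => // [|w hw]; first exact: gensub_A0.
by apply: gensub_gen; rewrite mem_cat; apply/orP; right; apply: (map_f (fun w => w / y1)).
Qed.

Let D0 z : B0 z -> D z.
Proof. by move=> h; exists z, 0; split=> //; [exact: (sub0 sB1)|rewrite addr0]. Qed.
Let D1 z : B1 z -> D z.
Proof. by move=> h; exists 0, z; split=> //; [exact: (sub0 sB0)|rewrite add0r]. Qed.

Lemma pencil_subm : subm A0 D.
Proof.
split; first by apply: D0; apply: (sub0 sB0).
 move=> _ _ [a [b [ha hb ->]]] [c [d [hc hd ->]]]; exists (a + c), (b + d).
 by split; [exact: (subD sB0)|exact: (subD sB1)|rewrite addrACA].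
move=> a _ Aa [b [c [hb hc ->]]]; exists (a * b), (a * c).
by split; [apply: (subM sB0) => //; apply: gensub_A0|apply: (subM sB1) => //; apply: gensub_A0|rewrite mulrDr].
Qed.

(** Products of the w / y0 have only bounded poles in t on the second chart. *)
Let good v := B0 v /\ exists d, forall l, (d <= l)%N -> B1 (v / t ^+ l).

Let goodM v w : good v -> good w -> good (v * w).
Proof.
move=> [Bv [d hd]] [Bw [e he]]; split; first exact: (subM sB0).
exists (d + e)%N => l hl; rewrite (_ : v * w / t ^+ l = (v / t ^+ d) * (w / t ^+ (l - d))).
 by apply: (subM sB1); [apply: hd|apply: he; rewrite leq_subRL // (leq_trans _ hl) // leq_addr].
by rewrite -{1}(subnKC (leq_trans (leq_addr e d) hl)) exprD; fld; rewrite ?expf_neq0.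
Qed.

Let good1 : good 1.
Proof.
split; first exact: (sub1 sB0).
by exists 0%N => l _; rewrite div1r -exprVn; apply: (subX sB1).
Qed.

Let goodw w : w \in ws0 -> good (w / y0).
Proof.
move=> hw; split; first by apply: pchart_spn; apply: spn_mem.
exists 1%N => -[//|l] _; rewrite (_ : _ / _ = w / y1 * t^-1 ^+ l).
 by apply: (subM sB1); [apply: pchart_spn; apply: spn_mem|apply: (subX sB1)].
by rewrite exprS exprVn; fld; rewrite ?expf_neq0.
Qed.

(** In a valuation ring containing t either y0 is largest, or y1 is and w / y0 = (w / y1) t. *)
Let integralw w : w \in ws0 -> integral (adjoin A0 t) (w / y0).
Proof.
move=> hw; apply: integral_vals => [|V vV RV]; first exact: adjoin_sr.
have sV := vV.1.
have AV : A0 `<=` V by move=> a Aa; apply: RV; apply: (sub_adjoin _ (sub_ideal sA)).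
have Vt : V t by apply: RV; apply: adjoin_gen.
have [h|h] := hV vV AV; first exact: h.
by rewrite (_ : w / y0 = w / y1 * t); [apply: (subM sV) => //; apply: h|fld].
Qed.

(** B0 is contained in a finite A0[t]-module spanned by good products v, and elements of B01 come
    into B0 after multiplication by a power of t. Since v / t^l lies in B1 for large l, finitely
    many v / t^l generate B01 modulo B0 + B1. *)
Lemma pencil_finite : exists us, B01 `<=` spanD A0 D us.
Proof.
have sR := adjoin_sr sA t.
have [|v [gv v1 hv]] := finite_span (G := [seq w / y0 | w <- ws0]) sR good1 goodM.
 by move=> _ /mapP [w hw ->]; split; [apply: integralw|apply: goodw].
have [us hus] : exists us : seq K, forall x l, x \in v -> x / t ^+ l \in us \/ B1 (x / t ^+ l).
 elim: v gv {v1 hv} => [|x v IH] gv; first by exists [::].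
 have [|us hus] := IH; first by move=> y hy; apply: gv; rewrite inE hy orbT.
 have [_ [d hd]] := gv x (mem_head _ _).
 exists ([seq x / t ^+ l | l <- iota 0 d] ++ us) => y l; rewrite inE => /predU1P [->|hy].
  have [ld|dl] := ltnP l d; last by right; apply: hd.
  by left; rewrite mem_cat; apply/orP; left; apply: (map_f (fun l => x / t ^+ l)); rewrite mem_iota.
 by have [h|h] := hus y l hy; [left; rewrite mem_cat h orbT|right].
exists us; have sS := spanD_subm sA us pencil_subm.
have spD z : D z -> spanD A0 D us z by apply: spanD_base; apply: (sub0 sA).
have spu z : z \in us -> spanD A0 D us z.
 by apply: spanD_mem; [exact: (sub0 sA)|exact: (sub1 sA)|case: pencil_subm].
have all z l : B0 z -> spanD A0 D us (z / t ^+ l).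
 have [RS sS'] := stable_sr v sR.
 move=> /(_ _ sS' (subset_trans (sub_adjoin _ (sub_ideal sA)) RS)) hz.
 have {}hz : spn (adjoin A0 t) v z by rewrite -[z]mul1r; apply: hz => // g hg y; apply: hv.
 suff [_ h] : [set z | B0 z /\ forall l, spanD A0 D us (z / t ^+ l)] z by apply: h.
 apply: hz => [|x xv]; last first.
  split=> [|i]; first by case: (gv x xv).
  by have [h|h] := hus x i xv; [apply: spu|apply: spD; apply: D1].
 apply: subm_adjoin => // [|x [Bx hx]].
  have [S0 SD SM] := sS; split=> [|a b [Ba ha] [Bb hb]|a b Aa [Bb hb]].
  + by split=> [|i]; [exact: (sub0 sB0)|rewrite mul0r].
  + by split=> [|i]; [exact: (subD sB0)|rewrite mulrDl; apply: SD].
  + split=> [|i]; first by apply: (subM sB0) => //; apply: gensub_A0.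
   by rewrite -mulrA; apply: SM.
 split=> [|[|i]]; first exact: (subM sB0).
  by rewrite divr1; apply: spD; apply: D0; apply: (subM sB0).
 by rewrite (_ : _ / _ = x / t ^+ i) // exprS; fld; rewrite ?expf_neq0.
move=> z hz; suff [l hl] : exists l, B0 (z * t ^+ l).
 by rewrite (_ : z = z * t ^+ l / t ^+ l); [apply: all|rewrite mulfK // expf_neq0].
apply: (hz [set z | exists l, B0 (z * t ^+ l)]) => /=.
- split=> [|a b [l hl] [m hm]|a b [l hl] [m hm]].
 + by exists 0%N; rewrite mulr1; apply: (sub1 sB0).
 + exists (l + m)%N; rewrite mulrBl; apply: (subB sB0); rewrite ?[(l + m)%N]addnC exprD mulrA.
   rewrite mulrAC; apply: (subM sB0) => //; exact: (subX sB0).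
  by apply: (subM sB0) => //; exact: (subX sB0).
 + by exists (l + m)%N; rewrite exprD mulrACA; apply: (subM sB0).
- by move=> a Aa; exists 0%N; rewrite mulr1; apply: gensub_A0.
- move=> g; rewrite mem_cat => /orP [] /mapP [w hw ->].
  by exists 0%N; rewrite mulr1; apply: pchart_spn; apply: spn_mem.
 exists 1%N; rewrite (_ : _ * _ = w / y0); last by rewrite expr1; fld.
 by apply: pchart_spn; apply: spn_mem.
Qed.

(* c is a value at the center of V, for all V containing pchart y, of the affine pullback of s. *)
Let pulled y (s : X -> K) c := forall V (x : X), valring V -> pchart y `<=` V -> dominated x V ->
 loc (pchart y) (pchart y `&` nonunit V) (s x - c).

Let pulled_in y s c V x : pulled y s c -> valring V -> pchart y `<=` V -> dominated x V -> V (s x - c).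
Proof. by move=> h vV BV dx; apply: (loc_center (gensub_sr _) vV BV).1; apply: h. Qed.

(** The Čech cocycle of s: on each of the two affine charts s is equivalent to a constant, and z is
    the difference of the constants. *)
Definition defect (s : X -> K) (z : K) : Prop :=
 exists c0 c1, [/\ pulled y0 s c0, pulled y1 s c1 & z = c0 - c1].

Lemma defect0 : defect (fun _ => 0) 0.
Proof.
have p y : pulled y (fun _ => 0) 0.
 move=> V x vV BV _; rewrite subr0; apply: (sub0 (loc_sr _ _)).
  exact: gensub_sr.
 by apply: center_prime => //; apply: gensub_sr.
by exists 0, 0; rewrite subr0; split=> //; apply: p.
Qed.

Lemma defectD l s s' z z' : defect s z -> defect s' z' ->
 defect (fun x => kap l * s x + s' x) (kap l * z + z').
Proof.
have p y r r' c c' : pulled y r c -> pulled y r' c' ->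
  pulled y (fun x => kap l * r x + r' x) (kap l * c + c').
 move=> h h' V x vV BV dx; have sR := gensub_sr [seq w / y | w <- ws0].
 have hP := center_prime sR vV BV; have sl := loc_sr sR hP.
 rewrite (_ : _ - _ = kap l * (r x - c) + (r' x - c')); last by ring.
 apply: (subD sl); [apply: (subM sl)|exact: h'] => //; last exact: h.
 by apply: (sub_loc sR hP); apply: gensub_A0.
move=> [c0 [c1 [h0' h1' ->]]] [d0 [d1 [g0 g1 ->]]].
exists (kap l * c0 + d0), (kap l * c1 + d1); split; [exact: p|exact: p|ring].
Qed.

Lemma defect_exists s : family floc s -> exists z, defect s z.
Proof.
move=> fs; have p y : y != 0 -> spn A0 ws0 y -> exists c, pulled y s c.
 move=> ny hy; apply: affine_pull => //; [exact: gensub_sr|exact: gensub_A0|].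
 by move=> P hP; apply: pchart_dominates.
have [c0 hc0] := p y0 n0 h0; have [c1 hc1] := p y1 n1 h1.
by exists (c0 - c1), c0, c1.
Qed.

(** If c0 - c1 = b0 + b1, then c0 - b0 = c1 + b1 is one constant good for both charts. It suffices
    to test this at discrete valuation rings, each of which contains one of the charts. *)
Lemma defect_trivial s z : family floc s -> defect s z -> D z -> exists c, forall x, floc x (s x - c).
Proof.
move=> fs [c0 [c1 [hc0 hc1 ->]]] [b0 [b1 [hb0 hb1 e]]].
exists (c0 - b0) => x; apply: contrapT => /detect [q [pi [qx dq nq]]].
have vV := dvrV dq; have sV := vV.1.
have [W [Wx hW]] := fs x; have Wq := gen_opens qx Wx.
apply: nq; rewrite (_ : s x - (c0 - b0) = (s q - (c0 - b0)) - (s q - s x)); last by ring.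
apply: (subB sV); last exact: hW.
have dq' : dominated q (floc q) by split.
have [h|h] := hV vV (@A0loc q).
 have BV := pchart_sub sV (@A0loc q) h.
 by rewrite opprB addrA addrAC; apply: (subD sV); [apply: pulled_in hc0 vV BV dq'|apply: BV].
have BV := pchart_sub sV (@A0loc q) h.
have -> : c0 = b0 + b1 + c1 by rewrite -e subrK.
rewrite (_ : s q - (b0 + b1 + c1 - b0) = (s q - c1) - b1); last by ring.
by apply: (subB sV); [apply: pulled_in hc1 vV BV dq'|apply: BV].
Qed.

Lemma defect_in s z : defect s z -> B01 z.
Proof.
move=> [c0 [c1 [hc0 hc1 ->]]]; apply: (loc_inter sB01) => P hP.
have [V [vV RV _ eP _]] := valring_over_prime sB01 hP.
have AV : A0 `<=` V by move=> z' Az; apply: RV; apply: gensub_A0.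
have [x dx] := center vV AV; have sl := loc_sr sB01 hP.
have low y c : pchart y `<=` B01 -> pulled y s c -> loc B01 P (s x - c).
 move=> yB h; have yV := subset_trans yB RV; have sR := gensub_sr [seq w / y | w <- ws0].
 have [a [b [ha hb nb b0 ->]]] := locP (center_prime sR vV yV) (h V x vV yV dx).
 apply: (locE hP); [exact: yB|exact: yB|] => Pb; apply: nb; split=> //.
 by move: Pb; rewrite -eP => -[].
rewrite (_ : c0 - c1 = (s x - c1) - (s x - c0)); last by ring.
by apply: (subB sl); [exact: low B1_B01 hc1|exact: low B0_B01 hc0].
Qed.

(** Where a is invertible, s is equivalent to a constant c, and c0 - c and c1 - c become regular on
    their charts after multiplication by a power of a. *)
Lemma defect_torsion s z a : family floc s -> defect s z -> nonunit A0 a -> exists m, D (a ^+ m * z).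
Proof.
move=> fs [c0 [c1 [hc0 hc1 ->]]] na; have Aa : A0 a by case: na.
have [a0|a0] := eqVneq a 0.
 by exists 1%N; rewrite a0 expr1 mul0r; case: pencil_subm.
pose R := adjoin A0 a^-1; have sR : subring R by apply: adjoin_sr.
have AR : A0 `<=` R by apply: (sub_adjoin _ (sub_ideal sA)).
have aR : R a^-1 by apply: adjoin_gen.
have [c hc] := away_pull fs na a0.
have low y c' : y != 0 -> spn A0 ws0 y -> pulled y s c' -> exists m, pchart y (a ^+ m * (c' - c)).
 move=> ny hy h; have sB := gensub_sr [seq w / y | w <- ws0].
 apply: (loc_denom sB); first exact: gensub_A0.
 move=> P hP nPa; have [V [vV RV lV eP nV]] := valring_over_prime sB hP.
 have AV : A0 `<=` V by move=> z' Az; apply: RV; apply: gensub_A0.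
 have [x dx] := center vV AV; have sl := loc_sr sB hP.
 have la : loc (pchart y) P a^-1.
  by rewrite -div1r; apply: (locE hP) => //; [exact: (sub1 sB)|exact: gensub_A0].
 have Rl : R `<=` loc (pchart y) P.
  by apply: adjoin_min => // z' Az; apply: (sub_loc sB hP); apply: gensub_A0.
 rewrite (_ : c' - c = (s x - c) - (s x - c')); last by ring.
 apply: (subB sl); last by rewrite -eP; apply: h.
 have RV' := subset_trans Rl lV; have hP' := center_prime sR vV RV'.
 have [b [d [Rb Rd nd d0 ->]]] := locP hP' (hc V x vV RV' dx).
 apply: (subM sl); first exact: Rl.
 have [|//] := @not_nonunit _ (loc (pchart y) P) d (Rl _ Rd).
 by move=> h'; apply: nd; split=> //; apply/(nV _ (Rl _ Rd)).
have [m0 hm0] := low y0 c0 n0 h0 hc0; have [m1 hm1] := low y1 c1 n1 h1 hc1.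
exists (m0 + m1)%N; exists (a ^+ (m0 + m1) * (c0 - c)), (- (a ^+ (m0 + m1) * (c1 - c))); split.
- rewrite addnC exprD -mulrA; apply: (subM sB0) => //; apply: gensub_A0; exact: (subX sA).
- apply: (subN sB1); rewrite exprD -mulrA; apply: (subM sB1) => //; apply: gensub_A0; exact: (subX sA).
- by ring.
Qed.

(** The defects lie in the part of the finite module B01 / D that is torsion for the maximal ideal.
    This part is finitely generated, hence of finite dimension over k. *)
Lemma defect_finite : exists us, forall s z, family floc s -> defect s z -> spanD (range kap) D us z.
Proof.
have sD := pencil_subm; have [D0' DD DM] := sD.
pose M : set K := [set z | B01 z /\ forall a, nonunit A0 a -> exists m, D (a ^+ m * z)].
have [us hus] := pencil_finite.
have [|d Dd|z [Bz _]|ws Mw hw] := submodule_fg sA noethA (D := D) (M := M) (us := us) sD.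
- split.
 + split; first exact: (sub0 sB01).
  by move=> a _; exists 0%N; rewrite mulr0.
 + move=> x y [Bx hx] [By hy]; split; first exact: (subD sB01).
  move=> a na; have Aa : A0 a by case: na.
  have [i hi] := hx a na; have [j hj] := hy a na; exists (i + j)%N.
  rewrite mulrDr; apply: DD.
   by rewrite addnC exprD -mulrA; apply: DM => //; exact: (subX sA).
  by rewrite exprD -mulrA; apply: DM => //; exact: (subX sA).
 + move=> b x Ab [Bx hx]; split; first by apply: (subM sB01) => //; apply: gensub_A0.
  by move=> a na; have [i hi] := hx a na; exists i; rewrite mulrCA; apply: DM.
- split; last by move=> a [Aa _]; exists 0%N; rewrite mul1r.
 by have [b0 [b1 [hb0 hb1 ->]]] := Dd; apply: (subD sB01); [apply: B0_B01|apply: B1_B01].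
- exact: hus.
have [|us' hus'] := kspan_span (ws := ws) (kap := kap) sD.
 by move=> w /Mw [_ tw]; apply: (torsion_cyclic sA resA noethA localA sD).
exists us' => s z fs dz; apply/hus'/hw.
by split; [apply: defect_in dz|move=> a na; apply: defect_torsion dz na].
Qed.

End Pencil.

(* A finite-dimensional quotient detecting the cohomology of the structure sheaf. *)
Lemma genus_finite : exists (D : set K) us (rel : (X -> K) -> K -> Prop),
 [/\ subm A0 D, rel (fun _ => 0) 0,
  forall l s s' z z', rel s z -> rel s' z' -> rel (fun x => kap l * s x + s' x) (kap l * z + z'),
  forall s, family floc s -> exists2 z, rel s z & spanD (range kap) D us z &
  forall s z, family floc s -> rel s z -> D z -> exists c, forall x, floc x (s x - c)].
Proof.
have [y0 [y1 [n0 n1 h0 h1 hV]]] := pencil ws0_covers.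
have [us hus] := defect_finite n0 n1 h0 h1 hV.
exists [set z | exists b0 b1, [/\ pchart y0 b0, pchart y1 b1 & z = b0 + b1]], us, (defect y0 y1); split.
- exact: pencil_subm.
- exact: defect0.
- exact: defectD.
- by move=> s fs; have [z dz] := defect_exists n0 n1 h0 h1 fs; exists z => //; apply: hus dz.
- by move=> s z fs dz; apply: defect_trivial dz.
Qed.

(** * A general section of the cycle and its strict transform *)

Section Cycle.
Variables (Z : X -> nat) (Zs : seq X).
Hypothesis Zfin : forall e, Z e != 0%N -> e \in Zs.

Implicit Types (e q x : X).

Definition exc (x : X) : Prop := nonunit A0 `<=` nonunit (floc x).

Hypothesis Zexc : forall e, Z e != 0%N -> exc e /\ exists pi, dvr_pt e pi.
Hypothesis Zpos : exists e, Z e != 0%N.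

(** The stalk of O_X(-Z), with orders of vanishing tested at the discrete valuation rings of the
    generizations of x. *)
Definition minusZ (x : X) : set K := [set z | floc x z /\
 forall e pi, closure [set e] x -> dvr_pt e pi -> floc e (z / pi ^+ Z e)].

Hypothesis nofix : forall e pi, dvr_pt e pi -> exc e ->
 exists2 s, (forall x, minusZ x s) & ~ floc e (s / pi ^+ (Z e).+1).

Lemma val_sub (V V' : set K) : valring V -> subring V' -> V `<=` V' -> nonunit V' `<=` nonunit V.
Proof.
move=> vV sV' VV z [V'z nz]; apply: contrapT => h.
have [Vz|nVz] := EM (V z).
 by have [z0 /VV Vi] := not_nonunit Vz h; apply: nz.
have [Vi _] := valring_inv vV nVz; apply: nz; split; last exact: VV.
by apply/eqP => z0; apply: nVz; rewrite z0; apply: sub0; case: vV.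
Qed.

Lemma gen_val e x : valring (floc e) -> floc x `<=` floc e ->
 closure [set e] x /\ floc e = loc (floc x) (floc x `&` nonunit (floc e)).
Proof.
move=> vV h; have hP := center_prime (floc_sr x) vV h.
have [y [xy ey py]] := prime_point hP.
have [lV lN] := loc_center (floc_sr x) vV h.
have E : e = y.
 apply: (unique_center vV); first by split.
 by rewrite /dominated ey; split=> // z nz; apply/lN => //; case: nz.
by split; [rewrite E|rewrite {1}E].
Qed.

Lemma nonunit_gen e x z : closure [set e] x -> floc x z -> nonunit (floc e) z -> nonunit (floc x) z.
Proof.
move=> ex xz [_ nz]; apply: contrapT => h; apply: nz.
by have [z0 h'] := not_nonunit xz h; split=> //; apply: (gen_sub ex).
Qed.

Lemma exc_gen e x : closure [set e] x -> exc e -> exc x.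
Proof. by move=> ex he a na; apply: (nonunit_gen ex) (he _ na); apply: A0loc; case: na. Qed.

Lemma dvr_pow e pi z w : dvr_pt e pi -> nonunit (floc e) z -> exists N, forall M, (N <= M)%N ->
 floc e (z ^+ M * w).
Proof.
move=> de nz; have vV := dvrV de; have sV := vV.1.
have [Vw|nVw] := EM (floc e w).
 by exists 0%N => M _; apply: (subM sV) => //; apply: (subX sV); case: nz.
have [Vi ni] := valring_inv vV nVw; have [pi0 _ hpi] := de.
have w0 : w^-1 != 0 by rewrite invr_eq0; apply/eqP => w0; apply: nVw; rewrite w0; apply: (sub0 sV).
have [N [h1 h2]] := dvr_ord de w0 Vi; exists N => M NM.
rewrite (_ : _ * w = z ^+ (M - N) * ((z / pi) ^+ N * (w^-1 / pi ^+ N)^-1)); last first.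
 have w0' : w != 0 by rewrite -invr_eq0.
 by rewrite -{1}(subnK NM) exprD expr_div_n; fld.
by apply: (subM sV); [apply: (subX sV); case: nz|apply: (subM sV) => //; apply: (subX sV); apply: hpi].
Qed.

Lemma minusZD x a b : minusZ x a -> minusZ x b -> minusZ x (a + b).
Proof.
move=> [h1 h2] [h3 h4]; split; first exact: (subD (floc_sr _)).
by move=> e pi ex de; rewrite mulrDl; apply: (subD (floc_sr _)); [apply: h2|apply: h4].
Qed.

Lemma minusZM x a b : floc x a -> minusZ x b -> minusZ x (a * b).
Proof.
move=> xa [h3 h4]; split; first exact: (subM (floc_sr _)).
by move=> e pi ex de; rewrite -mulrA; apply: (subM (floc_sr _)); [apply: (gen_sub ex)|apply: h4].
Qed.

Lemma minusZ0 x : minusZ x 0.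
Proof. by split=> [|e pi _ _]; rewrite ?mul0r; exact: (sub0 (floc_sr _)). Qed.

Lemma minusZ_subm : subm A0 [set z | forall x, minusZ x z].
Proof.
split=> [x|a b ha hb x|a b Aa hb x]; [exact: minusZ0|exact: minusZD|].
by apply: minusZM => //; apply: A0loc.
Qed.

Lemma minusZN x a : minusZ x a -> minusZ x (- a).
Proof.
by rewrite -mulN1r; apply: minusZM; apply: (subN (floc_sr _)); apply: (sub1 (floc_sr _)).
Qed.

(** Every valuation ring over A0 has a center on X, so a global function is integral over A0. *)
Lemma global_A0 z : (forall x : X, floc x z) -> A0 z.
Proof.
move=> h; apply: normA; apply: integral_vals => // V vV AV.
by have [x [lx _]] := center vV AV; apply: lx.
Qed.

(** Were Z e zero, a global section without zero along e would be a unit of A0, but it vanishes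
    along the curves of Z. *)
Lemma curve_pos e pi : dvr_pt e pi -> exc e -> Z e != 0%N.
Proof.
move=> de xe; apply/negP => /eqP Z0.
have [s Gs ns] := nofix de xe; have As : A0 s by apply: global_A0 => x; case: (Gs x).
have us : ~ nonunit A0 s by move=> /xe h; apply: ns; rewrite Z0 expr1; have [_ _ hp] := de; apply: hp.
have [s0 Ai] := not_nonunit As us; have [e0 Ze0] := Zpos.
have [xe0 [p0 de0]] := Zexc Ze0; have [pi0 np0 _] := de0.
have [_ h] := Gs e0; have := h _ _ (@subset_closure _ [set e0] e0 erefl) de0.
rewrite -(prednK (n := Z e0)) ?lt0n // exprS => h1.
have : nonunit (floc e0) s.
 rewrite (_ : s = s / (p0 * p0 ^+ (Z e0).-1) * p0 ^+ (Z e0).-1 * p0); last first.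
  by fld; rewrite ?expf_neq0.
 have sV := floc_sr e0; apply: (idM (floc_ideal e0)) => //.
 by apply: (subM sV) => //; apply: (subX sV); case: np0.
by move=> [_]; apply; split=> //; apply: A0loc.
Qed.

(** Each element of K takes only finitely many residues in k on the family VV; this finiteness is
    what general combinations require. *)
Definition FR (VV : set (set K)) : Prop := forall x : K, exists C : seq k, forall V c,
 VV V -> nonunit V (x - kap c) -> c \in C.

(* A general combination of finitely many elements has the worst pole among them. *)
Lemma general_element (VV : set (set K)) (y0 : K) (ys : seq K) :
 (forall V, VV V -> valring V /\ A0 `<=` V) -> FR VV -> y0 != 0 ->
 exists c, [/\ c != 0, spn A0 (y0 :: ys) c & forall V y, VV V -> y \in y0 :: ys -> V (y / c)].
Proof.
move=> hVV fr n0; elim: ys => [|y ys [c [c0 hc mc]]].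
 exists y0; split=> //; first by apply: spn_mem; rewrite mem_head.
 move=> V y hV; rewrite inE => /eqP ->; rewrite divff //; apply: sub1; by case: (hVV V hV) => -[].
have mono z : spn A0 (y0 :: ys) z -> spn A0 [:: y0, y & ys] z.
 move=> hz N sN hN; apply: hz => // w; rewrite inE => hw; apply: hN.
 by rewrite !inE; case/orP: hw => ->; rewrite ?orbT.
have [e0|y0'] := eqVneq y 0.
 exists c; split=> //; first exact: mono.
 move=> V w hV; rewrite !inE => /or3P [h|/eqP ->|h]; try by apply: mc; rewrite // inE h ?orbT.
 by rewrite e0 mul0r; apply: sub0; case: (hVV V hV) => -[].
have [C hC] := fr (c / y).
have [e eC ne] : exists2 e, e \notin C & c / y - kap e != 0.
 have [[d hd]|nd] := EM (exists d, kap d = c / y).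
  have [e _ he] := @avoid_seq 1 (d :: C) (oner_neq0 _).
  move: he; rewrite inE negb_or => /andP [ed eC]; exists e => //.
  by rewrite subr_eq0 -hd fmorph_eq eq_sym.
 have [e _ eC] := @avoid_seq 1 C (oner_neq0 _); exists e => //.
 by rewrite subr_eq0; apply/eqP => h; apply: nd; exists e.
have ec : c - kap e * y = y * (c / y - kap e) by fld.
have c'0 : c - kap e * y != 0 by rewrite ec mulf_neq0.
exists (c - kap e * y); split=> //.
 have sS := spn_sub A0 [:: y0, y & ys]; apply: (submB sA sS); first exact: mono.
 by have [_ _ M] := sS; apply: M => //; apply: spn_mem; rewrite !inE eqxx orbT.
move=> V w hV hw; have [vV AV] := hVV V hV; have sV := vV.1.
have [Vc Vy] : V (c / (c - kap e * y)) /\ V (y / (c - kap e * y)).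
 have [Vx|nVx] := EM (V (c / y)).
  have ne' : ~ nonunit V (c / y - kap e) by move=> /(hC V e hV) h; move/negP: eC; apply.
  have [_ Vi] := shift_unit sV AV y0' Vx ne'; split=> //.
  by rewrite (_ : c / _ = c / y * (y / (c - kap e * y))); [apply: subM|fld].
 have := valring_inv vV nVx; rewrite invf_div => ni; have [_ Vi] := shift_small e vV AV c0 ni.
 split=> //; rewrite (_ : y / _ = y / c * (c / (c - kap e * y))); last by fld.
 by apply: (subM sV) => //; case: ni.
have old : w \in y0 :: ys -> V (w / (c - kap e * y)).
 by move=> h; rewrite (_ : w / _ = w / c * (c / (c - kap e * y))); [apply: (subM sV) => //; apply: mc|fld].
by move: hw; rewrite !inE => /or3P [h|/eqP ->|h] //; apply: old; rewrite inE h ?orbT.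
Qed.

Lemma residue_union (VV : set (set K)) (T : eqType) (xs : seq T) (VT : T -> set (set K)) :
 (forall V, VV V -> exists2 t, t \in xs & VT t V) -> (forall t, FR (VT t)) -> FR VV.
Proof.
move=> h fr x; suff [C hC] : exists C : seq k, forall t V c, t \in xs -> VT t V ->
  nonunit V (x - kap c) -> c \in C.
 by exists C => V c /h [t ht tV]; apply: hC tV.
elim: xs {h} => [|t xs [C hC]]; first by exists [::].
have [C' hC'] := fr t x; exists (C' ++ C) => t' V c; rewrite inE mem_cat => /predU1P [->|h] tV nc.
 by rewrite (hC' V).
by rewrite (hC t' V) ?orbT.
Qed.

Lemma residue1 V : subring V -> A0 `<=` V -> ideal V (nonunit V) -> FR [set V].
Proof.
move=> sV AV iV x; have [[c hc]|nc] := EM (exists c, nonunit V (x - kap c)).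
 by exists [:: c] => _ d -> hd; rewrite inE (residue_unique sV AV iV hd hc).
by exists [::] => _ d -> hd; case: nc; exists d.
Qed.

Lemma exists_h : exists h, [/\ h != 0, forall x, minusZ x h &
 forall e pi, dvr_pt e pi -> exc e -> floc e (h / pi ^+ Z e)^-1].
Proof.
have /choice [s hs] : forall e, exists s, (forall x, minusZ x s) /\
  (Z e != 0%N -> exists pi, [/\ dvr_pt e pi, exc e & ~ floc e (s / pi ^+ (Z e).+1)]).
 move=> e; have [Z0|n0] := eqVneq (Z e) 0%N.
  by exists 0; split=> //; case: minusZ_subm.
 by have [xe [pi de]] := Zexc n0; have [s Gs ns] := nofix de xe; exists s; split=> // _; exists pi.
have [e0 Ze0] := Zpos; have s0 e : Z e != 0%N -> s e != 0.
 move=> Ze; have [_ h] := hs e; have [pi [_ _ ns]] := h Ze.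
 by apply/eqP => se; apply: ns; rewrite se mul0r; apply: (sub0 (floc_sr e)).
pose VV := [set V | exists2 e, Z e != 0%N & V = floc e].
have [|| h [h0 hh mh]] := @general_element VV (s e0) [seq s e | e <- Zs] _ _ (s0 _ Ze0).
- by move=> _ [e /Zexc [_ [pi de]] ->]; split; [apply: dvrV de|apply: A0loc].
- apply: (@residue_union _ _ Zs (fun e => [set floc e])).
  by move=> _ [e Ze ->]; exists e => //; apply: Zfin.
 by move=> e; apply: residue1; [apply: floc_sr|apply: A0loc|apply: floc_ideal].
have Gh x : minusZ x h.
 apply: (hh [set z | forall x, minusZ x z]); first exact: minusZ_subm.
 move=> w; rewrite inE => /predU1P [->|/mapP [e _ ->]] y; [by case: (hs e0)|by case: (hs e)].
exists h; split=> // e pi de xe; have Ze := curve_pos de xe.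
have [Gs /(_ Ze) [p [dp _ ns]]] := hs e; have [p0 np hp] := dp; have [pi0 npi hpi] := de.
have sV := floc_sr e; have hse : floc e (s e / h).
 by apply: mh; [exists e|rewrite inE map_f ?orbT //; apply: Zfin].
have self : closure [set e] e by apply: subset_closure.
have [_ hx] := Gs e; have h1 := hx _ _ self dp.
have [|u0 ui] := @not_nonunit _ (floc e) _ h1.
 by move=> /hp; rewrite -mulrA -invfM -exprSr.
have hpp : floc e (pi / p) by apply: hp.
rewrite (_ : _^-1 = (s e / h) * ((pi / p) ^+ Z e * (s e / p ^+ Z e)^-1)).
 by apply: (subM sV) => //; apply: (subM sV) => //; apply: (subX sV).
by move: (s0 e Ze) => se0; rewrite expr_div_n; fld.
Qed.

Section Hypersurface.
Variable h : K.
Hypotheses (h0 : h != 0) (Gh : forall x, minusZ x h)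
 (hunit : forall e pi, dvr_pt e pi -> exc e -> floc e (h / pi ^+ Z e)^-1).

(* The generic points of the strict transform of div(h). *)
Definition strict e : Prop := [/\ exists pi, dvr_pt e pi, ~ exc e & nonunit (floc e) h].

Let Ah : A0 h. Proof. by apply: global_A0 => x; case: (Gh x). Qed.

Lemma strict_valring e : strict e -> valring (floc e).
Proof. by case=> [[pi de] _ _]; apply: dvrV de. Qed.

Lemma height1_of e pi : dvr_pt e pi -> ~ exc e -> height1 (A0 `&` nonunit (floc e)) /\
 floc e = loc A0 (A0 `&` nonunit (floc e)).
Proof.
move=> de ne; have vV := dvrV de.
have nd : ~ dominating (floc e) by case=> _ _ d; apply: ne.
have [VK|[P h1 [eV eP]]] := not_dominating vV (@A0loc e) nd.
 by have [p0 [_ np] _] := de; case: np; split=> //; apply: VK.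
by rewrite -eP -eV.
Qed.

Lemma valring_eq e e' : valring (floc e) -> floc e = floc e' -> e = e'.
Proof. by move=> vV E; apply: (unique_center vV); [split|rewrite E; split]. Qed.

(** Q lies strictly above the height one prime of e, and dimension two leaves room only for the
    maximal ideal. *)
Lemma prime_above_strict e Q b : strict e -> pideal A0 Q -> A0 `&` nonunit (floc e) `<=` Q ->
 Q b -> ~ nonunit (floc e) b -> nonunit A0 `<=` Q.
Proof.
move=> [[pi de] ne nh] hQ PQ Qb nb a na; apply: contrapT => nQa.
have [[hP [z z0 Pz] _] _] := height1_of de ne; have [iQ Q1 _] := hQ.
have hm := nonunit_prime sA localA.
apply: (@chain3 A0 _ Q (nonunit A0) sA _ hP hQ hm); [by []|by exists z| |].
 by split=> // /(_ b Qb) [].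
by split; [exact: prime_sub_nonunit hQ|move=> /(_ a na)].
Qed.

(** The points where the strict transform meets the exceptional set. *)
Definition Tpt q : Prop := exc q /\ exists2 e, strict e & closure [set e] q.

(** If y is not exceptional, each b in A0 outside the prime of e is invertible at y by
    [prime_above_strict]. Then the local ring at e, a localization of A0, is contained in that at
    y. *)
Lemma strict_closure e y : strict e -> closure [set e] y -> Tpt y \/ y = e.
Proof.
move=> se cl; have [xy|ny] := EM (exc y); first by left; split=> //; exists e.
right; have [[pi de] ne nh] := se; have [[hP _ _] eV] := height1_of de ne.
have sy := floc_sr y; apply/esym; apply: valring_eq; first exact: dvrV de.
apply/seteqP; split; last exact: gen_sub.
rewrite eV => _ /(locP hP) [a [b [Aa Ab nb b0 ->]]]; apply: (subM sy); first exact: A0loc.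
have [|//] := @not_nonunit _ (floc y) b (@A0loc _ _ Ab); move=> yb; apply: ny.
have hy := contract_prime sA (@A0loc y) (floc_nonunit_prime y).
move=> c nc; have [] // := @prime_above_strict e _ b se hy _ (conj Ab yb) _ c nc.
 by move=> d [Ad ed]; split=> //; apply: (nonunit_gen cl) ed; apply: A0loc.
by move=> eb; apply: nb.
Qed.

(** A component of the strict transform is determined by its height one prime in A0, which contains
    h. *)
Lemma exists_strict_list : exists es : seq X, forall e, strict e -> e \in es.
Proof.
have inj : {in [set e | strict e] &, injective (fun e => A0 `&` nonunit (floc e))}.
 move=> e e' /set_mem [[pi de] ne _] /set_mem [[pi' de'] ne' _] h1; apply: valring_eq; first exact: dvrV de.
 by have [_ ->] := height1_of de ne; have [_ ->] := height1_of de' ne'; rewrite h1.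
have fin : finite_set [set e | strict e].
 rewrite -(eq_finite_set (inj_card_eq inj)); apply: sub_finite_set (height1_finite Ah h0).
 by move=> _ [e [[pi de] ne nh] <-]; have [h1 _] := height1_of de ne.
have [es ee] := (finite_seqP _).1 fin; exists es => e se.
by suff : [set` es] e by []; rewrite -ee.
Qed.

(** Off the strict transform h generates O_X(-Z). This is tested at discrete valuation rings: along
    exceptional curves by the exact order of h, along others since h is a unit there. *)
Lemma minusZ_off x z : (forall e, strict e -> ~ closure [set e] x) -> minusZ x z -> floc x (z / h).
Proof.
move=> off [xz hz]; apply: contrapT => /detect [e [pi [cl de nz]]]; apply: nz.
have sV := floc_sr e; have [p0 _ _] := de.
have [xe|ne] := EM (exc e).
 rewrite (_ : z / h = z / pi ^+ Z e * (h / pi ^+ Z e)^-1); last by fld.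
 by apply: (subM sV); [apply: hz|apply: hunit].
apply: (subM sV); first exact: (gen_sub cl).
have [|//] := @not_nonunit _ (floc e) h (@A0loc _ _ Ah); move=> nh.
by case: (off e) => //; split=> //; exists pi.
Qed.

Lemma minusZ_h x z : floc x z -> minusZ x (h * z).
Proof. by rewrite mulrC => xz; apply: minusZM. Qed.

Lemma minusZ_nonexc x z : ~ exc x -> floc x z -> minusZ x z.
Proof.
move=> nx xz; split=> // e pi cl de; have [->|Ze] := eqVneq (Z e) 0%N.
 by rewrite divr1; apply: (gen_sub cl).
by case: nx; apply: exc_gen cl _; case: (Zexc Ze).
Qed.

(** The valuation rings of the strict transform: its discrete valuation rings, and the composite
    ones below them, which stand for the branches at closed points. *)
Definition curve_val (V : set K) : Prop :=
 exists2 e, strict e & (dominating V /\ V `<=` floc e) \/ V = floc e.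

Lemma curve_valP V : curve_val V -> valring V /\ A0 `<=` V.
Proof. by case=> e /strict_valring vV [[[]]|->] //; split=> //; apply: A0loc. Qed.

Lemma residue_height1 e (x : K) : strict e -> exists C : seq k, forall V, dominating V -> V `<=` floc e ->
 V x -> exists2 c, c \in C & nonunit V (x - kap c).
Proof.
case=> [[pi de] ne _]; have [h1 eV] := height1_of de ne.
have [lx|nx] := EM (floc e x); last by exists [::] => V dV Ve /Ve.
by rewrite eV in lx *; apply: residues1.
Qed.

Lemma curve_val_FR : FR curve_val.
Proof.
have [es hes] := exists_strict_list.
apply: (@residue_union _ _ es (fun e V => strict e /\ ((dominating V /\ V `<=` floc e) \/ V = floc e))).
 by move=> V [e se hV]; exists e; [apply: hes|].
move=> e x; have [se|ne] := EM (strict e); last by exists [::] => V c [].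
have [C hC] := residue_height1 x se; have vV := strict_valring se.
have [D hD] := residue1 vV.1 (@A0loc e) (valring_ideal vV) x.
exists (C ++ D) => V c [_ hV] nc; rewrite mem_cat; case: hV nc => [[dV Ve] nc|-> nc]; last first.
 by rewrite (hD (floc e) c) ?orbT.
have [vV' AV _] := dV; have [|c' cC nc'] := hC V dV Ve.
 by rewrite -(subrK (kap c) x); apply: (subD vV'.1); [case: nc|apply: AV].
by rewrite (residue_unique vV'.1 AV (valring_ideal vV') nc nc') cC.
Qed.

(** V is a valuation ring over the local ring at q enlarged by the maximal ideal of e. As this ideal
    stays in the maximal ideal of V, no element of V has a pole along e. *)
Lemma exists_curve_val q e : strict e -> exc q -> closure [set e] q ->
 exists V, [/\ dominating V, V `<=` floc e & dominated q V].
Proof.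
move=> se xq cl; have vV := strict_valring se; have lt := gen_sub cl.
have sq := floc_sr q; have iq := floc_ideal q; have ie := valring_ideal vV.
pose R := [set z | exists a b, [/\ floc q a, nonunit (floc e) b & z = a + b]].
pose J := [set z | exists a b, [/\ nonunit (floc q) a, nonunit (floc e) b & z = a + b]].
have sR : subring R.
 split.
 - by exists 1, 0; split; [exact: (sub1 sq)|exact: (id0 ie)|rewrite addr0].
 - move=> _ _ [a [b [ha hb ->]]] [c [d [hc hd ->]]]; exists (a - c), (b - d).
  by split; [exact: (subB sq)|exact: (idB vV.1 ie)|ring].
 - move=> _ _ [a [b [ha hb ->]]] [c [d [hc hd ->]]]; exists (a * c), (a * d + b * (c + d)).
  split; [exact: (subM sq)| |ring]; apply: (idD ie); first by apply: (idM ie) => //; apply: lt.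
  by apply: (idMr ie) => //; apply: (subD vV.1); [apply: lt|case: hd].
have iJ : ideal R J.
 split.
 - by move=> _ [a [b [[ha _] hb ->]]]; exists a, b.
 - by exists 0, 0; rewrite addr0; split=> //; [exact: (id0 iq)|exact: (id0 ie)].
 - move=> _ _ [a [b [ha hb ->]]] [c [d [hc hd ->]]]; exists (a + c), (b + d).
  by split; [exact: (idD iq)|exact: (idD ie)|ring].
 - move=> _ _ [a [b [ha hb ->]]] [c [d [hc hd ->]]]; exists (a * c), (a * d + b * (c + d)).
  split; [exact: (idM iq)| |ring]; apply: (idD ie); first by apply: (idM ie) => //; apply: lt.
  by apply: (idMr ie) => //; apply: (subD vV.1); [apply: lt; case: hc|case: hd].
have nJ : ~ J 1.
 move=> [a [b [na nb e1]]]; have eb : b = 1 - a by rewrite e1 addrAC subrr add0r.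
 have qb : floc q b by rewrite eb; apply: (subB sq); [exact: (sub1 sq)|case: na].
 have [_ n1 _] := floc_nonunit_prime q; apply: n1; rewrite e1; apply: (idD iq) => //.
 exact: (nonunit_gen cl).
have [V [vV' RV JV]] := valring_exists sR iJ nJ.
have qV : floc q `<=` V.
 by move=> a ha; apply: RV; exists a, 0; split=> //; [exact: (id0 ie)|rewrite addr0].
have mV : nonunit (floc q) `<=` nonunit V.
 by move=> a ha; apply: JV; exists a, 0; split=> //; [exact: (id0 ie)|rewrite addr0].
exists V; split=> //; first by split=> // a; [move=> Aa; apply: qV; apply: A0loc|move=> na; apply: mV; apply: xq].
move=> z Vz; apply: contrapT => nz; have ni := valring_inv vV nz.
have : nonunit V z^-1 by apply: JV; exists 0, z^-1; rewrite add0r; split=> //; exact: (id0 iq).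
apply: nonunit_inv; first by rewrite invrK.
by rewrite invr_eq0; apply/eqP => z0; apply: nz; rewrite z0; apply: (sub0 vV.1).
Qed.

(** A general combination of h and of elements of the maximal ideal of A0, one for each strict
    curve, that do not vanish on it. Its zeros on the strict transform are the points of [Tpt]. *)
Lemma exists_transversal : exists a, [/\ nonunit A0 a, a != 0 & forall e, strict e -> floc e a^-1].
Proof.
have [es hes] := exists_strict_list.
have hm : nonunit A0 h.
 split=> // -[_ Ai]; have [e Ze] := Zpos; have [xe [pi de]] := Zexc Ze.
 have [_ hh] := Gh e; have h1 := hh _ _ (@subset_closure _ [set e] e erefl) de; have [p0 np _] := de.
 have [_ n1 _] := valring_prime (dvrV de); apply: n1; have ie := valring_ideal (dvrV de).
 rewrite (_ : 1 = pi * (pi ^+ (Z e).-1 * (h / pi ^+ Z e) * h^-1)).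
  apply: (idMr ie) => //; have sV := floc_sr e; apply: (subM sV); last exact: A0loc.
  by apply: (subM sV) => //; apply: (subX sV); case: np.
 by move: Ze; case: (Z e) => // N _; rewrite exprS /=; fld.
have /choice [b hb] : forall e, exists b, nonunit A0 b /\ (strict e -> ~ nonunit (floc e) b).
 move=> e; have [[[pi de] ne _]|ns] := EM (strict e); last by exists h.
 apply: contrapT => h'; apply: ne => c nc; apply: contrapT => nec.
 by apply: h'; exists c.
have [a [a0 ha ma]] := @general_element curve_val h [seq b e | e <- es] curve_valP curve_val_FR h0.
exists a; split=> //.
 apply: (ha (nonunit A0)); last by move=> w; rewrite inE => /predU1P [->|/mapP [e _ ->]] //; case: (hb e).
 by split; [exact: (id0 localA)|move=> x y; apply: (idD localA)|move=> x y; apply: (idM localA)].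
move=> e se; have [nb ub] := hb e; have [Ab _] := nb; have sV := floc_sr e.
have [b0 bi] := not_nonunit (@A0loc e _ Ab) (ub se).
rewrite (_ : a^-1 = b e / a * (b e)^-1); last by fld.
by apply: (subM sV) => //; apply: ma; [exists e; [|right]|rewrite inE map_f ?orbT // hes].
Qed.

Lemma Tpt_residue q (x : K) : Tpt q -> floc q x -> exists c, nonunit (floc q) (x - kap c).
Proof.
move=> [xq [e se cl]] qx; have [V [dV Ve [lV mV]]] := exists_curve_val se xq cl.
have [C hC] := residue_height1 x se; have [c _ nc] := hC V dV Ve (lV _ qx).
have qxc : floc q (x - kap c) by apply: (subB (floc_sr q)) => //; apply: A0loc.
exists c; apply: contrapT => /(not_nonunit qxc) [u0 /lV ui].
by case: nc => _; apply.
Qed.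

(** The residues of the generators of a chart take finitely many values at these points and
    determine the point within the chart. *)
Lemma exists_Tpt_list : exists ts : seq X, forall q, Tpt q -> q \in ts.
Proof.
have FRT (x : K) : exists C : seq k, forall q c, Tpt q -> nonunit (floc q) (x - kap c) -> c \in C.
 have [C hC] := curve_val_FR x; exists C => q c [xq [e se cl]] nc.
 have [V [dV Ve [lV mV]]] := exists_curve_val se xq cl.
 by apply: (hC V); [exists e => //; left|apply: mV].
pose res q (gs : seq K) (l : seq k) := forall j, (j < size gs)%N -> nonunit (floc q) (gs`_j - kap l`_j).
have resL gs : exists L : seq (seq k), forall q, Tpt q -> (forall g, g \in gs -> floc q g) ->
  exists2 l, l \in L & res q gs l.
 elim: gs => [|g gs [L hL]]; first by exists [:: [::]] => q _ _; exists [::]; rewrite ?mem_head.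
 have [C hC] := FRT g; exists [seq c :: l | c <- C, l <- L] => q Tq hq.
 have [l lL rl] : exists2 l, l \in L & res q gs l.
  by apply: hL => // g' hg; apply: hq; rewrite inE hg orbT.
 have [c nc] := Tpt_residue Tq (hq g (mem_head _ _)).
 exists (c :: l); first by apply: allpairs_f => //; apply: (hC q).
 by case=> [|j] // jlt; apply: rl.
have resU i q q' l : Tpt q -> Tpt q' -> U i q -> U i q' -> res q (gens i) l -> res q' (gens i) l -> q = q'.
 move=> Tq Tq' Uq Uq' rq rq'; apply: (chart_inj (hU i)) => //.
 pose S := [set b | [/\ floc q b, floc q' b & exists c, nonunit (floc q) (b - kap c) /\ nonunit (floc q') (b - kap c)]].
 have BS : B i `<=` S.
  have [xq _] := Tq; have [xq' _] := Tq'.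
  have iq := floc_ideal q; have iq' := floc_ideal q'.
  have sq := floc_sr q; have sq' := floc_sr q'.
  apply: Bgen.
  - split.
   + split; [exact: (sub1 sq)|exact: (sub1 sq')|exists 1; rewrite rmorph1 subrr].
    by split; [exact: (id0 iq)|exact: (id0 iq')].
   + move=> a b [qa qa' [c [ha ha']]] [qb qb' [d [hb hb']]].
    split; [exact: (subB sq)|exact: (subB sq')|exists (c - d)].
    rewrite rmorphB (_ : _ - _ = (a - kap c) - (b - kap d)); last by ring.
    by split; [exact: (idB sq iq)|exact: (idB sq' iq')].
   + move=> a b [qa qa' [c [ha ha']]] [qb qb' [d [hb hb']]].
    split; [exact: (subM sq)|exact: (subM sq')|exists (c * d)].
    rewrite rmorphM (_ : _ - _ = (a - kap c) * b + kap c * (b - kap d)); last by ring.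
    split; [apply: (idD iq); [exact: (idMr iq)|apply: (idM iq) => //; exact: A0loc]|].
    by apply: (idD iq'); [exact: (idMr iq')|apply: (idM iq') => //; exact: A0loc].
  - move=> a Aa; split; [exact: A0loc|exact: A0loc|].
   by have [c nc] := resA Aa; exists c; split; [apply: xq|apply: xq'].
  - move=> g gi; have Bg := Bgens gi.
   split; [exact: (chart_sub (hU i) Uq)|exact: (chart_sub (hU i) Uq')|].
   have ig : (index g (gens i) < size (gens i))%N by rewrite index_mem.
   exists l`_(index g (gens i)).
   by rewrite -{1 3}(nth_index 0 gi); split; [apply: rq|apply: rq'].
 have sub q1 q2 : (forall b, B i b -> exists c, nonunit (floc q1) (b - kap c) /\ nonunit (floc q2) (b - kap c)) ->
   trace floc (B i) q1 `<=` trace floc (B i) q2.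
  move=> hS b [Bb nb]; split=> //; have [c [n1 n2]] := hS b Bb.
  have : nonunit (floc q1) (kap c).
   rewrite (_ : kap c = b - (b - kap c)); last by ring.
   exact: (idB (floc_sr q1) (floc_ideal q1)).
  by move=> /(kap_nonunit (@A0loc q1)) c0; rewrite c0 rmorph0 subr0 in n2.
 apply/seteqP; split; apply: sub => b /BS [_ _] // [c [n1 n2]].
 by exists c.
have Ui i : exists ts : seq X, forall q, Tpt q -> U i q -> q \in ts.
 have [L hL] := resL (gens i).
 have /choice [g hg] : forall l : seq k, exists x, forall q, Tpt q -> U i q -> res q (gens i) l -> q = x.
  move=> l; have [[x [Tx Ux rx]]|ne] := EM (exists q, [/\ Tpt q, U i q & res q (gens i) l]).
   by exists x => q Tq Uq rq; apply: (resU i q x l).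
  by exists (fgen X) => q Tq Uq rq; case: ne; exists q.
 exists [seq g l | l <- L] => q Tq Uq; have [|l lL rl] := hL q Tq.
  by move=> g' gi; apply: (chart_sub (hU i) Uq); apply: Bgens.
 by rewrite (hg l q Tq Uq rl); apply: map_f.
have [ts hts] := choice Ui.
exists (flatten [seq ts i | i <- enum 'I_n]) => q Tq; have [i Uq] := cover q.
by apply/flattenP; exists (ts i); [apply: map_f; rewrite mem_enum|apply: hts].
Qed.

Lemma Tpt_prime q e P b : exc q -> strict e -> closure [set e] q -> pideal (floc q) P ->
 floc q `&` nonunit (floc e) `<=` P -> P b -> ~ nonunit (floc e) b -> nonunit (floc q) `<=` P.
Proof.
move=> xq se cl hP le Pb nb z nz; apply: contrapT => nPz; have vV := strict_valring se.
have hPe := center_prime (floc_sr q) vV (gen_sub cl); have [_ _ nh] := se.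
apply: (@chain3 (floc q) _ P (nonunit (floc q)) (floc_sr q) _ hPe hP (floc_nonunit_prime q)).
- exact: A0loc.
- by exists h => //; split=> //; apply: A0loc.
- by split=> // /(_ b Pb) [].
- by split; [exact: prime_sub_nonunit|move=> /(_ z nz)].
Qed.

Lemma Tpt_gen p x : Tpt p -> closure [set p] x -> Tpt x.
Proof.
move=> [xp [e se cle]] cl; split; first exact: exc_gen cl xp.
by exists e => //; apply: opens_gen => V Vx; apply: (gen_opens cle); apply: (gen_opens cl).
Qed.

(** A branch V at q' has a center on the local ring of q that contains a and lies over the prime of
    e, in which a is not; by dimension this center is the maximal ideal. So V dominates both
    points. *)
Lemma Tpt_closed q q' : Tpt q -> Tpt q' -> closure [set q'] q -> q' = q.
Proof.
move=> [xq _] [xq' [e se cl']] cl; have lt := gen_sub cl.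
have cle : closure [set e] q.
 by apply: opens_gen => W Wq; apply: (gen_opens cl'); apply: (gen_opens cl).
have [V [[vV AV mV] Ve [dV1 dV2]]] := exists_curve_val se xq' cl'.
apply: (unique_center vV); first by split.
split; first by move=> z /lt /dV1.
have [a [na a0 ia]] := exists_transversal.
have hP := center_prime (floc_sr q) vV (fun z hz => dV1 z (lt z hz)).
have nea : ~ nonunit (floc e) a by move=> [_]; apply; split=> //; apply: ia.
have sub : floc q `&` nonunit (floc e) `<=` floc q `&` nonunit V.
 by move=> w [qw ew]; split=> //; apply: (val_sub vV (floc_sr e) Ve).
have Pa : (floc q `&` nonunit V) a by split; [apply: A0loc; case: na|apply: mV].
by move=> z nz; have [] := Tpt_prime xq se cle hP sub Pa nea nz.
Qed.

Lemma eventually_seq (T : eqType) (xs : seq T) (Pr : T -> nat -> Prop) :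
 (forall x : T, x \in xs -> exists N, forall M, (N <= M)%N -> Pr x M) ->
 exists N, forall (x : T) M, x \in xs -> (N <= M)%N -> Pr x M.
Proof.
elim: xs => [|x xs IH] hx; first by exists 0%N.
have [|N hN] := IH; first by move=> y hy; apply: hx; rewrite inE hy orbT.
have [N' hN'] := hx x (mem_head _ _).
exists (N + N')%N => y M; rewrite inE => /predU1P [->|hy] le.
 by apply: hN'; apply: leq_trans le; apply: leq_addl.
by apply: hN => //; apply: leq_trans le; apply: leq_addr.
Qed.

(** * Approximation on the strict transform *)

Section Semilocal.
Variable a : K.
Hypotheses (na : nonunit A0 a) (a0 : a != 0) (unita : forall e, strict e -> floc e a^-1).

Let nea e : strict e -> ~ nonunit (floc e) a.
Proof. by move=> se [_]; apply; split=> //; apply: unita. Qed.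
Let Aa : A0 a. Proof. by case: na. Qed.

Definition semi q : set K := [set z | forall e, strict e -> closure [set e] q -> floc e z].

Lemma semi_sr q : subring (semi q).
Proof.
split=> [e _ _|x y hx hy e se cl|x y hx hy e se cl].
- exact: (sub1 (floc_sr e)).
- by apply: (subB (floc_sr e)); [apply: hx|apply: hy].
- by apply: (subM (floc_sr e)); [apply: hx|apply: hy].
Qed.

Lemma floc_semi q : floc q `<=` semi q.
Proof. by move=> z qz e _ cl; apply: (gen_sub cl). Qed.

(* The preimage in the semilocal ring of the local ring at q of the strict transform. *)
Definition hloc q : set K := [set z | exists x y : K, [/\ floc q x, semi q y & z = x + h * y]].

Lemma floc_hloc q : floc q `<=` hloc q.
Proof. by move=> x hx; exists x, 0; rewrite mulr0 addr0; split=> //; apply: (sub0 (semi_sr q)). Qed.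

Lemma hsemi q y : semi q y -> hloc q (h * y).
Proof. by move=> hy; exists 0, y; rewrite add0r; split=> //; apply: (sub0 (floc_sr q)). Qed.

Let sh q : floc q h. Proof. exact: A0loc. Qed.

Lemma hloc_sr q : subring (hloc q).
Proof.
have sq := floc_sr q; have ss := semi_sr q; have lt := @floc_semi q; split.
- by apply: floc_hloc; apply: (sub1 sq).
- move=> _ _ [x [y [hx hy ->]]] [z [w [hz hw ->]]]; exists (x - z), (y - w).
 by split; [exact: (subB sq)|exact: (subB ss)|ring].
- move=> _ _ [x [y [hx hy ->]]] [z [w [hz hw ->]]]; exists (x * z), (x * w + y * (z + h * w)).
 split; [exact: (subM sq)| |ring].
 apply: (subD ss); apply: (subM ss) => //; first exact: lt.
 by apply: (subD ss); [apply: lt|apply: (subM ss) => //; apply: lt].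
Qed.

(** Otherwise V contains for each strict curve through q an element with a pole along it, and so a
    general combination c having poles along all of them. Then c^(-N) / h lies in the semilocal ring
    for large N, and 1 is c^N times an element of h times that ring. *)
Lemma semi_val q V : valring V -> hloc q `<=` V -> (forall y, semi q y -> nonunit V (h * y)) ->
 exists e, [/\ strict e, closure [set e] q & V `<=` floc e].
Proof.
move=> vV LV hn; apply: contrapT => ne; have sV := vV.1.
have AV : A0 `<=` V by move=> z Az; apply: LV; apply: floc_hloc; apply: A0loc.
have [es hes] := exists_strict_list.
have /choice [z hz] : forall e, exists z, V z /\ (strict e -> closure [set e] q -> ~ floc e z).
 move=> e; apply: contrapT => h'; apply: ne; have [se|ns] := EM (strict e); last first.
  by case: h'; exists 1; split; [apply: (sub1 sV)|].
 have [cl|nc] := EM (closure [set e] q); last by case: h'; exists 1; split; [apply: (sub1 sV)|].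
 exists e; split=> // z Vz; apply: contrapT => nz; apply: h'; exists z; split=> //.
have [c [c0 hc mc]] := @general_element curve_val 1 [seq z e | e <- es] curve_valP curve_val_FR (oner_neq0 _).
have Vc : V c.
 apply: (spn_sr sV AV _ hc) => w.
 by rewrite inE => /predU1P [->|/mapP [e _ ->]]; [apply: (sub1 sV)|case: (hz e)].
have nc e : strict e -> closure [set e] q -> nonunit (floc e) c^-1.
 move=> se cl; have vE := strict_valring se; have [_ nz] := hz e; have nz' := nz se cl.
 have z0 : z e != 0 by apply/eqP => z0; apply: nz'; rewrite z0; apply: (sub0 vE.1).
 rewrite (_ : c^-1 = z e / c * (z e)^-1); last by fld.
 apply: (idM (valring_ideal vE)); last exact: valring_inv.
 by apply: mc; [exists e; [|right]|rewrite inE map_f ?orbT // hes].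
have [|N hN] := @eventually_seq _ es (fun e M => strict e -> closure [set e] q -> floc e (c^-1 ^+ M / h)).
 move=> e _; have [se|ns] := EM (strict e); last by exists 0%N.
 have [cl|ncl] := EM (closure [set e] q); last by exists 0%N.
 have [[pi de] _ _] := se; have [N hN] := dvr_pow (h^-1) de (nc e se cl).
 by exists N => M le _ _; apply: hN.
have [_ n1 _] := valring_prime vV; apply: n1.
rewrite (_ : 1 = c ^+ N * (h * (c^-1 ^+ N / h))); last by rewrite exprVn; fld.
apply: (idM (valring_ideal vV)); first exact: (subX sV).
by apply: hn => e se cl; apply: hN => //; apply: hes.
Qed.

Lemma hsemi_a q y : semi q y -> exists2 y', semi q y' & h * y = a * (h * y').
Proof.
move=> hy; exists (a^-1 * y); last by fld.
by move=> e se cl; apply: (subM (floc_sr e)); [apply: unita|apply: hy].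
Qed.

(** As a is a unit along the strict curves, it divides every multiple of h by the semilocal ring. So
    [semi_val] applies, and V is a branch at q. *)
Lemma hloc_val q V : Tpt q -> valring V -> hloc q `<=` V -> nonunit V a ->
 [/\ dominating V, dominated q V & exists2 e, strict e & V `<=` floc e].
Proof.
move=> [xq _] vV LV ma; have sV := vV.1; have iV := valring_ideal vV.
have qV := subset_trans (@floc_hloc q) LV; have AV := subset_trans (@A0loc q) qV.
have [|e [se cl Ve]] := semi_val vV LV.
 by move=> y /hsemi_a [y' /hsemi /LV hy' ->]; apply: (idMr iV).
have mm := val_sub vV (floc_sr e) Ve.
have hP := center_prime (floc_sr q) vV qV.
have sub : floc q `&` nonunit (floc e) `<=` floc q `&` nonunit V by move=> w [qw /mm].
have mq : nonunit (floc q) `<=` nonunit V.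
 have Pa : (floc q `&` nonunit V) a by split=> //; apply: A0loc.
 by move=> z nz; have [] := Tpt_prime xq se cl hP sub Pa (nea se) nz.
split=> //; last by exists e.
by split=> // z nz; apply: mq; apply: xq.
Qed.

(** The semilocal ring is [hloc q] with a inverted. At a prime P without a, either some h y is
    outside P and serves as denominator, or a valuation ring over P lies below a strict curve e, and
    elements of the local ring at q not vanishing on e are outside P. *)
Lemma hloc_denom q z : Tpt q -> semi q z -> exists N, forall M, (N <= M)%N -> hloc q (a ^+ M * z).
Proof.
move=> Tq hz; have [xq _] := Tq; have sL := hloc_sr q.
have La : hloc q a by apply: floc_hloc; apply: A0loc.
have [|N hN] := @loc_denom _ (hloc q) sL z a La; last first.
 exists N => M le; rewrite -(subnK le) exprD -mulrA; apply: (subM sL) => //; exact: (subX sL).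
move=> P hP nPa; have sl := loc_sr sL hP.
have [[y [hy nP]]|allP] := EM (exists y, semi q y /\ ~ P (h * y)).
 have [Lhy hyn] : hloc q (h * y) /\ h * y != 0 by split; [apply: hsemi|apply: (primeN0 hP)].
 rewrite -(mulfK hyn z); apply: (locE hP) => //.
 by rewrite mulrCA; apply: hsemi; apply: (subM (semi_sr q)).
have [V [vV LV _ eP _]] := valring_over_prime sL hP.
have PV w : hloc q w -> P w <-> nonunit V w.
 by move=> Lw; rewrite -eP; split=> [[]|].
have [|e [se cl Ve]] := semi_val vV LV.
 move=> y hy; apply/PV; first exact: hsemi.
 by apply: contrapT => nP; apply: allP; exists y.
have vE := strict_valring se; have [_ el] := gen_val vE (gen_sub cl).
have hPe := center_prime (floc_sr q) vE (gen_sub cl).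
have := hz e se cl; rewrite el => /(locP hPe) [x [b [qx qb nb _ ->]]].
apply: (locE hP); [exact: floc_hloc|exact: floc_hloc|] => Pb.
have qV := subset_trans (@floc_hloc q) LV.
have hP' := center_prime (floc_sr q) vV qV.
have sub : floc q `&` nonunit (floc e) `<=` floc q `&` nonunit V.
 by move=> w [qw ew]; split=> //; apply: (val_sub vV (floc_sr e) Ve).
have neb : ~ nonunit (floc e) b by move=> eb; apply: nb.
have [_ ma] := Tpt_prime xq se cl hP' sub (conj qb (proj1 (PV b (floc_hloc qb)) Pb)) neb (xq a na).
by apply: nPa; apply/PV.
Qed.

(* An element of the semilocal ring that is small at all branches at q is topologically
  nilpotent in hloc q. *)
Lemma hloc_power q z m : Tpt q -> semi q z ->
 (forall V, curve_val V -> dominated q V -> nonunit V z) ->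
 exists N, forall M, (N <= M)%N -> hloc q (z ^+ M / a ^+ m).
Proof.
move=> Tq hz small; have sL := hloc_sr q.
have La : hloc q a by apply: floc_hloc; apply: A0loc.
have small' V : valring V -> hloc q `<=` V -> nonunit V a -> nonunit V z.
 move=> vV LV ma; have [dV dq [e se Ve]] := hloc_val Tq vV LV ma.
 by apply: small => //; exists e => //; left.
pose R := adjoin (hloc q) z; have sR : subring R by apply: adjoin_sr.
have LR : hloc q `<=` R by apply: (sub_adjoin _ (sub_ideal sL)).
have Rz : R z by apply: adjoin_gen.
(* z is in the maximal ideal of every valuation ring over R with a in its maximal ideal, so a power
   of z is divisible by a in R. *)
have [N hN] : exists N, R (z ^+ N / a).
 apply: contrapT => nN; pose J := [set x : K | R x /\ R (x / a)].
 have iJ : ideal R J.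
  split; first by move=> x [].
  - by split; rewrite ?mul0r; exact: (sub0 sR).
  - by move=> x y [hx hx'] [hy hy']; split; rewrite ?mulrDl; exact: (subD sR).
  - by move=> x y hx [hy hy']; split; rewrite -?mulrA; exact: (subM sR).
 have [|V [vV RV JV nz]] := valring_avoid sR iJ Rz.
  by move=> N [_ h']; apply: nN; exists N.
 apply: nz; apply: small' => //; first exact: subset_trans RV.
 by apply: JV; split; [exact: LR|rewrite divff //; apply: (sub1 sR)].
(* By valuations z is integral over [hloc q], so R lies in a finite module, and one power of a
   clears all denominators. For large exponents z^M is then divisible in R by a^(s + m), and a^s is
   spent on them. *)
have [s hs] : exists s, forall x : K, R x -> hloc q (a ^+ s * x).
 have [n0 hn0] := hloc_denom Tq hz.
 have iz : integral (hloc q) z.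
  apply: integral_vals sL _ => V vV LV; have [ma|nma] := EM (nonunit V a); first by case: (small' V vV LV ma).
  have [_ ai] := not_nonunit (LV _ La) nma.
  rewrite (_ : z = a^-1 ^+ n0 * (a ^+ n0 * z)); last by rewrite exprVn; fld.
  by apply: (subM vV.1); [apply: (subX vV.1)|apply: LV; apply: hn0].
 pose good (x : K) := exists N, forall M, (N <= M)%N -> hloc q (a ^+ M * x).
 have [|||v [gv v1 hv]] := @finite_span _ (hloc q) good [:: z] sL.
 - by exists 0%N => M _; rewrite mulr1; apply: (subX sL).
 - move=> x y [i hi] [j hj]; exists (i + j)%N => M le; have iM := leq_trans (leq_addr j i) le.
  rewrite -{1}(subnKC iM) exprD mulrACA; apply: (subM sL); first exact: hi.
  by apply: hj; rewrite leq_subRL.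
 - by move=> x; rewrite inE => /eqP ->; split=> //; exists n0.
 have [N' hN'] := eventually_seq gv; exists N' => x Rx; have [LS sS] := stable_sr v sL.
 have : spn (hloc q) v (1 * x) by apply: (adjoin_min sS LS _ Rx) => // y; apply: hv; rewrite mem_head.
 rewrite mul1r => /(_ [set x | hloc q (a ^+ N' * x)]); apply=> [|y yv]; last exact: hN'.
 split=> [|x1 x2|x1 x2 Lx h2] /=; rewrite ?mulr0 ?mulrDr; [exact: (sub0 sL)|exact: (subD sL)|].
 by rewrite mulrCA; apply: (subM sL).
exists (N * (s + m))%N => M le.
rewrite (_ : _ / _ = a ^+ s * (z ^+ M / a ^+ (s + m))); last by rewrite exprD; fld.
apply: hs; rewrite -(subnK le) exprD exprM -mulrA -expr_div_n.
by apply: (subM sR); apply: (subX sR).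
Qed.

(** The function is b / c^2 with c a general combination of 1, b and the chart generators. At a
    valuation with center x either the center is in the chart and b is small, or the chart has a
    pole there, hence so does c. *)
Lemma exists_separator p x i b : Tpt p -> U i p -> B i b -> ~ nonunit (floc p) b ->
 (U i x -> nonunit (floc x) b) -> exists z, [/\ floc p z, ~ nonunit (floc p) z,
  forall V, curve_val V -> V z & forall V, curve_val V -> dominated x V -> nonunit V z].
Proof.
move=> [xp [e se cl]] Up Bb nb hx.
have [c [c0 hc mc]] := @general_element curve_val 1 (b :: gens i) curve_valP curve_val_FR (oner_neq0 _).
have sB := chart_sr (hU i).
have Bc : B i c.
 apply: (spn_sr sB (@A0B i) _ hc) => w.
 by rewrite !inE => /or3P [/eqP ->|/eqP ->|wg]; [exact: (sub1 sB)|exact: Bb|exact: Bgens].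
have [V [dV Ve [lV mV]]] := exists_curve_val se xp cl.
have cV : curve_val V by exists e => //; left.
have Vi W : curve_val W -> W c^-1 by move=> hW; rewrite -div1r; apply: mc; rewrite ?mem_head.
have Vb W : curve_val W -> W (b / c) by move=> hW; apply: mc; rewrite // !inE eqxx orbT.
have Bp := chart_sub (hU i) Up; have sp := floc_sr p.
have [|_ pi] := @not_nonunit _ (floc p) c (Bp _ Bc).
 by move=> /mV [_]; apply; split=> //; apply: Vi.
have [b0 bi] := not_nonunit (Bp _ Bb) nb.
exists (b / c * c^-1); split.
- by apply: (subM sp) => //; apply: (subM sp) => //; apply: Bp.
- have n0 : b / c * c^-1 != 0 by rewrite !mulf_neq0 ?invr_neq0.
 move=> [_]; apply; split=> //; rewrite !invfM !invrK.
 by apply: (subM sp); [apply: (subM sp) => //|]; apply: Bp.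
- by move=> W hW; apply: (subM (curve_valP hW).1.1); [apply: Vb|apply: Vi].
move=> W hW dW; have [vW AW] := curve_valP hW; have iW := valring_ideal vW.
have [BW|nBW] := EM (B i `<=` W).
 have [y Uy dy] := chart_center (hU i) vW BW; have xy := unique_center vW dW dy; subst y.
 have [_ mW] := dW; rewrite -mulrA; apply: (idMr iW) (mW _ (hx Uy)) _.
 by apply: (subM vW.1); apply: Vi.
have [g gi nWg] : exists2 g, g \in gens i & ~ W g.
 apply: contrapT => h'; apply: nBW; apply: Bgen => //; first by case: vW.
 by move=> g gi; apply: contrapT => nW; apply: h'; exists g.
apply: (idM iW); first exact: Vb.
apply: valring_inv => // Wc; apply: nWg; rewrite -(divfK c0 g); apply: (subM vW.1) => //.
by apply: mc; rewrite // !inE gi !orbT.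
Qed.

Let bad p x := (Tpt x /\ x <> p) \/ (strict x /\ ~ closure [set x] p).

(** If x is outside the chart of p, b = 1 serves. Otherwise a function vanishing at x but not at p
    exists, since p is not a specialization of x: by assumption for a strict curve, by dimension for
    another point of [Tpt]. *)
Lemma bad_separator p x : Tpt p -> bad p x -> exists z, [/\ floc p z, ~ nonunit (floc p) z,
  forall V, curve_val V -> V z & forall V, curve_val V -> dominated x V -> nonunit V z].
Proof.
move=> Tp bx; have [i Up] := cover p.
have [Ux|nUx] := EM (U i x); last first.
 apply: (@exists_separator p x i 1) => //; first exact: (sub1 (chart_sr (hU i))).
 by have [_ n1 _] := floc_nonunit_prime p.
suff [b [Bx np]] : exists b, trace floc (B i) x b /\ ~ nonunit (floc p) b.
 by case: Bx => Bb nx; apply: (@exists_separator p x i b).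
apply: contrapT => nb.
have sub : trace floc (B i) x `<=` trace floc (B i) p.
 by move=> b hb; split; [case: hb|apply: contrapT => np; apply: nb; exists b].
case: bx => [[[xx [e se cl]] xp]|[sx ncl]]; last first.
 apply: ncl; apply: (gen_val (strict_valring sx) _).1.
 rewrite (chart_loc (hU i) Up) (chart_loc (hU i) Ux) => _ /(locP (chart_prime (hU i) Up)) [c [d [Bc Bd nd _ ->]]].
 by apply: (locE (chart_prime (hU i) Ux)) => // /sub.
have Ue := gen_opens cl Ux; have [_ _ nh] := se.
have hB : A0 `<=` B i by exact: A0B.
apply: (@chain3 (B i) _ _ _ (chart_sr (hU i)) hB (chart_prime (hU i) Ue) (chart_prime (hU i) Ux) (chart_prime (hU i) Up)).
- by exists h => //; split=> //; apply: hB.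
- split; first by move=> b [Bb eb]; split=> //; apply: (nonunit_gen cl) eb; apply: (chart_sub (hU i)).
 by move=> /(_ a) []; [split; [exact: hB|exact: xx]|move=> _; apply: nea].
- split=> // le; apply: xp; apply: (chart_inj (hU i)) => //; exact/seteqP.
Qed.

(** The product of the separators over the finitely many bad points and curves, divided by its
    residue at p. *)
Lemma exists_bump p : Tpt p -> exists g, [/\ nonunit (floc p) (g - 1), forall V, curve_val V -> V g &
 forall x V, bad p x -> curve_val V -> dominated x V -> nonunit V g].
Proof.
move=> Tp; have [ts hts] := exists_Tpt_list; have [es hes] := exists_strict_list.
have sp := floc_sr p; have ip := floc_nonunit_prime p.
have [g [pg ng Vg mg]] : exists g, [/\ floc p g, ~ nonunit (floc p) g, forall V, curve_val V -> V g &
  forall x V, x \in ts ++ es -> bad p x -> curve_val V -> dominated x V -> nonunit V g].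
 elim: (ts ++ es) => [|x xs [g [pg ng Vg mg]]].
  exists 1; split=> //; [exact: (sub1 sp)|by case: ip|].
  by move=> V /curve_valP [[sV _] _]; apply: (sub1 sV).
 have [bx|nb] := EM (bad p x); last first.
  exists g; split=> // y V; rewrite inE => /predU1P [->|]; [by move=> /nb|exact: mg].
 have [z [pz nz Vz mz]] := bad_separator Tp bx.
 exists (z * g); split; first exact: (subM sp).
 - by case: ip => _ _ hp /(hp _ _ pz pg) [].
 - by move=> V hV; apply: (subM (curve_valP hV).1.1); [apply: Vz|apply: Vg].
 - move=> y V yx by' hV dy; have iV := valring_ideal (curve_valP hV).1.
  move: yx; rewrite inE => /predU1P [e|yx]; first by subst y; apply: (idMr iV); [apply: mz|apply: Vg].
  by apply: (idM iV); [apply: Vz|apply: (mg y)].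
have [c nc] := Tpt_residue Tp pg.
have c0 : kap c != 0.
 apply/eqP => c0; apply: ng; by rewrite -[g]subr0 -c0.
have ic V : A0 `<=` V -> V (kap c)^-1 by rewrite -fmorphV; apply.
exists (g / kap c); split.
- rewrite (_ : _ - 1 = (g - kap c) * (kap c)^-1); last by fld.
 by case: ip => i' _ _; apply: (idMr i') => //; apply: ic; apply: A0loc.
- by move=> V hV; have [vV AV] := curve_valP hV; apply: (subM vV.1); [apply: Vg|apply: ic].
- move=> x V bx hV dx; have [vV AV] := curve_valP hV.
 apply: (idMr (valring_ideal vV)); last exact: ic.
 apply: (mg x) => //; rewrite mem_cat; case: bx => [[/hts -> //]|[/hes ->]].
 by rewrite orbT.
Qed.

Lemma one_minus_power (R : set K) u N : subring R -> R u ->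
 exists2 G, R G & 1 - (1 - u) ^+ N = u * G.
Proof.
move=> sR Ru; elim: N => [|N [G RG e]]; first by exists 0; [exact: (sub0 sR)|rewrite expr0 subrr mulr0].
exists (1 + (1 - u) * G).
 by apply: (subD sR); [exact: (sub1 sR)|apply: (subM sR) => //; apply: (subB sR) => //; exact: (sub1 sR)].
rewrite mulrDr mulr1 mulrCA -e exprS; ring.
Qed.

(** With u a high power of the bump g, take y = (1 - (1 - u)^N) s. Near p the factor 1 - u is
    topologically nilpotent, so y is close to s; elsewhere u divides y / s and makes y small. *)
Lemma local_approximation p s m : Tpt p -> semi p s -> exists y,
 [/\ forall e, strict e -> floc e y, hloc p ((y - s) / a ^+ m) &
   forall q, Tpt q -> q <> p -> hloc q (y / a ^+ m)].
Proof.
move=> Tp hs; have [g [g1 Vg mg]] := exists_bump Tp.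
have [ts hts] := exists_Tpt_list; have [es hes] := exists_strict_list.
have eg e : strict e -> floc e g by move=> se; apply: Vg; exists e => //; right.
have gs q : semi q g by move=> e se _; apply: eg.
have [N1 hN1] : exists N, forall M, (N <= M)%N -> forall e, strict e -> floc e (g ^+ M * s).
 have [|N hN] := @eventually_seq _ es (fun e M => strict e -> floc e (g ^+ M * s)).
  move=> e _; have [se|ns] := EM (strict e); last by exists 0%N.
  have vE := strict_valring se; have [cl|ncl] := EM (closure [set e] p).
   exists 0%N => M _ _; apply: (subM vE.1); last exact: hs.
   by apply: (subX vE.1); apply: eg.
  have [[pi de] _ _] := se; have [|N hN] := @dvr_pow e pi g s de; last by exists N => M le _; apply: hN.
  by apply: (mg e) => //; [right|exists e => //; right|split].
 by exists N => M le e se; apply: hN => //; apply: hes.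
have [N2 hN2] : exists N, forall M, (N <= M)%N -> forall q, Tpt q -> q <> p ->
  hloc q (g ^+ (N1 + M) * s / a ^+ m) /\ hloc q (g ^+ (N1 + M)).
 have [|N hN] := @eventually_seq _ ts (fun q M => Tpt q -> q <> p ->
   hloc q (g ^+ (N1 + M) * s / a ^+ m) /\ hloc q (g ^+ (N1 + M))).
  move=> q _; have [Tq|nT] := EM (Tpt q); last by exists 0%N.
  have [->|qp] := EM (q = p); first by exists 0%N.
  have sm V : curve_val V -> dominated q V -> nonunit V g by apply: mg; left.
  have [n0 hn0] := hloc_denom Tq (fun e se _ => hN1 _ (leqnn _) e se).
  have [N hN] := hloc_power (n0 + m) Tq (gs q) sm; have [N' hN'] := hloc_power 0 Tq (gs q) sm.
  exists (N + N')%N => M le _ _; have sq := hloc_sr q; split.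
   rewrite (_ : _ / _ = g ^+ M / a ^+ (n0 + m) * (a ^+ n0 * (g ^+ N1 * s))); last by rewrite !exprD; fld.
   by apply: (subM sq); [apply: hN; apply: leq_trans le; apply: leq_addr|apply: hn0].
  have := hN' (N1 + M)%N; rewrite expr0 divr1; apply.
  by apply: leq_trans (leq_addl _ _); apply: leq_trans le; apply: leq_addl.
 by exists N => M le q Tq; apply: hN => //; apply: hts.
pose u := g ^+ (N1 + N2); have [n0 hn0] := hloc_denom Tp hs.
have sp := floc_sr p; have ip := floc_ideal p.
have pg : floc p g by rewrite -(subrK 1 g); apply: (subD sp); [case: g1|exact: (sub1 sp)].
have d1 : nonunit (floc p) (1 - u).
 rewrite /u; elim: (N1 + N2)%N => [|N IH]; first by rewrite expr0 subrr; exact: (id0 ip).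
 rewrite exprS (_ : 1 - g * g ^+ N = (1 - g ^+ N) - (g - 1) * g ^+ N); last by ring.
 by apply: (idB sp ip) => //; apply: (idMr ip) => //; apply: (subX sp).
have sd : semi p (1 - u) by move=> e se cl; apply: (gen_sub cl); case: d1.
have [N3 hN3] := hloc_power (m + n0) Tp sd (fun V hV dV => dV.2 _ d1).
(* The first claim needs u itself to cancel the poles of s along strict curves not through p; they
   are cancelled because N1 + N2 is at least N1. *)
exists ((1 - (1 - u) ^+ N3) * s); split.
- move=> e se; have vE := strict_valring se.
 have [G eG ->] := one_minus_power N3 vE.1 (subX vE.1 (N1 + N2) (eg e se)).
 by rewrite mulrAC; apply: (subM vE.1) => //; apply: hN1 => //; apply: leq_addr.
- have sL := hloc_sr p.
 rewrite (_ : _ / _ = - (((1 - u) ^+ N3 / a ^+ (m + n0)) * (a ^+ n0 * s))); last by rewrite exprD; fld.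
 by apply: (subN sL); apply: (subM sL); [apply: hN3|apply: hn0].
- move=> q Tq qp; have [h1 h2] := hN2 _ (leqnn _) q Tq qp; have sL := hloc_sr q.
 have [G LG ->] := one_minus_power N3 sL h2.
 by rewrite (_ : _ / _ = g ^+ (N1 + N2) * s / a ^+ m * G); [apply: (subM sL)|ring].
Qed.

Lemma approximation (s : X -> K) m : (forall q, Tpt q -> semi q (s q)) -> exists y,
 (forall e, strict e -> floc e y) /\ forall q, Tpt q -> hloc q ((y - s q) / a ^+ m).
Proof.
move=> hs; have [ts hts] := exists_Tpt_list.
suff [y [ey hy]] : exists y, (forall e, strict e -> floc e y) /\
  forall q, Tpt q -> hloc q ((y - (if q \in undup ts then s q else 0)) / a ^+ m).
 by exists y; split=> // q Tq; have := hy q Tq; rewrite mem_undup hts.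
elim: (undup ts) (undup_uniq ts) => [_|p l IH /= /andP [pl ul]].
 exists 0; split=> [e _|q _]; first exact: (sub0 (floc_sr e)).
 by rewrite subrr mul0r; exact: (sub0 (hloc_sr q)).
have [y [ey hy]] := IH ul; have [Tp|nT] := EM (Tpt p); last first.
 exists y; split=> // q Tq; have := hy q Tq; rewrite inE.
 by have [e|//] := eqVneq q p; case: nT; rewrite -e.
have [z [ez pz qz]] := local_approximation m Tp (hs p Tp).
exists (y + z); split=> [e se|q Tq].
 by apply: (subD (floc_sr e)); [apply: ey|apply: ez].
have := hy q Tq; rewrite inE; have [->|/eqP qp] := eqVneq q p => h1; have sL := hloc_sr.
 rewrite (negPf pl) subr0 in h1.
 by rewrite /= -addrA mulrDl; apply: (subD (sL p)).
by rewrite /= addrAC mulrDl; apply: (subD (sL q)) => //; apply: qz.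
Qed.

Lemma avoid_list (l : seq X) x : exists W : opens X, W x /\ forall y e, W y -> e \in l ->
 closure [set e] y -> closure [set e] x.
Proof.
elim: l => [|e l [W1 [h1 h2]]]; first by exists (opensT X).
have [cl|ncl] := EM (closure [set e] x).
 exists W1; split=> // y e' hy; rewrite inE => /predU1P [-> //|]; exact: h2.
have oc : open (~` closure [set e]) by apply: closed_openC; apply: closed_closure.
exists (opensI W1 (Opens oc)); split=> // y e' [hy ny]; rewrite inE => /predU1P [-> //|]; exact: h2.
Qed.

Lemma minusZ_nbhs x z : minusZ x z -> exists W : opens X, W x /\ forall y, W y -> minusZ y z.
Proof.
move=> [[W [s [Wx sz]]] hz].
have [W' [W'x hW']] := avoid_list Zs x.
exists (opensI W W'); split=> // y [Wy W'y].
have yz : floc y z by exists W, s.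
split=> // e pi cl de; have [->|Ze] := eqVneq (Z e) 0%N; first by rewrite divr1; apply: (gen_sub cl).
by apply: hz => //; apply: hW' W'y _ cl; apply: Zfin.
Qed.

Lemma avoid_nbhs x : exists W : opens X, W x /\ forall y e, W y -> Tpt e \/ strict e ->
 closure [set e] y -> closure [set e] x.
Proof.
have [ts hts] := exists_Tpt_list; have [es hes] := exists_strict_list.
have [W [Wx hW]] := avoid_list (ts ++ es) x.
exists W; split=> // y e Wy he; apply: (hW y) => //; rewrite mem_cat.
by case: he => [/hts -> //|/hes ->]; rewrite orbT.
Qed.

(** a vanishes along every exceptional curve, so it suffices that m bounds all multiplicities of
    Z. *)
Lemma exists_level : exists m, forall q z, exc q -> floc q (z / a ^+ m) -> minusZ q z.
Proof.
have [|m hm] := @eventually_seq _ Zs (fun e M => (Z e <= M)%N).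
 by move=> e _; exists (Z e).
exists m => q z xq hz; have am : a ^+ m != 0 by rewrite expf_neq0.
have sq := floc_sr q; split.
 rewrite -(divfK am z); apply: (subM sq) => //; apply: (subX sq); exact: A0loc.
move=> e pi cl de; have [Z0|Ze] := eqVneq (Z e) 0%N.
 rewrite Z0 divr1 -(divfK am z); apply: (gen_sub cl); apply: (subM sq) => //.
 by apply: (subX sq); exact: A0loc.
have [xe _] := Zexc Ze; have [p0 _ hp] := de; have sV := floc_sr e.
have le := hm e m (Zfin Ze) (leqnn _).
rewrite (_ : _ / _ = z / a ^+ m * a ^+ (m - Z e) * (a / pi) ^+ Z e).
 apply: (subM sV); last by apply: (subX sV); apply: hp; apply: xe.
 by apply: (subM sV); [exact: (gen_sub cl)|apply: (subX sV); exact: A0loc].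
by rewrite expr_div_n -{1}(subnK le) exprD; fld.
Qed.

(* H^1 of O_X(-Z)/hO_X vanishes, its support being affine. *)
Lemma family_division m (s : X -> K) : (forall q z, exc q -> floc q (z / a ^+ m) -> minusZ q z) ->
 family minusZ s -> exists y (t : X -> K), [/\ family floc t,
  forall x, minusZ x (s x - y - h * t x) &
  forall q, Tpt q -> floc q ((s q - y - h * t q) / a ^+ m)].
Proof.
move=> lev fs.
have fs' : family floc s by move=> x; have [W [Wx hW]] := fs x; exists W; split=> // y /hW [].
(* c is the constant to which s is equivalent off the closed point, in particular along the strict
   curves. *)
have [c hc] := away_pull fs' na a0.
have ec e : strict e -> floc e (s e - c).
 move=> se; have vE := strict_valring se.
 have RV : adjoin A0 a^-1 `<=` floc e.
  by apply: adjoin_min; [exact: vE.1|exact: A0loc|exact: unita].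
 have sR : subring (adjoin A0 a^-1) by apply: adjoin_sr.
 have de : dominated e (floc e) by split.
 by apply: (loc_center sR vE RV).1; apply: hc.
have [|y1 [ey1 hy1]] := @approximation (fun x => s x - c) m.
 move=> q Tq e se cl; rewrite (_ : s q - c = (s e - c) - (s e - s q)); last by ring.
 apply: (subB (floc_sr e)); first exact: ec.
 by have [W [Wq hW]] := fs' q; apply: hW; apply: (gen_opens cl).
have /choice [f hf] : forall q, exists f : K * K, Tpt q ->
  [/\ floc q f.1, semi q f.2 & y1 - (s q - c) = a ^+ m * f.1 + h * f.2].
 move=> q; have [Tq|nT] := EM (Tpt q); last by exists (0, 0).
 have [u [w [qu qw e]]] := hy1 q Tq; exists (u, a ^+ m * w) => _; split=> //=.
  by apply: (subM (semi_sr q)) => //; apply: floc_semi; apply: (subX (floc_sr q)); apply: A0loc.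
 by rewrite -[LHS](divfK (expf_neq0 m a0)) e; ring.
(* t is (s - y) / h wherever h generates O_X(-Z). On strict curves 0 will do, and at the points of
   [Tpt] the coefficient of h in the approximation, which leaves only the multiple a^m of a regular
   function. *)
pose t x := if pselect (Tpt x) then - (f x).2 else if pselect (strict x) then 0 else (s x - (y1 + c)) / h.
have tT x : Tpt x -> t x = - (f x).2 by rewrite /t; case: pselect.
have nTs x : strict x -> ~ Tpt x by move=> [_ nx _] [].
have ts x : strict x -> t x = 0.
 move=> sx; rewrite /t; case: (pselect (Tpt x)) => [b|b]; first by case: (nTs x sx).
 by case: (pselect (strict x)).
have to x : ~ Tpt x -> ~ strict x -> t x = (s x - (y1 + c)) / h.
 by rewrite /t => nT ns; case: (pselect (Tpt x)) => [//|b]; case: (pselect (strict x)).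
have mt q : Tpt q -> s q - (y1 + c) - h * t q = - (a ^+ m * (f q).1).
 move=> Tq; have [_ _ e] := hf q Tq; rewrite tT //.
 by rewrite (_ : a ^+ m * (f q).1 = y1 - (s q - c) - h * (f q).2); [ring|rewrite e addrK].
have am : a ^+ m != 0 by rewrite expf_neq0.
have me e : strict e -> minusZ e (s e - (y1 + c)).
 move=> se; apply: minusZ_nonexc; first by case: se.
 rewrite (_ : _ - _ = (s e - c) - y1); last by ring.
 by apply: (subB (floc_sr e)); [apply: ec|apply: ey1].
have mq q : Tpt q -> minusZ q (s q - (y1 + c) - h * t q).
 move=> Tq; rewrite mt //; apply: lev; first by case: Tq.
 by rewrite mulNr mulrAC divff // mul1r; apply: (subN (floc_sr q)); case: (hf q Tq).
have st x : minusZ x (s x - (y1 + c) - h * t x).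
 have [Tx|nTx] := EM (Tpt x); first exact: mq.
 have [sx|nsx] := EM (strict x); first by rewrite ts // mulr0 subr0; apply: me.
 by rewrite to // mulrCA divff // mulr1 subrr; apply: minusZ0.
(* Near x, the only points of [Tpt] or strict curves other than x are strict curves through x; there
   t vanishes and x itself is in [Tpt]. At the remaining points y, division by h is allowed. *)
exists (y1 + c), t; split=> // [x|q Tq]; last first.
 rewrite mt // mulNr mulrAC divff // mul1r.
 by apply: (subN (floc_sr q)); case: (hf q Tq).
have [W [Wx hW]] := fs x; have [W1 [W1x hW1]] := minusZ_nbhs (st x); have [W2 [W2x hW2]] := avoid_nbhs x.
exists (opensI W (opensI W1 W2)); split=> // y [Wy [W1y W2y]].
have [->|yx] := EM (y = x); first by rewrite subrr; exact: (sub0 (floc_sr x)).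
have self : closure [set y] y by apply: subset_closure.
have [Ty|nTy] := EM (Tpt y).
 have cl := hW2 y y W2y (or_introl Ty) self.
 by case: yx; apply: (Tpt_closed _ _ cl) => //; apply: Tpt_gen cl.
have [sy|nsy] := EM (strict y).
 have cl := hW2 y y W2y (or_intror sy) self.
 have [Tx|E] := strict_closure sy cl; last by case: yx.
 by rewrite ts // tT // sub0r opprK; have [_ sf _] := hf x Tx; apply: sf.
rewrite to // (_ : _ - _ = ((s y - s x) + (s x - (y1 + c) - h * t x)) / h); last by fld.
apply: minusZ_off; last by apply: minusZD; [apply: hW|apply: hW1].
by move=> e se cl; case: (strict_closure se cl) => // E; apply: nsy; rewrite E.
Qed.

End Semilocal.

(** For p in [Tpt] the family that is z at p and 0 elsewhere is divided as y + h t up to O_X(-Z).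
    Since h t is then equivalent to the constant -y, injectivity makes t equivalent to a constant c.
    So h c + y is a global section, and it generates z together with h and a^m. At other points a^m
    or h alone suffices. *)
Lemma generated : (forall t : X -> K, family floc t -> (exists c, forall x, minusZ x (h * t x - c)) ->
  exists c, forall x, floc x (t x - c)) ->
 forall p z, minusZ p z -> exists r (b g : 'I_r -> K),
  [/\ forall i, floc p (b i), forall i x, minusZ x (g i) & z = \sum_i b i * g i].
Proof.
move=> inj p z hz; have sp := floc_sr p.
have [a [na a0 unita]] := exists_transversal; have [m lev] := exists_level na a0.
have Aa : A0 a by case: na.
have Ga x : minusZ x (a ^+ m).
 have [xx|nx] := EM (exc x).
  by apply: lev => //; rewrite divff ?expf_neq0 //; exact: (sub1 (floc_sr x)).
 by apply: minusZ_nonexc => //; apply: A0loc; apply: (subX sA).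
have [Tp|nTp] := EM (Tpt p); last first.
 have [sp'|nsp] := EM (strict p).
  exists 1%N, (fun _ => z / a ^+ m), (fun _ => a ^+ m); split=> //.
   by move=> _; rewrite -exprVn; apply: (subM sp); [case: hz|apply: (subX sp); apply: unita].
  by rewrite big_ord1 divfK // expf_neq0.
 exists 1%N, (fun _ => z / h), (fun _ => h); split=> //; last by rewrite big_ord1 divfK.
 move=> _; apply: minusZ_off => // e se cl.
 by case: (strict_closure se cl) => // E; apply: nsp; rewrite E.
pose s x := if pselect (x = p) then z else 0.
have s1 : s p = z by rewrite /s; case: pselect.
have s0 x : x <> p -> s x = 0 by rewrite /s; case: pselect.
have ms x : minusZ x (s x).
 by have [->|xp] := EM (x = p); [rewrite s1|rewrite s0 //; apply: minusZ0].
have fs : family minusZ s.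
 move=> x; have [->|xp] := EM (x = p).
  have [W [Wp hW]] := minusZ_nbhs hz; exists W; split=> // y Wy.
  have [->|yp] := EM (y = p); first by rewrite subrr; apply: minusZ0.
  by rewrite s1 s0 // sub0r; apply: minusZN; apply: hW.
 have [W [Wx hW]] := avoid_nbhs x; exists W; split=> // y Wy; rewrite (s0 x xp) subr0.
 have [yp|yp] := EM (y = p); last by rewrite s0 //; apply: minusZ0.
 subst y; have cl : closure [set p] x.
  by apply: (hW p p Wy (or_introl Tp)); apply: subset_closure.
 by case: xp; apply/esym; apply: Tpt_closed => //; apply: Tpt_gen cl.
have [y [t [ft st qt]]] := family_division na a0 unita lev fs.
have [|c hc] := inj t ft.
 exists (- y) => x; rewrite (_ : _ - _ = s x - (s x - y - h * t x)); last by ring.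
 apply: minusZD; last exact: minusZN.
 exact: ms.
have Gg x : minusZ x (h * c + y).
 rewrite (_ : _ + _ = s x - (s x - y - h * t x) - h * (t x - c)); last by ring.
 apply: minusZD; last by apply: minusZN; apply: minusZ_h; apply: hc.
 apply: minusZD; last exact: minusZN.
 exact: ms.
exists 3%N, (fun i => [:: 1; t p - c; (s p - y - h * t p) / a ^+ m]`_i),
 (fun i => [:: h * c + y; h; a ^+ m]`_i); split.
- by case=> -[|[|[|i]]] lt //=; [exact: (sub1 sp)|exact: qt].
- by case=> -[|[|[|]]] //= _ x.
- by rewrite !big_ord_recl big_ord0 /= divfK ?expf_neq0 // s1; ring.
Qed.

End Hypersurface.

Lemma surface_cohomology : exists h, [/\ h != 0, forall x z, floc x z -> minusZ x (h * z),
 forall s : X -> K, family minusZ s -> exists y (t : X -> K), family floc t /\ forall x, minusZ x (s x - y - h * t x) &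
 (forall t : X -> K, family floc t -> (exists c, forall x, minusZ x (h * t x - c)) ->
  exists c, forall x, floc x (t x - c)) ->
 forall p z, minusZ p z -> exists r (b g : 'I_r -> K),
  [/\ forall i, floc p (b i), forall i x, minusZ x (g i) & z = \sum_i b i * g i]].
Proof.
have [h [h0 Gh hunit]] := exists_h; exists h; split=> //.
- by move=> x z; apply: minusZ_h.
- move=> s fs; have [a [na a0 unita]] := exists_transversal h0 Gh.
 have [m lev] := exists_level na a0.
 have [y [t [ft st _]]] := family_division h0 Gh hunit na a0 unita lev fs.
 by exists y, t.
- exact: generated.
Qed.

End Cycle.
End Surface.

(** * Sheaf cohomology and families *)

Section Restriction.
Variables (X : ringed_space) (M : mod_sheaf X).
Implicit Types U V W : opens X.

(* Restriction, with junk value 0 when V is not contained in U. *)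
Definition rs U V (s : M U) : M V :=
 match pselect (V `<=` U) with left h => mres M h s | right _ => 0 end.
Arguments rs {U} V.

Lemma rsE U V (h : V `<=` U) s : mres M h s = rs V s.
Proof. by rewrite /rs; case: pselect => [k|//]; rewrite (Prop_irrelevance h k). Qed.

Lemma rs_rs U V W (s : M U) : W `<=` V -> V `<=` U -> rs W (rs V s) = rs W s.
Proof. by move=> k h; rewrite -(rsE h) -(rsE k) (mres_comp _ _ (subset_trans k h)) rsE. Qed.

Lemma rsB U V (s t : M U) : rs V (s - t) = rs V s - rs V t.
Proof.
rewrite /rs; case: pselect => [h|_]; last by rewrite subrr.
by rewrite -scaleN1r addrC mres_linear rmorphN1 scaleN1r addrC.
Qed.

Lemma rs0 U V : rs V (0 : M U) = 0.
Proof. by rewrite -(subrr 0) rsB subrr. Qed.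

Definition glob W (a : OO X (opensT X)) : OO X W := rres (U := opensT X) (@subsetT _ W) a.

Lemma rsL U V a (s t : M U) : V `<=` U ->
 rs V (glob U a *: s + t) = glob V a *: rs V s + rs V t.
Proof. by move=> h; rewrite -!(rsE h) mres_linear /glob (rres_comp _ _ (@subsetT _ V : V `<=` opensT X)). Qed.

Lemma mod_local_eq U (s t : M U) :
 (forall x, U x -> exists V, [/\ V `<=` U, V x & rs V s = rs V t]) -> s = t.
Proof.
move=> loc0; have /choice [V hV] : forall x : {x | U x}, exists V, [/\ V `<=` U, V (sval x) & rs V s = rs V t].
 by move=> [x Ux]; apply: loc0.
have sub i : V i `<=` U by case: (hV i).
have [||r [hr ur]] := mres_sheaf sub _ (s := fun i => rs (V i) s).
- by move=> x Ux; exists (exist _ x Ux); case: (hV (exist _ x Ux)).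
- by move=> i j W hi hj; rewrite !rsE !rs_rs.
by rewrite -(ur s) ?[LHS](ur t) // => i; rewrite rsE //; case: (hV i).
Qed.

End Restriction.
Arguments rs {X M U} V.

Section RestrictionMor.
Variables (X : ringed_space) (M N P : mod_sheaf X) (u : mod_mor M N) (w : mod_mor N P).

Lemma mmap_rs (U V : opens X) (s : M U) : u V (rs V s) = rs V (u U s).
Proof. by rewrite /rs; case: pselect => [h|_]; [apply: mmap_nat|apply: linear0]. Qed.

Lemma exact_rs (U : opens X) (s : N U) x : exact_sheaf u w -> w U s = 0 -> U x ->
 exists (V : opens X) (t : M V), [/\ V x, V `<=` U & u V t = rs V s].
Proof. by move=> [_ ex] ws Ux; have [V [h [t [Vx e]]]] := ex U s ws x Ux; exists V, t; rewrite -(rsE h). Qed.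

End RestrictionMor.

(* F is realized by v as a subsheaf, with stalks Fx, of the constant sheaf K; the first
  cohomology of F is that of the families of elements of K that locally are constant up to F. *)
Section Families.
Variables (K : fieldType) (X : fscheme K) (F : mod_sheaf X) (I : injective_resolution F).
Implicit Types U V W : opens X.
Variables (v : forall U, F U -> K) (Fx : X -> set K).
Arguments v {U}.

Record realization : Prop := Realization {
 vlin : forall U a (s t : F U), v (a *: s + t) = fval a * v s + v t;
 vres : forall U V (h : V `<=` U) (s : F U), V (fgen X) -> v (mres F h s) = v s;
 vinj : forall U (s : F U), U (fgen X) -> v s = 0 -> s = 0;
 vmem : forall U (s : F U) x, U x -> Fx x (v s);
 vex : forall x z, Fx x z -> exists U (s : F U), U x /\ v s = z }.
Hypothesis rF : realization.

Local Notation I0 := (ir_obj I 0).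
Local Notation I1 := (ir_obj I 1).
Local Notation d0 := (ir_diff I 0).
Local Notation aug := (ir_aug I).
Local Notation T := (opensT X).

Lemma vB U (s t : F U) : U (fgen X) -> v (s - t) = v s - v t.
Proof. by move=> Ug; rewrite -scaleN1r addrC (vlin rF) fvalN fval1 // mulN1r addrC. Qed.

Lemma veq U (s t : F U) : U (fgen X) -> v s = v t -> s = t.
Proof. by move=> Ug e; apply/eqP; rewrite -subr_eq0; apply/eqP; apply: (vinj rF) => //; rewrite vB // e subrr. Qed.

Lemma vrs U V (s : F U) : V (fgen X) -> V `<=` U -> v (rs V s) = v s.
Proof. by move=> Vg h; rewrite -(rsE h) (vres rF). Qed.

(* s is the family of elements by which local primitives of the cocycle c differ. *)
Definition represents (c : I1 T) (s : X -> K) : Prop :=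
 exists (V : X -> opens X) (b : forall x, I0 (V x)),
 [/\ forall x, V x x, forall x, d0 (V x) (b x) = rs (V x) c &
  forall x y z, V x z -> V y z -> exists W (f : F W),
   [/\ W z, W `<=` V x, W `<=` V y, aug W f = rs W (b x) - rs W (b y) & v f = s x - s y]].

Lemma represents_family c s : represents c s -> family Fx s.
Proof.
move=> [V [b [Vx _ hV]]] x; exists (V x); split=> // y Vy.
by have [W [f [Wy _ _ _ <-]]] := hV y x y (Vx y) Vy; apply: (vmem rF).
Qed.

Lemma represents_exists c : @cocycles _ _ I 1 c -> exists s, represents c s.
Proof.
move=> dc.
have /choice [Vb hVb] : forall x, exists Vb : {V : opens X & I0 V}, projT1 Vb x /\
  d0 (projT1 Vb) (projT2 Vb) = rs (projT1 Vb) c.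
 by move=> x; have [//|V [b [Vx _ e]]] := exact_rs (x := x) (ir_exactS I 0) dc; exists (existT _ V b).
pose V x := projT1 (Vb x); pose b x : I0 (V x) := projT2 (Vb x).
have Vx x : V x x by case: (hVb x).
have db x : d0 (V x) (b x) = rs (V x) c by case: (hVb x).
have loc0 x y z : V x z -> V y z -> exists W (f : F W),
  [/\ W z, W `<=` V x, W `<=` V y & aug W f = rs W (b x) - rs W (b y)].
 move=> Vxz Vyz; pose W0 := opensI (V x) (V y).
 have hx : W0 `<=` V x by move=> ? []. have hy : W0 `<=` V y by move=> ? [].
 have [||W [f [Wz k e]]] := exact_rs (x := z) (ir_exact0 I) (s := rs W0 (b x) - rs W0 (b y)).
 - by rewrite linearB /= !mmap_rs !db !rs_rs // subrr.
 - by split.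
 have kx := subset_trans k hx; have ky := subset_trans k hy.
 by exists W, f; split=> //; rewrite e rsB !rs_rs.
have Vg x : V x (fgen X) by apply: (fgenP (Vx x)).
(* s x is the value of the difference between the primitives at x and at the generic point; as all
   open sets here contain the generic point, these values determine all other differences. *)
have /choice [s hs] : forall x, exists s, exists W (f : F W),
  [/\ W (fgen X), W `<=` V x, W `<=` V (fgen X), aug W f = rs W (b x) - rs W (b (fgen X)) & v f = s].
 by move=> x; have [W [f [Wg kx k e]]] := loc0 x (fgen X) (fgen X) (Vg x) (Vg _); exists (v f), W, f.
exists s, V, b; split=> // x y z Vxz Vyz; have [W [f [Wz hx hy e]]] := loc0 x y z Vxz Vyz.
exists W, f; split=> //; have Wg := fgenP Wz.
have [Wx [fx [Wxg kx lx ex' <-]]] := hs x; have [Wy [fy [Wyg ky ly ey <-]]] := hs y.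
pose W' := opensI W (opensI Wx Wy); have Wg' : W' (fgen X) by [].
have m0 : W' `<=` W by move=> ? []. have mx : W' `<=` Wx by move=> ? [_ []].
have my : W' `<=` Wy by move=> ? [_ []].
rewrite -(vrs f Wg' m0) -(vrs fx Wg' mx) -(vrs fy Wg' my) -vB //; congr v.
apply: (@ir_mono _ _ I); rewrite linearB /= !mmap_rs e ex' ey !rsB !rs_rs //.
by rewrite opprB addrA subrK.
Qed.

Lemma represents0 : represents 0 (fun _ => 0).
Proof.
exists (fun _ => T), (fun _ => 0); split=> // [x|x y z _ _]; first by rewrite linear0 rs0.
exists T, 0; split=> //; first by rewrite linear0 rs0 subrr.
by rewrite -(subrr (0 : F T)) vB // !subrr.
Qed.

Lemma representsD a c c' s s' : represents c s -> represents c' s' ->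
 represents (a *: c + c') (fun x => fval a * s x + s' x).
Proof.
move=> [V [b [Vx db hV]]] [V' [b' [Vx' db' hV']]].
pose U x := opensI (V x) (V' x).
have l x : U x `<=` V x by move=> ? []. have l' x : U x `<=` V' x by move=> ? [].
have aT : glob T a = a by rewrite /glob rres_id.
exists U, (fun x => glob (U x) a *: rs (U x) (b x) + rs (U x) (b' x)); split.
- by move=> x; split.
- move=> x; rewrite linearD linearZ /= !mmap_rs db db' !rs_rs //.
 by rewrite -[in RHS]aT rsL.
- move=> x y z [h1 h1'] [h2 h2'].
 have [W [f [Wz hx hy e ef]]] := hV x y z h1 h2.
 have [W' [f' [Wz' hx' hy' e' ef']]] := hV' x y z h1' h2'.
 pose W2 := opensI W W'; have Wg : W2 (fgen X) by apply: (@fgenP _ _ W2 z); split.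
 have k : W2 `<=` W by move=> ? []. have k' : W2 `<=` W' by move=> ? [].
 have kx : W2 `<=` U x by move=> w [/hx ? /hx' ?]; split.
 have ky : W2 `<=` U y by move=> w [/hy ? /hy' ?]; split.
 exists W2, (glob W2 a *: rs W2 f + rs W2 f'); split=> //.
  rewrite linearD linearZ /= !mmap_rs e e' !rsB !rsL // !rs_rs //.
  by rewrite scalerBr opprD addrACA.
 rewrite (vlin rF) !vrs // ef ef' /glob fval_res //; ring.
Qed.

(** Corrected by local sections of value s x - k, the primitives agree on overlaps and glue to a
    global primitive. *)
Lemma trivial_coboundary c s k : represents c s -> (forall x, Fx x (s x - k)) -> range (d0 T) c.
Proof.
move=> [V [b [Vx db hV]]] hk; have /choice [Ug hUg] : forall x, exists Ug : {U : opens X & F U},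
  projT1 Ug x /\ v (projT2 Ug) = s x - k.
 by move=> x; have [U [g [Ux e]]] := vex rF (hk x); exists (existT _ U g).
pose W x := opensI (V x) (projT1 (Ug x)).
have l x : W x `<=` V x by move=> ? []. have l' x : W x `<=` projT1 (Ug x) by move=> ? [].
pose b' x := rs (W x) (b x) - rs (W x) (aug _ (projT2 (Ug x))).
have subT x : W x `<=` T by [].
have Wx x : W x x by split=> //; case: (hUg x).
have [||B [hB _]] := mres_sheaf subT _ (s := b').
- by move=> x _; exists x.
- move=> x y W' hi hj; apply: mod_local_eq => z W'z.
 have [Vz Uz] := hi z W'z; have [Vz' Uz'] := hj z W'z.
 have [W0 [f [W0z hx hy e ev]]] := hV x y z Vz Vz'.
 pose W2 := opensI W' W0; have m1 : W2 `<=` W' by move=> ? []. have m0 : W2 `<=` W0 by move=> ? [].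
 have Wg : W2 (fgen X) by apply: (@fgenP _ _ W2 z); split.
 have ni := subset_trans m1 hi; have nj := subset_trans m1 hj.
 have nx := subset_trans ni (l' x); have ny := subset_trans nj (l' y).
 have mx := subset_trans m0 hx; have my := subset_trans m0 hy.
 exists W2; split=> //.
 rewrite !rsE !rs_rs // /b' !rsB !rs_rs // -!mmap_rs.
 have : rs W2 (b x) - rs W2 (b y) = aug W2 (rs W2 f) by rewrite mmap_rs e rsB !rs_rs.
 have -> : rs W2 f = rs W2 (projT2 (Ug x)) - rs W2 (projT2 (Ug y)).
  apply: veq => //; rewrite vB // !vrs // ev; case: (hUg x) => _ ->; case: (hUg y) => _ ->; ring.
 rewrite linearB => e3; rewrite -[rs W2 (b x)](subrK (rs W2 (b y))) e3.
 by rewrite addrC addrA addrA addNr add0r addrC.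
- exists B => //=; apply: mod_local_eq => x _; exists (W x); split=> //.
 rewrite -mmap_rs -(rsE (subT x)) hB linearB /= !mmap_rs db !rs_rs //.
 by have [z0 _] := ir_exact0 I; rewrite z0 rs0 subr0.
Qed.

(** The local primitives differ from the global primitive B by sections g x of F, and s x minus the
    value of g x does not depend on x. *)
Lemma coboundary_trivial B s : represents (d0 T B) s -> exists k, forall x, Fx x (s x - k).
Proof.
move=> [V [b [Vx db hV]]].
have /choice [Wg hWg] : forall x, exists Wg : {W : opens X & F W}, [/\ projT1 Wg x, projT1 Wg `<=` V x &
  aug _ (projT2 Wg) = rs (projT1 Wg) (b x) - rs (projT1 Wg) B].
 move=> x; have [||W [f [Wx k e]]] := exact_rs (x := x) (ir_exact0 I) (s := b x - rs (V x) B).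
 - by rewrite linearB /= mmap_rs db subrr.
 - exact: Vx.
 - by exists (existT _ W f); split=> //=; rewrite e rsB rs_rs.
pose W x := projT1 (Wg x); pose g x : F (W x) := projT2 (Wg x).
exists (s (fgen X) - v (g (fgen X))) => x; rewrite (_ : s x - _ = v (g x)).
 by apply: (vmem rF); case: (hWg x).
have [Wx lx ex'] := hWg x; have [Wg0 lg eg] := hWg (fgen X).
have [W0 [f [W0g hx hy e ev]]] := hV x _ _ (fgenP (Vx x)) (Vx (fgen X)).
pose W2 := opensI W0 (opensI (W x) (W (fgen X))).
have W2g : W2 (fgen X) by split=> //; split=> //; apply: (fgenP Wx).
have m0 : W2 `<=` W0 by move=> ? []. have mx : W2 `<=` W x by move=> ? [_ []].
have mg : W2 `<=` W (fgen X) by move=> ? [_ []].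
have nx := subset_trans m0 hx; have ng := subset_trans m0 hy.
have E : rs W2 f = rs W2 (g x) - rs W2 (g (fgen X)).
 apply: (@ir_mono _ _ I); rewrite linearB /= !mmap_rs e ex' eg !rsB !rs_rs //.
 by rewrite opprB addrA subrK.
have := congr1 v E; rewrite vB // !vrs // ev => E2.
by rewrite opprB addrCA E2 addrCA subrr addr0.
Qed.

End Families.

(** * The constant sheaf of rational functions *)

Section ConstantSheaf.
Variables (K : fieldType) (X : fscheme K).
Implicit Types U V W : opens X.

Definition csec_pred U : {pred K} := fun z => `[< ~ U (fgen X) -> z = 0 >].

Lemma csec_zmod U : zmod_closed (csec_pred U).
Proof.
split; first by apply/asboolP.
by move=> x y /asboolP hx /asboolP hy; apply/asboolP => n; rewrite hx ?hy ?subrr.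
Qed.

HB.instance Definition _ U := GRing.isZmodClosed.Build K (csec_pred U) (csec_zmod U).

Record csec U := CSec { cval : K ; cvalP : cval \in csec_pred U }.

HB.instance Definition _ U := [isSub for @cval U].
HB.instance Definition _ U := [Choice of csec U by <:].
HB.instance Definition _ U := [SubChoice_isSubZmodule of csec U by <:].

Lemma csecE U (s : csec U) : ~ U (fgen X) -> cval s = 0.
Proof. by have /asboolP := cvalP s. Qed.

Lemma csec_eq U (s t : csec U) : (U (fgen X) -> cval s = cval t) -> s = t.
Proof. by move=> h; apply: val_inj; have [/h|n] := EM (U (fgen X)); rewrite //= !csecE. Qed.

Lemma celt_subproof U z : (if `[< U (fgen X) >] then z else 0) \in csec_pred U.
Proof. by apply/asboolP => n; case: asboolP. Qed.
Definition celt U z : csec U := CSec (celt_subproof U z).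

Lemma celtE U z : U (fgen X) -> cval (celt U z) = z.
Proof. by rewrite /=; case: asboolP. Qed.

Lemma cvalD U (s t : csec U) : cval (s + t) = cval s + cval t. Proof. by []. Qed.

Definition cscale U (a : OO X U) (s : csec U) : csec U := celt U (fval a * cval s).

Lemma cscaleA U a b (s : csec U) : cscale a (cscale b s) = cscale (a * b) s.
Proof. by apply: csec_eq => Ug; rewrite !celtE // fvalM mulrA. Qed.
Lemma cscale1 U : left_id 1 (@cscale U).
Proof. by move=> s; apply: csec_eq => Ug; rewrite !celtE // fval1 // mul1r. Qed.
Lemma cscaleDr U : right_distributive (@cscale U) +%R.
Proof. by move=> a s t; apply: csec_eq => Ug; rewrite cvalD !celtE // cvalD mulrDr. Qed.
Lemma cscaleDl U s : {morph (@cscale U)^~ s : a b / a + b}.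
Proof. by move=> a b; apply: csec_eq => Ug; rewrite cvalD !celtE // fvalD mulrDl. Qed.

HB.instance Definition _ U := GRing.Zmodule_isLmodule.Build (OO X U) (csec U)
 (@cscaleA U) (@cscale1 U) (@cscaleDr U) (@cscaleDl U).

Definition cres U V (h : V `<=` U) (s : csec U) : csec V := celt V (cval s).

Lemma cres_linear U V (h : V `<=` U) a (s t : csec U) :
 cres h (a *: s + t) = rres h a *: cres h s + cres h t.
Proof. by apply: csec_eq => Vg; have Ug := h _ Vg; rewrite cvalD !celtE // cvalD celtE // fval_res. Qed.
Lemma cres_id U (h : U `<=` U) (s : csec U) : cres h s = s.
Proof. by apply: csec_eq => Ug; rewrite celtE. Qed.
Lemma cres_comp U V W (h : V `<=` U) (k : W `<=` V) (l : W `<=` U) (s : csec U) :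
 cres k (cres h s) = cres l s.
Proof. by apply: csec_eq => Wg; rewrite !celtE //; apply: k. Qed.

Lemma csec_sheaf : is_sheaf (fun U V h => @cres U V h).
Proof.
move=> U J V hV cov s hs; have [[i0 g0]|ng] := EM (exists i, V i (fgen X)).
 have Ug := hV _ _ g0; exists (celt U (cval (s i0))); split=> [i|t ht]; apply: csec_eq => g.
  rewrite !celtE //; pose W := opensI (V i) (V i0).
  have hi : W `<=` V i by move=> ? []. have h0 : W `<=` V i0 by move=> ? [].
  by have := congr1 (@cval W) (hs i i0 W hi h0); rewrite !celtE.
 by rewrite celtE // -(ht i0) celtE.
have nU : ~ U (fgen X) by move=> /cov [i ?]; apply: ng; exists i.
exists 0; split=> [i|t _]; apply: csec_eq => g; first by case: ng; exists i.
by case: nU.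
Qed.

Definition constK : mod_sheaf X := @ModSheaf X csec cres cres_linear cres_id cres_comp csec_sheaf.

Definition cmap U (s : (OO X U)^o) : csec U := celt U (fval s).
Lemma cmap_linear U : linear (@cmap U).
Proof. by move=> a s t; apply: csec_eq => Ug; rewrite cvalD !celtE // fvalD fvalM. Qed.
HB.instance Definition _ U := GRing.isLinear.Build (OO X U) (OO X U)^o (csec U) _ (@cmap U) (@cmap_linear U).

Lemma cmap_nat U V (h : V `<=` U) (s : OX X U) :
 (cmap (rres h s) : constK V) = mres constK h (cmap s).
Proof. by apply: csec_eq => Vg; have Ug := h _ Vg; rewrite !celtE // fval_res. Qed.

Definition cmor : mod_mor (OX X) constK := @ModMor X (OX X) constK (fun U => @cmap U) cmap_nat.

Lemma OX_realization : realization (F := OX X) (fun U s => fval (s : OO X U)) floc.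
Proof.
split.
- by move=> U a s t; rewrite fvalD fvalM.
- by move=> U V h s Vg; rewrite /= fval_res.
- by move=> U s; apply: fval_inj0.
- by move=> U s x; apply: floc_val.
- by move=> x z [U [s [Ux e]]]; exists U, s.
Qed.

(** Since I^0 is injective, the augmentation of O_X extends to the constant sheaf. The images of the
    constants s x are local primitives whose differentials glue to the cocycle. *)
Lemma family_represented (I : injective_resolution (OX X)) s : family floc s ->
 exists2 c, @cocycles _ _ I 1 c & represents (I := I) (fun U t => fval (t : OO X U)) c s.
Proof.
move=> fs; have [|w hw] := @ir_injective _ _ I 0%N (OX X) constK cmor (ir_aug I).
 move=> U s1 s2 e; have [Ug|n] := EM (U (fgen X)).
  by apply: fval_inj; have := congr1 (@cval U) e; rewrite !celtE.
 by apply: sec0 => x /fgenP.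
have /choice [V hV] := fs; have Vx x : V x x by case: (hV x).
pose el U z : constK U := celt U z.
have elrs U W z : W (fgen X) -> W `<=` U -> rs W (el U z) = el W z.
 by move=> Wg h; rewrite -(rsE h); apply: csec_eq => _; rewrite !celtE //; apply: h.
pose b x := w (V x) (el (V x) (s x)).
have loc0 x y z (W := opensI (V x) (V y)) : V x z -> V y z -> exists f : OX X W,
  ir_aug I W f = rs W (b x) - rs W (b y) /\ fval (f : OO X W) = s x - s y.
 move=> h1 h2; have Wg : W (fgen X) by apply: (@fgenP _ _ W z); split.
 have [y' [Vy1 Vy2]|f ef] := @fval_glue _ _ W (s x - s y) Wg.
  rewrite (_ : s x - s y = (s y' - s y) - (s y' - s x)); last by ring.
  by apply: (subB (floc_sr y')); [case: (hV y) => _; apply|case: (hV x) => _; apply].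
 exists f; split=> //; rewrite -hw /b -!mmap_rs -linearB !elrs //; try by move=> ? [].
 congr (w W _); apply: csec_eq => _; rewrite -[LHS]/(cval (celt W (fval f))).
 by rewrite [RHS](_ : _ = cval (celt W (s x)) - cval (celt W (s y))) // !celtE.
have [z0 _] := ir_exact0 I; have [z1 _] := ir_exactS I 0.
have sub x : V x `<=` opensT X by [].
have [||c [hc _]] := mres_sheaf sub _ (s := fun x => ir_diff I 0 (V x) (b x)).
- by move=> x _; exists x.
- move=> x y W hi hj; apply: mod_local_eq => z Wz; have [f [ef _]] := loc0 x y z (hi z Wz) (hj z Wz).
 exists W; split=> //; rewrite !rsE !rs_rs //; apply/eqP; rewrite -subr_eq0 -!(mmap_rs (ir_diff I 0)) -linearB.
 have k : W `<=` opensI (V x) (V y) by move=> u Wu; split; [apply: hi|apply: hj].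
 have := congr1 (rs W) ef; rewrite rsB !rs_rs //; try by move=> ? [].
 by move=> <-; rewrite mmap_rs z0 rs0.
exists c; last first.
 exists V, b; split=> // [x|x y z h1 h2]; first by rewrite -(rsE (sub x)) hc.
 have [f [e ef]] := loc0 x y z h1 h2.
 by exists (opensI (V x) (V y)), f; split=> // ? [].
rewrite /cocycles /=; apply: mod_local_eq => x _; exists (V x); split=> //.
by rewrite rs0 -mmap_rs -(rsE (sub x)) hc z1.
Qed.

End ConstantSheaf.

(** * Comparison of the lengths of cohomology *)

Section Compare.
Variables (A : comPzRingType) (K : fieldType) (X : fscheme K) (alg : {rmorphism A -> OO X (opensT X)}).

Lemma enat_sup_max (P : set nat) R : P 0%N -> (forall n, P n -> (n <= R)%N) ->
 exists2 m, enat_sup P = Some m & P m /\ forall n, P n -> (n <= m)%N.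
Proof.
move=> P0 hR; have [|n /asboolP Pn|m /asboolP Pm hm] := @ex_maxnP (fun n => `[< P n >]) R.
- by exists 0%N; apply/asboolP.
- exact: hR.
have ex : exists n, P n /\ forall m, P m -> (m <= n)%N.
 by exists m; split=> // i Pi; apply: hm; apply/asboolP.
rewrite /enat_sup; case: pselect => [e|//]; exists (sval (cid e)) => //.
by case: (cid e).
Qed.

Variables (k : fieldType) (iota : {rmorphism k -> A}) (kap : {rmorphism k -> K}).
Hypothesis fval_iota : forall c, fval (alg (iota c)) = kap c.
Variables (F : mod_sheaf X) (v : forall U : opens X, F U -> K) (Fx : X -> set K).
Hypothesis rF : realization v Fx.
Variables (I : injective_resolution (OX X)) (J : injective_resolution F).
Local Notation fv := (fun (U : opens X) (s : OX X U) => fval (s : OO X U)).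
Local Notation rI := (represents (I := I) fv).
Local Notation rJ := (represents (I := J) v).
Let rO : realization fv floc := @OX_realization K X.

Variables (D : set K) (us : seq K) (rel : (X -> K) -> K -> Prop).
Hypotheses (D0 : D 0) (DD : forall a b, D a -> D b -> D (a + b)) (DM : forall l a, D a -> D (kap l * a)).
Hypothesis rel0 : rel (fun _ => 0) 0.
Hypothesis relD : forall l s s' z z', rel s z -> rel s' z' -> rel (fun x => kap l * s x + s' x) (kap l * z + z').
Hypothesis rel_span : forall s, family floc s -> exists2 z, rel s z & spanD (range kap) D us z.
Hypothesis rel_ker : forall s z, family floc s -> rel s z -> D z -> exists c, forall x, floc x (s x - c).

Variable h : K.
Hypothesis h0 : h != 0.
Hypothesis Fxh : forall x z, floc x z -> Fx x (h * z).
Hypothesis FxB : forall x a b, Fx x a -> Fx x b -> Fx x (a - b).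
Hypothesis FxM : forall x a b, floc x a -> Fx x b -> Fx x (a * b).
Hypothesis division : forall s : X -> K, family Fx s -> exists y (t : X -> K),
 family floc t /\ forall x, Fx x (s x - y - h * t x).

Let chain_of (G : mod_sheaf X) (L : injective_resolution G) n (c : nat -> set (ir_obj L 1 (opensT X))) :=
 [/\ forall i, (i <= n)%N -> is_submodule alg (c i), forall i, (i < n)%N -> c i `<` c i.+1,
  @coboundaries _ _ L 1 `<=` c 0%N & c n `<=` @cocycles _ _ L 1].

Let chains (G : mod_sheaf X) (L : injective_resolution G) : set nat :=
 [set n | exists c : nat -> set (ir_obj L 1 (opensT X)), chain_of n c].

Let lengthE (G : mod_sheaf X) (L : injective_resolution G) :
 cohomology_length alg L 1 = enat_sup (chains L).
Proof. by []. Qed.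

Lemma coboundary_submodule (G : mod_sheaf X) (L : injective_resolution G) :
 is_submodule alg (@coboundaries _ _ L 1) /\ @coboundaries _ _ L 1 `<=` @cocycles _ _ L 1.
Proof.
split; last by move=> _ [b _ <-]; have [z1 _] := ir_exactS L 0; apply: z1.
split=> [|_ _ [b _ <-] [b' _ <-]|a _ [b _ <-]].
- by exists 0 => //; rewrite linear0.
- by exists (b + b') => //; rewrite linearD.
- by exists (alg a *: b) => //; rewrite linearZ.
Qed.

Let chain0 (G : mod_sheaf X) (L : injective_resolution G) : chains L 0%N.
Proof. by exists (fun _ => @coboundaries _ _ L 1); have [h1 h2] := coboundary_submodule L; split. Qed.

Let genus_bound n : chains I n -> (n <= size us)%N.
Proof.
move=> [c [cs clt c0 cn]].
apply: (@kspan_chain K k _ _ (alg \o iota) kap D us c n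
 (fun x z => exists s, rI x s /\ rel s z)) => //.
- move=> i le; have [z0 zD zM] := cs i le; split=> // l x y hx hy.
 by apply: zD => //; apply: zM.
- by exists (fun _ => 0); split=> //; apply: represents0 rO.
- move=> l x y a b [s [hs rs1]] [s' [hs' rs']]; exists (fun z => kap l * s z + s' z); split; last exact: relD.
 by have := representsD rO (alg (iota l)) hs hs'; rewrite fval_iota.
- move=> x /cn /(represents_exists rO) [s hs].
 have [z rz sz] := rel_span (represents_family rO hs); by exists z => //; exists s.
- move=> x a [s [hs rs1]] Da; have [e he] := rel_ker (represents_family rO hs) rs1 Da.
 exact: c0 _ (trivial_coboundary rO hs he).
Qed.

(** The inverse image of c under the map from H^1(O_X) to H^1(F) induced by multiplication by h,
    described by families instead of a map of resolutions. *)
Let lift (c : set (ir_obj J 1 (opensT X))) : set (ir_obj I 1 (opensT X)) :=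
 [set a | @cocycles _ _ I 1 a /\ exists t b s,
  [/\ rI a t, c b, rJ b s & exists y, forall x, Fx x (s x - y - h * t x)]].

Let FxD x a b : Fx x a -> Fx x b -> Fx x (a + b).
Proof. by move=> ha hb; rewrite -[b]opprK -[- b]sub0r; apply: FxB => //; apply: FxB => //; rewrite -(subrr a); apply: FxB. Qed.

Lemma lift_sub c : is_submodule alg c -> is_submodule alg (lift c).
Proof.
move=> [c0 cD cM]; have [z1 _] := ir_exactS I 0.
have l0 : lift c 0.
 split; first by rewrite /cocycles /= linear0.
 exists (fun _ => 0), 0, (fun _ => 0); split=> //; [exact: represents0 rO|exact: represents0 rF|].
 by exists 0 => x; have := Fxh (sub0 (floc_sr x)); congr (Fx x _); ring.
have lin r a a' : lift c a -> lift c a' -> lift c (alg r *: a + a').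
 move=> [ka [t [b [s [ht cb hs [y hy]]]]]] [ka' [t' [b' [s' [ht' cb' hs' [y' hy']]]]]].
 split; first by rewrite /cocycles /= linearD linearZ ka ka' addr0 /= scaler0.
 exists (fun x => fval (alg r) * t x + t' x), (alg r *: b + b'), (fun x => fval (alg r) * s x + s' x).
 split; [by have := representsD rO (alg r) ht ht'|by apply: cD => //; apply: cM|by have := representsD rF (alg r) hs hs'|].
 exists (fval (alg r) * y + y') => x.
 by have := FxD (FxM (floc_val (x := x) (alg r) Logic.I) (hy x)) (hy' x); congr (Fx x _); ring.
split=> // [a a' ha ha'|r a ha]; first by rewrite -[a]scale1r -(rmorph1 alg); apply: lin.
by rewrite -[_ *: a]addr0; apply: lin.
Qed.

Let sub_repr a t t' : rI a t -> rI a t' -> exists y, forall x, floc x (t x - t' x - y).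
Proof.
move=> h1 h2; have := representsD rO (-1) h2 h1; rewrite scaleN1r addNr -(linear0 (ir_diff I 0 (opensT X))).
move=> /(coboundary_trivial rO) [y hy]; exists y => x; have := hy x.
by rewrite fvalN fval1 // mulN1r (addrC (- t' x)).
Qed.

Let sub_reprF b b' s s' : rJ b s -> rJ b' s' -> (exists y, forall x, Fx x (s x - s' x - y)) ->
 @coboundaries _ _ J 1 (b - b').
Proof.
move=> h1 h2 [y hy]; have := representsD rF (-1) h2 h1; rewrite scaleN1r addrC => h3.
by apply: (trivial_coboundary rF h3 (k := y)) => x; rewrite fvalN fval1 // mulN1r (addrC (- s' x)).
Qed.

(** Inverse images under a surjection preserve strict inclusions; surjectivity is the hypothesis
    [division]. *)
Lemma lift_chain n (c : nat -> set (ir_obj J 1 (opensT X))) : chain_of n c ->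
 chain_of n (fun i => lift (c i)).
Proof.
move=> [cs clt c0 cn].
have cle i j : (i <= j)%N -> (j <= n)%N -> c i `<=` c j.
 elim: j => [|j IH]; first by rewrite leqn0 => /eqP -> _ z.
 rewrite leq_eqVlt => /predU1P [-> _ z //|ij jn].
 by apply: (subset_trans (IH ij (ltnW jn))); have [] := clt j jn.
split.
- by move=> i le; apply: lift_sub; apply: cs.
- move=> i lt; have [le ne] := clt i lt; split.
  by move=> a [ka [t [b [s [h1 h2 h3 h4]]]]]; split=> //; exists t, b, s; split=> //; apply: le.
 move=> ge; apply: ne => b cb.
 have kb : @cocycles _ _ J 1 b by apply: cn; apply: cle cb.
 have [s hs] := represents_exists rF kb; have [y [t [ft ht]]] := division (represents_family rF hs).
 have [a ka ha] := family_represented I ft.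
 have [|_ [t' [b' [s' [ha' cb' hs' [y' hy']]]]]] := ge a.
  by split=> //; exists t, b, s; split=> //; exists y.
 have [w hw] := sub_repr ha ha'.
 have [_ cD _] := cs i (ltnW lt); rewrite -(subrK b' b); apply: cD => //.
 apply: (cle 0%N i _ (ltnW lt)) => //; apply: c0; apply: (sub_reprF hs hs').
 exists (y - y' + h * w) => x.
 have := FxD (FxB (ht x) (hy' x)) (Fxh (hw x)); congr (Fx x _); ring.
- move=> a ba; have [h1 h2] := coboundary_submodule I; split; first exact: h2.
 have [t ht] := represents_exists rO (h2 a ba); have [B _ eB] := ba.
 have [y hy] : exists y, forall x, floc x (t x - y) by apply: (coboundary_trivial rO (B := B)); rewrite eB.
 exists t, 0, (fun _ => 0); split=> //; [|exact: represents0 rF|].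
  by have [z0 _ _] := cs 0%N (leq0n n).
 exists (- (h * y)) => x; have := Fxh (subN (floc_sr x) (hy x)); congr (Fx x _); ring.
- by move=> a [].
Qed.

Let length_max : exists2 m, cohomology_length alg I 1 = Some m & forall n, chains I n -> (n <= m)%N.
Proof. by rewrite lengthE; have [m em [_ hm]] := enat_sup_max (chain0 I) genus_bound; exists m. Qed.

Let lift_max : exists2 p, cohomology_length alg J 1 = Some p & chains J p.
Proof.
have [m _ hm] := length_max; have hJ n : chains J n -> (n <= m)%N.
 by move=> [c hc]; apply: hm; eexists; apply: lift_chain hc.
by rewrite lengthE; have [p ep [Pp _]] := enat_sup_max (chain0 J) hJ; exists p.
Qed.

Lemma length_le : enat_le (cohomology_length alg J 1) (cohomology_length alg I 1).
Proof.
have [m -> hm] := length_max; have [p -> [c hc]] := lift_max.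
by apply: hm; eexists; apply: lift_chain hc.
Qed.

(** A nontrivial t in the kernel would make the coboundaries strictly smaller than the first step of
    a lifted maximal chain, and give a chain longer than the maximum. *)
Lemma length_eq_injective : cohomology_length alg J 1 = cohomology_length alg I 1 ->
 forall t : X -> K, family floc t -> (exists y, forall x, Fx x (h * t x - y)) ->
  exists y, forall x, floc x (t x - y).
Proof.
have [m -> hm] := length_max; have [p -> [c hc]] := lift_max => -[pm].
move=> t ft [y hy]; apply: contrapT => nt; have [h1 _ _ _] := hc; have [l1 l2 l3 l4] := lift_chain hc.
suff : chains I p.+1 by move=> /hm; rewrite pm ltnn.
have [s1 s2] := coboundary_submodule I.
exists (fun i => if i is i.+1 then lift (c i) else @coboundaries _ _ I 1); split=> //.
 by case=> [|i] //; apply: l1.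
case=> [_|i]; last exact: l2.
split=> // ge; have [a ka ha] := family_represented I ft; apply: nt.
have [|B _ eB] := ge a.
 split=> //; exists t, 0, (fun _ => 0); split=> //; [|exact: represents0 rF|].
  by have [z0 _ _] := h1 0%N (leq0n p).
 exists (- y) => x; have h00 : Fx x 0 by rewrite -(subrr (h * t x - y)); apply: FxB.
 by have := FxB h00 (hy x); congr (Fx x _); ring.
by apply: (coboundary_trivial rO (B := B)); rewrite eB.
Qed.

End Compare.

(** * Conclusion *)

Lemma fractionP (A : idomainType) (z : {fraction A}) :
 exists a b : A, b != 0 /\ z = @tofrac A a / @tofrac A b.
Proof.
elim/quotW: z => x; exists (frac x).1, (frac x).2; have d0 := denom_ratioP x; split=> //.
have t0 : @tofrac A (frac x).2 != 0 by rewrite tofrac_eq0.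
apply: (mulIf t0); rewrite divfK //; apply/eqP; rewrite !piE FracField.equivfE /FracField.mulf /=.
by rewrite !numden_Ratio ?mulf_neq0 ?oner_eq0 // !mulr1 mulrC.
Qed.

Section SurfaceRing.
Variables (A : idomainType) (k : closedFieldType) (iota : {rmorphism k -> A}).
Hypotheses (lA : is_local A) (nA : noetherian A) (ucA : universally_catenary A) (dA : krull_dim A 2).
Hypothesis resA : forall a : A, exists c : k, @nonunits A (a - iota c).

Lemma catenary_poly1 : catenary {poly A}.
Proof.
apply: (ucA (phi := (polyC : {rmorphism A -> {poly A}}))); exists 1%N, (fun _ => 'X) => P P1 PB PM hC hX s.
have PX : P 'X by apply: hX; exists ord0.
have P0 : P 0 by rewrite -(subrr 1); apply: PB.
elim/poly_ind: s => [//|p c hp]; rewrite -[c%:P]opprK; apply: (PB); first exact: PM.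
by rewrite -sub0r; apply: PB => //; apply: hC; exists c.
Qed.

Lemma catenary_poly2 : catenary {poly {poly A}}.
Proof.
pose C2 : {rmorphism A -> {poly {poly A}}} := (polyC : {rmorphism {poly A} -> {poly {poly A}}}) \o (polyC : {rmorphism A -> {poly A}}).
apply: (ucA (phi := C2)); exists 2%N, (fun i => if val i == 0%N then 'X%:P else 'X) => P P1 PB PM hC hX s.
have PX : P 'X by apply: hX; exists (lift ord0 ord0).
have PY : P 'X%:P by apply: hX; exists ord0.
have P0 : P 0 by rewrite -(subrr 1); apply: PB.
have PD a b : P a -> P b -> P (a + b) by move=> ha hb; rewrite -[b]opprK -[- b]sub0r; apply: (PB) => //; apply: PB.
elim/poly_ind: s => [//|p c hp]; apply: (PD); first exact: PM.
elim/poly_ind: c => [//|q c hq]; rewrite polyCD polyCM; apply: PD; first exact: PM.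
by apply: hC; exists c.
Qed.

(** Noetherian induction. A maximal counterexample is proper and not prime, and for a product a b in
    it, primes above it contain a or b and are covered by the two larger ideals. *)
Lemma minimal_primes (J : set A) : is_ideal J -> exists2 F : set (set A), finite_set F &
 (forall p, F p -> is_prime p) /\ forall P, is_prime P -> J `<=` P -> exists2 p, F p & J `<=` p /\ p `<=` P.
Proof.
move=> iJ; apply: contrapT => nJ.
pose Good (I : set A) := is_ideal I /\ ~ exists2 F : set (set A), finite_set F &
 (forall p, F p -> is_prime p) /\ forall P, is_prime P -> I `<=` P -> exists2 p, F p & I `<=` p /\ p `<=` P.
have [|I [[iI nI] _ maxI]] := @noetherian_max A Good J nA (fun I h => h.1); first by split.
have big a : ~ I a -> exists2 F : set (set A), finite_set F & (forall p, F p -> is_prime p) /\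
  forall P, is_prime P -> I `<=` P -> P a -> exists2 p, F p & I `<=` p /\ p `<=` P.
 move=> na; pose G := I `|` [set a]; apply: contrapT => h; apply: na.
 have IG : I `<=` ideal_gen G by move=> z Iz; apply: ideal_gen_sub; left.
 rewrite -(maxI (ideal_gen G)) //; first by apply: ideal_gen_sub; right.
 split=> [|[F fF [hF gF]]]; first exact: ideal_gen_ideal.
 apply: h; exists F => //; split=> // P hP IP Pa; have [|p Fp [Gp pP]] := gF P hP.
  by move=> z; apply; [case: hP|move=> ? [/IP|->]].
 by exists p => //; split=> // z /IG /Gp.
have [[a [b [na nb Iab]]]|nab] := EM (exists a b, [/\ ~ I a, ~ I b & I (a * b)]).
 have [F fF [hF gF]] := big a na; have [G fG [hG gG]] := big b nb.
 apply: nI; exists (F `|` G); first by rewrite finite_setU.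
 split=> [p [/hF|/hG] //|P hP IP]; have [_ _ hM] := hP; case: (hM _ _ (IP _ Iab)) => [Pa|Pb].
  by have [p Fp] := gF P hP IP Pa; exists p => //; left.
 by have [p Gp] := gG P hP IP Pb; exists p => //; right.
have [I1|I1] := EM (I 1).
 by apply: nI; exists set0 => //; split=> // P [_ P1 _] /(_ _ I1).
apply: nI; exists [set I]; first exact: finite_set1.
split=> [p ->|P _ IP]; last by exists I => //; split.
by split=> // a b Iab; apply: contrapT => /not_orP [na nb]; apply: nab; exists a, b.
Qed.

Variables (K : fieldType) (tf : {rmorphism A -> K}).
Hypothesis tf_inj : injective tf.
Hypothesis frac : forall z : K, exists a b, b != 0 /\ z = tf a / tf b.
Hypothesis normA : forall z, integral (range tf) z -> range tf z.
Variable res : {rmorphism A -> k}.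
Hypotheses (res_iota : forall c, res (iota c) = c) (res0 : forall a, res a = 0 <-> @nonunits A a).

Local Notation AK := (range tf).
Local Notation kap := (tf \o iota : {rmorphism k -> K}).

Lemma nonunit_range a : nonunit AK (tf a) <-> @nonunits A a.
Proof.
split=> [[_ nu] [b ab]|nu].
 have e : tf a * tf b = 1 by rewrite -rmorphM ab rmorph1.
 have a0 : tf a != 0 by apply/eqP => a0; move/eqP: e; rewrite a0 mul0r eq_sym oner_eq0.
 apply: nu; split=> //; exists b => //.
 by rewrite -[LHS](mulKf a0) e mulr1.
split; first by exists a.
move=> [a0 [b _ e]]; apply: nu; exists b; apply: tf_inj.
by rewrite rmorphM rmorph1 e divff.
Qed.

Lemma height1_A P : height1 AK P -> [/\ pideal AK P, exists2 a : K, a != 0 & P a &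
 exists2 a, @nonunits A a & ~ P (tf a)].
Proof. by move=> [hP h0 [_ [[a _ <-] na] nP]]; split=> //; exists a => //; apply/nonunit_range. Qed.

Lemma AK_height1_valring P : height1 AK P -> valring (loc AK P).
Proof. by move=> /height1_A [h1 h2 h3]; apply: height1_valring. Qed.

Lemma AK_height1_finite z : AK z -> z != 0 -> finite_set [set P | height1 AK P /\ P z].
Proof.
move=> [a _ <-] z0; have [F fF [hF gF]] := minimal_primes (principal_ideal a).
apply: (@sub_finite_set _ _ ((fun p => tf @` p) @` F)); last exact: finite_image.
move=> P [/height1_A [hP P0 Pm] Pa]; have prP := pideal_preim hP.
have [|p Fp [ap hp]] := gF _ prP.
 by move=> _ [c ->] /=; rewrite rmorphM; case: hP => iP _ _; apply: (idM iP) => //; exists c.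
exists p => //; apply: (@height1_prime A lA dA K tf) => //; last by move=> _ [b pb <-]; apply: hp.
 by apply: (tf_pideal tf_inj); apply: hF.
by exists (tf a) => //; exists a => //; apply: ap; exists 1; rewrite mul1r.
Qed.

Lemma evk_factor (V : set K) y (f : {poly k}) d : valring V -> AK `<=` V -> nonunit V (y - kap d) ->
 nonunit V (evk iota tf y f - kap f.[d]).
Proof.
move=> vV AV nd; have sV := vV.1; have Vy : V y.
 by rewrite -(subrK (kap d) y); apply: (subD sV); [case: nd|apply: AV; exists (iota d)].
have /factor_theorem [q eq] : root (f - f.[d]%:P) d by rewrite /root hornerD hornerN hornerC subrr.
rewrite -(subrK f.[d]%:P f) eq rmorphD rmorphM rmorphB /= evkX !evkC hornerD hornerC hornerM.
rewrite hornerXsubC subrr mulr0 add0r addrK.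
by apply: (idM (valring_ideal vV)) => //; apply: evk_in.
Qed.

(** A relation between x and y with nonzero reduction G descends to the residues: modulo the maximal
    ideal of V, G(x, y) agrees with G(c, d), and a constant of k that is a nonunit is 0. *)
Lemma AK_residues2 x y : exists2 F : {poly {poly k}}, F != 0 &
 forall V c d, dominating AK V -> nonunit V (x - kap c) -> nonunit V (y - kap d) -> F.[d%:P].[c] = 0.
Proof.
have [F [F0 rF]] := residually_dependent2 lA dA catenary_poly2 tf_inj frac res0 x y.
exists (red2 res F) => // V c d [vV AV mV] nc nd; set G := red2 res F.
have sV := vV.1; have iV := valring_ideal vV.
have Vin z e : nonunit V (z - kap e) -> V z.
 by move=> [h _]; rewrite -(subrK (kap e) z); apply: (subD sV) => //; apply: AV; exists (iota e).
have Vx := Vin _ _ nc; have Vy := Vin _ _ nd.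
have mA a : @nonunits A a -> nonunit V (tf a) by move=> na; apply: mV; apply/nonunit_range.
have nG : nonunit V (evk2 iota tf x y G).
 by have := ev2_residue res_iota res0 F iV mA Vx Vy; rewrite F0 sub0r => /(idN sV iV); rewrite opprK.
have /factor_theorem [q eq] : root (G - G.[d%:P]%:P) d%:P by rewrite /root hornerD hornerN hornerC subrr.
have n2 : nonunit V (evk iota tf x G.[d%:P]).
 rewrite (_ : evk iota tf x G.[d%:P] = evk2 iota tf x y G - evk2 iota tf x y q * (y - kap d)).
  by apply: (idB sV iV) => //; apply: (idM iV) => //; apply: evk2_in.
 have -> : evk2 iota tf x y q * (y - kap d) = evk2 iota tf x y (q * ('X - d%:P%:P)).
  by rewrite rmorphM rmorphB /= evk2X evk2C evkC.
 by rewrite -eq rmorphB /= evk2C opprB addrC subrK.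
have n3 : nonunit V (kap G.[d%:P].[c]).
 rewrite (_ : kap _ = evk iota tf x G.[d%:P] - (evk iota tf x G.[d%:P] - kap G.[d%:P].[c])); last by ring.
 by apply: (idB sV iV) => //; apply: evk_factor.
by apply: (kap_nonunit (A0 := AK) _ AV n3) => e; exists (iota e).
Qed.

(** Modulo P, y is a root of a polynomial whose reduction over k is nonzero and splits; its roots
    are the only possible residues. *)
Lemma AK_residues1 P y : height1 AK P -> loc AK P y -> exists C : seq k,
 forall V, dominating AK V -> V `<=` loc AK P -> V y -> exists2 c, c \in C & nonunit V (y - kap c).
Proof.
move=> h1 ly; have [hP P0 Pm] := height1_A h1.
have [F [nF rF]] := residually_dependent1 lA dA catenary_poly1 res0 hP P0 Pm ly.
have [C eC] := closed_field_poly_normal (red1 res F); exists C => V [vV AV mV] Vl Vy.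
have sV := vV.1; have iV := valring_ideal vV.
have mA a : @nonunits A a -> nonunit V (tf a) by move=> na; apply: mV; apply/nonunit_range.
have nf : nonunit V (evk iota tf y (red1 res F)).
 rewrite (_ : evk _ _ _ _ = ev1 tf y F - (ev1 tf y F - evk iota tf y (red1 res F))); last by ring.
 apply: (idB sV iV); last exact: (ev1_residue res_iota res0 F iV mA Vy).
 by apply: (val_sub vV _ Vl) nF; apply: (loc_sr (range_sr tf)).
have l0 : lead_coef (red1 res F) != 0 by rewrite lead_coef_eq0.
move: nf; rewrite eC -mul_polyC rmorphM /= evkC.
have [_ V1 Vp] := valring_prime vV.
move=> /Vp [||h|]; first by apply: AV; exists (iota (lead_coef (red1 res F))).
- by apply: evk_in => //.
- by case/negP: l0; apply/eqP; apply: (kap_nonunit (kap := kap) _ AV h) => e; exists (iota e).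
elim: C {eC} => [|c C IH]; first by rewrite big_nil rmorph1 => /V1.
rewrite big_cons rmorphM /= rmorphB /= evkX evkC => /Vp [||h|/IH [d dC nd]].
- by apply: (subB sV) => //; apply: AV; exists (iota c).
- exact: evk_in.
- by exists c; rewrite ?mem_head.
- by exists d; rewrite // inE dC orbT.
Qed.

Lemma AK_noetherian J : ideal AK J -> exists n (t : 'I_n -> K), (forall i, J (t i)) /\
 forall z, J z -> exists c : 'I_n -> K, (forall i, AK (c i)) /\ z = \sum_i c i * t i.
Proof.
move=> iJ; have [|n [t [Jt gen]]] := @noetherian_gens A [set a | J (tf a)] nA.
 split; [by rewrite /= rmorph0; exact: (id0 iJ)|by move=> a b; rewrite /= rmorphD; exact: (idD iJ)|].
 by move=> a b Jb; rewrite /= rmorphM; apply: (idM iJ) => //; exists a.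
exists n, (fun i => tf (t i)); split=> // z Jz; have [a _ ea] := idS iJ Jz; subst z.
have [c ->] := gen a Jz; exists (fun i => tf (c i)); split; first by move=> i; exists (c i).
by rewrite rmorph_sum; apply: eq_bigr => i _; rewrite rmorphM.
Qed.

Lemma AK_local : ideal AK (nonunit AK).
Proof.
have [_ hD] := lA; split.
- by move=> z [].
- by rewrite -(rmorph0 tf); apply/nonunit_range => -[b]; rewrite mul0r => /esym; case: lA.
- move=> _ _ [[a _ <-] na] [[b _ <-] nb]; rewrite -rmorphD; apply/nonunit_range.
 by apply: hD; apply/nonunit_range; split=> //.
- move=> _ _ [a _ <-] [[b _ <-] nb]; rewrite -rmorphM; apply/nonunit_range => -[c e].
 case: nb; apply: contrapT => h; have /nonunit_range : nonunit AK (tf b) by split=> //; exists b.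
 by apply; exists (a * c); rewrite -e; ring.
Qed.

Lemma AK_residue z : AK z -> exists c, nonunit AK (z - kap c).
Proof. by move=> [a _ <-]; have [c nc] := resA a; exists c; rewrite /= -rmorphB; apply/nonunit_range. Qed.

Lemma AK_frac z : exists a b, [/\ AK a, AK b, b != 0 & z = a / b].
Proof.
have [a [b [b0 ->]]] := frac z; exists (tf a), (tf b); split=> //.
by rewrite -(rmorph0 tf) (inj_eq tf_inj).
Qed.

Lemma AK_chain3 : no_chains3 AK.
Proof.
move=> B c1 c2 c3 sB AB; apply: (no_prime_chain3 lA dA catenary_poly1 catenary_poly2 tf_inj frac res_iota res0 nA normA sB AB).
Qed.

Variables (S X : fscheme K) (phi : {rmorphism A -> OO S (opensT S)}) (f : morphism X S).
Hypotheses (hphi : is_spec phi) (hres : resolution f).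
Hypothesis fvS : forall (U : opens S) a, U (fgen S) -> fval (algr phi U a) = tf a.
Hypothesis fvX : forall (U : opens X) a, U (fgen X) -> fval (algr (salg phi f) U a) = tf a.

Lemma resolution_compat : val_compat id f.
Proof.
move=> V U h s Ug; have Vg : V (fgen S) := fgenP (h _ Ug).
have [a [b [b0 e]]] := frac (fval s).
have tb : tf b != 0 by rewrite -(rmorph0 tf) (inj_eq tf_inj).
have eb : algr phi V b * s = algr phi V a by apply: fval_inj; rewrite fvalM !fvS // e mulrC divfK.
have := congr1 (fun w => fval (msh f h w)) eb; rewrite rmorphM fvalM -!algr_msh !fvX // => e2.
by apply: (mulfI tb); rewrite e2 e mulrC divfK.
Qed.

Lemma fval_phi a : fval (phi a) = tf a.
Proof. by rewrite -(@fvS (opensT S) a) // /algr rres_id. Qed.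

Lemma fval_salg a : fval (structure_map phi f a) = tf a.
Proof. by rewrite -(@fvX (opensT X) a) // /algr rres_id. Qed.

Lemma base_chart : chart floc [set: S] AK.
Proof.
suff <- : range (@fval K S (opensT S)) = AK by apply: (spec_chart (U := opensT S)) hphi.
apply/seteqP; split=> [_ [s _ <-]|_ [a _ <-]]; last by exists (phi a); rewrite // fval_phi.
by have [r ->] := spec_bijective hphi s; exists r; rewrite // fval_phi.
Qed.

(** The only neighbourhood of the closed point is S, so the local finiteness of f at this point is
    global. *)
Lemma closed_point : exists y : S, forall V : opens S, V y -> forall x, V x.
Proof.
have [pr _ surj op _] := hphi; have [y _ ey] := surj _ (nonunits_prime lA).
exists y => V Vy x; have [|G hG] := (op V _).1 (oset_open V); first by [].
apply/(hG x) => // Gx; have := (hG y Logic.I).1 Vy; apply; rewrite ey => a /Gx.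
by apply: prime_nonunit; apply: pr.
Qed.

Lemma finite_charts : exists n (U : 'I_n -> opens X) (B : 'I_n -> set K) (gens : 'I_n -> seq K),
 [/\ forall i, chart floc (U i) (B i), forall x, exists i, U i x, forall i g, g \in gens i -> B i g &
   forall i R, subring R -> AK `<=` R -> (forall g, g \in gens i -> R g) -> B i `<=` R].
Proof.
have [_ [_ ft _] _] := hres; have [y hy] := closed_point.
have [V [Vy _ [n [U [cov hU]]]]] := ft y; have VT := hy V Vy.
pose ok (V : opens X) (g : seq K) (B := range (@fval K X V)) := [/\ chart floc V B,
 forall z, z \in g -> B z & forall R, subring R -> AK `<=` R -> (forall z, z \in g -> R z) -> B `<=` R].
have ex (i : 'I_n) : U i (fgen X) -> exists g, ok (U i) g.
 move=> Ug; have [aff [h [m [t gen]]]] := hU i.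
 exists [seq fval (t j) | j : 'I_m]; split; first exact: affine_chart.
  by move=> _ /mapP [j _ ->]; exists (t j).
 move=> R sR AR gR _ [s _ <-]; apply: (gen (fun s => R (fval s))) => [|a b|a b|_ [w _ <-]|_ [j _ <-]].
 - by rewrite fval1 //; apply: (sub1 sR).
 - by rewrite fvalB; apply: (subB sR).
 - by rewrite fvalM; apply: (subM sR).
 - rewrite resolution_compat //; apply: AR; apply: (chart_inter base_chart) => x _.
  exact: floc_val.
 - by apply: gR; apply/mapP; exists j; rewrite ?mem_enum.
have [i0 hi0] := cov (fgen X) (VT _).
(* Empty members of the cover have no chart; they are replaced by a nonempty one. *)
pose U' i := if `[< U i (fgen X) >] then U i else U i0.
have hU' i : exists j, U' i = U j /\ U j (fgen X) by rewrite /U'; case: asboolP => h; [exists i|exists i0].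
have /choice [g hg] i : exists g, ok (U' i) g.
 by have [j [-> Ug]] := hU' i; apply: ex.
exists n, U', (fun i => range (@fval K X (U' i))), g; split=> [i|x|i|i]; try by case: (hg i).
have [i Ui] := cov x (VT _); exists i; rewrite /U' asboolT //; exact: fgenP Ui.
Qed.

Lemma AK_floc x : AK `<=` floc (Y := X) x.
Proof. by move=> _ [a _ <-]; rewrite -fval_salg; apply: floc_val. Qed.

Lemma exceptionalP x : exceptional_set phi f x <-> exc AK (X := X) x.
Proof.
have e a : spec_point phi (f x) a <-> nonunit (floc (Y := X) x) (tf a).
 have l : floc (f x) (tf a) by rewrite -fval_phi; apply: floc_val.
 split=> [h|/(val_compat_nonunit resolution_compat l) h].
  apply/(val_compat_nonunit resolution_compat l); rewrite -fval_phi; apply: contrapT => n; apply: h.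
  exact/finvP.
 by move=> /finvP; rewrite fval_phi; apply.
split=> [ex z nz|ex].
 by have [[a _ ea] _] := nz; subst z; apply/e; rewrite ex; apply/nonunit_range.
have [pr _ _ _ _] := hphi; apply/seteqP; split=> a; first by apply: prime_nonunit; apply: pr.
by move=> na; apply/e; apply: ex; apply/nonunit_range.
Qed.

Let regX : regular_scheme X. Proof. by case: hres. Qed.
Let dvrV e pi : dvr_pt (X := X) e pi -> valring (floc e).
Proof. exact: (dvr_valring AK_frac AK_chain3 regX AK_floc). Qed.

Lemma resolution_unique_center V (x y : X) : valring V -> dominated x V -> dominated y V -> x = y.
Proof. by apply: (separated_unique resolution_compat base_chart); case: hres => _ []. Qed.

(** There is no ring strictly between a discrete valuation ring and K, and by uniqueness of centers
    a point is determined by such a local ring. So the only proper generization of e is the generic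
    point. *)
Lemma dvr_codim1 (e : X) pi : dvr_pt e pi -> codim e 1.
Proof.
move=> hd; have vV := dvrV hd; have [p0 np hpi] := hd; have se := floc_sr e.
have gen0 z : nonunit (floc (fgen X)) z -> z = 0 := @mgen_nonunit K (fmodel X) z.
have g1 (y : X) : closure [set y] e -> y = e \/ y = fgen X.
 move=> cl; have lt := gen_sub cl; have sy := floc_sr y; have iy := floc_ideal y.
 have mm := val_sub vV sy lt.
 have [ny|ny] := EM (nonunit (floc y) pi); [left|right].
  apply: (resolution_unique_center vV) => //; split=> // z Fz; apply: contrapT => nz.
  have [//|zi] := vV.2 z; have z0 : z != 0 by apply: contra_not_neq nz => ->; apply: (sub0 se).
  have nzi : nonunit (floc e) z^-1 by split=> // -[_]; rewrite invrK.
  have := idM iy (lt _ (hpi _ nzi)) ny; rewrite divfK // => -[_]; apply.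
  by rewrite invrK invr_neq0.
 have [_ pV] := not_nonunit (lt _ np.1) ny.
 have all z : floc y z.
  have [->|z0] := eqVneq z 0; first exact: (sub0 sy).
  have [n [m [h _]]] := dvr_orderZ AK_frac AK_chain3 regX AK_floc hd z0.
  rewrite (_ : z = z * pi ^+ m / pi ^+ n * (pi ^+ n * pi^-1 ^+ m)); last by rewrite exprVn; fld.
  by apply: (subM sy (lt _ h)); apply: (subM sy); apply: (subX sy) => //; apply: lt; case: np.
 have vy : valring (floc y) by split=> // z; left.
 apply: (resolution_unique_center vy) => //; split=> // z /gen0 ->; exact: (id0 iy).
have ne : e <> fgen X by move=> eg; move: np; rewrite eg => /gen0 /eqP; rewrite (negPf p0).
have g2 (y : X) : closure [set y] (fgen X) -> y = fgen X.
 move=> cl; have [|ye|//] := g1 y.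
  by apply: opens_gen => U Ue; apply: (gen_opens cl); apply: fgenP Ue.
 rewrite ye in cl; have [_] := np; case; split=> //; apply: (gen_sub cl); apply: contrapT => nf.
 have fp : floc (fgen X) pi := gen_sub (@gen_fgen _ X e) np.1.
 by case/eqP: p0; apply: gen0; split=> // -[].
split.
 by exists (fun i => if i is 0%N then e else fgen X); split=> // -[|//] _; split; [exact: gen_fgen|exact: ne].
move=> n c [c0 hc]; rewrite leqNgt; apply/negP => n2.
have [k0 d0] := hc 0%N (ltnW n2); have [k1 d1] := hc 1%N n2; rewrite c0 in k0 d0.
have [e1|e1] := g1 _ k0; first by apply: d0.
by rewrite e1 in k1 d1; apply: d1; rewrite (g2 _ k1).
Qed.

Lemma exceptional_curveP e : exceptional_curve phi f e <-> exc AK (X := X) e /\ exists pi, dvr_pt e pi.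
Proof.
split=> [[/exceptionalP ex cd]|[ex [pi hd]]]; last by split; [exact/exceptionalP|exact: dvr_codim1 hd].
split=> //; apply: (codim1_dvr AK_chain3 regX AK_floc cd).
have [[c [cP clt]] _] := dA; have [_ /existsNP [a /not_implyP [ca na]]] := clt 0%N isT.
exists (tf a); last by apply: ex; apply/nonunit_range; apply: (prime_nonunit (cP 1%N isT)).
rewrite -(rmorph0 tf) (inj_eq tf_inj); apply/eqP => a0; apply: na; rewrite a0.
by have [[]] := cP 0%N isT.
Qed.

Variable Z : X -> nat.
Hypotheses (eZ : effective_cycle phi f Z) (Zpos : exists x, Z x <> 0%N) (nfZ : no_fixed_component phi f Z).

Let Zexc e : Z e != 0%N -> exc AK (X := X) e /\ exists pi, dvr_pt e pi.
Proof. by move=> /eqP Ze; apply/exceptional_curveP; apply: eZ.2. Qed.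

Lemma in_minusP (U : opens X) (s : OO X U) : in_minus Z s <-> forall x, U x -> minusZ Z x (fval s).
Proof.
split=> h x Ux.
 split=> [|e pi cl hd]; first exact: floc_val.
 by have Ue := gen_opens cl Ux; apply/(order_geP _ _ Ue hd); apply: h.
have [Z0|Z0] := eqVneq (Z x) 0%N.
 rewrite Z0; exists U, (@subset_refl _ U); split=> // I [_ _ IM] GI; rewrite -[rres _ s]mulr1.
 by apply: IM; apply: GI; exists (fun _ => 0) => [[]//|]; rewrite big_ord0.
have [_ [pi hd]] := Zexc Z0; apply/(order_geP _ _ Ux hd).
by case: (h x Ux) => _; apply=> //; apply: subset_closure.
Qed.

Let nofix (e : X) pi : dvr_pt e pi -> exc AK e ->
 exists2 s, (forall x, minusZ Z x s) & ~ floc e (s / pi ^+ (Z e).+1).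
Proof.
move=> hd ex; have [p0 np _] := hd; have Ee : exceptional_curve phi f e by apply/exceptional_curveP; split=> //; exists pi.
have Te : opensT X e by [].
apply: contrapT => no; apply: (nfZ Ee); apply/seteqP; split=> s /=.
 move=> hs y _; have [->|ne] := eqVneq y e; last by rewrite addn0; apply: hs.
 rewrite [(_ + _)%N]addn1; apply/(order_geP _ _ Te hd); apply: contrapT => nf; apply: no; exists (fval s) => //.
 by move=> x; apply: (in_minusP s).1.
move=> hs y _; have := hs y Logic.I; have [->|ne] := eqVneq y e; last by rewrite addn0.
rewrite [(_ + _)%N]addn1 => /(order_geP _ _ Te hd) h; apply/(order_geP _ _ Te hd).
rewrite (_ : fval s / pi ^+ Z e = fval s / pi ^+ (Z e).+1 * pi); last by rewrite exprS; fld.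
by apply: (subM (floc_sr e) h); case: np.
Qed.

Lemma effective_seq : exists Zs : seq X, forall e, Z e != 0%N -> e \in Zs.
Proof.
by have [Zs eZs] := (finite_seqP _).1 eZ.1; exists Zs => e /eqP h; have : [set x | Z x <> 0%N] e by []; rewrite eZs.
Qed.

Definition minus_value (U : opens X) (s : OX_minus Z U) : K := fval (val (s : minus_sec Z U) : OO X U).

Lemma minus_realization : realization minus_value (minusZ Z).
Proof.
split=> [U a s t|U V h s Vg|U s Ug e|U s x Ux|x z hz].
- by rewrite /minus_value fvalD fvalM.
- by rewrite /minus_value fval_res.
- by apply: val_inj; apply: fval_inj0.
- by have /asboolP/in_minusP := valP (s : minus_sec Z U); apply.
have [Zs Zfin] := effective_seq; have [W [Wx hW]] := minusZ_nbhs Zfin hz.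
have [|s es] := @fval_glue _ _ W z (fgenP Wx); first by move=> y /hW [].
have sP : (s : (OO X W)^o) \in minus_pred Z (U := W) by apply/asboolP/in_minusP; rewrite es.
by exists W, (MinusSec sP).
Qed.

Lemma floc_common (x : X) (U : opens X) r (b : 'I_r -> K) : U x -> (forall i, floc x (b i)) ->
 exists (V : opens X) (a : 'I_r -> OO X V), [/\ V x, V `<=` U & forall i, fval (a i) = b i].
Proof.
move=> Ux; elim: r b => [|r IH] b hb; first by exists U, (fun _ => 0); split=> // -[].
have [V [a [Vx VU ha]]] := IH (fun i => b (lift ord0 i)) (fun i => hb _).
have [W [c [Wx ec]]] := hb ord0; pose V' := opensI V W.
have h1 : V' `<=` V by move=> ? []. have h2 : V' `<=` W by move=> ? [].
have g : V' (fgen X) by apply: (@fgenP _ _ _ x).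
exists V', (fun i => if unlift ord0 i is Some j then rres h1 (a j) else rres h2 c); split=> // [y /h1 /VU //|i].
by case: unliftP => [j ->|->]; rewrite fval_res.
Qed.

Lemma stalk_generated : (forall p z, minusZ Z p z -> exists r (b g : 'I_r -> K),
  [/\ forall i, floc p (b i), forall i x, minusZ Z x (g i) & z = \sum_i b i * g i]) ->
 globally_generated (OX_minus Z).
Proof.
move=> gen U s x Ux; have [r [b [g [hb hg es]]]] := gen x _ (vmem minus_realization s Ux).
have [V [a [Vx VU ha]]] := floc_common Ux hb.
have /choice [G hG] i : exists t : OX_minus Z (opensT X), minus_value t = g i.
 have [|t et] := @fval_glue _ _ (opensT X) (g i) Logic.I; first by move=> y _; case: (hg i y).
 have tP : (t : (OO X (opensT X))^o) \in minus_pred Z (U := opensT X) by apply/asboolP/in_minusP; rewrite et.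
 by exists (MinusSec tP).
have Vg : V (fgen X) := fgenP Vx; have rl := minus_realization.
have v0 : minus_value (0 : OX_minus Z V) = 0 by rewrite /minus_value fval0.
have vD : {morph (@minus_value V) : u w / u + w >-> u + w} by move=> u w; rewrite /minus_value fvalD.
exists V, VU, r, a, G; split=> //; apply/eqP; rewrite -subr_eq0; apply/eqP; apply: (vinj rl Vg).
rewrite /minus_value fvalB -/(minus_value _) -/(minus_value _) (vres rl) // es (big_morph _ vD v0).
apply/eqP; rewrite subr_eq0; apply/eqP; apply: eq_bigr => i _.
by rewrite -[a i *: _]addr0 (vlin rl) v0 addr0 ha (vres rl) // hG.
Qed.

Lemma resolution_cohomology (I : injective_resolution (OX X)) (J : injective_resolution (OX_minus Z)) :
 enat_le (cohomology_length (structure_map phi f) J 1) (cohomology_length (structure_map phi f) I 1) /\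
 (cohomology_length (structure_map phi f) J 1 = cohomology_length (structure_map phi f) I 1 ->
  globally_generated (OX_minus Z)).
Proof.
have [n [U [B [gens [hU cov Bg Bgen]]]]] := finite_charts; have [Zs Zfin] := effective_seq.
have sA : subring AK := range_sr tf.
have kA c : AK (kap c) by exists (iota c).
have ec V : valring V -> AK `<=` V -> exists i, B i `<=` V.
 by apply: (valuative_existence resolution_compat base_chart _ cov hU); case: hres => _ [].
have detect (x : X) z : ~ floc x z -> exists e pi, [/\ closure [set e] x, dvr_pt e pi & ~ floc e z].
 exact: (dvr_detect AK_frac AK_chain3 regX AK_floc).
have Zp : exists e, Z e != 0%N by have [e /eqP] := Zpos; exists e.
have [D [us [rel [[D0 DD DM] r0 rD rspan rker]]]] := genus_finite sA kA AK_residue AK_noetherian AK_local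
 AK_frac AK_height1_valring AK_height1_finite AK_residues2 hU Bg Bgen ec resolution_unique_center AK_floc detect dvrV.
have [h [h0 hO hdiv hgen]] := surface_cohomology sA kA AK_residue AK_local normA AK_frac AK_chain3
 AK_height1_valring AK_height1_finite AK_residues1 hU cov Bg Bgen ec resolution_unique_center AK_floc detect dvrV
 (dvr_order AK_chain3 regX AK_floc) Zfin Zexc Zp nofix.
have vi c : fval (structure_map phi f (iota c)) = kap c by rewrite fval_salg.
have kM l a : D a -> D (kap l * a) by apply: DM.
have FB x a b : minusZ Z x a -> minusZ Z x b -> minusZ Z x (a - b).
 by move=> ha hb; apply: minusZD => //; apply: minusZN.
have FM x a b : floc x a -> minusZ Z x b -> minusZ Z x (a * b) by apply: minusZM.
split; first exact: (length_le vi minus_realization I J D0 DD kM r0 rD rspan rker hO FB FM hdiv).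
move=> e; apply: stalk_generated; apply: hgen.
exact: (length_eq_injective vi minus_realization D0 DD kM r0 rD rspan rker hO FB FM hdiv e).
Qed.

End SurfaceRing.

Lemma normal_integral (A : idomainType) : normal_domain A ->
 forall z : {fraction A}, integral (range (@tofrac A)) z -> range (@tofrac A) z.
Proof.
move=> nA z [n [c [hc e]]]; have /choice [a ha] i : exists a, @tofrac A a = c i by have [a _ <-] := hc i; exists a.
pose q : {poly A} := \poly_(i < n) a i; have sq : (size q < size ('X^n : {poly A}))%N.
 by rewrite size_polyXn ltnS size_poly.
have [|b ->] := nA z; last by exists b.
exists ('X^n - q).
 by rewrite monicE lead_coefDl ?size_polyN // lead_coefXn.
rewrite /root rmorphB /= map_polyXn hornerD hornerN hornerXn e.
have -> : map_poly (@tofrac A) q = \poly_(i < n) c i.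
 by apply/polyP => i; rewrite coef_map !coef_poly; case: ifP; rewrite ?rmorph0 //= ha.
by rewrite horner_poly subrr.
Qed.

Local Close Scope ring_scope.
Local Close Scope classical_set_scope.

Theorem theorem3p1 :
  forall (A : idomainType),
    is_local A -> excellent A -> krull_dim A 2 -> normal_domain A ->
  forall (k : closedFieldType) (iota : {rmorphism k -> A}),
    (forall a : A, exists c : k, @nonunits A (a - iota c)%R) ->
  forall (S : scheme) (phi : {rmorphism A -> OO S (opensT S)}),
    is_spec phi ->
  forall (X : scheme) (f : morphism X S),
    resolution f ->
  forall Z : X -> nat,
    effective_cycle phi f Z -> (exists x, Z x <> 0) ->
    no_fixed_component phi f Z ->
  forall (I : injective_resolution (OX X)) (J : injective_resolution (OX_minus Z)),
    let p_g := cohomology_length (structure_map phi f) I 1 in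
    let h1 := cohomology_length (structure_map phi f) J 1 in
    enat_le h1 p_g /\ (h1 = p_g -> globally_generated (OX_minus Z)).
Proof.
move=> A lA [nA ucA _ _] dA normA k iota resA S phi hphi X f hres Z eZ Zpos nfZ I J p_g h1.
have [res [res_iota res0]] := exists_residue lA resA.
pose tf : {rmorphism A -> {fraction A}} := @tofrac A.
have tf_inj : injective tf by move=> a b /eqP; rewrite tofrac_eq => /eqP.
have frac (z : {fraction A}) : exists a b, (b != 0 /\ z = tf a / tf b)%R := fractionP z.
have normK := normal_integral normA.
have [eta [eta0 eta_gen]] := spec_generic hphi.
have [vS [vSB vSM vS1 vSr [vSa _]] vSi] := spec_values tf_inj hphi eta0 eta_gen.
have [regX _ bir] := hres.
have [xi [fxi [xi_gen [U0 [U0x bijU0]]]]] := birational_generic eta_gen bir.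
have [v [vB vM v1 vr [va vk]]] := bir_values tf_inj hphi eta0 fxi U0x bijU0.
have chain3 := @AK_chain3 A k iota lA nA ucA dA _ tf tf_inj frac normK res res_iota res0.
have gl z : range tf z -> exists s : OO X (opensT X), v (opensT X) s = z.
 by move=> [a _ <-]; exists (algr (salg phi f) (opensT X) a); rewrite va.
(* So far a section of X with value 0 is known to vanish only near the generic point; regularity of
   the stalks makes values injective, as required for [FX]. *)
have vi := regular_val_inj chain3 xi_gen vB vM v1 vr gl vk regX.
pose FS := @FScheme {fraction A} S eta eta_gen vS vSB vSM vS1 vSr vSi.
pose FX := @FScheme {fraction A} X xi xi_gen v vB vM v1 vr vi.
exact: (@resolution_cohomology A k iota lA nA ucA dA resA _ tf tf_inj frac normK res res_iota res0 FS FX phi f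
 hphi hres vSa va Z eZ Zpos nfZ I J).
Qed.
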